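(* Let $\pi : (M, g_0) \rightarrow (N, g_N)$ be a Riemannian submersion, where $M$ is compact. Then $g_0$ is critical for the functional $$J_H(g_t) = \int_{M} g_t(H_t,H_t) \, \mathrm{vol}_{g_t}$$ with respect to variations preserving the Riemannian submersion $\pi$ if and only if $H_0$ is projectable.
   Context: Manifolds are smooth, connected and oriented; all functions and tensor fields are smooth. A Riemannian submersion $\pi:(M,g)\to(N,g_N)$ is a smooth map with $\operatorname{rank}\pi_*=\dim N$ and $g(X,Y)=g_N(\pi_*X,\pi_*Y)$ for all $X,Y$ that are $g$-orthogonal to $\ker\pi_*$. $\mathcal{V}=\ker\pi_*$ is the vertical distribution, $n=\dim\mathcal{V}$; vertical vector fields are those with values in $\mathcal{V}$. $\mathrm{Riem}(M,\mathcal{V},g_0)$ is the set of Riemannian metrics $g$ on $M$ with $g(X,Y)=g_0(X,Y)$ for all vertical $X,Y$. A variation of $g_0$ is a one-parameter family $\{g_t, t\in(-\epsilon,\epsilon)\}\subset \mathrm{Riem}(M,\mathcal{V},g_0)$ depending smoothly on $t$, whose member at $t=0$ is $g_0$; it preserves the Riemannian submersion $\pi$ if $\pi:(M,g_t)\to(N,g_N)$ is a Riemannian submersion for all $t$. The mean curvature of the fibers is $H_t=\sum_{a=1}^n P_{\mathcal{H}}^t\nabla^t_{E_a}E_a$ for a local $g_t$-orthonormal frame $\{E_a\}$ of $\mathcal{V}$, where $\nabla^t$ is the Levi-Civita connection of $g_t$ and $P_{\mathcal{H}}^t$ is the $g_t$-orthogonal projection onto the $g_t$-orthogonal complement of $\mathcal{V}$;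 $\mathrm{vol}_{g_t}$ is the volume form of $(M,g_t)$. $g_0$ is critical for $J_H$ with respect to variations preserving $\pi$ if $\partial_t J_H(g_t)|_{t=0}=0$ for all such variations. A vector field $X$ on $M$ is projectable if $\pi_*X$ is a well defined vector field, equivalently $[X,V]$ is vertical for every vertical $V$. *)

(* Defs.v *)
From HB Require Import structures.
From mathcomp Require Import all_boot all_order all_algebra.
From mathcomp Require Import all_classical all_reals all_analysis.
From mathcomp Require Import ring.
Set Implicit Arguments.
Unset Strict Implicit.
Unset Printing Implicit Defensive.
Import Order.TTheory GRing.Theory Num.Theory.
Import numFieldNormedType.Exports.
Local Open Scope classical_set_scope.
Local Open Scope ring_scope.

(* C^k and C^oo functions on an open subset [U] of R^m: all the iterated
   partial derivatives exist and are continuous at the points of [U]. *)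
Fixpoint Ck_on (R : realType) (m k : nat) (U : set 'rV[R]_m)
    (f : 'rV[R]_m -> R) : Prop :=
  (forall x, U x -> {for x, continuous f}) /\
  (if k is k'.+1 then
     forall i : 'I_m,
       (forall x, U x -> derivable f x (delta_mx 0 i)) /\
       Ck_on k' U (fun x => 'D_(delta_mx 0 i) f x)
   else True).

Definition smooth_on (R : realType) (m : nat) (U : set 'rV[R]_m)
    (f : 'rV[R]_m -> R) : Prop :=
  forall k, Ck_on k U f.

Definition smooth_vec_on (R : realType) (m k : nat) (U : set 'rV[R]_m)
    (f : 'rV[R]_m -> 'rV[R]_k) : Prop :=
  forall j : 'I_k, smooth_on U (fun x => f x 0 j).

(* Charts are homeomorphisms between the open sets [cdom] and [cimg]; the values
   of [cfun] and [cinv] outside these sets are irrelevant. *)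
Record chart (R : realType) (T : topologicalType) (m : nat) := Chart {
  cdom : set T;
  cimg : set 'rV[R]_m;
  cfun : T -> 'rV[R]_m;
  cinv : 'rV[R]_m -> T;
  open_cdom : open cdom;
  open_cimg : open cimg;
  cfun_cimg : forall p, cdom p -> cimg (cfun p);
  cinv_cdom : forall x, cimg x -> cdom (cinv x);
  cfunK : forall p, cdom p -> cinv (cfun p) = p;
  cinvK : forall x, cimg x -> cfun (cinv x) = x;
  cfun_continuous : forall p, cdom p -> {for p, continuous cfun};
  cinv_continuous : forall x, cimg x -> {for x, continuous cinv} }.

(* Smooth, connected, oriented manifolds: the orientation is given by the choice
   of an atlas whose transition maps have positive Jacobian determinant.
   [chart_at p] is a preferred chart around [p]. *)
Record manifold (R : realType) (m : nat) := Manifold {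
  carrier :> topologicalType;
  atlas : set (chart R carrier m);
  chart_at : carrier -> chart R carrier m;
  chart_at_atlas : forall p, atlas (chart_at p);
  chart_at_cdom : forall p, cdom (chart_at p) p;
  transition_smooth : forall c d, atlas c -> atlas d ->
    smooth_vec_on (cimg c `&` cinv c @^-1` cdom d) (cfun d \o cinv c);
  transition_oriented : forall c d x, atlas c -> atlas d ->
    cimg c x -> cdom d (cinv c x) -> 0 < \det ('J (cfun d \o cinv c) x);
  manifold_hausdorff : hausdorff_space carrier;
  manifold_second_countable : @second_countable carrier;
  manifold_connected : connected [set: carrier] }.

Section Calculus.
Variables (R : realType) (m : nat) (M : manifold R m).
Implicit Types (p : M) (c : chart R M m) (x : 'rV[R]_m).

Definition pos_at p : 'rV[R]_m := cfun (chart_at p) p.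

(* A tangent vector at [p] is the row vector of its coordinates in the chart
   [chart_at p]; a symmetric 2-tensor at [p] is its Gram matrix in that chart.
   As ['J f x] acts on row vectors on the right, differentials do so too. *)
Definition vfield := M -> 'rV[R]_m.
Definition tensor2 := M -> 'M[R]_m.

Definition vfield_in c (X : vfield) x : 'rV[R]_m :=
  let p := cinv c x in X p *m 'J (cfun c \o cinv (chart_at p)) (pos_at p).

Definition tensor2_in c (g : tensor2) x : 'M[R]_m :=
  let p := cinv c x in let K := 'J (cfun (chart_at p) \o cinv c) x in
  K *m g p *m K^T.

Definition smooth_function (f : M -> R) : Prop :=
  forall c, atlas c -> smooth_on (cimg c) (f \o cinv c).

Definition smooth_vfield_on (W : set M) (X : vfield) : Prop :=
  forall c, atlas c -> smooth_vec_on (cimg c `&` cinv c @^-1` W) (vfield_in c X).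

Definition smooth_tensor2 (g : tensor2) : Prop :=
  forall c, atlas c -> forall i j, smooth_on (cimg c) (fun x => tensor2_in c g x i j).

Definition gdot (G : 'M[R]_m) (v w : 'rV[R]_m) : R := (v *m G *m w^T) 0 0.

Definition riemannian_metric (g : tensor2) : Prop :=
  [/\ smooth_tensor2 g,
      forall p, (g p)^T = g p &
      forall p v, v != 0 -> 0 < gdot (g p) v v].

Definition lie_bracket (X Y : vfield) : vfield := fun p =>
  'D_(X p) (vfield_in (chart_at p) Y) (pos_at p) -
  'D_(Y p) (vfield_in (chart_at p) X) (pos_at p).

(* Christoffel symbol Gamma^l_{ij} of a metric on an open subset of R^m. *)
Definition christoffel (G : 'rV[R]_m -> 'M[R]_m) x (i j l : 'I_m) : R :=
  2^-1 * \sum_s invmx (G x) l s *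
    ('D_(delta_mx 0 i) (fun y => G y j s) x +
     'D_(delta_mx 0 j) (fun y => G y i s) x -
     'D_(delta_mx 0 s) (fun y => G y i j) x).

(* The connection with these symbols is torsion-free and metric. *)
Lemma christoffel_sym (G : 'rV[R]_m -> 'M[R]_m) x i j l :
  (forall y, (G y)^T = G y) -> christoffel G x i j l = christoffel G x j i l.
Proof.
move=> Gsym; rewrite /christoffel; congr (_ * _); apply: eq_bigr => s _.
congr (_ * _); congr (_ - _); first exact: addrC.
by congr ('D_ _ _ _); apply/funext => y; rewrite -[in LHS](Gsym y) mxE.
Qed.

Lemma christoffel_metric (G : 'rV[R]_m -> 'M[R]_m) x i j l :
  (forall y, (G y)^T = G y) -> G x \in unitmx ->
  'D_(delta_mx 0 i) (fun y => G y j l) x =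
  \sum_s (christoffel G x i j s * G x s l + christoffel G x i l s * G x j s).
Proof.
move=> Gsym Gx.
have symD v a b : 'D_v (fun y => G y a b) x = 'D_v (fun y => G y b a) x.
  by congr ('D_ _ _ _); apply/funext => y; rewrite -[in LHS](Gsym y) mxE.
have lower a b : \sum_s christoffel G x i a s * G x s b =
    2^-1 * ('D_(delta_mx 0 i) (fun y => G y a b) x +
            'D_(delta_mx 0 a) (fun y => G y i b) x -
            'D_(delta_mx 0 b) (fun y => G y i a) x).
  under eq_bigr do rewrite /christoffel -mulrA mulr_suml.
  rewrite -mulr_sumr exchange_big /=; congr (_ * _).
  pose d t := 'D_(delta_mx 0 i) (fun y => G y a t) x +
    'D_(delta_mx 0 a) (fun y => G y i t) x -
    'D_(delta_mx 0 t) (fun y => G y i a) x.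
  rewrite -/(d b).
  transitivity (\sum_t d t * (G x *m invmx (G x)) b t).
    apply: eq_bigr => t _; rewrite mxE mulr_sumr; apply: eq_bigr => s _.
    have -> : G x b s = G x s b by rewrite -[in LHS]Gsym mxE.
    have -> : invmx (G x) s t = invmx (G x) t s.
      by rewrite -[in LHS](Gsym x) -trmx_inv mxE.
    by rewrite -/(d t) mulrAC mulrC; congr (_ * _); rewrite mulrC.
  rewrite mulmxV // (bigD1 b) //= big1 => [|t tb].
    by rewrite mxE eqxx mulr1 addr0.
  by rewrite mxE eq_sym (negbTE tb) mulr0.
rewrite big_split /= lower.
have -> : \sum_s christoffel G x i l s * G x j s =
          \sum_s christoffel G x i l s * G x s j.
  by apply: eq_bigr => s _; rewrite -[in LHS]Gsym mxE.
by rewrite lower (symD _ l j); field.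
Qed.

Definition levi_civita (g : tensor2) (X Y : vfield) : vfield := fun p =>
  'D_(X p) (vfield_in (chart_at p) Y) (pos_at p) +
  \row_l \sum_i \sum_j
    christoffel (tensor2_in (chart_at p) g) (pos_at p) i j l * X p 0 i * Y p 0 j.

End Calculus.

Section Integration.
Variable R : realType.

(* Lebesgue integral over R^m of a continuous compactly supported function, as
   an iterated integral. *)
Fixpoint integral_Rn (m : nat) : ('rV[R]_m -> R) -> R :=
  match m with
  | 0 => fun f => f 0
  | m'.+1 => fun f : 'rV[R]_(1 + m') -> R =>
      \int[lebesgue_measure]_(t in [set: R])
        integral_Rn (fun v : 'rV[R]_m' => f (row_mx t%:M v))
  end.

Variables (m : nat) (M : manifold R m).

Record partition_of_unity := PartitionOfUnity {
  pu_size : nat;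
  pu_chart : 'I_pu_size -> chart R M m;
  pu_fun : 'I_pu_size -> M -> R;
  pu_atlas : forall a, atlas (pu_chart a);
  pu_smooth : forall a, smooth_function (pu_fun a);
  pu_ge0 : forall a p, 0 <= pu_fun a p;
  pu_support : forall a,
    closure [set p | pu_fun a p != 0] `<=` cdom (pu_chart a);
  pu_sum1 : forall p, \sum_a pu_fun a p = 1 }.

(* Charts being positively oriented, the volume form of [g] in a chart is
   sqrt (det g) dx_1 /\ ... /\ dx_m. *)
Definition integral_wrt (P : partition_of_unity) (g : tensor2 M) (f : M -> R) : R :=
  \sum_(a < pu_size P)
    let c := pu_chart a in
    integral_Rn ((fun x => pu_fun a (cinv c x) * f (cinv c x) *
                           Num.sqrt (\det (tensor2_in c g x))) \_ (cimg c)).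

(* Integral over a compact [M] of [f] against the volume form of [g]: its value
   does not depend on the finite partition of unity, which exists by
   compactness. *)
Definition vol_integral (g : tensor2 M) (f : M -> R) : R :=
  match pselect (exists P : partition_of_unity, True) with
  | left h => integral_wrt (projT1 (cid h)) g f
  | right _ => 0
  end.

End Integration.

Section Submersion.
Variables (R : realType) (m k : nat) (M : manifold R m) (N : manifold R k).
Variable pi : M -> N.
Implicit Types (p : M) (g : tensor2 M).

Definition smooth_map : Prop :=
  continuous pi /\
  forall c d, atlas c -> atlas d ->
    smooth_vec_on (cimg c `&` (pi \o cinv c) @^-1` cdom d) (cfun d \o pi \o cinv c).

Definition dpi p : 'M[R]_(m, k) :=
  'J (cfun (chart_at (pi p)) \o pi \o cinv (chart_at p)) (pos_at p).

(* The vertical and horizontal subspaces of the tangent space at [p], as row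
   spaces: [X <= horizontal g p] iff X is [g p]-orthogonal to [ker (dpi p)]. *)
Definition vertical p : 'M[R]_m := kermx (dpi p).
Definition horizontal g p : 'M[R]_m := kermx (g p *m (vertical p)^T).
Definition hproj g p : 'M[R]_m := proj_mx (horizontal g p) (vertical p).

Definition vertical_vfield (V : vfield M) : Prop :=
  forall p, (V p <= vertical p)%MS.

Definition riemannian_submersion g (gN : tensor2 N) : Prop :=
  [/\ smooth_map,
      forall p, \rank (dpi p) = k &
      forall p X Y, (X <= horizontal g p)%MS -> (Y <= horizontal g p)%MS ->
        gdot (g p) X Y = gdot (gN (pi p)) (X *m dpi p) (Y *m dpi p)].

(* [m - k] is the dimension of the fibers. *)
Definition vertical_frame_on g (W : set M) (E : 'I_(m - k) -> vfield M) : Prop :=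
  [/\ forall a, smooth_vfield_on W (E a),
      forall a p, W p -> (E a p <= vertical p)%MS &
      forall a b p, W p -> gdot (g p) (E a p) (E b p) = (a == b)%:R].

(* Mean curvature of the fibers; it does not depend on the local orthonormal
   vertical frame. *)
Definition mean_curvature g : vfield M := fun p =>
  xget 0 [set H | exists W E,
    [/\ open W, W p, vertical_frame_on g W E &
        H = \sum_a levi_civita g (E a) (E a) p *m hproj g p]].

Definition JH g : R :=
  vol_integral g (fun p => gdot (g p) (mean_curvature g p) (mean_curvature g p)).

Definition Riem (g0 g : tensor2 M) : Prop :=
  riemannian_metric g /\
  forall p X Y, (X <= vertical p)%MS -> (Y <= vertical p)%MS ->
    gdot (g p) X Y = gdot (g0 p) X Y.

(* The coordinates on ]-eps, eps[ x cimg c are (t, x_1, ..., x_m). *)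
Definition smooth_family (eps : R) (gt : R -> tensor2 M) : Prop :=
  forall c, atlas c -> forall i j,
    smooth_on [set v : 'rV[R]_(1 + m) |
                 `|lsubmx v 0 0| < eps /\ cimg c (rsubmx v)]
      (fun v => tensor2_in c (gt (lsubmx v 0 0)) (rsubmx v) i j).

Definition variation (g0 : tensor2 M) (eps : R) (gt : R -> tensor2 M) : Prop :=
  [/\ 0 < eps, forall t, `|t| < eps -> Riem g0 (gt t),
      smooth_family eps gt & gt 0 = g0].

Definition preserves (gN : tensor2 N) (eps : R) (gt : R -> tensor2 M) : Prop :=
  forall t, `|t| < eps -> riemannian_submersion (gt t) gN.

Definition critical_JH (gN : tensor2 N) (g0 : tensor2 M) : Prop :=
  forall eps gt, variation g0 eps gt -> preserves gN eps gt ->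
    is_derive (0 : R) 1 (fun t => JH (gt t)) 0.

(* For disconnected fibers this is weaker than the existence of a vector field
   on [N] that is [pi]-related to [X]. *)
Definition projectable (X : vfield M) : Prop :=
  forall V, smooth_vfield_on setT V -> vertical_vfield V ->
    vertical_vfield (lie_bracket X V).

End Submersion.

(* Main.v *)
Require Import Defs.
From HB Require Import structures.
From mathcomp Require Import all_boot all_order all_algebra.
From mathcomp Require Import all_classical all_reals all_analysis.
From mathcomp Require Import ring lra.
Set Implicit Arguments.
Unset Strict Implicit.
Unset Printing Implicit Defensive.
Import Order.TTheory GRing.Theory Num.Theory.
Import numFieldNormedType.Exports.
Local Open Scope classical_set_scope.
Local Open Scope ring_scope.

(* As H is horizontal, g(H, H) = gN(dpi H, dpi H), and in charts the components
   eta of dpi(H) are of the form (function of the base point) - div(grad pi^a).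
   A variation preserving pi fixes the vertical metric and, by a determinant
   identity, the volume density; it only moves the gradients of the components of
   pi, by a vertical field Z, so the derivative of eta is -div Z.  Integrating by
   parts with a partition of unity gives
     dJ_H = 2 * integral of tr(Z d(eta) gN),
   in which only the vertical derivatives of eta occur.  Since dpi [H, V] is the
   derivative of eta along V up to sign, H is projectable exactly when these
   derivatives vanish, and then g0 is critical.  Conversely Z can be chosen to be
   the vertical gradient of eta: with K = dpi gN Z, the metrics
   (1 - tK) g0 (1 - tK)^T form a variation preserving pi, for which dJ_H is the
   integral of a nonnegative density vanishing only where Z does. *)

(** * Differential calculus on R^m *)

(** Let [D] be the differential of [pi] in charts, [G] and [Q] the two metrics, [X] the matrix of
    gradients. A vertical frame satisfies [e_a *m D = 0]; differentiating this along [e_a] shows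
    that [dpi] sends the covariant derivative of [e_a] along itself to minus the Hessian of [pi] at
    [(e_a, e_a)]. The sum over an orthonormal frame is therefore a trace against [G^-1 - X^T Q X]:
    the part in [G^-1] is a divergence of gradients, and the part in [X] depends on [Q] alone
    because [X *m D = Q^-1]. The same identity, differentiated in [t], gives [Z *m D = 0]. The
    obstacle to integrating by parts on [M] is that the cutoffs [chi_a] get differentiated too. The
    resulting terms are [Y(chi_a)] with [Y = eta Q Z], which turns out to be a vector field on all
    of [M], and they cancel because the [chi_a] sum to 1. Verticality also settles changes of chart
    in [N], whose transition matrices have no vertical derivative. The shear satisfies [K *m K = 0]
    and [X *m K = Z], hence explicit inverse metrics and gradients affine in [t]. *)

Notation "''e_' i" := (delta_mx 0 i) (at level 8, i at level 2, format "''e_' i").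

Section Differentiability.
Variable R : realType.

Lemma ler_mx_coord (a b : nat) (x : 'M[R]_(a, b)) i j : `|x i j| <= `|x|.
Proof.
by rewrite [leRHS]/Num.Def.normr/= mx_normrE; exact: (le_bigmax _ _ (i, j)).
Qed.

Lemma mx_norm_le (a b : nat) (x : 'M[R]_(a, b)) (r : R) :
  0 <= r -> (forall i j, `|x i j| <= r) -> `|x| <= r.
Proof.
move=> r0 xr; rewrite [leLHS]/Num.Def.normr/= mx_normrE.
by apply: bigmax_le => // -[i j] _; exact: xr.
Qed.

Lemma mx_norm_lt (a b : nat) (x : 'M[R]_(a, b)) (r : R) :
  0 < r -> (forall i j, `|x i j| < r) -> `|x| < r.
Proof.
move=> r0 xr; rewrite [ltLHS]/Num.Def.normr/= mx_normrE.
by apply: bigmax_lt => // -[i j] _; exact: xr.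
Qed.

Lemma ler_norm_mulmx (a b c : nat) (x : 'M[R]_(a, b)) (y : 'M[R]_(b, c)) :
  `|x *m y| <= b%:R * `|x| * `|y|.
Proof.
apply: mx_norm_le => [|i j]; first by rewrite !mulr_ge0.
rewrite mxE (le_trans (ler_norm_sum _ _ _))//.
have -> : b%:R * `|x| * `|y| = \sum_(s < b) `|x| * `|y|.
  by rewrite sumr_const card_ord -mulrA mulr_natl.
by apply: ler_sum => s _; rewrite normrM ler_pM// ler_mx_coord.
Qed.

Lemma cvg_mx_coord (T : Type) (F : set_system T) (FF : Filter F) (a b : nat)
    (f : T -> 'M[R]_(a, b)) (l : 'M[R]_(a, b)) :
  (forall i j, f x i j @[x --> F] --> l i j) -> f x @[x --> F] --> l.
Proof.
move=> fl; apply/cvgrPdist_lt => e e0.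
have : \forall x \near F, forall ij : 'I_a * 'I_b, `|l ij.1 ij.2 - f x ij.1 ij.2| < e.
  by apply: filter_forall => -[i j] /=; move/cvgrPdist_lt : (fl i j); apply.
apply: filterS => x H; apply: mx_norm_lt => // i j; rewrite !mxE.
exact: H (i, j).
Qed.

Lemma is_derive_line (V W : normedModType R) (f : V -> W) (x v : V) (s : R) :
  derivable f (x + s *: v) v ->
  is_derive s 1 (fun s => f (x + s *: v)) ('D_v f (x + s *: v)).
Proof.
move=> df; suff E : (fun h : R => h^-1 *: (((fun s => f (x + s *: v)) \o shift s) (h *: 1)
     - f (x + s *: v))) = (fun h : R => h^-1 *: ((f \o shift (x + s *: v)) (h *: v) - f (x + s *: v))).
  by split; [rewrite /derivable E|rewrite /derive E].
apply/funext => h /=; congr (_ *: (f _ - _)).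
by rewrite [h *: 1]mulr1 scalerDl addrCA.
Qed.

Lemma MVT_line (V : normedModType R) (f : V -> R) (x v : V) :
  (forall s : R, 0 <= s <= 1 -> derivable f (x + s *: v) v) ->
  exists2 s : R, 0 <= s <= 1 & f (x + v) - f x = 'D_v f (x + s *: v).
Proof.
move=> df.
pose g (s : R) := f (x + s *: v); pose dg (s : R) := 'D_v f (x + s *: v).
have H (s : R) : 0 <= s <= 1 -> is_derive s 1 g (dg s).
  by move=> s01; apply: is_derive_line; exact: df.
have H1 (s : R) : s \in `]0, 1[%R -> is_derive s 1 g (dg s).
  by rewrite in_itv /= => /andP[s0 s1]; apply: H; rewrite !ltW.
have cg : {within `[0, 1], continuous g}.
  apply: derivable_within_continuous => s; rewrite in_itv /= => s01.
  exact: (@ex_derive _ _ _ _ _ _ _ (H s s01)).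
have [s + E] := MVT_segment ler01 H1 cg.
rewrite in_itv /= => s01; exists s => //.
by move: E; rewrite /g scale1r scale0r addr0 subr0 mulr1.
Qed.

(** Only the derivative along [v] is assumed. On the line through [x] the function has one real
    variable, where derivability is differentiability and the differential is linear; this also
    covers [a = 0]. *)
Lemma derivable_scale (V W : normedModType R) (f : V -> W) (x v : V) (a : R) :
  derivable f x v ->
  derivable f x (a *: v) /\ 'D_(a *: v) f x = a *: 'D_v f x.
Proof.
move=> df.
have := @is_derive_line V W f x v 0; rewrite scale0r addr0 => /(_ df) H.
pose g (s : R) := f (x + s *: v).
have d0 : is_derive (0 : R) a g (a *: 'D_v f x).
  have dd : differentiable g (0 : R) by apply/derivable1_diffP; case: H.
  split; first exact: diff_derivable.
  have -> : a = a *: (1 : R) by rewrite [RHS]mulr1.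
  rewrite deriveE// [LHS]linearZ -deriveE//.
  by case: H => _; rewrite -/g => ->; rewrite [a *: 1]mulr1.
have E : (fun h : R => h^-1 *: ((f \o shift x) (h *: (a *: v)) - f x)) =
   (fun h : R => h^-1 *: ((g \o shift 0) (h *: a) - g 0)).
  apply/funext => h /=; congr (_ *: (f _ - f _)); last by rewrite scale0r addr0.
  by rewrite scalerA addr0 addrC.
by case: d0 => d1 d2; split; [rewrite /derivable E|rewrite /derive E].
Qed.

Section Strict.
Variable m : nat.
Implicit Types (x y : 'rV[R]_m) (f : 'rV[R]_m -> R).

Definition grad f x : 'cV[R]_m := \col_i 'D_('e_i) f x.

Lemma near_dist_lt (V : normedModType R) (x : V) (d : R) : 0 < d ->
  \forall y \near x, `|y - x| < d.
Proof.
move=> d0; apply/nbhs_ballP; exists d => //= y.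
by rewrite -ball_normE /= distrC.
Qed.

Lemma continuous_distP (V W : normedModType R) (f : V -> W) (x : V) :
  (forall e : R, 0 < e -> \forall y \near x, `|f y - f x| <= e) ->
  {for x, continuous f}.
Proof.
move=> H; apply/cvgrPdist_le => e /H; apply: filterS => y.
by rewrite distrC.
Qed.

Lemma convex_ball_norm (x0 x v : 'rV[R]_m) (r s : R) : 0 <= s <= 1 ->
  `|x - x0| < r -> `|x + v - x0| < r -> `|x + s *: v - x0| < r.
Proof.
move=> /andP[s0 s1] xr vr.
have -> : x + s *: v - x0 = (1 - s) *: (x - x0) + s *: (x + v - x0).
  apply/rowP => j; rewrite !mxE; ring.
rewrite (le_lt_trans (ler_normD _ _))// !normrZ !ger0_norm// ?subr_ge0//.
have [->|s0'] := eqVneq s 0; first by rewrite subr0 mul1r mul0r addr0.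
have {s0'}sgt0 : 0 < s by rewrite lt_def s0' s0.
have -> : r = (1 - s) * r + s * r by rewrite -mulrDl subrK mul1r.
by rewrite ler_ltD ?ltr_pM2l// ler_wpM2l ?subr_ge0// ltW.
Qed.

(* The segment from [x] to [y] is replaced by a path along the coordinate axes,
   on each edge of which the mean value theorem applies. *)
Lemma C1_strict (U : set 'rV[R]_m) f x0 : open U -> U x0 -> Ck_on 1 U f ->
  forall e, 0 < e -> exists2 r, 0 < r & forall x y, `|x - x0| < r -> `|y - x0| < r ->
    `|f y - f x - ((y - x) *m grad f x0) 0 0| <= e * `|y - x|.
Proof.
move=> oU Ux0 [_ fC1] e e0.
(* The path has [m] edges, each allowed this error; the denominator [m + 1] also covers [m = 0]. *)
have e1 : 0 < e / m.+1%:R by rewrite divr_gt0.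
have [r r0 H] : exists2 r, 0 < r & forall z, `|z - x0| < r -> U z /\
    forall i, `|'D_('e_i) f z - 'D_('e_i) f x0| <= e / m.+1%:R.
  have : \forall z \near x0, U z /\ forall i, `|'D_('e_i) f z - 'D_('e_i) f x0| <= e / m.+1%:R.
    near=> z; split; first by near: z; exact: open_nbhs_nbhs.
    near: z; apply: filter_forall => i; have [_ [+ _]] := fC1 i.
    by move=> /(_ x0 Ux0)/cvgrPdist_le/(_ _ e1); apply: filterS => z; rewrite distrC.
  move=> /nbhs_ballP[r /= r0 H]; exists r => // z zr; apply: H.
  by rewrite -ball_normE /= distrC.
exists r => // x y xr yr.
pose z j : 'rV[R]_m := \row_i (if (i < j)%N then y 0 i else x 0 i).
have zr j : `|z j - x0| < r.
  apply: mx_norm_lt => // a b; rewrite !mxE ord1; case: ifP => _.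
    by apply: le_lt_trans yr; rewrite (le_trans _ (ler_mx_coord _ 0 b))// !mxE.
  by apply: le_lt_trans xr; rewrite (le_trans _ (ler_mx_coord _ 0 b))// !mxE.
have zS (j : 'I_m) : z j.+1 = z j + (y 0 j - x 0 j) *: 'e_j.
  apply/rowP => i; rewrite !mxE eqxx /= ltnS leq_eqVlt.
  have [->|ij] := eqVneq i j; first by rewrite eqxx ltnn /= mulr1 addrC subrK.
  by rewrite -val_eqE /= in ij; rewrite (negbTE ij) mulr0 addr0.
have step (j : 'I_m) : `|f (z j.+1) - f (z j) - (y 0 j - x 0 j) * 'D_('e_j) f x0|
    <= e / m.+1%:R * `|y - x|.
  have dz s : 0 <= s <= 1 -> `|z j + s *: ((y 0 j - x 0 j) *: 'e_j) - x0| < r.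
    by move=> s01; apply: convex_ball_norm => //; rewrite -zS.
  have df s : 0 <= s <= 1 -> derivable f (z j + s *: ((y 0 j - x 0 j) *: 'e_j))
     ((y 0 j - x 0 j) *: 'e_j) /\ 'D_((y 0 j - x 0 j) *: 'e_j) f (z j + s *: ((y 0 j - x 0 j) *: 'e_j)) =
     (y 0 j - x 0 j) * 'D_('e_j) f (z j + s *: ((y 0 j - x 0 j) *: 'e_j)).
    move=> s01; apply: derivable_scale.
    have [+ _] := H _ (dz s s01); exact: (fC1 j).1.
  have [|s s01] := @MVT_line _ f (z j) ((y 0 j - x 0 j) *: 'e_j).
    by move=> s /df[].
  rewrite -zS => ->; have [_ ->] := df s s01.
  rewrite -mulrBr normrM mulrC ler_pM//.
    by have [_ ->] := H _ (dz s s01).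
  by rewrite (le_trans _ (ler_mx_coord _ 0 j))// !mxE.
have -> : f y - f x - ((y - x) *m grad f x0) 0 0 =
    \sum_(j < m) (f (z j.+1) - f (z j) - (y 0 j - x 0 j) * 'D_('e_j) f x0).
  rewrite sumrB; congr (_ - _).
    have := telescope_sumr (fun j => f (z j)) (leq0n m); rewrite big_mkord => ->.
    congr (f _ - f _); apply/rowP => i; rewrite !mxE ?ltn_ord//.
  by rewrite mxE; apply: eq_bigr => j _; rewrite !mxE.
rewrite (le_trans (ler_norm_sum _ _ _))//.
apply: le_trans (_ : \sum_(j < m) e / m.+1%:R * `|y - x| <= _); first by apply: ler_sum.
rewrite sumr_const card_ord -mulrnAl ler_wpM2r//.
have -> : e / m.+1%:R *+ m = e * (m%:R / m.+1%:R) by rewrite -mulr_natr; ring.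
by rewrite ler_piMr ?(ltW e0)// ler_pdivrMr// mul1r ler_nat.
Unshelve. all: by end_near. Qed.

End Strict.

Lemma diff_dist (V W : normedModType R) (f : V -> W) (L : {linear V -> W}) (x : V) :
  continuous L ->
  (forall e : R, 0 < e -> \forall y \near x, `|f y - f x - L (y - x)| <= e * `|y - x|) ->
  differentiable f x /\ 'd f x = L :> (V -> W).
Proof.
move=> cL H.
have E : f \o shift x = cst (f x) + L +o_ 0 id.
  apply/eqaddoP => e e0; have := H _ e0.
  rewrite (near_shift 0) subr0.
  apply: filterS => h; rewrite /= addrK.
  by rewrite opprD addrA.
have dE := diff_unique cL E; split => //.
by apply/diff_locallyP; rewrite dE.
Qed.

Lemma diff_rowP (m n : nat) (F : 'rV[R]_m -> 'rV[R]_n) x (A : 'M[R]_(m, n)) :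
  (forall e, 0 < e -> \forall y \near x, `|F y - F x - (y - x) *m A| <= e * `|y - x|) ->
  differentiable F x /\ 'J F x = A.
Proof.
move=> H.
have cA : continuous (mulmxr A : 'rV[R]_m -> 'rV[R]_n).
  move=> z; apply: continuous_distP => e e0.
  have c0 : 0 < m%:R * `|A| + 1 by rewrite ltr_wpDl// mulr_ge0.
  have d0 : 0 < e / (m%:R * `|A| + 1) by rewrite divr_gt0.
  apply: (@filterS _ (nbhs z) _ _ _ _ (near_dist_lt z d0)) => y /= yz.
  rewrite -mulmxBl (le_trans (ler_norm_mulmx _ _))// mulrAC.
  rewrite (@le_trans _ _ ((m%:R * `|A| + 1) * `|y - z|))//.
    by rewrite ler_wpM2r// lerDl.
  by rewrite -ler_pdivlMl// mulrC ltW.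
have [] := @diff_dist _ _ F (mulmxr A) x cA H.
move=> D dE; split => //.
apply/row_matrixP => i; rewrite !rowE /jacobian mul_rV_lin1 /=.
by rewrite dE.
Qed.

End Differentiability.

Section IsDerive.
Variables (R : realType) (V : normedModType R).
Implicit Types (x v : V).

Lemma is_derive_mxP (a b : nat) (F : V -> 'M[R]_(a, b)) x v dF :
  is_derive x v F dF <-> forall i j, is_derive x v (fun y => F y i j) (dF i j).
Proof.
split=> [[dv <-] i j|H].
  split; first by move/derivable_mxP : dv; apply.
  by rewrite derive_mx// mxE.
have dv : derivable F x v by apply/derivable_mxP => i j; case: (H i j).
split=> //; rewrite derive_mx//; apply/matrixP => i j; rewrite mxE.
by case: (H i j).
Qed.

Lemma is_derive_sumr (I : finType) (f : I -> V -> R) x v (df : I -> R) :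
  (forall i, is_derive x v (f i) (df i)) ->
  is_derive x v (fun y => \sum_i f i y) (\sum_i df i).
Proof.
move=> H; have := @is_derive_sum R V R #|I| (fun k => f (enum_val k)) x v
  (fun k => df (enum_val k)) (fun k => H _).
rewrite (reindex (@enum_val I predT)) /=; last first.
  by exists enum_rank => i _; rewrite ?enum_valK ?enum_rankK.
suff -> : (\sum_(i < #|I|) f (enum_val i)) = (fun y => \sum_i f i y) by [].
apply/funext => y; rewrite fct_sumE [RHS](reindex (@enum_val I predT)) //=.
by exists enum_rank => i _; rewrite ?enum_valK ?enum_rankK.
Qed.

Lemma is_deriveMr (f g : V -> R) x v df dg :
  is_derive x v f df -> is_derive x v g dg ->
  is_derive x v (fun y => f y * g y) (df * g x + f x * dg).
Proof.
move=> Hf Hg; have := is_deriveM Hf Hg; rewrite -[fun y => _]/(f * g).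
case=> d1 d2; split=> //; rewrite [LHS]d2 addrC; congr (_ + _).
by rewrite [LHS]mulrC.
Qed.

Lemma is_derive_mulmx (a b c : nat) (F : V -> 'M[R]_(a, b)) (G : V -> 'M[R]_(b, c))
    x v dF dG :
  is_derive x v F dF -> is_derive x v G dG ->
  is_derive x v (fun y => F y *m G y) (dF *m G x + F x *m dG).
Proof.
move=> /is_derive_mxP HF /is_derive_mxP HG; apply/is_derive_mxP => i j.
have -> : (fun y => (F y *m G y) i j) = (fun y => \sum_s F y i s * G y s j).
  by apply/funext => y; rewrite mxE.
rewrite !mxE -big_split /=.
by apply: is_derive_sumr => s; apply: is_deriveMr.
Qed.

Lemma is_derive_tr (a b : nat) (F : V -> 'M[R]_(a, b)) x v dF :
  is_derive x v F dF -> is_derive x v (fun y => (F y)^T) dF^T.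
Proof.
move=> /is_derive_mxP HF; apply/is_derive_mxP => i j; rewrite mxE.
have -> : (fun y => (F y)^T i j) = (fun y => F y j i); last exact: HF.
by apply/funext => y; rewrite mxE.
Qed.

(** The inner map is only derivable along [v]. Restricted to the line it is a differentiable
    function of one real variable, to which the chain rule for differentials applies. *)
Lemma is_derive_comp_diff (W W' : normedModType R) (Phi : W -> W') (F : V -> W) x v dF :
  is_derive x v F dF -> differentiable Phi (F x) ->
  is_derive x v (Phi \o F) ('d Phi (F x) dF).
Proof.
move=> HF dPhi.
pose g (s : R) := F (x + s *: v).
have F0 : F x = g 0 by rewrite /g scale0r addr0.
have Hg : is_derive (0 : R) (1 : R) g dF.
  rewrite -(@derive_val _ _ _ x v F dF).
  have := @is_derive_line R V W F x v 0; rewrite scale0r addr0; apply.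
  by case: HF.
have dg : differentiable g (0 : R) by apply/derivable1_diffP; case: Hg.
rewrite F0 in dPhi *.
have dc : differentiable (Phi \o g) (0 : R) by exact: differentiable_comp.
have Hc : is_derive (0 : R) (1 : R) (Phi \o g) ('d Phi (g 0) dF).
  split; first exact: diff_derivable.
  rewrite deriveE// diff_comp//=; case: Hg => _ <-; by rewrite [in RHS]deriveE.
have E : (fun h : R => h^-1 *: (((Phi \o F) \o shift x) (h *: v) - (Phi \o F) x)) =
   (fun h : R => h^-1 *: (((Phi \o g) \o shift 0) (h *: (1 : R)) - (Phi \o g) 0)).
  apply/funext => h; rewrite /= /g scale0r !addr0.
  by rewrite [h *: (1 : R)]mulr1 [h *: v + x]addrC.
by case: Hc => d1 d2; split; [rewrite /derivable E|rewrite /derive E].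
Qed.

End IsDerive.

(** * Derivatives of determinants and inverses *)

Section DetDerive.
Variable R : realType.

(** The cofactors along row [i] do not involve row [i], so the determinant is affine in each entry
    of that row. *)
Lemma det_add_delta n (A : 'M[R]_n) i j (t : R) :
  \det (A + t *: delta_mx i j) = \det A + t * cofactor A i j.
Proof.
rewrite (expand_det_row _ i) (expand_det_row A i).
have E s : cofactor (A + t *: delta_mx i j) i s = cofactor A i s.
  rewrite /cofactor; congr (_ * \det _); apply/matrixP => a b.
  rewrite !mxE [(lift i a == i)]eq_sym (negbTE (neq_lift _ _)) /=.
  by rewrite mulr0 addr0.
under eq_bigr do rewrite E !mxE eqxx /= mulrDl.
rewrite big_split /=; congr (_ + _).
rewrite (bigD1 j) //= big1 => [|s sj]; first by rewrite eqxx mulr1 addr0.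
by rewrite (negbTE sj) mulr0 mul0r.
Qed.

Lemma differentiable_sumr (V : normedModType R) (I : Type) (r : seq I)
    (f : I -> V -> R) x : (forall i, differentiable (f i) x) ->
  differentiable (fun y => \sum_(i <- r) f i y) x.
Proof.
move=> H; elim: r => [|i r IH].
  under eq_fun do rewrite big_nil; exact: differentiable_cst.
under eq_fun do rewrite big_cons; exact: (differentiableD (H i) IH).
Qed.

Lemma differentiable_prodr (V : normedModType R) (I : Type) (r : seq I)
    (f : I -> V -> R) x : (forall i, differentiable (f i) x) ->
  differentiable (fun y => \prod_(i <- r) f i y) x.
Proof.
move=> H; elim: r => [|i r IH].
  under eq_fun do rewrite big_nil; exact: differentiable_cst.
under eq_fun do rewrite big_cons; exact: (differentiableM (H i) IH).
Qed.

Lemma differentiable_det n (A : 'M[R]_n) :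
  differentiable (fun B : 'M[R]_n => \det B) A.
Proof.
rewrite /determinant; apply: differentiable_sumr => s.
apply: differentiableM; first exact: differentiable_cst.
by apply: differentiable_prodr => i; exact: differentiable_coord.
Qed.

(** Jacobi's formula. By linearity of the differential it suffices to test elementary matrices,
    along which the determinant is affine. *)
Lemma diff_det n (A H : 'M[R]_n) :
  'd (fun B : 'M[R]_n => \det B) A H = \tr (\adj A *m H).
Proof.
have -> : \tr (\adj A *m H) = \sum_i \sum_j H i j * cofactor A i j.
  rewrite /mxtrace; under eq_bigr do rewrite mxE.
  rewrite exchange_big /=; apply: eq_bigr => i _; apply: eq_bigr => j _.
  by rewrite !mxE mulrC.
rewrite {1}(matrix_sum_delta H) linear_sum; apply: eq_bigr => i _.
rewrite linear_sum; apply: eq_bigr => j _; rewrite linearZ /=.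
congr (_ * _); rewrite -deriveE; last exact: differentiable_det.
apply: cvg_lim => //.
have E : {near (0 : R)^', (fun h : R => h^-1 *: (((fun B : 'M[R]_n => \det B) \o shift A) (h *: delta_mx i j) - \det A))
  =1 cst (cofactor A i j)}.
  near=> h; rewrite /= [_ + A]addrC det_add_delta [\det A + _]addrC addrK /GRing.scale /= mulKf//.
  by near: h; exact: nbhs_dnbhs_neq.
apply: cvg_trans (@cvg_cst R (cofactor A i j) R (0 : R)^' _).
by apply: near_eq_cvg; apply: filterS E => h ->.
Unshelve. all: by end_near. Qed.

Lemma is_derive_det (V : normedModType R) n (F : V -> 'M[R]_n) x v dF :
  is_derive x v F dF ->
  is_derive x v (fun y => \det (F y)) (\tr (\adj (F x) *m dF)).
Proof.
move=> HF; rewrite -diff_det.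
exact: (is_derive_comp_diff HF (@differentiable_det _ _)).
Qed.

(** With derivability of the inverse assumed, the formula follows by differentiating
    [F y *m invmx (F y) = 1%:M]. For smooth families that derivability comes from the adjugate
    ([smx_inv]). *)
Lemma is_derive_invmx (V : normedModType R) n (F : V -> 'M[R]_n) x v dF :
  (\forall y \near x, F y \in unitmx) ->
  derivable (fun y => invmx (F y)) x v ->
  is_derive x v F dF ->
  is_derive x v (fun y => invmx (F y)) (- (invmx (F x) *m dF *m invmx (F x))).
Proof.
move=> Fu di HF; split=> //.
have Hi := derivableP di.
have := is_derive_mulmx HF Hi; set dI := 'D_v _ _.
move=> H1.
have H2 : is_derive x v (fun y => F y *m invmx (F y)) 0.
  apply: (near_eq_is_derive _ (is_derive_cst (1%:M : 'M[R]_n) x v)).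
  by near do rewrite /cst mulmxV//.
have [_ e1] := H1; have [_ e2] := H2; rewrite e2 in e1.
have Fx : F x \in unitmx by exact: nbhs_singleton Fu.
move/(congr1 (mulmx (invmx (F x)))): e1.
rewrite mulmx0 mulmxDr !mulmxA mulVmx// mul1mx => /eqP.
by rewrite eq_sym addrC addr_eq0 => /eqP.
Unshelve. all: by end_near. Qed.

End DetDerive.

(** * Functions of class C^k on an open set *)

Section CkCalculus.
Variables (R : realType) (m : nat).
Implicit Types (U V : set 'rV[R]_m) (f g : 'rV[R]_m -> R) (x : 'rV[R]_m).

Lemma Ck_on_continuous k U f x : Ck_on k U f -> U x -> {for x, continuous f}.
Proof. by case: k => [|k] [+ _]; exact. Qed.

Lemma Ck_on_derivable k U f x i : Ck_on k.+1 U f -> U x -> derivable f x 'e_i.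
Proof. by move=> [_ /(_ i)[+ _]]; exact. Qed.

Lemma Ck_on_pderive k U f i : Ck_on k.+1 U f -> Ck_on k U (fun x => 'D_('e_i) f x).
Proof. by move=> [_ /(_ i)[]]. Qed.

Lemma Ck_onW k U f : Ck_on k.+1 U f -> Ck_on k U f.
Proof.
elim: k f => [|k IH] f [cf Hf]; first by split.
by split=> // i; have [df /IH ?] := Hf i; split.
Qed.

Lemma Ck_on_sub k U V f : V `<=` U -> Ck_on k U f -> Ck_on k V f.
Proof.
move=> VU; elim: k f => [|k IH] f [cf Hf]; first by split=> // x /VU; exact: cf.
split=> [x /VU|i]; first exact: cf.
by have [df /IH ?] := Hf i; split=> // x /VU; exact: df.
Qed.

Lemma Ck_on_union k U V f : Ck_on k U f -> Ck_on k V f -> Ck_on k (U `|` V) f.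
Proof.
elim: k f => [|k IH] f [cf Hf] [cg Hg].
  by split=> // x [/cf|/cg].
split=> [x [/cf|/cg]//|i].
have [df Df] := Hf i; have [dg Dg] := Hg i.
by split=> [x [/df|/dg]//|]; exact: IH.
Qed.

Lemma near_open_eq U f g x : open U -> (forall y, U y -> f y = g y) -> U x ->
  \forall y \near x, f y = g y.
Proof.
move=> oU fg Ux; near=> y; apply: fg; near: y.
exact: open_nbhs_nbhs.
Unshelve. all: by end_near. Qed.

Lemma continuous_near_eq (T : topologicalType) (f' g' : T -> R) (x : T) :
  (\forall y \near x, f' y = g' y) -> {for x, continuous f'} -> {for x, continuous g'}.
Proof.
move=> fg cf; have E := nbhs_singleton fg.
rewrite /prop_for /continuous_at -E.
apply: cvg_trans cf; apply: near_eq_cvg.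
by apply: filterS fg => y ->.
Qed.

Lemma continuous_mx_coord (T : topologicalType) (a b : nat) (F : T -> 'M[R]_(a, b)) (x : T) :
  (forall i j, {for x, continuous (fun y => F y i j)}) -> {for x, continuous F}.
Proof. by move=> H; apply: cvg_mx_coord => i j; exact: H. Qed.

Lemma eq_Ck_on k U f g : open U -> (forall x, U x -> f x = g x) ->
  Ck_on k U f -> Ck_on k U g.
Proof.
move=> oU; elim: k f g => [|k IH] f g fg [cf Hf].
  split=> // x Ux; exact: continuous_near_eq (near_open_eq oU fg Ux) (cf x Ux).
split=> [x Ux|i].
  exact: continuous_near_eq (near_open_eq oU fg Ux) (cf x Ux).
have [df Df] := Hf i; split=> [x Ux|].
  exact: near_eq_derivable (near_open_eq oU fg Ux) (df x Ux).
apply: IH Df => x Ux; exact: near_eq_derive (near_open_eq oU fg Ux).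
Qed.

Lemma Ck_cst k U (c : R) : Ck_on k U (cst c).
Proof.
elim: k c => [|k IH] c; first by split=> // x _; exact: cst_continuous.
split=> [x _|i]; first exact: cst_continuous.
split=> [x _|]; first exact: derivable_cst.
have -> : (fun x => 'D_('e_i) (cst c) x) = cst 0 :> ('rV[R]_m -> R); last exact: IH.
by apply/funext => x; rewrite derive_cst.
Qed.

Lemma is_derive_coord x v j : is_derive x v (fun y : 'rV[R]_m => y 0 j) (v 0 j).
Proof. by have /is_derive_mxP := is_derive_id x v; apply. Qed.

Lemma Ck_coord k U j : Ck_on k U (fun x => x 0 j).
Proof.
have cc : continuous (fun x : 'rV[R]_m => x 0 j) by exact: coord_continuous.
case: k => [|k]; first by split=> // x _; exact: cc.
split=> [x _|i]; first exact: cc.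
split=> [x _|]; first by case: (is_derive_coord x 'e_i j).
suff -> : (fun x => 'D_('e_i) (fun y : 'rV[R]_m => y 0 j) x) = cst (('e_i : 'rV[R]_m) 0 j) :> ('rV[R]_m -> R).
  exact: Ck_cst.
by apply/funext => x; case: (is_derive_coord x 'e_i j).
Qed.

Lemma CkD k U f g : open U -> Ck_on k U f -> Ck_on k U g -> Ck_on k U (fun x => f x + g x).
Proof.
move=> oU; elim: k f g => [|k IH] f g [cf Hf] [cg Hg].
  by split=> // x Ux; apply: continuousD; [exact: cf|exact: cg].
split=> [x Ux|i]; first by apply: continuousD; [exact: cf|exact: cg].
have [df Df] := Hf i; have [dg Dg] := Hg i; split=> [x Ux|].
  exact: derivableD (df x Ux) (dg x Ux).
apply: eq_Ck_on (IH _ _ Df Dg) => // x Ux.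
by rewrite [RHS](deriveD (df x Ux) (dg x Ux)).
Qed.

Lemma CkM k U f g : open U -> Ck_on k U f -> Ck_on k U g -> Ck_on k U (fun x => f x * g x).
Proof.
move=> oU; elim: k f g => [|k IH] f g.
  move=> [cf Hf] [cg Hg].
  by split=> // x Ux; apply: continuousM; [exact: cf|exact: cg].
move=> /[dup] fk [cf Hf] /[dup] gk [cg Hg].
split=> [x Ux|i]; first by apply: continuousM; [exact: cf|exact: cg].
have [df Df] := Hf i; have [dg Dg] := Hg i; split=> [x Ux|].
  by case: (is_deriveMr (derivableP (df x Ux)) (derivableP (dg x Ux))).
apply: eq_Ck_on (CkD oU (IH _ _ Df (Ck_onW gk)) (IH _ _ (Ck_onW fk) Dg)) => // x Ux.
by case: (is_deriveMr (derivableP (df x Ux)) (derivableP (dg x Ux))).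
Qed.

Lemma CkZ k U f (c : R) : open U -> Ck_on k U f -> Ck_on k U (fun x => c * f x).
Proof. by move=> oU ?; apply: CkM => //; exact: Ck_cst. Qed.

Lemma CkN k U f : open U -> Ck_on k U f -> Ck_on k U (fun x => - f x).
Proof.
by move=> oU fk; apply: eq_Ck_on (CkZ (-1) oU fk) => // x _; rewrite mulN1r.
Qed.

Lemma CkB k U f g : open U -> Ck_on k U f -> Ck_on k U g -> Ck_on k U (fun x => f x - g x).
Proof. by move=> oU ? ?; apply: CkD => //; exact: CkN. Qed.

Lemma Ck_sum k U (I : Type) (r : seq I) (P : pred I) (f : I -> 'rV[R]_m -> R) : open U ->
  (forall i, P i -> Ck_on k U (f i)) -> Ck_on k U (fun x => \sum_(i <- r | P i) f i x).
Proof.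
move=> oU H; elim: r => [|i r IH].
  by under eq_fun do rewrite big_nil; exact: Ck_cst.
under eq_fun do rewrite big_cons; case Pi: (P i) => //.
by apply: CkD => //; exact: H.
Qed.

Lemma Ck_prod k U (I : Type) (r : seq I) (P : pred I) (f : I -> 'rV[R]_m -> R) : open U ->
  (forall i, P i -> Ck_on k U (f i)) -> Ck_on k U (fun x => \prod_(i <- r | P i) f i x).
Proof.
move=> oU H; elim: r => [|i r IH].
  by under eq_fun do rewrite big_nil; exact: Ck_cst.
under eq_fun do rewrite big_cons; case Pi: (P i) => //.
by apply: CkM => //; exact: H.
Qed.

(** The derivative is [- f^-2 f'], so the induction hypothesis for [f^-1] itself gains one order;
    [Ck_sqrt] bootstraps in the same way. *)
Lemma CkV k U f : open U -> (forall x, U x -> f x != 0) ->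
  Ck_on k U f -> Ck_on k U (fun x => (f x)^-1).
Proof.
move=> oU f0; elim: k => [|k IH].
  by move=> [cf Hf]; split=> // x Ux; apply: continuousV; [exact: f0|exact: cf].
move=> /[dup] fk [cf Hf].
split=> [x Ux|i]; first by apply: continuousV; [exact: f0|exact: cf].
have [df Df] := Hf i; split=> [x Ux|].
  exact: (derivableV (f0 x Ux) (df x Ux)).
have fV := IH (Ck_onW fk).
apply: eq_Ck_on (CkN oU (CkM oU (CkM oU fV fV) Df)) => // x Ux.
rewrite [RHS](deriveV (f0 x Ux) (df x Ux)) -expr2 exprVn.
by rewrite [RHS]mulNr.
Qed.

Lemma is_derive_sqrt (V : normedModType R) (h : V -> R) (y v : V) dh :
  0 < h y -> is_derive y v h dh ->
  is_derive y v (fun z => Num.sqrt (h z)) (dh / (2 * Num.sqrt (h y))).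
Proof.
move=> h0 Hh.
have Hs := is_derive1_sqrt h0.
have ds : differentiable (Num.sqrt : R -> R) (h y).
  by apply/derivable1_diffP; case: Hs.
have [d1 d2] := is_derive_comp_diff Hh ds; split=> //.
rewrite [LHS]d2 -[dh in LHS]mulr1 [LHS]linearZ /= -deriveE//.
by case: Hs => _ ->.
Qed.

Lemma Ck_sqrt k U f : open U -> (forall x, U x -> 0 < f x) ->
  Ck_on k U f -> Ck_on k U (fun x => Num.sqrt (f x)).
Proof.
move=> oU f0.
have cs x : U x -> {for x, continuous f} -> {for x, continuous (fun x => Num.sqrt (f x))}.
  by move=> Ux cf; apply: continuous_comp cf _; exact: sqrt_continuous.
elim: k => [|k IH].
  by move=> [cf Hf]; split=> // x Ux; apply: cs (cf x Ux).
move=> /[dup] fk [cf Hf].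
split=> [x Ux|i]; first by apply: cs (cf x Ux).
have [df Df] := Hf i; split=> [x Ux|].
  by case: (is_derive_sqrt (f0 x Ux) (derivableP (df x Ux))).
have fV := IH (Ck_onW fk).
have sV : Ck_on k U (fun x => (2 * Num.sqrt (f x))^-1).
  apply: CkV => //; last exact: CkZ.
  by move=> x Ux; rewrite mulf_neq0// gt_eqF// sqrtr_gt0 f0.
apply: eq_Ck_on (CkM oU Df sV) => // x Ux.
by case: (is_derive_sqrt (f0 x Ux) (derivableP (df x Ux))).
Qed.

Lemma smooth_pderive U f i : smooth_on U f -> smooth_on U (fun x => 'D_('e_i) f x).
Proof. by move=> sf k; exact: Ck_on_pderive (sf k.+1). Qed.

End CkCalculus.

Section C1.
Variables (R : realType) (m : nat).
Implicit Types (U V : set 'rV[R]_m) (f g : 'rV[R]_m -> R) (x : 'rV[R]_m).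

Lemma C1_vec_diff (n : nat) U (F : 'rV[R]_m -> 'rV[R]_n) x : open U -> U x ->
  (forall j, Ck_on 1 U (fun y => F y 0 j)) ->
  differentiable F x /\ 'J F x = \matrix_(i, j) 'D_('e_i) (fun y => F y 0 j) x.
Proof.
move=> oU Ux H; apply: diff_rowP => e e0.
have : \forall y \near x, forall j, `|F y 0 j - F x 0 j - ((y - x) *m grad (fun y => F y 0 j) x) 0 0|
    <= e * `|y - x|.
  near=> y; near: y; apply: filter_forall => j.
  have [r r0 K] := C1_strict oU Ux (H j) e0.
  apply: filterS (near_dist_lt x r0) => y yr; apply: K => //.
  by rewrite subrr normr0.
apply: filterS => y K; apply: mx_norm_le; first by rewrite mulr_ge0// ltW.
move=> i j; set A := \matrix_(_, _) _.
have -> : (F y - F x - (y - x) *m A) i j =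
    F y 0 j - F x 0 j - ((y - x) *m grad (fun y => F y 0 j) x) 0 0; last exact: K.
  rewrite ord1 !mxE; congr (_ - _).
  by apply: eq_bigr => s _; rewrite !mxE.
Unshelve. all: by end_near. Qed.

Lemma C1_derive U f x v : open U -> U x -> Ck_on 1 U f ->
  is_derive x v f (\sum_i v 0 i * 'D_('e_i) f x).
Proof.
move=> oU Ux H; pose F (y : 'rV[R]_m) : 'rV[R]_1 := (f y)%:M.
have fF : f = (fun y => F y 0 0) by apply/funext => y; rewrite mxE mulr1n.
have [dF JF] : differentiable F x /\ 'J F x = \matrix_(i, j) 'D_('e_i) (fun y => F y 0 j) x.
  by apply: C1_vec_diff Ux _ => // j; rewrite ord1 -fF.
have HF : is_derive x v F (v *m 'J F x).
  by split; [exact: diff_derivable|rewrite deriveEjacobian].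
rewrite fF; have /is_derive_mxP/(_ 0 0) := HF.
rewrite mxE; under eq_bigr do rewrite JF mxE.
by under eq_bigr do rewrite -fF; rewrite -fF.
Qed.

End C1.

Section Compose.
Variables (R : realType) (m n : nat).

Lemma C1_chain (U : set 'rV[R]_m) (V : set 'rV[R]_n) (phi : 'rV[R]_m -> 'rV[R]_n)
    (f : 'rV[R]_n -> R) x v :
  open U -> open V -> U x -> V (phi x) ->
  (forall j, Ck_on 1 U (fun y => phi y 0 j)) -> Ck_on 1 V f ->
  is_derive x v (f \o phi) (\sum_j 'D_v (fun y => phi y 0 j) x * 'D_('e_j) f (phi x)).
Proof.
move=> oU oV Ux Vx Hphi Hf.
have [dphi _] := C1_vec_diff oU Ux Hphi.
pose F (y : 'rV[R]_n) : 'rV[R]_1 := (f y)%:M.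
have fF : f = (fun y => F y 0 0) by apply/funext => y; rewrite mxE mulr1n.
have F1 j : Ck_on 1 V (fun y => F y 0 j) by rewrite ord1 -fF.
have [dF JF] := C1_vec_diff oV Vx F1.
have Hp : is_derive x v phi ('D_v phi x) by apply: derivableP; exact: diff_derivable.
have := is_derive_comp_diff Hp dF.
have -> : 'd F (phi x) ('D_v phi x) = 'D_v phi x *m 'J F (phi x).
  by rewrite -deriveE// deriveEjacobian.
move=> /is_derive_mxP/(_ 0 0); rewrite mxE.
have -> : (fun y => (F \o phi) y 0 0) = f \o phi.
  by apply/funext => y; rewrite /= mxE mulr1n.
under eq_bigr do rewrite JF mxE -fF.
suff E j : ('D_v phi x) 0 j = 'D_v (fun y => phi y 0 j) x.
  by under eq_bigr do rewrite E.
by have /is_derive_mxP/(_ 0 j)[_ <-] := Hp.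
Qed.

(** The induction on [k] is for all [f] at once: the chain rule produces the partial derivatives of
    [f] composed with the same [phi]. *)
Lemma Ck_comp k (U : set 'rV[R]_m) (V : set 'rV[R]_n) (phi : 'rV[R]_m -> 'rV[R]_n)
    (f : 'rV[R]_n -> R) :
  open U -> open V -> (forall x, U x -> V (phi x)) ->
  (forall j, Ck_on k U (fun y => phi y 0 j)) -> Ck_on k V f ->
  Ck_on k U (f \o phi).
Proof.
move=> oU oV UV.
have cont (f' : 'rV[R]_n -> R) : (forall j x, U x -> {for x, continuous (fun y => phi y 0 j)}) ->
   (forall y, V y -> {for y, continuous f'}) ->
   forall x, U x -> {for x, continuous (f' \o phi)}.
  move=> cphi cf x Ux; 
  have c1 : {for x, continuous phi}.
    by apply: continuous_mx_coord => i j; rewrite ord1; exact: cphi.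
  exact: (continuous_comp c1 (cf _ (UV _ Ux))).
elim: k f => [|k IH] f Hphi Hf.
  split=> //; apply: cont => [j|y Vy]; first by case: (Hphi j).
  exact: Ck_on_continuous Hf Vy.
have Hphi1 j : Ck_on 1 U (fun y => phi y 0 j).
  by elim: (k) (Hphi j) => // k' IHk /Ck_onW.
have Hf1 : Ck_on 1 V f by elim: (k) Hf => // k' IHk /Ck_onW.
split.
  apply: cont => [j|y Vy]; first by case: (Hphi j).
  exact: Ck_on_continuous Hf Vy.
move=> i; split=> [x Ux|].
  by case: (C1_chain 'e_i oU oV Ux (UV x Ux) Hphi1 Hf1).
have K : Ck_on k U (fun x => \sum_j 'D_('e_i) (fun y => phi y 0 j) x *
    ((fun y => 'D_('e_j) f y) \o phi) x).
  apply: Ck_sum => // j _; apply: CkM => //; first exact: Ck_on_pderive.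
  by apply: IH; [move=> j'; exact: Ck_onW|exact: Ck_on_pderive].
apply: eq_Ck_on K => // x Ux.
by case: (C1_chain 'e_i oU oV Ux (UV x Ux) Hphi1 Hf1).
Qed.

End Compose.

(** * Symmetry of second derivatives *)

Section Schwarz.
Variables (R : realType) (m : nat).

(** The second difference is the increment along [t e_i] of [G y = f (y + t e_j) - f y]. The mean
    value theorem turns it into an increment of [D_i f] along [t e_j], and strict differentiability
    of [D_i f] at [x] evaluates that. *)
Let second_difference (U : set 'rV[R]_m) (f : 'rV[R]_m -> R) x i j : open U -> U x ->
  Ck_on 2 U f -> forall e, 0 < e -> \forall t \near (0 : R)^',
  `|(f (x + t *: 'e_i + t *: 'e_j) - f (x + t *: 'e_i) - (f (x + t *: 'e_j) - f x))
     / t ^+ 2 - 'D_('e_j) (fun y => 'D_('e_i) f y) x| <= e.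
Proof.
move=> oU Ux Hf e e0.
have Hg := Ck_on_pderive i Hf; set g := fun y => _ in Hg.
have [r0 r00 K] := C1_strict oU Ux Hg e0.
have [r1 r10 Ur1] : exists2 r, 0 < r & forall y, `|y - x| < r -> U y.
  have /nbhs_ballP[r /= r_gt0 H] : nbhs x U by exact: open_nbhs_nbhs.
  by exists r => // y yr; apply: H; rewrite -ball_normE /= distrC.
pose r := Num.min r0 r1; have r_gt0 : 0 < r by rewrite lt_min r00.
near=> t.
have t0 : t != 0 by near: t; exact: nbhs_dnbhs_neq.
have tr : `|t| + `|t| < r.
  have : `|t| < r / 2.
    near: t; apply: dnbhs0_lt; exact: divr_gt0.
  by move=> h; rewrite (splitr r) ltrD.
have ne (a : 'I_m) : `|'e_a : 'rV[R]_m| <= 1.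
  by apply: mx_norm_le => // p q; rewrite mxE; case: (_ && _); rewrite ?normr1 ?normr0.
have small (s s' : R) : 0 <= s <= 1 -> 0 <= s' <= 1 ->
    `|x + s *: (t *: 'e_i) + (s' * t) *: 'e_j - x| < r.
  move=> /andP[s0 s1] /andP[s'0 s'1].
  have -> : x + s *: (t *: 'e_i) + (s' * t) *: 'e_j - x = s *: (t *: 'e_i) + (s' * t) *: 'e_j.
    by rewrite addrAC [x + _]addrC addrK.
  apply: le_lt_trans tr; rewrite (le_trans (ler_normD _ _))//.
  apply: lerD.
    rewrite !normrZ [X in X * _]ger0_norm// -[leRHS]mul1r ler_pM ?mulr_ge0//.
    by rewrite -[leRHS]mulr1 ler_pM.
  rewrite !normrZ [X in X * _ * _]ger0_norm// -[leRHS]mulr1 ler_pM ?mulr_ge0//.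
  by rewrite -[leRHS]mul1r ler_pM.
pose G y := f (y + t *: 'e_j) - f y.
have dG (s : R) : 0 <= s <= 1 ->
    is_derive (x + s *: (t *: 'e_i)) (t *: 'e_i) G
     (t * (g (x + s *: (t *: 'e_i) + t *: 'e_j) - g (x + s *: (t *: 'e_i)))).
  move=> s01; rewrite mulrBr.
  have U0 : U (x + s *: (t *: 'e_i)).
    apply: Ur1; have := small s 0 s01; rewrite lexx ler01 mul0r scale0r addr0 => /(_ isT).
    by rewrite lt_min => /andP[].
  have U1 : U (x + s *: (t *: 'e_i) + t *: 'e_j).
    apply: Ur1; have := small s 1 s01; rewrite lexx ler01 mul1r => /(_ isT).
    by rewrite lt_min => /andP[].
  have [a1 a2] := derivable_scale t (@Ck_on_derivable _ _ _ _ _ _ i Hf U0).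
  have [b1 b2] := derivable_scale t (@Ck_on_derivable _ _ _ _ _ _ i Hf U1).
  apply: is_deriveB; last by split.
  have E (w : 'rV[R]_m) : (fun h : R => h^-1 *: (((fun y => f (y + t *: 'e_j)) \o shift w) (h *: (t *: 'e_i)) - f (w + t *: 'e_j)))
   = (fun h : R => h^-1 *: ((f \o shift (w + t *: 'e_j)) (h *: (t *: 'e_i)) - f (w + t *: 'e_j))).
    by apply/funext => h /=; rewrite addrA.
  by split; [rewrite /derivable E|rewrite /derive E].
have [|s s01] := @MVT_line R _ G x (t *: 'e_i); first by move=> s /dG[].
have [_ ->] := dG s s01.
rewrite /G => ->.
have K1 := K (x + s *: (t *: 'e_i)) (x + s *: (t *: 'e_i) + t *: 'e_j).
have L0 : `|x + s *: (t *: 'e_i) - x| < r0.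
  have := small s 0 s01; rewrite lexx ler01 mul0r scale0r addr0 => /(_ isT).
  by rewrite lt_min => /andP[].
have L1 : `|x + s *: (t *: 'e_i) + t *: 'e_j - x| < r0.
  have := small s 1 s01; rewrite lexx ler01 mul1r => /(_ isT).
  by rewrite lt_min => /andP[].
have {K1} := K1 L0 L1.
have -> : x + s *: (t *: 'e_i) + t *: 'e_j - (x + s *: (t *: 'e_i)) = t *: 'e_j.
  by rewrite addrC addKr.
rewrite -scalemxAl mxE -rowE !mxE; set q := _ - g _ => H.
have -> : t * q / t ^+ 2 - 'D_('e_j) g x = (q - t * 'D_('e_j) g x) / t.
  by field.
rewrite normrM normfV ler_pdivrMr ?normr_gt0//; apply: (le_trans H).
by rewrite normrZ ler_wpM2l ?(ltW e0)// ler_piMr.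
Unshelve. all: by end_near. Qed.

(** The second difference is symmetric in [i] and [j], so its quotient by [t ^+ 2] tends to both
    mixed derivatives. *)
Lemma pderiveC (U : set 'rV[R]_m) (f : 'rV[R]_m -> R) x i j : open U -> U x ->
  Ck_on 2 U f ->
  'D_('e_j) (fun y => 'D_('e_i) f y) x = 'D_('e_i) (fun y => 'D_('e_j) f y) x.
Proof.
move=> oU Ux Hf; apply/eqP; rewrite -subr_eq0 -normr_le0; apply/ler_addgt0Pr => e e0.
have e2 : 0 < e / 2 by rewrite divr_gt0.
have [t [H1 H2]] := @filter_ex _ (0 : R)^' _ _ (filterI (second_difference i j oU Ux Hf e2) (second_difference j i oU Ux Hf e2)).
rewrite add0r (splitr e).
have gen (X Y T a b d : R) : X = Y -> `|X / T - a| <= d -> `|Y / T - b| <= d -> `|a - b| <= d + d.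
  move=> -> Xa Yb; have -> : a - b = (Y / T - b) - (Y / T - a) by rewrite opprB [RHS]addrC subrKA.
  by rewrite (le_trans (ler_normB _ _))// lerD.
have E : x + t *: 'e_i + t *: 'e_j = x + t *: 'e_j + t *: 'e_i by rewrite addrAC.
apply: gen H1 H2; rewrite E.
move: (f (x + t *: 'e_j + t *: 'e_i)) (f (x + t *: 'e_i)) (f (x + t *: 'e_j)) (f x) => a b c d.
ring.
Qed.

End Schwarz.

(** * Iterated integrals *)

(** The radius is a parameter so that sums, slices and families of functions can share one bound on
    their supports, on which the uniform estimates rest. *)
Definition ccont (R : realType) (V : normedModType R) (r : R) (f : V -> R) : Prop :=
  [/\ 0 < r, continuous f & forall x, r < `|x| -> f x = 0].

(** * Integrals over R *)

Section OneDim.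
Variable R : realType.
Implicit Types (f g F G : R -> R) (r a b : R).

Notation int1 f := (\int[lebesgue_measure]_(t in [set: R]) f t).

Lemma continuous_withinT (A : set R) f : continuous f -> {within A, continuous f}.
Proof. by move=> cf; apply: continuous_subspaceT => x; exact: cf. Qed.

Lemma ccont_restrict r f b : ccont r f -> r < b -> f = f \_ `[- b, b]%classic.
Proof.
move=> [r0 cf f0] rb; apply/funext => t; rewrite patchE; case: ifPn => // tb.
apply: f0; move: tb; rewrite notin_setE /= in_itv /= => /negP.
by rewrite -ler_norml -ltNge; exact: lt_trans.
Qed.

Lemma integrable_ccont r f : ccont r f ->
  (@lebesgue_measure R).-integrable setT (EFin \o f).
Proof.
move=> /[dup] H [r0 cf f0].
have rb : r < r + 1 by rewrite ltrDl.
have cW : {within `[- (r + 1), r + 1], continuous f} by exact: continuous_withinT.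
have H3 := @continuous_compact_integrable R f _ (@segment_compact _ _ _) cW.
rewrite (ccont_restrict H rb) -restrict_EFin.
exact: (integrable_mkcond _ _).1 H3.
Qed.

(** Compact support reduces the integral over R to two values of a primitive. The facts on
    one-dimensional integrals below follow from this and from the mean value theorem applied to the
    primitive. *)
Lemma int1_FTC r f F b : ccont r f -> (forall t, is_derive t (1 : R) F (f t)) -> r < b ->
  int1 f = F b - F (- b).
Proof.
move=> /[dup] H [r0 cf f0] dF rb.
have b0 : - b < b by rewrite gtrN// (lt_trans r0).
rewrite (ccont_restrict H rb) -Rintegral_mkcond /Rintegral.
have cF t : {for t, continuous F}.
  by apply: differentiable_continuous; apply/derivable1_diffP; case: (dF t).
rewrite (@continuous_FTC2 _ f F _ _ b0) //.
- exact: continuous_withinT.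
- split.
  + by move=> t _; case: (dF t).
  + by apply: cvg_at_right_filter; exact: cF.
  + by apply: cvg_at_left_filter; exact: cF.
- by move=> t _; rewrite derive1E; case: (dF t).
Qed.

Lemma ccont_prim r f : ccont r f -> exists F : R -> R, forall t, is_derive t (1 : R) F (f t).
Proof.
move=> /[dup] H [r0 cf f0].
exists (fun x => \int[lebesgue_measure]_(t in [set` `]-oo, x]]) (f t))%R => t.
have tu : t < t + 1 by rewrite ltrDl.
have intf : (@lebesgue_measure R).-integrable [set` `]-oo, t + 1]] (EFin \o f).
  exact: integrableS (integrable_ccont H).
have [d e] := @continuous_FTC1 R f -oo%O t (t + 1) tu intf (ltNyr _) (cf t).
by split=> //; rewrite -derive1E.
Qed.

Lemma ccontD (V : normedModType R) r (f g : V -> R) :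
  ccont r f -> ccont r g -> ccont r (fun x => f x + g x).
Proof.
move=> [r0 cf f0] [_ cg g0]; split=> // [x|x rx].
  by apply: continuousD; [exact: cf|exact: cg].
by rewrite f0// g0// addr0.
Qed.

Lemma ccontMr (V : normedModType R) r (f g : V -> R) :
  ccont r f -> continuous g -> ccont r (fun x => g x * f x).
Proof.
move=> [r0 cf f0] cg; split=> // [x|x rx].
  by apply: continuousM; [exact: cg|exact: cf].
by rewrite f0// mulr0.
Qed.

Lemma ccontZ (V : normedModType R) r (f : V -> R) c :
  ccont r f -> ccont r (fun x => c * f x).
Proof. by move=> H; apply: (ccontMr (g := cst c) H) => x; exact: cst_continuous. Qed.

Lemma ccontW (V : normedModType R) r s (f : V -> R) : r <= s -> ccont r f -> ccont s f.
Proof.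
move=> rs [r0 cf f0]; split=> //; first exact: lt_le_trans rs.
by move=> x sx; apply: f0; exact: le_lt_trans sx.
Qed.

Lemma int1D r f g : ccont r f -> ccont r g ->
  int1 (fun t => f t + g t) = int1 f + int1 g.
Proof.
move=> Hf Hg; have [F dF] := ccont_prim Hf; have [G dG] := ccont_prim Hg.
have rb : r < r + 1 by rewrite ltrDl.
rewrite (int1_FTC Hf dF rb) (int1_FTC Hg dG rb).
have dFG t : is_derive t (1 : R) (F + G) (f t + g t) by exact: is_deriveD.
rewrite (int1_FTC (ccontD Hf Hg) dFG rb) /=.
by rewrite -[(F + G) _]/(F _ + G _) -[(F + G) (- _)]/(F _ + G _) addrACA -opprD.
Qed.

Lemma int1Z r f c : ccont r f -> int1 (fun t => c * f t) = c * int1 f.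
Proof.
move=> Hf; have [F dF] := ccont_prim Hf.
have rb : r < r + 1 by rewrite ltrDl.
rewrite (int1_FTC Hf dF rb).
have dFG t : is_derive t (1 : R) (c *: F) (c * f t) by exact: is_deriveZ.
by rewrite (int1_FTC (ccontZ c Hf) dFG rb) mulrBr.
Qed.

Lemma prim_MVT f F a b : (forall t, is_derive t (1 : R) F (f t)) -> a <= b ->
  exists2 t, a <= t <= b & F b - F a = f t * (b - a).
Proof.
move=> dF ab.
have cF : {within `[a, b], continuous F}.
  apply: continuous_withinT => t; apply: differentiable_continuous.
  by apply/derivable1_diffP; case: (dF t).
have [t tab E] := MVT_segment ab (fun t _ => dF t) cF.
by exists t; rewrite // in_itv /= in tab.
Qed.

Lemma int1_ge0 r f : ccont r f -> (forall t, 0 <= f t) -> 0 <= int1 f.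
Proof.
move=> Hf f0; have [F dF] := ccont_prim Hf.
have [r0 _ _] := Hf.
have rb : r < r + 1 by rewrite ltrDl.
rewrite (int1_FTC Hf dF rb).
have [|t _ ->] := @prim_MVT f F (- (r + 1)) (r + 1) dF.
  by lra.
by rewrite mulr_ge0// opprK addr_ge0// ltW// (lt_trans r0).
Qed.

Lemma int1_le r f e : ccont r f -> (forall t, `|f t| <= e) ->
  `|int1 f| <= 2 * (r + 1) * e.
Proof.
move=> Hf f0; have [F dF] := ccont_prim Hf.
have [r0 _ _] := Hf.
have rb : r < r + 1 by rewrite ltrDl.
have r1 : 0 < r + 1 by rewrite (lt_trans r0).
rewrite (int1_FTC Hf dF rb).
have [|t _ ->] := @prim_MVT f F (- (r + 1)) (r + 1) dF.
  by lra.
rewrite normrM mulrC opprK; have -> : r + 1 + (r + 1) = 2 * (r + 1) by ring.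
have r2 : 0 <= 2 * (r + 1) by rewrite mulr_ge0// ltW.
by rewrite (ger0_norm r2) ler_wpM2l.
Qed.

Lemma int1_gt0 r f t0 : ccont r f -> (forall t, 0 <= f t) -> 0 < f t0 -> 0 < int1 f.
Proof.
move=> Hf f0 ft0; have [F dF] := ccont_prim Hf.
have [r0 cf fr] := Hf.
have [d d0 Hd] : exists2 d, 0 < d & forall t, t0 <= t <= t0 + d -> 0 < f t.
  have : \forall t \near t0, 0 < f t by apply: (cvgr_gt _ (cf t0)).
  move=> /nbhs_ballP[e /= e0 H]; exists (e / 2); first by rewrite divr_gt0.
  move=> t /andP[t1 t2]; apply: H; rewrite /ball /= distrC ger0_norm ?subr_ge0//.
  by rewrite ltrBlDl (le_lt_trans t2)// ltrD2l gtr_pMr// invf_lt1// ltr1n.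
(* The interval [[- b, b]] contains both the support of [f] and [[t0, t0 + d]], on which [f] is
   positive. *)
pose b := Num.max (r + 1) (Num.max (- t0) (t0 + d)).
have rb : r < b by rewrite lt_max ltrDl ltr01.
have b1 : - b <= t0 by rewrite lerNl !le_max lexx orbT.
have b2 : t0 + d <= b by rewrite !le_max lexx !orbT.
rewrite (int1_FTC Hf dF rb).
have ge0 a c : a <= c -> F a <= F c.
  move=> ac; have [t _ E] := prim_MVT dF ac.
  by rewrite -subr_ge0 E mulr_ge0// subr_ge0.
rewrite subr_gt0 (le_lt_trans (ge0 _ _ b1))// (lt_le_trans _ (ge0 _ _ b2))//.
have [|t /Hd ft E] := @prim_MVT f F t0 (t0 + d) dF; first by rewrite lerDl ltW.
by rewrite -subr_gt0 E mulr_gt0// addrAC subrr add0r.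
Qed.

Lemma int1_derive0 r F f : ccont r f -> (forall t, is_derive t (1 : R) F (f t)) ->
  (forall t, r < `|t| -> F t = 0) -> int1 f = 0.
Proof.
move=> Hf dF F0; have [r0 _ _] := Hf.
have rb : r < r + 1 by rewrite ltrDl.
have r1 : 0 < r + 1 by rewrite (lt_trans r0).
rewrite (int1_FTC Hf dF rb) !F0 ?subrr// ?normrN ger0_norm// ltW//.
Qed.

Lemma is_derive_affine F (f : R -> R) (a b t : R) : (forall t, is_derive t (1 : R) F (f t)) ->
  is_derive t (1 : R) (fun s => F (a * s + b)) (a * f (a * t + b)).
Proof.
move=> dF.
have d1 : is_derive t (1 : R) (fun s => a * s + b) a.
  have := is_deriveD (@is_deriveZ _ _ _ id a t (1 : R) 1 (is_derive_id t (1 : R))) (is_derive_cst b t (1 : R)).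
  by rewrite addr0 [a *: 1]mulr1.
have dd : differentiable F (a * t + b) by apply/derivable1_diffP; case: (dF (a * t + b)).
have [e1 e2] := is_derive_comp_diff d1 dd.
split=> //; rewrite [LHS]e2 -[X in 'd F _ X]mulr1 [LHS]linearZ /= -deriveE//.
by case: (dF (a * t + b)) => _ ->.
Qed.

Lemma int1_affine r f a b : ccont r f -> a != 0 ->
  `|a| * int1 (fun t => f (a * t + b)) = int1 f.
Proof.
move=> Hf a0; have [F dF] := ccont_prim Hf.
have [r0 cf fr] := Hf.
have na0 : 0 < `|a| by rewrite normr_gt0.
pose s := (r + `|b|) / `|a|.
have s0 : 0 < s by rewrite divr_gt0// ltr_wpDr.
have Hg : ccont s (fun t => f (a * t + b)).
  split=> // [t|t].
    apply: (@continuous_comp _ _ _ (fun t => a * t + b) f); last exact: cf.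
    by apply: continuousD; [apply: mulrl_continuous|exact: cst_continuous].
  rewrite ltr_pdivrMr// => H; apply: fr.
  rewrite -ltrBrDr in H; apply: (lt_le_trans H).
  rewrite mulrC -normrM lerBlDr.
  by have := ler_normB (a * t + b) b; rewrite addrK.
have dG t : is_derive t (1 : R) (a^-1 *: (fun s => F (a * s + b))) (f (a * t + b)).
  have dA := is_derive_affine a b t dF; have := @is_deriveZ _ _ _ _ a^-1 t 1 _ dA.
  by rewrite /GRing.scale /= mulKf.
pose B := Num.max (s + 1) ((r + 1 + `|b|) / `|a|).
have sB : s < B by rewrite lt_max ltrDl ltr01.
rewrite (int1_FTC Hg dG sB).
(* Beyond the support the primitive is constant on each side, so only the side on which an endpoint
   falls matters. For [a < 0] the two sides are exchanged, whence the absolute value. *)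
have FE x y : r < x -> r < y -> F x = F y.
  have mono u v : r < u -> u <= v -> F u = F v.
    move=> ru uv; have [t /andP[ut _] E] := prim_MVT dF uv.
    apply/eqP; rewrite eq_sym -subr_eq0 E fr ?mul0r//.
    by rewrite (lt_le_trans ru)// (le_trans ut)// ler_norm.
  by move=> rx ry; have [xy|/ltW xy] := leP x y; [apply: mono|apply/esym/mono].
have FN x y : x < - r -> y < - r -> F x = F y.
  have mono u v : v < - r -> u <= v -> F u = F v.
    move=> ru uv; have [t /andP[_ tv] E] := prim_MVT dF uv.
    apply/eqP; rewrite eq_sym -subr_eq0 E fr ?mul0r//.
    rewrite -normrN (lt_le_trans _ (ler_norm _))// ltrNr.
    exact: le_lt_trans ru.
  by move=> rx ry; have [xy|/ltW xy] := leP x y; [apply: mono|apply/esym/mono].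
have rb : r < r + 1 by rewrite ltrDl.
have nrb : - (r + 1) < - r by rewrite ltrN2.
rewrite (int1_FTC Hf dF rb) -[(_ *: _) B]/(a^-1 * _) -[(_ *: _) (- B)]/(a^-1 * _) -mulrBr.
have aB : r + `|b| < `|a| * B.
  rewrite -ltr_pdivrMl// lt_max; apply/orP; right.
  by rewrite mulrC ltr_pM2r ?invr_gt0// ltrD2r ltrDl.
have lb := ler_norm b; have lb' := ler_norm (- b); rewrite normrN in lb'.
have [ap|an] := ltP 0 a.
  have Ea := gtr0_norm ap; rewrite Ea in aB; rewrite Ea mulVKf ?gt_eqF//.
  rewrite (FE (a * B + b) (r + 1)) ?(FN (a * - B + b) (- (r + 1)))//.
  - rewrite mulrN; lra.
  - lra.
have {}an : a < 0 by rewrite lt_neqAle a0.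
have Ea := ltr0_norm an; rewrite Ea in aB; rewrite Ea mulNr mulVKf ?lt_eqF// opprB.
rewrite (FN (a * B + b) (- (r + 1))) ?(FE (a * - B + b) (r + 1))//.
- rewrite mulrN; lra.
- lra.
Qed.

End OneDim.

Section RowMx.
Variables (R : realType).

Lemma integral_RnS m (f : 'rV[R]_(1 + m) -> R) :
  @integral_Rn R m.+1 f =
  \int[lebesgue_measure]_(t in [set: R]) integral_Rn (fun v : 'rV[R]_m => f (row_mx t%:M v)).
Proof. by []. Qed.

Lemma norm_row_mxl m (t : R) (v : 'rV[R]_m) : `|t| <= `|row_mx (t%:M : 'rV_1) v|.
Proof.
by have := ler_mx_coord (row_mx (t%:M : 'rV_1) v) 0 (lshift m 0); rewrite row_mxEl mxE eqxx mulr1n.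
Qed.

Lemma norm_row_mxr m (t : R) (v : 'rV[R]_m) : `|v| <= `|row_mx (t%:M : 'rV_1) v|.
Proof.
apply: mx_norm_le => // i j; rewrite ord1.
by have := ler_mx_coord (row_mx (t%:M : 'rV_1) v) 0 (rshift 1 j); rewrite row_mxEr.
Qed.

Lemma row_mx_continuous m :
  continuous (fun p : R * 'rV[R]_m => row_mx (p.1%:M : 'rV_1) p.2).
Proof.
move=> p; apply: continuous_mx_coord => i j; rewrite ord1.
rewrite -(splitK j); case: (fintype.split j) => j' /=.
  rewrite (_ : (fun y => _) = (fun y : R * 'rV[R]_m => y.1)); first exact: cvg_fst.
  by apply/funext => y; rewrite row_mxEl ord1 mxE eqxx mulr1n.
rewrite (_ : (fun y => _) = (fun y : R * 'rV[R]_m => y.2 0 j')).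
  apply: (@continuous_comp _ _ _ (fun y : R * 'rV[R]_m => y.2) (fun v : 'rV[R]_m => v 0 j')).
    exact: cvg_snd.
  exact: coord_continuous.
by apply/funext => y; rewrite row_mxEr.
Qed.

Lemma continuous_pair2 (T U W : topologicalType) (f : T * U -> W) (s : T) :
  continuous f -> continuous (fun u => f (s, u)).
Proof.
move=> cf u; apply: (@continuous_comp _ _ _ (fun u => (s, u)) f); last exact: cf.
by apply: cvg_pair => /=; [exact: cvg_cst|exact: cvg_id].
Qed.

Lemma ccont_slice m r (f : 'rV[R]_(1 + m) -> R) (t : R) : ccont r f ->
  ccont r (fun v : 'rV[R]_m => f (row_mx t%:M v)).
Proof.
move=> [r0 cf f0]; split=> //.
  apply: (@continuous_pair2 _ _ _ (fun p : R * 'rV[R]_m => f (row_mx p.1%:M p.2)) t) => p.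
  apply: (@continuous_comp _ _ _ (fun p : R * 'rV[R]_m => row_mx p.1%:M p.2) f).
    exact: row_mx_continuous.
  exact: cf.
by move=> v rv; apply: f0; apply: lt_le_trans rv (norm_row_mxr _ _).
Qed.

Lemma compact_norm_le m (r : R) : compact [set v : 'rV[R]_m | `|v| <= r].
Proof.
apply: bounded_closed_compact.
  by exists r; split; [exact: num_real|move=> x rx v /= vr; apply: le_trans vr (ltW rx)].
rewrite (_ : mkset _ = (fun v : 'rV[R]_m => `|v|) @^-1` [set x | x <= r]) //.
apply: closed_comp => [v _|]; first exact: norm_continuous.
exact: closed_le.
Qed.

(** A quantitative tube lemma: it turns joint continuity into uniform closeness on the common
    support, which is what lets limits pass under the integral. *)
Lemma unif_near (T X : topologicalType) (K : set X) (F : T -> X -> R) s0 : compact K ->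
  (forall v, K v -> {for (s0, v), continuous (fun p : T * X => F p.1 p.2)}) ->
  forall e, 0 < e -> \forall s \near s0, forall v, K v -> `|F s v - F s0 v| <= e.
Proof.
move=> /compact_near_coveringP cK cF e e0.
apply: (cK T (nbhs s0) (fun s v => `|F s v - F s0 v| <= e)) => v Kv.
have e2 : 0 < e / 2 by rewrite divr_gt0.
have /cvgrPdist_lt/(_ _ e2) [[A B] /= [As0 Bv] AB] := cF v Kv.
exists (B, A) => // -[w s] /= [Bw As].
rewrite (le_trans (ler_distD (F s0 v) _ _))// (splitr e) lerD//.
  by have /ltW := AB (s, w) (conj As Bw); rewrite distrC.
have /ltW := AB (s0, w) (conj (nbhs_singleton As0) Bw).
by [].
Qed.

End RowMx.

(** * Linearity, bounds and differentiation under the integral *)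

Section IntegralProps.
Variable R : realType.
Local Notation I f := (integral_Rn f).

(** These facts are proved together by induction on [m]: linearity and the bound in dimension [m]
    give continuity of the partial integral over slices, which is what the outer integral over R
    requires in dimension [m + 1]. *)
Definition int_props m := forall r,
  [/\ forall f g : 'rV[R]_m -> R, ccont r f -> ccont r g ->
        I (fun x => f x + g x) = I f + I g,
      forall (f : 'rV[R]_m -> R) c, ccont r f -> I (fun x => c * f x) = c * I f,
      forall f : 'rV[R]_m -> R, ccont r f -> (forall x, 0 <= f x) -> 0 <= I f &
      forall (f : 'rV[R]_m -> R) e, ccont r f -> (forall x, `|f x| <= e) ->
        `|I f| <= (2 * (r + 1)) ^+ m * e].

Let int_param_cvg m : int_props m ->
  forall (T : topologicalType) (F : T -> 'rV[R]_m -> R) s0 r,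
  (\forall s \near s0, ccont r (F s)) ->
  (forall v, {for (s0, v), continuous (fun p : T * 'rV[R]_m => F p.1 p.2)}) ->
  {for s0, continuous (fun s => I (F s))}.
Proof.
move=> H T F s0 r Fr cF; have [HD HZ _ HB] := H r.
have Fr0 := nbhs_singleton Fr; have [r0 _ F0] := Fr0.
apply/cvgrPdist_le => e e0.
have c0 : 0 < (2 * (r + 1)) ^+ m by rewrite exprn_gt0// mulr_gt0// ltr_wpDr.
have d0 : 0 < e / (2 * (r + 1)) ^+ m by rewrite divr_gt0.
have U := unif_near (@compact_norm_le R m r) (fun v _ => cF v) d0.
near=> s.
have Frs : ccont r (F s) by near: s.
have -> : I (F s0) - I (F s) = I (fun v => F s0 v + -1 * F s v).
  rewrite HD ?HZ ?mulN1r//; exact: ccontZ.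
have -> : e = (2 * (r + 1)) ^+ m * (e / (2 * (r + 1)) ^+ m).
  by rewrite mulrC divfK// gt_eqF.
apply: HB => [|v]; first by apply: ccontD => //; exact: ccontZ.
rewrite mulN1r; have [rv|vr] := ltP r `|v|.
  by case: Frs => _ _ Fs; rewrite F0// Fs// subrr normr0 ltW.
by rewrite distrC; move: v vr; near: s.
Unshelve. all: by end_near. Qed.

Let ccont_integral_slice0 m r (f : 'rV[R]_(1 + m) -> R) : int_props m -> ccont r f ->
  ccont r (fun t : R => I (fun v : 'rV[R]_m => f (row_mx t%:M v))).
Proof.
move=> H Hf; have [r0 cf f0] := Hf; split=> // [t|t rt].
  apply: (int_param_cvg H (r := r)).
    by near=> s; exact: ccont_slice.
  move=> v; apply: (@continuous_comp _ _ _ (fun p : R * 'rV[R]_m => row_mx p.1%:M p.2) f).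
    exact: row_mx_continuous.
  exact: cf.
have [HD HZ _ _] := H r.
have -> : (fun v : 'rV[R]_m => f (row_mx t%:M v)) = (fun v => 0 * f (row_mx t%:M v)).
  apply/funext => v; rewrite mul0r f0//.
  exact: lt_le_trans rt (norm_row_mxl _ _).
by rewrite HZ ?mul0r//; exact: ccont_slice.
Unshelve. all: by end_near. Qed.

Lemma integral_Rn_props m : int_props m.
Proof.
elim: m => [|m IH] r.
  split=> //= f e _ H; by rewrite expr0 mul1r.
have [HD HZ HP HB] := IH r.
split=> [f g Hf Hg|f c Hf|f Hf f0|f e Hf fe]; rewrite !integral_RnS.
- rewrite -(@int1D _ r); [|exact: ccont_integral_slice0|exact: ccont_integral_slice0].
  apply: eq_Rintegral => t _; apply: HD; exact: ccont_slice.
- rewrite -(@int1Z _ r); last exact: ccont_integral_slice0.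
  by apply: eq_Rintegral => t _; apply: HZ; exact: ccont_slice.
- apply: (@int1_ge0 _ r); first exact: ccont_integral_slice0.
  by move=> t; apply: HP => //; exact: ccont_slice.
- rewrite exprS -mulrA; apply: int1_le; first exact: ccont_integral_slice0.
  by move=> t; apply: HB => //; exact: ccont_slice.
Qed.

Lemma ccont_integral_slice m r (f : 'rV[R]_(1 + m) -> R) : ccont r f ->
  ccont r (fun t : R => I (fun v : 'rV[R]_m => f (row_mx t%:M v))).
Proof. exact: ccont_integral_slice0 (@integral_Rn_props m). Qed.

Variable m : nat.
Implicit Types (f g : 'rV[R]_m -> R) (r : R).

Lemma integral_RnD r f g : ccont r f -> ccont r g ->
  I (fun x => f x + g x) = I f + I g.
Proof. by have [+ _ _ _] := @integral_Rn_props m r; exact. Qed.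

Lemma integral_RnZ r f c : ccont r f -> I (fun x => c * f x) = c * I f.
Proof. by have [_ + _ _] := @integral_Rn_props m r; exact. Qed.

Lemma integral_RnB r f g : ccont r f -> ccont r g ->
  I (fun x => f x - g x) = I f - I g.
Proof.
move=> Hf Hg; have -> : (fun x => f x - g x) = (fun x => f x + -1 * g x).
  by apply/funext => x; rewrite mulN1r.
by rewrite (integral_RnD Hf (ccontZ _ Hg)) (integral_RnZ _ Hg) mulN1r.
Qed.

Lemma integral_Rn_ge0 r f : ccont r f -> (forall x, 0 <= f x) -> 0 <= I f.
Proof. by have [_ _ + _] := @integral_Rn_props m r; exact. Qed.

Lemma integral_Rn_le r f e : ccont r f -> (forall x, `|f x| <= e) ->
  `|I f| <= (2 * (r + 1)) ^+ m * e.
Proof. by have [_ _ _ +] := @integral_Rn_props m r; exact. Qed.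

Lemma integral_Rn0 : I (fun _ : 'rV[R]_m => 0) = 0.
Proof.
have H : ccont 1 (fun _ : 'rV[R]_m => (0 : R)).
  by split=> // x; exact: cst_continuous.
transitivity (I (fun x : 'rV[R]_m => 0 * (fun _ : 'rV[R]_m => (0 : R)) x)).
  by congr integral_Rn; apply/funext => x; rewrite mul0r.
by rewrite (integral_RnZ 0 H) mul0r.
Qed.

Lemma ccont_sum (J : Type) (s : seq J) (P : pred J) r (F : J -> 'rV[R]_m -> R) : 0 < r ->
  (forall j, P j -> ccont r (F j)) -> ccont r (fun x => \sum_(j <- s | P j) F j x).
Proof.
move=> r0 HF; elim: s => [|j s IH].
  under eq_fun do rewrite big_nil; split=> // x; exact: cst_continuous.
under eq_fun do rewrite big_cons.
by case E: (P j) => //; apply: ccontD => //; exact: HF.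
Qed.

Lemma integral_Rn_sum (J : Type) (s : seq J) (P : pred J) r (F : J -> 'rV[R]_m -> R) : 0 < r ->
  (forall j, P j -> ccont r (F j)) ->
  I (fun x => \sum_(j <- s | P j) F j x) = \sum_(j <- s | P j) I (F j).
Proof.
move=> r0 HF; elim: s => [|j s IH].
  by under eq_fun do rewrite big_nil; rewrite integral_Rn0 big_nil.
under eq_fun do rewrite big_cons.
rewrite big_cons; case E: (P j) => //.
by rewrite (@integral_RnD r) ?IH//; [exact: HF|exact: ccont_sum].
Qed.

Lemma integral_Rn_continuous (T : topologicalType) (F : T -> 'rV[R]_m -> R) s0 r :
  (\forall s \near s0, ccont r (F s)) ->
  (forall v, {for (s0, v), continuous (fun p : T * 'rV[R]_m => F p.1 p.2)}) ->
  {for s0, continuous (fun s => I (F s))}.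
Proof. exact: int_param_cvg (@integral_Rn_props m) _ _ _ _. Qed.

(** The mean value theorem replaces the difference quotient at [v] by [dF] at an intermediate time,
    which is uniformly close to [dF s0 v] for [v] in the support ball; the bound on integrals
    concludes. *)
Lemma integral_Rn_derive (F dF : R -> 'rV[R]_m -> R) (s0 r : R) :
  (\forall s \near s0, ccont r (F s)) ->
  (\forall s \near s0, forall v, is_derive s (1 : R) (F ^~ v) (dF s v)) ->
  continuous (dF s0) ->
  (forall v, {for (s0, v), continuous (fun p : R * 'rV[R]_m => dF p.1 p.2)}) ->
  is_derive s0 (1 : R) (fun s => I (F s)) (I (dF s0)).
Proof.
move=> Fr HdF cdF0 cdF.
have Fr0 := nbhs_singleton Fr; have [r0 cF0 F0] := Fr0.
(* Outside the ball [F s v] vanishes for all [s] near [s0], hence so does its time derivative. *)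
have dFr v : r < `|v| -> dF s0 v = 0.
  move=> rv; have [_ <-] := nbhs_singleton HdF v.
  transitivity ('D_(1 : R) (cst (0 : R)) s0); last by rewrite derive_cst.
  apply: near_eq_derive; near=> s; rewrite /cst.
  by have [_ _ ->] : ccont r (F s) by near: s.
have HdF0 : ccont r (dF s0) by split.
have c0 : 0 < (2 * (r + 1)) ^+ m by rewrite exprn_gt0// mulr_gt0// ltr_wpDr.
have main : h^-1 *: (I (F (h *: (1 : R) + s0)) - I (F s0)) @[h --> (0 : R)^'] --> I (dF s0).
  apply/cvgrPdist_le => e e0.
  have d0 : 0 < e / (2 * (r + 1)) ^+ m by rewrite divr_gt0.
  have [d dpos Hd] : exists2 d, 0 < d & forall s, `|s - s0| < d ->
      [/\ ccont r (F s), forall v, is_derive s (1 : R) (F ^~ v) (dF s v) &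
          forall v, `|v| <= r -> `|dF s v - dF s0 v| <= e / (2 * (r + 1)) ^+ m].
    have U := unif_near (@compact_norm_le R m r) (fun v _ => cdF v) d0.
    have : \forall s \near s0, [/\ ccont r (F s), forall v, is_derive s (1 : R) (F ^~ v) (dF s v) &
          forall v, `|v| <= r -> `|dF s v - dF s0 v| <= e / (2 * (r + 1)) ^+ m].
      by near=> s; split; near: s.
    move=> /nbhs_ballP[d /= dp Hd]; exists d => // s sd; apply: Hd.
    by rewrite -ball_normE /= distrC.
  near=> h.
  have hd : `|h| < d by near: h; exact: dnbhs0_lt.
  have h0 : h != 0 by near: h; exact: nbhs_dnbhs_neq.
  have Fh : ccont r (F (h + s0)) by have [] := Hd (h + s0); rewrite ?addrK.
  rewrite [h *: 1]mulr1 /GRing.scale /= -(integral_RnB Fh Fr0).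
  have HB := ccontD Fh (ccontZ (-1) Fr0).
  have EB : (fun x => F (h + s0) x + -1 * F s0 x) = (fun x => F (h + s0) x - F s0 x).
    by apply/funext => x; rewrite mulN1r.
  rewrite EB in HB; rewrite -(integral_RnZ _ HB) -(integral_RnB HdF0 (ccontZ _ HB)).
  have -> : e = (2 * (r + 1)) ^+ m * (e / (2 * (r + 1)) ^+ m).
    by rewrite mulrC divfK// gt_eqF.
  apply: (@integral_Rn_le r) => [|v].
    have := ccontD HdF0 (ccontZ (-1) (ccontZ h^-1 HB)).
    by congr ccont; apply/funext => x; rewrite mulN1r.
  have [rv|vr] := ltP r `|v|.
    by case: Fh => _ _ Fs; rewrite dFr// F0// Fs// subrr mulr0 subrr normr0 ltW.
  have dl (s : R) : 0 <= s <= 1 -> is_derive (s0 + s *: h) h (F ^~ v) (h * dF (s0 + s *: h) v).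
    move=> /andP[s_ge0 s1].
    have [_ D _] : [/\ ccont r (F (s0 + s *: h)), forall v, is_derive (s0 + s *: h) (1 : R) (F ^~ v) (dF (s0 + s *: h) v) &
          forall v, `|v| <= r -> `|dF (s0 + s *: h) v - dF s0 v| <= e / (2 * (r + 1)) ^+ m].
      apply: Hd; rewrite addrAC subrr add0r normrM ger0_norm//.
      by rewrite (le_lt_trans _ hd)// ler_piMl.
    have [D1 D2] := D v.
    have := derivable_scale h D1; rewrite [h *: 1]mulr1 D2 => -[? ?].
    by split.
  have [|s s01] := @MVT_line R R^o (F ^~ v) s0 h.
    by move=> s /dl[].
  have [_ ->] := dl s s01; rewrite [s0 + h]addrC => ->.
  rewrite mulKf// distrC.
  have [_ _ +] : [/\ ccont r (F (s0 + s *: h)), forall v, is_derive (s0 + s *: h) (1 : R) (F ^~ v) (dF (s0 + s *: h) v) &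
          forall v, `|v| <= r -> `|dF (s0 + s *: h) v - dF s0 v| <= e / (2 * (r + 1)) ^+ m].
    have /andP[s_ge0 s1] := s01.
    apply: Hd; rewrite addrAC subrr add0r normrM ger0_norm//.
    by rewrite (le_lt_trans _ hd)// ler_piMl.
  by apply.
split; first by apply/cvg_ex; exists (I (dF s0)).
by apply: cvg_lim => //; exact: main.
Unshelve. all: by end_near. Qed.

End IntegralProps.

(** * Vanishing of integrals of derivatives, Fubini, linear substitutions *)

Section IntegralMore.
Variable R : realType.
Local Notation I f := (integral_Rn f).

Lemma continuous_comp2 (T U V W : topologicalType) (f : T -> U) (g : T -> V)
    (F : U * V -> W) x : {for x, continuous f} -> {for x, continuous g} ->
  {for (f x, g x), continuous F} -> {for x, continuous (fun y => F (f y, g y))}.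
Proof.
move=> cf cg cF; apply: (@continuous_comp _ _ _ (fun y => (f y, g y)) F); last exact: cF.
exact: cvg_pair.
Qed.

Lemma continuous_at_cst (T U : topologicalType) (c : U) (x : T) :
  {for x, continuous (fun _ : T => c)}.
Proof. exact: cvg_cst. Qed.

Lemma continuous_at_id (T : topologicalType) (x : T) : {for x, continuous (fun y : T => y)}.
Proof. exact: cvg_id. Qed.

Lemma continuous_at_fst (T U : topologicalType) (x : T * U) :
  {for x, continuous (fun y : T * U => y.1)}.
Proof. exact: cvg_fst. Qed.

Lemma continuous_at_snd (T U : topologicalType) (x : T * U) :
  {for x, continuous (fun y : T * U => y.2)}.
Proof. exact: cvg_snd. Qed.

Lemma continuous_at_sum (T : topologicalType) (J : Type) (s : seq J) (P : pred J)
    (f : J -> T -> R) (x : T) : (forall j, P j -> {for x, continuous (f j)}) ->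
  {for x, continuous (fun y => \sum_(j <- s | P j) f j y)}.
Proof.
move=> H; elim: s => [|j s IH].
  rewrite (_ : (fun y : T => _) = (fun=> 0)); first exact: continuous_at_cst.
  by apply/funext => y; rewrite big_nil.
rewrite (_ : (fun y : T => _) = (fun y => (if P j then f j y else 0) + \sum_(j <- s | P j) f j y)).
  case E: (P j); first by apply: continuousD => //; exact: H.
  by apply: continuousD => //; exact: continuous_at_cst.
by apply/funext => y; rewrite big_cons; case: (P j); rewrite ?add0r.
Qed.

Lemma row_mx_split m (x : 'rV[R]_(1 + m)) : x = row_mx ((lsubmx x 0 0)%:M : 'rV_1) (rsubmx x).
Proof. by rewrite -[LHS]hsubmxK; congr row_mx; exact: mx11_scalar. Qed.

Lemma rV0_eq (x y : 'rV[R]_0) : x = y.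
Proof. by apply/rowP => -[]. Qed.

Lemma integral_Rn_gt0 m r (f : 'rV[R]_m -> R) x0 : ccont r f ->
  (forall x, 0 <= f x) -> 0 < f x0 -> 0 < I f.
Proof.
elim: m f x0 => [|m IH] f x0 Hf f0 fx0; first by rewrite (rV0_eq x0 0) in fx0.
rewrite integral_RnS.
apply: (@int1_gt0 _ r _ (lsubmx (x0 : 'rV_(1 + m)) 0 0)).
- exact: ccont_integral_slice.
- by move=> t; apply: (@integral_Rn_ge0 _ _ r) => //; exact: ccont_slice.
apply: (IH _ (rsubmx (x0 : 'rV_(1 + m)))) => //; first exact: ccont_slice.
by rewrite -row_mx_split.
Qed.

Lemma row_mx_scalarD m (s t : R) (v : 'rV[R]_m) :
  row_mx ((s + t)%:M : 'rV_1) v = s *: 'e_(lshift m 0) + row_mx t%:M v.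
Proof.
apply/rowP => j; rewrite -(splitK j); case: (fintype.split j) => j' /=.
  rewrite row_mxEl [RHS]mxE row_mxEl !mxE !ord1 eqxx !mulr1n.
  by rewrite /= ?mulr1.
by rewrite row_mxEr [RHS]mxE row_mxEr !mxE eq_rlshift andbF mulr0 add0r.
Qed.

Lemma row_mx_addr m (t s : R) (v : 'rV[R]_m) j :
  row_mx (t%:M : 'rV_1) (s *: 'e_j + v) = s *: 'e_(rshift 1 j) + row_mx t%:M v.
Proof.
apply/rowP => i; rewrite -(splitK i); case: (fintype.split i) => i' /=.
  rewrite row_mxEl [RHS]mxE row_mxEl !mxE (_ : (lshift m i' == _) = false) ?mulr0 ?add0r//.
  by rewrite eq_lrshift.
by rewrite row_mxEr [RHS]mxE row_mxEr !mxE eq_rshift.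
Qed.

Lemma is_derive_slicel m (f : 'rV[R]_(1 + m) -> R) t v d :
  is_derive (row_mx (t%:M : 'rV_1) v) 'e_(lshift m 0) f d <->
  is_derive t (1 : R) (fun s => f (row_mx (s%:M : 'rV_1) v)) d.
Proof.
have E : (fun h : R => h^-1 *: ((f \o shift (row_mx (t%:M : 'rV_1) v)) (h *: 'e_(lshift m 0)) -
    f (row_mx t%:M v))) =
  (fun h : R => h^-1 *: (((fun s => f (row_mx (s%:M : 'rV_1) v)) \o shift t) (h *: (1 : R)) -
    f (row_mx t%:M v))).
  by apply/funext => h /=; rewrite [h *: (1 : R)]mulr1 row_mx_scalarD.
by split=> -[d1 d2]; split;
  [rewrite /derivable -E|rewrite /derive -E|rewrite /derivable E|rewrite /derive E].
Qed.

Lemma is_derive_slicer m (f : 'rV[R]_(1 + m) -> R) t v j d :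
  is_derive (row_mx (t%:M : 'rV_1) v) 'e_(rshift 1 j) f d <->
  is_derive v 'e_j (fun w => f (row_mx (t%:M : 'rV_1) w)) d.
Proof.
have E : (fun h : R => h^-1 *: ((f \o shift (row_mx (t%:M : 'rV_1) v)) (h *: 'e_(rshift 1 j)) -
    f (row_mx t%:M v))) =
  (fun h : R => h^-1 *: (((fun w => f (row_mx (t%:M : 'rV_1) w)) \o shift v) (h *: 'e_j) -
    f (row_mx t%:M v))).
  by apply/funext => h /=; rewrite row_mx_addr.
by split=> -[d1 d2]; split;
  [rewrite /derivable -E|rewrite /derive -E|rewrite /derivable E|rewrite /derive E].
Qed.

Lemma ccont_pderive m r (f : 'rV[R]_m -> R) i : ccont r f ->
  continuous (fun x => 'D_('e_i) f x) -> ccont r (fun x => 'D_('e_i) f x).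
Proof.
move=> [r0 cf f0] cD; split=> // x rx.
transitivity ('D_('e_i) (cst (0 : R)) x); last by rewrite derive_cst.
apply: near_eq_derive.
have d0 : 0 < `|x| - r by rewrite subr_gt0.
apply: filterS (near_dist_lt x d0) => y yx; apply: f0.
by have := ler_distD y x 0; rewrite !subr0 distrC; lra.
Qed.

(** In the first coordinate the partial integral of [f] over slices is a compactly supported
    primitive of the partial integral of its derivative; in the other coordinates the inner integral
    already vanishes. *)
Let integral_Rn_pderive_step m r (f : 'rV[R]_(1 + m) -> R) (i : 'I_(1 + m)) :
  (forall (g : 'rV[R]_m -> R) j, ccont r g -> (forall x, derivable g x 'e_j) ->
    continuous (fun x => 'D_('e_j) g x) -> I (fun x => 'D_('e_j) g x) = 0) ->
  ccont r f ->
  (forall x, derivable f x 'e_i) -> continuous (fun x => 'D_('e_i) f x) ->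
  @integral_Rn R m.+1 (fun x : 'rV[R]_(1 + m) => 'D_('e_i) f x) = 0.
Proof.
move=> IH Hf; rewrite -(splitK i); case: (fintype.split i) => i' /= df cD.
all: have HD := ccont_pderive Hf cD.
  rewrite /= (ord1 i') in df cD HD *.
  have dI t : is_derive t (1 : R) (fun t => I (fun v : 'rV[R]_m => f (row_mx t%:M v)))
      (I (fun v : 'rV[R]_m => 'D_('e_(lshift m 0)) f (row_mx t%:M v))).
    apply: (@integral_Rn_derive R m (fun t (v : 'rV[R]_m) => f (row_mx t%:M v))
        (fun t (v : 'rV[R]_m) => 'D_('e_(lshift m 0)) f (row_mx t%:M v)) t r).
    + by near=> s; exact: ccont_slice.
    + near=> s => v; apply/is_derive_slicel; exact: derivableP.
    + by have [] := ccont_slice t HD.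
    + move=> v; apply: (@continuous_comp _ _ _ (fun p : R * 'rV[R]_m => row_mx p.1%:M p.2) (fun x => 'D_('e_(lshift m 0)) f x)).
        exact: row_mx_continuous.
      exact: cD.
  apply: (@int1_derive0 R r (fun t => I (fun v : 'rV[R]_m => f (row_mx t%:M v)))
    (fun t => I (fun v : 'rV[R]_m => 'D_('e_(lshift m 0)) f (row_mx t%:M v)))).
  - exact: (ccont_integral_slice HD).
  - by have [] := ccont_integral_slice Hf.
transitivity (\int[lebesgue_measure]_(t in [set: R]) (0 * (fun _ : R => (0 : R)) t)); last first.
  rewrite (@int1Z _ 1) ?mul0r//; split=> // x; exact: cst_continuous.
apply: eq_Rintegral => t _; rewrite mul0r.
have E : (fun v : 'rV[R]_m => 'D_('e_(rshift 1 i')) f (row_mx t%:M v)) =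
   (fun v : 'rV[R]_m => 'D_('e_i') (fun w : 'rV[R]_m => f (row_mx t%:M w)) v).
  apply/funext => v; have /is_derive_slicer[_ ->] // := derivableP (df (row_mx t%:M v)).
rewrite E; apply: IH; first exact: ccont_slice.
  by move=> v; have /is_derive_slicer[] := derivableP (df (row_mx t%:M v)).
by rewrite -E; have [] := ccont_slice t HD.
Unshelve. all: by end_near. Qed.

Lemma integral_Rn_pderive m r (f : 'rV[R]_m -> R) i : ccont r f ->
  (forall x, derivable f x 'e_i) -> continuous (fun x => 'D_('e_i) f x) ->
  I (fun x => 'D_('e_i) f x) = 0.
Proof.
elim: m f i => [|m IH] f i Hf df cD; first by case: i {df cD} => -[].
exact: (integral_Rn_pderive_step IH Hf df cD).
Qed.

(** Let [Q s y] be the integral of [F t y] for [t] from [- b] to [s]. Then [s -> I (Q s)] is a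
    primitive of [s -> I (F s)], and both sides of the equality equal [I (Q b) - I (Q (- b))]. *)
Lemma Fubini_R_Rn n (F : R -> 'rV[R]_n -> R) r :
  continuous (fun p : R * 'rV[R]_n => F p.1 p.2) -> 0 < r ->
  (forall t y, r < `|t| \/ r < `|y| -> F t y = 0) ->
  \int[lebesgue_measure]_(t in [set: R]) I (F t) =
  I (fun y => \int[lebesgue_measure]_(t in [set: R]) F t y).
Proof.
move=> cF r0 F0.
have cFt t : ccont r (F t).
  by split=> // [|y ry]; [exact: (@continuous_pair2 _ _ _ (fun p : R * 'rV[R]_n => F p.1 p.2) t cF)|rewrite F0//; right].
have cFy y : ccont r (F ^~ y).
  split=> // [t|t rt]; last by rewrite F0//; left.
  exact: (@continuous_comp2 _ _ _ _ _ _ (fun p : R * 'rV[R]_n => F p.1 p.2) t (@continuous_at_id _ t) (@continuous_at_cst _ _ y t) (cF _)).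
have [P dP] := choice (fun y => ccont_prim (cFy y)).
pose b := r + 1; have rb : r < b by rewrite ltrDl.
(* The primitives [P y] are picked with no relation between different [y]; normalising them at [- b]
   is what makes [Q s] continuous in [y]. *)
pose Q s y := P y s - P y (- b).
have dQ y s : is_derive s (1 : R) (Q ^~ y) (F s y).
  rewrite -[F s y]subr0; apply: is_deriveB; exact: is_derive_cst.
have cQ s : ccont r (Q s).
  split=> // [y0|y ry]; last first.
    have dz t : is_derive t (1 : R) (P y) (0 : R) by rewrite -(F0 t y)//; right.
    rewrite /Q; apply/eqP; rewrite subr_eq0; apply/eqP.
    have [sb|/ltW sb] := leP s (- b).
      have [t _] := @prim_MVT _ (fun _ => 0) (P y) s (- b) dz sb.
      by rewrite mul0r => /eqP; rewrite subr_eq0 => /eqP.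
    have [t _] := @prim_MVT _ (fun _ => 0) (P y) (- b) s dz sb.
    by rewrite mul0r => /eqP; rewrite subr_eq0 => /eqP.
  (* The difference [Q s y - Q s y0] vanishes at [s = - b] and its derivative in [s] is uniformly
     small for [y] near [y0], so the mean value theorem bounds it. *)
  apply: continuous_distP => e e0.
  pose c := `|s + b| + 1; have c0 : 0 < c by rewrite ltr_wpDl.
  have d0 : 0 < e / c by rewrite divr_gt0.
  have cF' (t : R) : `[- r, r]%classic t -> {for (y0, t), continuous (fun p : 'rV[R]_n * R => F p.2 p.1)}.
    move=> _; exact: (@continuous_comp2 _ _ _ _ _ _ (fun p : R * 'rV[R]_n => F p.1 p.2) (y0, t) (@continuous_at_snd _ _ (y0, t)) (@continuous_at_fst _ _ (y0, t)) (cF _)).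
  have U := unif_near (F := fun y t => F t y) (@segment_compact _ (- r) r) cF' d0.
  near=> y.
  have Uy t : `|F t y - F t y0| <= e / c.
    have [rt|tr] := ltP r `|t|.
      rewrite !F0; [|by left|by left]; by rewrite subrr normr0 ltW.
    suff : forall v, `[- r, r]%classic v -> `|F v y - F v y0| <= e / c.
      by apply; rewrite /= in_itv /= -ler_norml.
    by near: y.
  have dz t : is_derive t (1 : R) (fun t => Q t y - Q t y0) (F t y - F t y0).
    exact: is_deriveB.
  have Q0 : Q (- b) y - Q (- b) y0 = 0 by rewrite /Q !subrr.
  have fin t : `|(F t y - F t y0) * (s + b)| <= e.
    rewrite normrM (@le_trans _ _ (e / c * c))//; last by rewrite divfK// gt_eqF.
    by rewrite ler_pM// lerDl.
  have [sb|/ltW sb] := leP s (- b).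
    have [t _] := @prim_MVT _ _ _ s (- b) dz sb.
    rewrite Q0 sub0r => E; rewrite -normrN E -normrN -mulrN opprB opprK; exact: fin.
  have [t _] := @prim_MVT _ _ _ (- b) s dz sb.
  rewrite Q0 subr0 => ->; rewrite opprK; exact: fin.
have dI s : is_derive s (1 : R) (fun s => I (Q s)) (I (F s)).
  apply: (@integral_Rn_derive _ _ Q F s r).
  - by near=> u; exact: cQ.
  - by near=> u => v; exact: dQ.
  - by case: (cFt s).
  - by move=> v; exact: cF.
have cI : ccont r (fun s => I (F s)).
  split=> // [s|s rs].
    apply: (@integral_Rn_continuous _ _ _ _ _ r); first by near=> u; exact: cFt.
    by move=> v; exact: cF.
  rewrite -[RHS](@integral_Rn0 R n); congr integral_Rn.
  by apply/funext => v; rewrite F0//; left.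
rewrite (int1_FTC cI dI rb) -(integral_RnB (cQ _) (cQ _)).
congr integral_Rn; apply/funext => y.
by rewrite (int1_FTC (cFy y) (dQ y) rb).
Unshelve. all: by end_near. Qed.

Lemma Fubini_Rn m n (F : 'rV[R]_m -> 'rV[R]_n -> R) r :
  continuous (fun p : 'rV[R]_m * 'rV[R]_n => F p.1 p.2) -> 0 < r ->
  (forall x y, r < `|x| \/ r < `|y| -> F x y = 0) ->
  I (fun x => I (F x)) = I (fun y => I (F ^~ y)).
Proof.
elim: m F => [|m IH] F cF r0 F0.
  by [].
rewrite [LHS]integral_RnS.
have cFr : continuous (fun p : (R * 'rV[R]_n) * 'rV[R]_m => F (row_mx p.1.1%:M p.2) p.1.2).
  move=> p; pose f1 (p : (R * 'rV[R]_n) * 'rV[R]_m) := row_mx (p.1.1%:M : 'rV_1) p.2.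
  pose f2 (p : (R * 'rV[R]_n) * 'rV[R]_m) := p.1.2.
  have c11 : {for p, continuous (fun p : (R * 'rV[R]_n) * 'rV[R]_m => p.1.1)}.
    exact: (@continuous_comp _ _ _ (fun p : (R * 'rV[R]_n) * 'rV[R]_m => p.1) (fun q => q.1) p (@continuous_at_fst _ _ p) (@continuous_at_fst _ _ p.1)).
  have c1 : {for p, continuous f1}.
    exact: (@continuous_comp2 _ _ _ _ _ _ (fun p : R * 'rV[R]_m => row_mx p.1%:M p.2) p c11 (@continuous_at_snd _ _ p) (@row_mx_continuous R m _)).
  have c2 : {for p, continuous f2}.
    exact: (@continuous_comp _ _ _ (fun p : (R * 'rV[R]_n) * 'rV[R]_m => p.1) (fun q => q.2) p (@continuous_at_fst _ _ p) (@continuous_at_snd _ _ p.1)).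
  exact: (@continuous_comp2 _ _ _ _ _ _ (fun p : 'rV[R]_(1 + m) * 'rV[R]_n => F p.1 p.2) p c1 c2 (cF _)).
pose G t y := I (fun v : 'rV[R]_m => F (row_mx t%:M v) y).
transitivity (\int[lebesgue_measure]_(t in [set: R]) I (G t)).
  apply: eq_Rintegral => t _; rewrite (IH (fun v y => F (row_mx t%:M v) y))//.
    move=> p.
    have c1 := @continuous_comp2 _ _ _ _ _ _ (fun q : R * 'rV[R]_n => q) p (@continuous_at_cst _ _ t p) (@continuous_at_snd _ _ p) (@continuous_at_id _ _).
    exact: (@continuous_comp2 _ _ _ _ _ _ (fun p : (R * 'rV[R]_n) * 'rV[R]_m => F (row_mx p.1.1%:M p.2) p.1.2) p c1 (@continuous_at_fst _ _ p) (cFr _)).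
  move=> v y [rv|ry]; apply: F0; last by right.
  by left; exact: lt_le_trans rv (norm_row_mxr _ _).
rewrite (@Fubini_R_Rn _ _ r)//.
  move=> p; apply: (@integral_Rn_continuous R m _ (fun (p : R * 'rV[R]_n) v => F (row_mx p.1%:M v) p.2) p r).
    near=> q; split=> // [|v rv].
      exact: (@continuous_pair2 _ _ _ (fun p : (R * 'rV[R]_n) * 'rV[R]_m => F (row_mx p.1.1%:M p.2) p.1.2) q cFr).
    by apply: F0; left; exact: lt_le_trans rv (norm_row_mxr _ _).
  by move=> v; exact: cFr.
move=> t y ty; rewrite /G -[RHS](@integral_Rn0 R m); congr integral_Rn.
apply/funext => v; apply: F0; case: ty => [rt|ry]; [left|by right].
exact: lt_le_trans rt (norm_row_mxl _ _).
Unshelve. all: by end_near. Qed.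

Lemma ccont_translate (V : normedModType R) r (f : V -> R) (b : V) : ccont r f ->
  ccont (r + `|b|) (fun x => f (x + b)).
Proof.
move=> [r0 cf f0]; split=> [|x|x rx]; first by rewrite ltr_wpDr.
  apply: (@continuous_comp _ _ _ (fun x => x + b) f); last exact: cf.
  by apply: continuousD; [exact: cvg_id|exact: cst_continuous].
by apply: f0; have := ler_normB (x + b) b; rewrite addrK; lra.
Qed.

Lemma integral_Rn_translate m r (f : 'rV[R]_m -> R) b : ccont r f ->
  I (fun x => f (x + b)) = I f.
Proof.
elim: m f b => [|m IH] f b Hf; first by congr (f _); exact: rV0_eq.
rewrite !integral_RnS -(@int1_affine _ _ _ 1 (lsubmx (b : 'rV_(1 + m)) 0 0) (ccont_integral_slice Hf)) ?oner_eq0//.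
rewrite normr1 mul1r; apply: eq_Rintegral => t _.
rewrite mul1r -(IH _ (rsubmx (b : 'rV_(1 + m))) (ccont_slice _ Hf)).
congr integral_Rn; apply/funext => v; congr f.
rewrite (raddfD (@scalar_mx R 1)) -add_row_mx.
by rewrite -(row_mx_split (b : 'rV_(1 + m))).
Qed.

Lemma ccont_mulmx m r (f : 'rV[R]_m -> R) (A : 'M[R]_m) : A \in unitmx -> ccont r f ->
  exists2 s, r <= s & ccont s (fun x => f (x *m A)).
Proof.
move=> uA [r0 cf f0].
pose c := m%:R * `|invmx A| + 1; have c1 : 1 <= c by rewrite lerDr mulr_ge0.
exists (r * c); first by rewrite ler_pMr.
have c0 : 0 < c by exact: lt_le_trans c1.
split=> [|x|x rx]; first by rewrite mulr_gt0.
  apply: (@continuous_comp _ _ _ (fun x : 'rV[R]_m => x *m A) f); last exact: cf.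
  apply: continuous_mx_coord => i j.
  have -> : (fun y : 'rV[R]_m => (y *m A) i j) = (fun y => \sum_s y i s * A s j).
    by apply/funext => y; rewrite mxE.
  apply: continuous_at_sum => s _; apply: continuousM; first exact: coord_continuous.
  exact: continuous_at_cst.
apply: f0; rewrite -(ltr_pM2r c0) (lt_le_trans rx)//.
rewrite -{1}[x](mulmxK uA) (le_trans (ler_norm_mulmx _ _))// mulrAC mulrC.
by rewrite ler_wpM2l// lerDl.
Qed.

(** Invertibility is part of the property so that it is stable under products; it then has to be
    checked on block triangular factors only. *)
Definition lin_subst m (A : 'M[R]_m) := A \in unitmx /\ forall r f, ccont r f ->
  `|\det A| * I (fun x : 'rV[R]_m => f (x *m A)) = I f.

Lemma lin_subst_mul m (A B : 'M[R]_m) : lin_subst A -> lin_subst B -> lin_subst (A *m B).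
Proof.
move=> [uA HA] [uB HB]; split=> [|r f Hf]; first by rewrite unitmx_mul uA.
rewrite det_mulmx normrM -(HB _ _ Hf).
have [s _ Hs] := ccont_mulmx uB Hf; rewrite -(HA _ _ Hs).
rewrite mulrCA mulrA; congr (_ * integral_Rn _).
by apply/funext => x; rewrite mulmxA.
Qed.

Lemma lin_subst1 m : lin_subst (1%:M : 'M[R]_m).
Proof.
split=> [|r f Hf]; first exact: unitmx1.
by rewrite det1 normr1 mul1r; congr integral_Rn; apply/funext => x; rewrite mulmx1.
Qed.

Lemma mul_row_scalar_block m (t a : R) (v b : 'rV[R]_m) (c : 'cV[R]_m) D :
  row_mx (t%:M : 'rV_1) v *m block_mx (a%:M : 'M[R]_1) b c D =
  row_mx ((t * a + (v *m c) 0 0)%:M : 'rV_1) (t *: b + v *m D).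
Proof.
rewrite mul_row_block; congr row_mx.
  by apply/rowP => i; rewrite !ord1 !mxE big_ord1 !mxE eqxx !mulr1n.
by rewrite mul_scalar_mx.
Qed.

(** For such a block matrix the first coordinate of a row vector is only rescaled, and the others
    undergo [D] followed by a translation by a multiple of [b]: the inner integral is handled by [D]
    and translation invariance, the outer one by rescaling. *)
Lemma lin_subst_upper m a (b : 'rV[R]_m) D : a != 0 -> lin_subst D ->
  lin_subst (block_mx (a%:M : 'M[R]_1) b 0 D).
Proof.
move=> a0 [uD HD]; have detE : \det (block_mx (a%:M : 'M[R]_1) b 0 D) = a * \det D.
  by rewrite det_ublock det_scalar1.
split=> [|r f Hf].
  by rewrite unitmxE detE unitrM -unitmxE uD unitfE a0.
have d0 : `|\det D| != 0 by rewrite normr_eq0 -unitfE -unitmxE.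
pose g (t : R) := I (fun v : 'rV[R]_m => f (row_mx t%:M v)).
have Hg : ccont r (fun t => `|\det D|^-1 * g t) by apply/ccontZ/ccont_integral_slice.
rewrite detE normrM (integral_RnS (m := m)) [in RHS](integral_RnS (m := m)).
transitivity (`|a| * `|\det D| * \int[lebesgue_measure]_(t in [set: R]) (`|\det D|^-1 * g (a * t + 0))).
  congr (_ * _); apply: eq_Rintegral => t _.
  have E v : f (row_mx t%:M v *m block_mx a%:M b 0 D) = f (row_mx (a * t + 0)%:M (v *m D + t *: b)).
    by rewrite mul_row_scalar_block mulmx0 mxE mulrC [t *: b + _]addrC.
  under eq_fun do rewrite E.
  have Hs := ccont_slice (a * t + 0) Hf.
  rewrite -[I _](mulKf d0) (HD _ _ (ccont_translate (t *: b) Hs)).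
  by rewrite (integral_Rn_translate _ Hs).
rewrite [`|a| * _]mulrC -mulrA (int1_affine 0 Hg a0) (int1Z _ (ccont_integral_slice Hf)).
by rewrite mulVKf.
Qed.

(** Here the first coordinate is shifted by an amount depending on the others; Fubini moves its
    integral inside, where it is translation invariant. *)
Lemma lin_subst_lower m (c : 'cV[R]_m) :
  lin_subst (block_mx (1%:M : 'M[R]_1) 0 c (1%:M : 'M[R]_m)).
Proof.
have detE : \det (block_mx (1%:M : 'M[R]_1) 0 c (1%:M : 'M[R]_m)) = 1.
  by rewrite det_lblock !det1 mulr1.
have uL : block_mx (1%:M : 'M[R]_1) 0 c (1%:M : 'M[R]_m) \in unitmx.
  by rewrite unitmxE detE unitr1.
split=> // r f Hf; rewrite detE normr1 mul1r.
have [s rs Hs] := ccont_mulmx uL Hf; have [s0 cs fs] := Hs.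
have [r0 cf fr] := Hf.
rewrite (integral_RnS (m := m)) [in RHS](integral_RnS (m := m)).
rewrite (@Fubini_R_Rn m (fun t v => f (row_mx t%:M v *m block_mx 1%:M 0 c 1%:M)) s) //; first last.
- move=> t y ty; apply: fs; case: ty => h.
    exact: lt_le_trans h (norm_row_mxl _ _).
  exact: lt_le_trans h (norm_row_mxr _ _).
- move=> p; apply: (@continuous_comp _ _ _ (fun p : R * 'rV[R]_m => row_mx p.1%:M p.2) (fun x => f (x *m block_mx 1%:M 0 c 1%:M)) p (@row_mx_continuous R m p)).
  exact: cs.
rewrite (@Fubini_R_Rn m (fun t v => f (row_mx t%:M v)) r) //; first last.
- move=> t y ty; apply: fr; case: ty => h.
    exact: lt_le_trans h (norm_row_mxl _ _).
  exact: lt_le_trans h (norm_row_mxr _ _).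
- move=> p; apply: (@continuous_comp _ _ _ (fun p : R * 'rV[R]_m => row_mx p.1%:M p.2) f p (@row_mx_continuous R m p)).
  exact: cf.
congr integral_Rn; apply/funext => v.
have Hv : ccont r (fun t : R => f (row_mx t%:M v)).
  split=> // [t|t rt]; last by apply: fr; exact: lt_le_trans rt (norm_row_mxl _ _).
  apply: (@continuous_comp _ _ _ (fun t : R => row_mx t%:M v) f t); last exact: cf.
  exact: (@continuous_comp2 _ _ _ _ _ _ (fun p : R * 'rV[R]_m => row_mx p.1%:M p.2) t (@continuous_at_id _ t) (@continuous_at_cst _ _ v t) (@row_mx_continuous R m _)).
rewrite -(int1_affine ((v *m c) 0 0) Hv (oner_neq0 _)) normr1 mul1r.
apply: eq_Rintegral => t _; congr f.
by rewrite mul_row_scalar_block scaler0 add0r mulmx1 mulr1 mul1r.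
Qed.

(** If the corner entry is nonzero, block elimination with the Schur complement factors the matrix.
    If it is zero, some entry below it is not, and adding the row of that entry to the first row
    makes the corner nonzero. *)
Lemma lin_subst_all m (A : 'M[R]_m) : A \in unitmx -> lin_subst A.
Proof.
elim: m A => [|m IH] A uA.
  split=> // r f Hf; rewrite det_mx00 normr1 mul1r.
  by congr integral_Rn; apply/funext => x; congr f; exact: rV0_eq.
move: A uA; rewrite -[m.+1]/(1 + m)%N => A uA.
have base (B : 'M[R]_(1 + m)) : B \in unitmx -> ulsubmx B 0 0 != 0 -> lin_subst B.
  move=> uB; set a := ulsubmx B 0 0 => a0.
  pose D := drsubmx B - a^-1 *: (dlsubmx B *m ursubmx B).
  have BE : B = block_mx (1%:M : 'M[R]_1) 0 (a^-1 *: dlsubmx B) (1%:M : 'M[R]_m) *m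
      block_mx (a%:M : 'M[R]_1) (ursubmx B) 0 D.
    rewrite mulmx_block ?mul1mx ?mul0mx ?mulmx0 ?addr0 mul_mx_scalar scalerA mulfV// scale1r.
    by rewrite -scalemxAl /D addrC subrK -[LHS]submxK; congr block_mx; exact: mx11_scalar.
  rewrite BE; apply: lin_subst_mul; first exact: lin_subst_lower.
  apply: lin_subst_upper => //; apply: IH; move: uB.
  rewrite BE unitmx_mul => /andP[_]; rewrite !unitmxE det_ublock det_scalar1 unitrM.
  by case/andP.
have [A0|A0] := eqVneq (ulsubmx A 0 0) 0; last exact: base.
have [i Ai] : exists i, dlsubmx A i 0 != 0.
  apply/existsP; rewrite -[X in is_true X]negbK negb_exists; apply/negP => /forallP H.
  have : \det A = 0.
    rewrite (expand_det_col A (lshift m 0)) big1 // => j _.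
    rewrite (_ : A j _ = 0) ?mul0r// -(splitK j); case: (fintype.split j) => j' /=.
      by rewrite (ord1 j') -[RHS]A0 !mxE.
    by have := H j'; rewrite negbK !mxE => /eqP.
  by move: uA; rewrite unitmxE => /[swap] ->; rewrite unitr0.
pose E (s : R) := block_mx (1%:M : 'M[R]_1) (s *: 'e_i) 0 (1%:M : 'M[R]_m).
have ES s : lin_subst (E s).
  by apply: lin_subst_upper; [exact: oner_neq0|exact: lin_subst1].
have EE : E (-1) *m E 1 = 1%:M.
  rewrite mulmx_block ?mul1mx ?mulmx0 ?mul0mx ?mulmx1 ?addr0 ?add0r scaleN1r scale1r subrr.
  by rewrite -scalar_mx_block.
rewrite -[A]mul1mx -EE -mulmxA; apply: lin_subst_mul => //.
apply: base; first by rewrite unitmx_mul uA andbT; have [] := ES 1.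
rewrite -{1}[A]submxK mulmx_block block_mxKul !mul1mx scale1r.
by rewrite -rowE !mxE; move: A0 Ai; rewrite !mxE => -> ; rewrite add0r.
Qed.

Lemma integral_Rn_linear m r (f : 'rV[R]_m -> R) (A : 'M[R]_m) : A \in unitmx -> ccont r f ->
  `|\det A| * I (fun x : 'rV[R]_m => f (x *m A)) = I f.
Proof. by move=> /lin_subst_all[_]; apply. Qed.

End IntegralMore.

(** * Change of variables *)

Section CompactSupport.
Variable R : realType.

Lemma continuous_at_mul (T : topologicalType) (f g : T -> R) (x : T) :
  {for x, continuous f} -> {for x, continuous g} -> {for x, continuous (fun y => f y * g y)}.
Proof. exact: cvgM. Qed.

(** Extension by zero is continuous because [U] and the complement of [L] are open and cover the
    space. *)
Lemma continuous_restrict_compact (X : topologicalType) (U L : set X) (h : X -> R) :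
  open U -> closed L -> L `<=` U -> (forall x, U x -> {for x, continuous h}) ->
  (forall x, U x -> ~ L x -> h x = 0) ->
  continuous (h \_ U) /\ (forall x, ~ L x -> (h \_ U) x = 0).
Proof.
move=> oU cL LU ch h0.
have z x : ~ L x -> (h \_ U) x = 0.
  by rewrite patchE; case: ifPn => // /set_mem Ux Lx; rewrite h0.
split=> // x; have [Ux|NUx] := pselect (U x).
  apply: (@continuous_near_eq R X h (h \_ U) x _ (ch x Ux)).
  near=> y; rewrite patchE mem_set//; near: y; exact: open_nbhs_nbhs.
apply: (@continuous_near_eq R X (fun _ => 0) (h \_ U) x _ (@continuous_at_cst _ _ 0 x)).
near=> y; rewrite z//; near: y.
by apply: open_nbhs_nbhs; split; [exact: closed_openC|move=> /LU].
Unshelve. all: by end_near. Qed.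

Lemma compact_closed_rV m (K : set 'rV[R]_m) : compact K -> closed K.
Proof. by apply: compact_closed; exact: norm_hausdorff. Qed.

Lemma ccont_compact m (K : set 'rV[R]_m) (f : 'rV[R]_m -> R) : compact K -> continuous f ->
  (forall x, ~ K x -> f x = 0) -> exists r, [/\ ccont r f & forall x, K x -> `|x| <= r].
Proof.
move=> cK cf f0; have [M [Mr HM]] := compact_bounded cK.
pose r := `|M| + 1.
have Kr x : K x -> `|x| <= r.
  move=> Kx; apply: (HM r) => //; rewrite (le_lt_trans (ler_norm M))// ltrDl//.
exists r; split=> //; split=> //; first by rewrite ltr_wpDl.
by move=> x rx; apply: f0 => /Kr; rewrite leNgt rx.
Qed.

End CompactSupport.

(** * A Lipschitz mollifier *)

Section Mollifier.
Variables (R : realType) (m : nat).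
Local Notation I f := (integral_Rn f).

(** A Lipschitz profile is enough: the convergence estimate below only compares values of the
    mollifier at nearby points. *)
Let tent (u : 'rV[R]_m) : R := Num.max 0 (1 - `|u|).

Let tent_lip u v : `|tent u - tent v| <= `|u - v|.
Proof.
have h := ler_dist_dist u v; move: h; rewrite /tent; move: `|u - v| => d.
by rewrite !ler_norml; case: (lerP 0 (1 - `|u|)); case: (lerP 0 (1 - `|v|)); lra.
Qed.

Let tent_ccont : ccont 1 tent.
Proof.
split=> // [u|u u1]; last by rewrite /tent max_l// subr_le0 ltW.
apply: continuous_distP => e e0.
apply: filterS (near_dist_lt u e0) => v vu.
exact: le_trans (tent_lip _ _) (ltW vu).
Qed.

Let tent_int : 0 < I tent.
Proof.
apply: (@integral_Rn_gt0 _ _ 1 _ 0) => //; first by move=> u; rewrite /tent le_max lexx.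
by rewrite /tent normr0 subr0 lt_max ltr01 orbT.
Qed.

Definition moll (u : 'rV[R]_m) : R := (I tent)^-1 * tent u.
Definition moll_lip_cst : R := (I tent)^-1.

Lemma moll_ccont : ccont 1 moll. Proof. exact: ccontZ. Qed.

Lemma moll_int : I moll = 1.
Proof. by rewrite /moll (integral_RnZ _ tent_ccont) mulVf// gt_eqF. Qed.

Lemma moll_lip_gt0 : 0 < moll_lip_cst. Proof. by rewrite invr_gt0. Qed.

Lemma moll_lip u v : `|moll u - moll v| <= moll_lip_cst * `|u - v|.
Proof.
rewrite /moll -mulrBr normrM ger0_norm ?invr_ge0 ?(ltW tent_int)//.
by rewrite ler_wpM2l ?tent_lip// invr_ge0 ltW.
Qed.

Lemma moll_bound u : `|moll u| <= moll_lip_cst.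
Proof.
rewrite /moll normrM ger0_norm ?invr_ge0 ?(ltW tent_int)//.
rewrite ler_piMr ?invr_ge0 ?(ltW tent_int)// /tent ger0_norm ?le_max ?lexx//.
Qed.

Lemma moll_even u : moll (- u) = moll u.
Proof. by rewrite /moll /tent normrN. Qed.

End Mollifier.

Section ChangeOfVariables.
Variables (R : realType) (m : nat).
Local Notation I f := (integral_Rn f).

Lemma C1_vec_strict (U : set 'rV[R]_m) (phi : 'rV[R]_m -> 'rV[R]_m) x0 :
  open U -> U x0 -> (forall j, Ck_on 1 U (fun x => phi x 0 j)) ->
  forall e : R, 0 < e -> exists2 r : R, 0 < r & forall x y, `|x - x0| < r -> `|y - x0| < r ->
    `|phi y - phi x - (y - x) *m 'J phi x0| <= e * `|y - x|.
Proof.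
move=> oU Ux0 phi1 e e0.
have [_ ->] := C1_vec_diff oU Ux0 phi1.
have : \forall r \near (0 : R)^'+, forall j x y, `|x - x0| < r -> `|y - x0| < r ->
    `|phi y 0 j - phi x 0 j - ((y - x) *m grad (fun x => phi x 0 j) x0) 0 0| <= e * `|y - x|.
  apply: filter_forall => j; have [r r0 H] := C1_strict oU Ux0 (phi1 j) e0.
  near=> s => x y xs ys; apply: H; [apply: (lt_trans xs)|apply: (lt_trans ys)].
    by near: s; exact: nbhs_right_lt.
  by near: s; exact: nbhs_right_lt.
move=> H; have pos : \forall r \near (0 : R)^'+, 0 < r by exact: nbhs_right_gt.
have [r [H' r0]] := filter_ex (filterI H pos).
exists r => // x y xr yr; apply: mx_norm_le; first by rewrite mulr_ge0// ltW.
move=> i j; set A := \matrix_(_, _) _.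
have -> : (phi y - phi x - (y - x) *m A) i j =
    phi y 0 j - phi x 0 j - ((y - x) *m grad (fun y => phi y 0 j) x0) 0 0; last exact: H'.
rewrite ord1 !mxE; congr (_ - _).
by apply: eq_bigr => s _; rewrite !mxE.
Unshelve. all: by end_near. Qed.

Variables (U V K : set 'rV[R]_m) (phi psi : 'rV[R]_m -> 'rV[R]_m) (f : 'rV[R]_m -> R).
Hypotheses (oU : open U) (oV : open V).
Hypotheses (phiUV : forall x, U x -> V (phi x)) (psiVU : forall y, V y -> U (psi y)).
Hypotheses (phiK : forall x, U x -> psi (phi x) = x) (psiK : forall y, V y -> phi (psi y) = y).
Hypotheses (phi1 : forall j, Ck_on 1 U (fun x => phi x 0 j)).
Hypotheses (cpsi : forall y, V y -> {for y, continuous psi}).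
Hypotheses (Jphi : forall x, U x -> 'J phi x \in unitmx).
Hypotheses (cK : compact K) (KV : K `<=` V) (cf : continuous f).
Hypotheses (f0 : forall y, ~ K y -> f y = 0).

Let h x := f (phi x) * `|\det ('J phi x)|.
Let g := h \_ U.
Let L := psi @` K.

Let LU : L `<=` U. Proof. by move=> _ [y /KV Vy <-]; exact: psiVU. Qed.

Let cL : compact L.
Proof.
apply: continuous_compact => //; apply: continuous_in_subspaceT => y.
by rewrite inE => /KV; exact: cpsi.
Qed.

Let cphi x : U x -> {for x, continuous phi}.
Proof.
move=> Ux; apply: continuous_mx_coord => i j; rewrite ord1.
exact: Ck_on_continuous (phi1 j) Ux.
Qed.

Let continuous_det n (F : 'rV[R]_m -> 'M[R]_n) x : (forall i j, {for x, continuous (fun y => F y i j)}) ->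
  {for x, continuous (fun y => \det (F y))}.
Proof.
move=> cF; have cF' : {for x, continuous F} by exact: continuous_mx_coord.
apply: (@continuous_comp _ _ _ F (fun B => \det B) x cF').
exact: (differentiable_continuous (@differentiable_det R n (F x))).
Qed.

Let ch x : U x -> {for x, continuous h}.
Proof.
move=> Ux; apply: continuousM.
  by apply: (@continuous_comp _ _ _ phi f x (cphi Ux)); exact: cf.
apply: (@continuous_comp _ _ _ (fun y => \det ('J phi y)) (fun z => `|z|) x); last exact: norm_continuous.
apply: continuous_det => i j.
apply: (@continuous_near_eq _ _ (fun y => 'D_('e_i) (fun z => phi z 0 j) y)).
  near=> y; have Uy : U y by near: y; exact: open_nbhs_nbhs.
  by have [_ ->] := C1_vec_diff oU Uy phi1; rewrite mxE.
exact: Ck_on_continuous (Ck_on_pderive i (phi1 j)) Ux.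
Unshelve. all: by end_near. Qed.

Let gP : continuous g /\ (forall x, ~ L x -> g x = 0).
Proof.
apply: (@continuous_restrict_compact _ _ U L) => //; first exact: compact_closed_rV.
move=> x Ux Lx; rewrite /h f0 ?mul0r// => Kx.
exact: (Lx (ex_intro2 _ _ (phi x) Kx (phiK Ux))).
Qed.

Let g_supp x : g x != 0 -> U x /\ K (phi x).
Proof.
move=> gx; have Lx : L x.
  by apply: contrapT => Lx; move: gx; have [_ ->] := gP; rewrite ?eqxx.
split; first exact: LU.
by case: Lx => y Ky <-; rewrite psiK//; exact: KV.
Qed.

(** The mass [g x] is spread around [phi x] at scale [s]. The integral in [z] is exactly [g x],
    while the integral in [x] tends to [f z]; Fubini then equates the integrals of [g] and [f] as
    [s] tends to 0. *)
Let F (s : R) x z := g x * (`|\det (s^-1%:M : 'M[R]_m)| * moll ((z - phi x) *m s^-1%:M)).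

Let F_supp s x z : 0 < s -> F s x z != 0 -> [/\ U x, K (phi x) & `|z - phi x| <= s].
Proof.
move=> s0; rewrite /F mulf_eq0 negb_or => /andP[/g_supp[Ux Kx]].
rewrite mulf_eq0 negb_or => /andP[_ H]; split=> //.
rewrite leNgt; apply/negP => H1; move/eqP: H; apply.
have [_ _ ->] := @moll_ccont R m => //.
rewrite mul_mx_scalar normrZ gtr0_norm ?invr_gt0// ltr_pdivlMl// mulr1//.
Qed.

Let cF s : continuous (fun p : 'rV[R]_m * 'rV[R]_m => F s p.1 p.2).
Proof.
move=> p; rewrite /F; have [Ux|NUx] := pselect (U p.1).
  pose k (q : 'rV[R]_m * 'rV[R]_m) := moll ((q.2 - phi q.1) *m s^-1%:M).
  apply: (@continuous_at_mul _ _ (fun q : 'rV[R]_m * 'rV[R]_m => g q.1)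
    (fun q => `|\det (s^-1%:M : 'M[R]_m)| * k q) p).
    exact: (@continuous_comp _ _ _ (fun q : 'rV[R]_m * 'rV[R]_m => q.1) g p (@continuous_at_fst _ _ p) (gP.1 p.1)).
  apply: (@continuous_at_mul _ _ (fun=> `|\det (s^-1%:M : 'M[R]_m)|) k p); first exact: continuous_at_cst.
  have c1 : {for p, continuous (fun q : 'rV[R]_m * 'rV[R]_m => phi q.1)}.
    exact: (@continuous_comp _ _ _ (fun q : 'rV[R]_m * 'rV[R]_m => q.1) phi p (@continuous_at_fst _ _ p) (cphi Ux)).
  have c2 : {for p, continuous (fun q : 'rV[R]_m * 'rV[R]_m => (q.2 - phi q.1) *m s^-1%:M)}.
    rewrite (_ : (fun q : 'rV[R]_m * 'rV[R]_m => _) = (fun q => s^-1 *: (q.2 - phi q.1))).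
      have c3 : {for p, continuous (fun q : 'rV[R]_m * 'rV[R]_m => q.2 - phi q.1)}.
        exact: cvgB (@continuous_at_snd _ _ p) c1.
      exact: cvgZl_tmp c3.
    by apply/funext => q; rewrite mul_mx_scalar.
  apply: (@continuous_comp _ _ _ _ (@moll R m) p c2).
  by have [_ c _] := @moll_ccont R m; exact: c.
apply: (@continuous_near_eq R _ (fun _ => 0) _ p _ (@continuous_at_cst _ _ 0 p)).
have N : \forall x \near p.1, ~ L x.
  by apply: open_nbhs_nbhs; split; [exact: closed_openC (compact_closed_rV cL)|move=> /LU].
have : nbhs p ((fun q : 'rV[R]_m * 'rV[R]_m => q.1) @^-1` [set x | ~ L x]).
  exact: (@continuous_at_fst _ _ p _ N).
by apply: filterS => q Lq; rewrite /F (gP.2 _ Lq) mul0r.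
Qed.

Let int_F_z s x : 0 < s -> I (F s x) = g x.
Proof.
move=> s0; have Hm := @moll_ccont R m.
have us : (s^-1%:M : 'M[R]_m) \in unitmx.
  by rewrite unitmxE det_scalar unitrX// unitfE invr_eq0 gt_eqF.
have [r _ Hr] := ccont_mulmx us Hm.
have Hr' := ccont_translate (- phi x) Hr.
rewrite /F (integral_RnZ _ (ccontZ _ Hr')) (integral_RnZ _ Hr') (integral_Rn_translate _ Hr).
by rewrite (integral_Rn_linear us Hm) moll_int mulr1.
Qed.

(** The substitution [x = psi z + s u A^-1], with [A] the Jacobian of [phi] at [psi z0], turns the
    integrand into a small perturbation of [f z * moll u], because [phi] is strictly differentiable
    at [psi z0]. The estimate is uniform in [z] near [z0], as the later compactness argument
    requires. *)
Let local_cvg (z0 : 'rV[R]_m) (e : R) : 0 < e ->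
  \forall z \near z0 & s \near (0 : R)^'+, `|I (F s ^~ z) - f z| <= e.
Proof.
move=> e0; have [Kz0|NKz0] := pselect (K z0); last first.
  have : \forall z \near z0, ~ K z.
    by apply: open_nbhs_nbhs; split=> //; exact: closed_openC (compact_closed_rV cK).
  move=> /nbhs_ballP[d /= d0 Hd].
  have d2 : 0 < d / 2 by rewrite divr_gt0.
  have Sn : \forall s \near (0 : R)^'+, 0 < s /\ s < d / 2.
    by near=> s; split; near: s; [exact: nbhs_right_gt|exact: nbhs_right_lt].
  exists ([set z | `|z - z0| < d / 2], [set s | 0 < s /\ s < d / 2]).
    by split; [exact: (near_dist_lt (z0 : 'rV[R]_m) d2)|exact: Sn].
  move=> [z s] [/= zd [s0 sd]].
  have -> : F s ^~ z = (fun _ => 0).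
    apply/funext => x; apply/eqP/negP => /negP/(F_supp s0)[_ Kx zx].
    apply: (Hd (phi x)) => //; rewrite -ball_normE /= distrC.
    have := ler_distD z (phi x) z0; rewrite [`|phi x - z|]distrC => H.
    by rewrite (le_lt_trans H)// (splitr d) ler_ltD// (le_trans zx)// ltW.
  rewrite integral_Rn0 f0 ?subrr ?normr0 ?ltW// => Kz.
  apply: (Hd z) => //; rewrite -ball_normE /= distrC.
  by rewrite (lt_trans zd)// gtr_pMr// invf_lt1// ltr1n.
have Vz0 := KV Kz0; pose x0 := psi z0; have Ux0 : U x0 by exact: psiVU.
pose A := 'J phi x0; have uA : A \in unitmx by exact: Jphi.
have detA0 : `|\det A| != 0 by rewrite normr_eq0 -unitfE -unitmxE.
pose c := m%:R * `|invmx A| + 1; have c0 : 0 < c by rewrite ltr_wpDl// mulr_ge0.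
have cP (w : 'rV[R]_m) : `|w *m invmx A| <= c * `|w|.
  by rewrite (le_trans (ler_norm_mulmx _ _))// mulrAC ler_wpM2r// lerDl.
(* Near [x0] the inverse of [phi] has Lipschitz constant [2 * c] (see [biLip]), so in the rescaled
   variable [u] the integrand is supported in the ball of radius [rho - 1]. *)
pose rho := m%:R * (2 * c) * `|A| + 1; have rho1 : 1 <= rho by rewrite lerDr !mulr_ge0// ltW.
have rho0 : 0 < rho by exact: lt_le_trans rho1.
pose kap := moll_lip_cst R m; have kap0 : 0 < kap := moll_lip_gt0 R m.
pose C := (2 * (rho + 1)) ^+ m; have C0 : 0 < C by rewrite exprn_gt0// mulr_gt0// ltr_wpDr.
pose e' := e / C; have e'0 : 0 < e' by rewrite divr_gt0.
pose B := `|f z0| + 1; have B0 : 0 < B by rewrite ltr_wpDl.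
(* The first bound yields [biLip], by absorbing half of the left-hand side; the second makes the
   error in the argument of the mollifier contribute at most [e' / 2]. The variation of [f] and [G]
   accounts for the other half, through [e2]. *)
pose e1 := Num.min (2 * c)^-1 (e' / 2 / (B * kap * (c * rho))).
have e10 : 0 < e1.
  by rewrite lt_min invr_gt0 mulr_gt0//= !divr_gt0// !mulr_gt0.
have [r0 r00 Hr0] := C1_vec_strict oU Ux0 phi1 e10.
pose G x := `|\det A|^-1 * g x.
have Gx0 : G x0 = f z0.
  by rewrite /G /g patchE mem_set// /h psiK// mulrCA mulVf// mulr1.
have cG : continuous G.
  by move=> x; exact: (@continuous_at_mul _ _ (fun=> `|\det A|^-1) g x (@continuous_at_cst _ _ _ x) (gP.1 x)).
pose e2 := Num.min 1 (e' / 4 / kap).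
have e20 : 0 < e2 by rewrite lt_min ltr01 !divr_gt0.
have [r [r_gt0 rr0 rU rG]] : exists r, [/\ 0 < r, r <= r0, forall x, `|x - x0| < r -> U x &
    forall x, `|x - x0| < r -> `|G x - f z0| <= e2].
  have : \forall x \near x0, U x /\ `|G x - f z0| <= e2.
    near=> x; split; first by near: x; exact: open_nbhs_nbhs.
    by near: x; have /cvgrPdist_le/(_ _ e20) := cG x0; rewrite Gx0; apply: filterS => x; rewrite distrC.
  move=> /nbhs_ballP[r /= rp Hr]; exists (Num.min r r0); split.
  - by rewrite lt_min rp.
  - by rewrite ge_min lexx orbT.
  - move=> x; rewrite lt_min => /andP[xr _]; have [] // := Hr x.
    by rewrite -ball_normE /= distrC.
  - move=> x; rewrite lt_min => /andP[xr _]; have [] // := Hr x.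
    by rewrite -ball_normE /= distrC.
have biLip x y : `|x - x0| < r -> `|y - x0| < r -> `|y - x| <= 2 * c * `|phi y - phi x|.
  move=> xr yr; have H := Hr0 x y (lt_le_trans xr rr0) (lt_le_trans yr rr0).
  have H1 : `|y - x| <= c * `|(y - x) *m A| by rewrite -{1}[y - x](mulmxK uA).
  have H2 : `|(y - x) *m A| <= `|phi y - phi x| + e1 * `|y - x|.
    rewrite -[(y - x) *m A](subKr (phi y - phi x)) (le_trans (ler_normB _ _))// lerD2l.
    exact: H.
  have H3 : c * (e1 * `|y - x|) <= 2^-1 * `|y - x|.
    rewrite mulrA ler_wpM2r// -ler_pdivlMl// -invfM mulrC.
    by rewrite ge_min lexx.
  have H4 := ler_wpM2l (ltW c0) H2; rewrite mulrDr in H4.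
  by move: H1 H3 H4; lra.
have [d d0 Hd] : exists2 d, 0 < d & forall z, `|z - z0| < d -> [/\ V z, `|psi z - x0| < r / 2 & `|f z - f z0| <= e2].
  have r2 : 0 < r / 2 by rewrite divr_gt0.
  have : \forall z \near z0, [/\ V z, `|psi z - x0| < r / 2 & `|f z - f z0| <= e2].
    near=> z; split; first by near: z; exact: open_nbhs_nbhs.
      near: z; have /cvgrPdist_lt/(_ _ r2) := cpsi Vz0.
      by apply: filterS => z; rewrite distrC.
    by near: z; have /cvgrPdist_le/(_ _ e20) := @cf z0; apply: filterS => x; rewrite distrC.
  move=> /nbhs_ballP[d /= dp Hd]; exists d => // z zd; apply: Hd.
  by rewrite -ball_normE /= distrC.
have d2 : 0 < d / 2 by rewrite divr_gt0.
have r2c : 0 < r / 2 / (c * rho) by rewrite !divr_gt0// mulr_gt0.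
have Sn : \forall s \near (0 : R)^'+, [/\ 0 < s, s < d / 2 & s < r / 2 / (c * rho)].
  by near=> s; split; near: s; [exact: nbhs_right_gt|exact: nbhs_right_lt|exact: nbhs_right_lt].
exists ([set z | `|z - z0| < d / 2], [set s | [/\ 0 < s, s < d / 2 & s < r / 2 / (c * rho)]]).
  by split; [exact: (near_dist_lt (z0 : 'rV[R]_m) d2)|exact: Sn].
move=> [z s] [/= zd [s0 sd sr]].
have sn0 : s != 0 by rewrite gt_eqF.
have dd : d / 2 < d by move: d0; lra.
have [Vz x1r fz] := Hd z (lt_trans zd dd).
pose x1 := psi z; have x1r' : `|x1 - x0| < r.
  by rewrite (lt_trans x1r)// gtr_pMr// invf_lt1// ltr1n.
pose T := s *: invmx A.
have uT : T \in unitmx.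
  by rewrite unitmxZ ?unitmx_inv// unitfE.
have detT : `|\det T| * `|\det (s^-1%:M : 'M[R]_m)| = `|\det A|^-1.
  rewrite /T detZ det_scalar det_inv !normrM mulrAC -normrM -exprMn mulfV// expr1n normr1 mul1r.
  by rewrite normfV.
have HF : exists q, ccont q (F s ^~ z).
  have cFz : continuous (F s ^~ z).
    move=> x; exact: (@continuous_comp2 _ _ _ _ _ _ (fun p : 'rV[R]_m * 'rV[R]_m => F s p.1 p.2) x (@continuous_at_id _ x) (@continuous_at_cst _ _ z x) (@cF s _)).
  have F0 x : ~ L x -> F s x z = 0 by move=> Lx; rewrite /F (gP.2 _ Lx) mul0r.
  have [q [Hq _]] := ccont_compact cL cFz F0.
  by exists q.
have [q Hq] := HF.
have [q' qq' Hq'] := ccont_mulmx uT (ccont_translate x1 Hq).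
pose k u := G (u *m T + x1) * moll (s^-1 *: (z - phi (u *m T + x1))).
have IE : I (F s ^~ z) = I k.
  rewrite -(integral_Rn_translate x1 Hq) -(integral_Rn_linear uT (ccont_translate x1 Hq)).
  rewrite -(integral_RnZ _ Hq'); congr integral_Rn; apply/funext => u.
  rewrite /F /k /G mul_mx_scalar -detT; ring.
have kC : ccont q' k.
  have := ccontZ `|\det T| Hq'; congr ccont; apply/funext => u.
  rewrite /F /k /G mul_mx_scalar -detT; ring.
have uE u : u = s^-1 *: ((u *m T + x1 - x1) *m A).
  by rewrite addrK /T -scalemxAr -scalemxAl scalerA mulVf// scale1r mulmxKV.
have ksupp u : rho < `|u| -> k u = 0.
  move=> ru; apply/eqP/negP => /negP ku.
  have : F s (u *m T + x1) z != 0.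
    move: ku; rewrite /k /G /F mul_mx_scalar !mulf_eq0 !negb_or => /andP[/andP[_ ->] ->].
    rewrite andbT normr_eq0 det_scalar expf_neq0// invr_eq0//.
  move=> /(F_supp s0)[Ux Kx zx]; set x := u *m T + x1 in Ux Kx zx.
  have xr : `|x - x0| < r.
    have [_ + _] : [/\ V (phi x), `|psi (phi x) - x0| < r / 2 & `|f (phi x) - f z0| <= e2].
      apply: Hd; have := ler_distD z (phi x) z0; rewrite [`|phi x - z|]distrC => H.
      by rewrite (le_lt_trans H)// (splitr d) ler_ltD// (le_trans zx)// ltW.
    rewrite phiK// => xr; rewrite (lt_trans xr)// gtr_pMr// invf_lt1// ltr1n//.
  have H := biLip x1 x x1r' xr; rewrite psiK// in H.
  have : `|u| <= rho - 1.
    rewrite [u in `|u|]uE normrZ gtr0_norm ?invr_gt0// ler_pdivrMl//.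
    have -> : rho - 1 = m%:R * (2 * c) * `|A| by rewrite /rho addrK.
    rewrite (le_trans (ler_norm_mulmx _ _))// -/x.
    rewrite distrC in zx.
    have c2 : 0 <= 2 * c by rewrite mulr_ge0// ltW.
    have H' := le_trans H (ler_wpM2l c2 zx).
    by have := ler_wpM2l (mulr_ge0 (ler0n R m) (normr_ge0 A)) H'; lra.
  by move: ru; lra.
have kbound u : `|u| <= rho -> `|k u - f z * moll u| <= e'.
  move=> ur; set x := u *m T + x1.
  have xx1 : `|x - x1| <= c * rho * s.
    rewrite /x addrK /T -scalemxAr normrZ gtr0_norm// mulrC ler_wpM2r ?(ltW s0)//.
    by rewrite (le_trans (cP _))// ler_wpM2l// (ltW c0).
  have xr : `|x - x0| < r.
    have := ler_distD x1 x x0 => H; rewrite (le_lt_trans H)// (splitr r) ltrD//.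
    rewrite (le_lt_trans xx1)// mulrC -ltr_pdivlMr//; first by rewrite mulr_gt0.
  have H := Hr0 x1 x (lt_le_trans x1r' rr0) (lt_le_trans xr rr0).
  have Hu : `|s^-1 *: (z - phi x) - (- u)| <= e1 * (c * rho).
    have -> : s^-1 *: (z - phi x) - (- u) = - (s^-1 *: (phi x - phi x1 - (x - x1) *m A)).
      rewrite [u in LHS]uE -/x psiK// -scalerN -scalerBr -scalerN; congr (_ *: _).
      by rewrite opprB opprB addrC opprK.
    rewrite normrN normrZ gtr0_norm ?invr_gt0// ler_pdivrMl// mulrC (le_trans H)//.
    by rewrite -mulrA ler_wpM2l// ltW.
  have Hm : `|moll (s^-1 *: (z - phi x)) - moll u| <= kap * (e1 * (c * rho)).
    rewrite -(moll_even u) (le_trans (moll_lip _ _))// ler_wpM2l ?(ltW kap0)//.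
  have GB : `|G x| <= B.
    have := rG x xr; have e21 : e2 <= 1 by rewrite ge_min lexx.
    by have := ler_normD (G x - f z0) (f z0); rewrite subrK /B; move: e21; lra.
  have GG : `|G x - f z| <= e2 + e2.
    by have := ler_distD (f z0) (G x) (f z); have := rG x xr; move: fz; rewrite [`|f z - _|]distrC; lra.
  have -> : k u - f z * moll u = G x * (moll (s^-1 *: (z - phi x)) - moll u) + (G x - f z) * moll u.
    rewrite /k -/x; ring.
  rewrite (le_trans (ler_normD _ _))// (normrM (G x)) (normrM (G x - f z)) (splitr e') lerD//.
    have h1 : B * (kap * (e1 * (c * rho))) <= e' / 2.
      have -> : B * (kap * (e1 * (c * rho))) = e1 * (B * kap * (c * rho)) by ring.
      by rewrite -ler_pdivlMr ?ge_min ?lexx ?orbT// !mulr_gt0.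
    by rewrite (le_trans _ h1)// ler_pM.
  have h1 : (e2 + e2) * kap <= e' / 2.
    rewrite -ler_pdivlMr//.
    have : e2 <= e' / 4 / kap by rewrite ge_min lexx orbT.
    have -> : e' / 2 / kap = e' / 4 / kap + e' / 4 / kap by field; rewrite gt_eqF.
    by lra.
  by rewrite (le_trans _ h1)// ler_pM// moll_bound.
have fzE : f z = I (fun u : 'rV[R]_m => f z * moll u).
  by have := @integral_RnZ R m 1 (@moll R m) (f z) (@moll_ccont R m); rewrite moll_int mulr1 => E; exact: (esym E).
have kR : ccont rho k by case: kC => *; split.
have mR : ccont rho (fun u : 'rV[R]_m => f z * moll u) by exact/ccontZ/(ccontW rho1)/moll_ccont.
rewrite IE fzE -(integral_RnB kR mR).
have -> : e = C * e' by rewrite mulrC divfK// gt_eqF.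
apply: (@integral_Rn_le R m rho) => [|u].
  have := ccontD kR (ccontZ (-1) mR); congr ccont; apply/funext => u.
  by rewrite mulN1r.
have [ru|/kbound//] := ltP rho `|u|.
rewrite ksupp//; have [_ _ ->] := @moll_ccont R m; last exact: le_lt_trans ru.
by rewrite mulr0 subrr normr0 ltW.
Unshelve. all: by end_near. Qed.

Lemma change_of_variables :
  integral_Rn ((fun x => f (phi x) * `|\det ('J phi x)|) \_ U) = integral_Rn f.
Proof.
rewrite -/h -/g; have [rL [Hg gL]] := ccont_compact cL gP.1 gP.2.
have [rK [Hf fK]] := ccont_compact cK cf f0.
(* At scales [s <= 1] the smearing enlarges the support of [f] by at most 1. *)
pose r := Num.max rL (rK + 1).
have [rL0 _ _] := Hg; have [rK0 _ _] := Hf.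
have r0 : 0 < r by rewrite lt_max rL0.
have Frange s x z : 0 < s -> s <= 1 -> r < `|x| \/ r < `|z| -> F s x z = 0.
  move=> s0 s1 H; apply/eqP/negP => /negP/(F_supp s0)[Ux Kx zx].
  case: H; rewrite gt_max => /andP[h1 h2].
    have : L x by exists (phi x) => //; exact: phiK.
    by move=> /gL; rewrite leNgt h1.
  by have := fK _ Kx; have := ler_distD (phi x) z 0; rewrite !subr0; move: s1 zx h2; lra.
have cS s : 0 < s -> s <= 1 -> ccont r (fun z => I (F s ^~ z)).
  move=> s0 s1; split=> // [z|z rz]; last first.
    rewrite -[RHS](@integral_Rn0 R m); congr integral_Rn; apply/funext => x.
    by rewrite Frange//; right.
  apply: (@integral_Rn_continuous R m _ (fun z x => F s x z) z r).
    near=> y; split=> // [x|x rx]; last by rewrite Frange//; left.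
    exact: (@continuous_comp2 _ _ _ _ _ _ (fun p : 'rV[R]_m * 'rV[R]_m => F s p.1 p.2) x (@continuous_at_id _ x) (@continuous_at_cst _ _ y x) (@cF s _)).
  move=> x; exact: (@continuous_comp2 _ _ _ _ _ _ (fun p : 'rV[R]_m * 'rV[R]_m => F s p.1 p.2) (z, x) (@continuous_at_snd _ _ (z, x)) (@continuous_at_fst _ _ (z, x)) (@cF s _)).
have IgE s : 0 < s -> s <= 1 -> I g = I (fun z => I (F s ^~ z)).
  move=> s0 s1; rewrite -(@Fubini_Rn R m m (F s) r (@cF s) r0) => [|x z xz].
    by congr integral_Rn; apply/funext => x; rewrite int_F_z.
  exact: Frange.
have fR : ccont r f.
  by apply: ccontW Hf; rewrite le_max; apply/orP; right; rewrite lerDl.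
apply/eqP; rewrite -subr_eq0 -normr_le0; apply/ler_addgt0Pr => e e0; rewrite add0r.
pose C := (2 * (r + 1)) ^+ m; have C0 : 0 < C by rewrite exprn_gt0// mulr_gt0// ltr_wpDr.
have eC0 : 0 < e / C by rewrite divr_gt0.
(* Each point of the ball has a neighbourhood with a uniform scale; compactness provides a single
   scale [s] for the whole ball. *)
have /compact_near_coveringP/(_ _ _ (fun s z => `|I (F s ^~ z) - f z| <= e / C)) near_ball := @compact_norm_le R m r.
have H : \forall s \near (0 : R)^'+, [set v : 'rV[R]_m | `|v| <= r] `<=`
    (fun z => `|I (F s ^~ z) - f z| <= e / C).
  by apply: near_ball => z _; exact: local_cvg.
have [s [[s0 s1] Hs]] : exists s, (0 < s /\ s <= 1) /\ [set v : 'rV[R]_m | `|v| <= r] `<=`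
    (fun z => `|I (F s ^~ z) - f z| <= e / C).
  apply: (@filter_ex _ (0 : R)^'+); near=> s; split; last by near: s.
  by split; near: s; [exact: nbhs_right_gt|exact: nbhs_right_le].
have -> : e = C * (e / C) by rewrite mulrC divfK// gt_eqF.
rewrite (IgE s s0 s1) -(integral_RnB (cS s s0 s1) fR).
apply: (@integral_Rn_le R m r) => [|z].
  have := ccontD (cS s s0 s1) (ccontZ (-1) fR); congr ccont; apply/funext => z.
  by rewrite mulN1r.
have [rz|zr] := ltP r `|z|; last exact: Hs.
have [_ _ -> //] := cS s s0 s1; have [_ _ -> //] := fR.
by rewrite subrr normr0 ltW.
Unshelve. all: by end_near. Qed.

End ChangeOfVariables.

(** * Smooth bump functions *)

Section FlatFunction.
Variable R : realType.

(* [flat P t] is [P(1/t) exp(-1/t)] for [t > 0]; the polynomial factor makes the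
   family stable under differentiation. *)
Definition flat (P : {poly R}) (t : R) : R :=
  if 0 < t then P.[t^-1] * expR (- t^-1) else 0.

(** This is [1 + u <= exp u] at [u = y / n.+1%:R], raised to the power [n]. *)
Lemma expR_ge_pow n (y : R) : 0 <= y -> y ^+ n <= n.+1%:R ^+ n * expR y.
Proof.
move=> y0; have n0 : 0 < n.+1%:R :> R by [].
have -> : y ^+ n = n.+1%:R ^+ n * (y / n.+1%:R) ^+ n.
  by rewrite -exprMn mulrC divfK// gt_eqF.
rewrite ler_wpM2l ?exprn_ge0//.
have h1 : y / n.+1%:R <= expR (y / n.+1%:R).
  by rewrite (le_trans _ (expR_ge1Dx _))// lerDr.
apply: le_trans (lerXn2r n _ _ h1) _; rewrite ?nnegrE ?divr_ge0// ?expR_ge0//.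
rewrite -expRM_natl ler_expR mulrC mulrAC -mulrA.
rewrite ler_piMr// ler_pdivrMr// mul1r ler_nat//.
Qed.

Lemma poly_bound (P : {poly R}) : exists2 C, 0 <= C & forall y, 1 <= y ->
  `|P.[y]| <= C * y ^+ size P.
Proof.
exists (\sum_(i < size P) `|P`_i|); first by apply: sumr_ge0.
move=> y y1; have y0 : 0 <= y by exact: le_trans y1.
rewrite horner_coef (le_trans (ler_norm_sum _ _ _))// mulr_suml.
apply: ler_sum => i _; rewrite normrM ler_wpM2l// ger0_norm ?exprn_ge0//.
by rewrite ler_weXn2l// ltnW.
Qed.

(** Quadratic decay at [0] is what makes the derivative vanish there; it holds because [exp (1 / t)]
    dominates every polynomial in [1 / t]. *)
Lemma flat_bound P : exists2 C, 0 <= C & forall t, 0 <= t <= 1 -> `|flat P t| <= C * t ^+ 2.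
Proof.
have [C C0 HC] := poly_bound P.
have [N N0 HN] : exists2 N : R, 0 <= N & forall y, 0 <= y ->
    y ^+ size P * y ^+ 2 <= N * expR y.
  exists ((size P + 2).+1%:R ^+ (size P + 2)); first by rewrite exprn_ge0.
  by move=> y y0; rewrite -exprD; exact: expR_ge_pow.
exists (C * N); first by rewrite mulr_ge0.
move=> t /andP[t0 t1]; rewrite /flat; case: ifPn => [tp|]; last first.
  by rewrite normr0 mulr_ge0 ?exprn_ge0// mulr_ge0.
have y1 : 1 <= t^-1 by rewrite invf_ge1.
have y0 : 0 < t^-1 by rewrite invr_gt0.
rewrite normrM (ger0_norm (expR_ge0 _)) expRN ler_pdivrMr ?expR_gt0//.
apply: le_trans (HC _ y1) _.
have H := ler_wpM2l (exprn_ge0 2 t0) (HN _ (ltW y0)).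
rewrite mulrCA -exprMn mulfV ?gt_eqF// expr1n mulr1 in H.
have -> : C * N * t ^+ 2 * expR t^-1 = C * (t ^+ 2 * (N * expR t^-1)) by ring.
by rewrite ler_wpM2l.
Qed.

Lemma is_derive_cast (V W : normedModType R) (f : V -> W) (x v : V) (d d' : W) :
  is_derive x v f d -> d = d' -> is_derive x v f d'.
Proof. by move=> H <-. Qed.

Lemma is_derive_flat P (t : R) :
  is_derive t (1 : R) (flat P) (flat ('X^2 * (P - P^`())) t).
Proof.
have [t0|t0|->] := ltrgtP t 0.
- rewrite {2}/flat ltNge (ltW t0) /=.
  apply: (near_eq_is_derive _ (is_derive_cst (0 : R) t (1 : R))).
  near=> s; rewrite /flat /cst ifN// -leNgt ltW//; near: s.
  exact: (cvgr_lt _ (@cvg_id _ (nbhs t))).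
- have tn0 : t != 0 by rewrite gt_eqF.
  have dV : is_derive t (1 : R) (fun s : R => s^-1) (- t ^- 2).
    have := is_deriveV (f := id) tn0 (is_derive_id t (1 : R)).
    by move=> /is_derive_cast; apply; rewrite [_ *: _]mulr1.
  have dE : is_derive t (1 : R) (fun s => expR (- s^-1)) (t ^- 2 * expR (- t^-1)).
    have dN := is_deriveN dV.
    have de : differentiable (@expR R) (- t^-1) by apply/derivable1_diffP.
    have [e1 e2] := is_derive_comp_diff dN de; split=> //.
    rewrite [LHS]e2 opprK -[t ^- 2]mulr1 [LHS]linearZ /= -deriveE//.
    by rewrite (@derive_val _ _ _ _ _ _ _ (is_derive_expR (- t^-1))) mulr1.
  have dP : is_derive t (1 : R) (fun s => P.[s^-1]) (- t ^- 2 * (P^`()).[t^-1]).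
    have dp : differentiable (horner P) (t^-1) by apply/derivable1_diffP; exact: derivable_horner.
    have [e1 e2] := is_derive_comp_diff dV dp; split=> //.
    rewrite [LHS]e2 -[- t ^- 2]mulr1 [LHS]linearZ /= -deriveE// mulr1.
    by rewrite -derive1E -derivE.
  have H := is_deriveMr dP dE.
  have E : \near t, P.[t^-1] * expR (- t^-1) = flat P t.
    by near=> s; rewrite /flat ifT//; near: s; exact: (cvgr_gt _ (@cvg_id _ (nbhs t))).
  apply: (near_eq_is_derive E).
  rewrite /flat t0; apply: is_derive_cast H _.
  rewrite hornerM hornerXn hornerD hornerN exprVn; ring.
- have [C C0 HC] := flat_bound P.
  rewrite {2}/flat ltxx; have f0 : flat P 0 = 0 by rewrite /flat ltxx.
  have main : h^-1 *: (flat P (h *: (1 : R) + 0) - flat P 0) @[h --> (0 : R)^'] --> (0 : R).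
    apply/cvgrPdist_le => e e0.
    have d0 : 0 < e / (C + 1) by rewrite divr_gt0// ltr_wpDl.
    near=> h.
    have h0 : h != 0 by near: h; exact: nbhs_dnbhs_neq.
    have h1 : `|h| < 1 by near: h; exact: dnbhs0_lt.
    have he : `|h| < e / (C + 1) by near: h; exact: dnbhs0_lt.
    rewrite sub0r normrN f0 subr0 addr0 [h *: 1]mulr1 normrM normfV.
    rewrite ler_pdivrMl ?normr_gt0// mulrC.
    have hC : C * `|h| <= e.
      rewrite (@le_trans _ _ ((C + 1) * `|h|))// ?ler_wpM2r// ?lerDl//.
      by rewrite -ler_pdivlMl ?ltr_wpDl// mulrC ltW.
    have [hp|hn] := ltP 0 h; last first.
      by rewrite /flat ltNge hn /= normr0 mulr_ge0// ltW.
    rewrite (gtr0_norm hp) in h1 hC.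
    have F1 : `|flat P h| <= C * h ^+ 2 by apply: HC; rewrite !ltW.
    have F2 : C * h ^+ 2 <= e * h by rewrite expr2 mulrA ler_wpM2r// ltW.
    by rewrite (gtr0_norm hp); exact: le_trans F1 F2.
  split; first by apply/cvg_ex; exists 0.
  by apply: cvg_lim => //; exact: main.
Unshelve. all: by end_near. Qed.

Lemma Ck_flat k m (U : set 'rV[R]_m) f P : open U -> Ck_on k U f -> Ck_on k U (flat P \o f).
Proof.
move=> oU; elim: k P => [|k IH] P fk.
  split=> // x Ux; apply: (@continuous_comp _ _ _ f (flat P)); first exact: Ck_on_continuous fk Ux.
  by apply/differentiable_continuous/derivable1_diffP; case: (is_derive_flat P (f x)).
have cflat : forall x, U x -> {for x, continuous (flat P \o f)}.
  move=> x Ux; apply: (@continuous_comp _ _ _ f (flat P)); first exact: Ck_on_continuous fk Ux.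
  by apply/differentiable_continuous/derivable1_diffP; case: (is_derive_flat P (f x)).
have D x i : U x -> is_derive x 'e_i (flat P \o f)
    ((flat ('X^2 * (P - P^`())) \o f) x * 'D_('e_i) f x).
  move=> Ux; have df := derivableP (@Ck_on_derivable _ _ _ _ _ _ i fk Ux).
  have dF : differentiable (flat P) (f x) by apply/derivable1_diffP; case: (is_derive_flat P (f x)).
  have [e1 e2] := is_derive_comp_diff df dF; split=> //.
  rewrite [LHS]e2 -['D_('e_i) f x in LHS]mulr1 [LHS]linearZ /= -deriveE//.
  by case: (is_derive_flat P (f x)) => _ ->; rewrite [LHS]mulrC.
split=> // i; split=> [x Ux|]; first by case: (D x i Ux).
apply: (eq_Ck_on oU _ (CkM oU (IH ('X^2 * (P - P^`())) (Ck_onW fk)) (Ck_on_pderive i fk))).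
by move=> x Ux; case: (D x i Ux).
Qed.

(** A product over coordinates fits the matrix norm, whose balls are cubes. *)
Definition bump_at m (x0 : 'rV[R]_m) (r : R) (x : 'rV[R]_m) : R :=
  \prod_i flat 1 (r ^+ 2 - (x 0 i - x0 0 i) ^+ 2).

Lemma bump_smooth m x0 r (U : set 'rV[R]_m) : open U -> smooth_on U (bump_at x0 r).
Proof.
move=> oU k; apply: Ck_prod => // i _.
have H : Ck_on k U (fun x : 'rV[R]_m => r ^+ 2 - (x 0 i - x0 0 i) ^+ 2).
  apply: CkB => //; first exact: Ck_cst.
  by apply: CkM => //; apply: CkB => //; (exact: Ck_coord || exact: Ck_cst).
exact: Ck_flat oU H.
Qed.

Lemma flat1_ge0 t : 0 <= flat 1 t.
Proof. by rewrite /flat; case: ifP => // _; rewrite hornerE mul1r expR_ge0. Qed.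

Lemma flat1_gt0 t : (0 < flat 1 t) = (0 < t).
Proof.
by rewrite /flat; case: ifP => // _; rewrite ?ltxx// hornerE mul1r expR_gt0.
Qed.

Lemma bump_ge0 m (x0 : 'rV[R]_m) r x : 0 <= bump_at x0 r x.
Proof. by apply: prodr_ge0 => i _; exact: flat1_ge0. Qed.

Lemma bump_center m (x0 : 'rV[R]_m) r : 0 < r -> 0 < bump_at x0 r x0.
Proof.
by move=> r0; apply: prodr_gt0 => i _; rewrite flat1_gt0 subrr expr0n subr0 exprn_gt0.
Qed.

Lemma bump_supp m (x0 : 'rV[R]_m) r x : 0 < r -> bump_at x0 r x != 0 -> `|x - x0| <= r.
Proof.
move=> r0 /prodf_neq0 H; apply: mx_norm_le; first exact: ltW.
move=> a i; rewrite ord1 !mxE; have := H i isT.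
have [+ _|] := ltP 0 (r ^+ 2 - (x 0 i - x0 0 i) ^+ 2).
  by rewrite subr_gt0 -real_normK ?num_real// => /ltW; rewrite ler_pXn2r// ?nnegrE// ltW.
by rewrite /flat leNgt => /negbTE ->; rewrite eqxx.
Qed.

End FlatFunction.

(** * Smooth matrix-valued functions *)

Section SmoothMatrix.
Variables (R : realType) (n : nat) (U : set 'rV[R]_n).
Hypothesis oU : open U.

Definition smx (a b : nat) (F : 'rV[R]_n -> 'M[R]_(a, b)) : Prop :=
  forall i j, smooth_on U (fun x => F x i j).

Lemma smooth_onM (f g : 'rV[R]_n -> R) : smooth_on U f -> smooth_on U g -> smooth_on U (fun x => f x * g x).
Proof. by move=> sf sg k; exact: CkM. Qed.

Lemma smooth_onD (f g : 'rV[R]_n -> R) : smooth_on U f -> smooth_on U g -> smooth_on U (fun x => f x + g x).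
Proof. by move=> sf sg k; exact: CkD. Qed.

Lemma smooth_onB (f g : 'rV[R]_n -> R) : smooth_on U f -> smooth_on U g -> smooth_on U (fun x => f x - g x).
Proof. by move=> sf sg k; exact: CkB. Qed.

Lemma smooth_onN (f : 'rV[R]_n -> R) : smooth_on U f -> smooth_on U (fun x => - f x).
Proof. by move=> sf k; exact: CkN. Qed.

Lemma smooth_on_cst (c : R) : smooth_on U (fun=> c).
Proof. by move=> k; exact: Ck_cst. Qed.

Lemma smooth_on_sum (I : Type) (r : seq I) (P : pred I) (f : I -> 'rV[R]_n -> R) :
  (forall i, P i -> smooth_on U (f i)) -> smooth_on U (fun x => \sum_(i <- r | P i) f i x).
Proof. by move=> sf k; apply: Ck_sum => // i Pi; exact: sf. Qed.

Lemma smooth_onV (f : 'rV[R]_n -> R) : (forall x, U x -> f x != 0) -> smooth_on U f ->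
  smooth_on U (fun x => (f x)^-1).
Proof. by move=> f0 sf k; exact: CkV. Qed.

Lemma smooth_on_sqrt (f : 'rV[R]_n -> R) : (forall x, U x -> 0 < f x) -> smooth_on U f ->
  smooth_on U (fun x => Num.sqrt (f x)).
Proof. by move=> f0 sf k; exact: Ck_sqrt. Qed.

Lemma eq_smooth_on (f g : 'rV[R]_n -> R) : (forall x, U x -> f x = g x) ->
  smooth_on U f -> smooth_on U g.
Proof. by move=> fg sf k; exact: eq_Ck_on oU fg (sf k). Qed.

Lemma eq_smx a b (F G : 'rV[R]_n -> 'M[R]_(a, b)) : (forall x, U x -> F x = G x) ->
  smx F -> smx G.
Proof.
by move=> FG sF i j; apply: eq_smooth_on (sF i j) => x Ux; rewrite FG.
Qed.

Lemma smx_cst a b (A : 'M[R]_(a, b)) : smx (fun=> A).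
Proof. by move=> i j; exact: smooth_on_cst. Qed.

Lemma smxM a b c (F : 'rV[R]_n -> 'M[R]_(a, b)) (G : 'rV[R]_n -> 'M[R]_(b, c)) :
  smx F -> smx G -> smx (fun x => F x *m G x).
Proof.
move=> sF sG i j; apply: (@eq_smooth_on (fun x => \sum_s F x i s * G x s j)).
  by move=> x _; rewrite mxE.
by apply: smooth_on_sum => s _; exact: smooth_onM.
Qed.

Lemma smxD a b (F G : 'rV[R]_n -> 'M[R]_(a, b)) : smx F -> smx G -> smx (fun x => F x + G x).
Proof.
move=> sF sG i j; apply: (@eq_smooth_on (fun x => F x i j + G x i j)).
  by move=> x _; rewrite mxE.
exact: smooth_onD.
Qed.

Lemma smxN a b (F : 'rV[R]_n -> 'M[R]_(a, b)) : smx F -> smx (fun x => - F x).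
Proof.
move=> sF i j; apply: (@eq_smooth_on (fun x => - F x i j)).
  by move=> x _; rewrite mxE.
exact: smooth_onN.
Qed.

Lemma smxB a b (F G : 'rV[R]_n -> 'M[R]_(a, b)) : smx F -> smx G -> smx (fun x => F x - G x).
Proof. by move=> sF sG; apply: smxD => //; exact: smxN. Qed.

Lemma smxZ a b (f : 'rV[R]_n -> R) (F : 'rV[R]_n -> 'M[R]_(a, b)) : smooth_on U f -> smx F ->
  smx (fun x => f x *: F x).
Proof.
move=> sf sF i j; apply: (@eq_smooth_on (fun x => f x * F x i j)).
  by move=> x _; rewrite mxE.
exact: smooth_onM.
Qed.

Lemma smx_tr a b (F : 'rV[R]_n -> 'M[R]_(a, b)) : smx F -> smx (fun x => (F x)^T).
Proof.
move=> sF i j; apply: (@eq_smooth_on (fun x => F x j i)); last exact: sF.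
by move=> x _; rewrite mxE.
Qed.

Lemma smooth_on_det a (F : 'rV[R]_n -> 'M[R]_a) : smx F -> smooth_on U (fun x => \det (F x)).
Proof.
move=> sF; apply: smooth_on_sum => s _; apply: smooth_onM; first exact: smooth_on_cst.
by move=> k; apply: Ck_prod => // i _; exact: sF.
Qed.

Lemma smx_inv a (F : 'rV[R]_n -> 'M[R]_a) : (forall x, U x -> F x \in unitmx) ->
  smx F -> smx (fun x => invmx (F x)).
Proof.
move=> uF sF.
apply: (@eq_smx _ _ (fun x => (\det (F x))^-1 *: \adj (F x))).
  by move=> x Ux; rewrite /invmx uF.
apply: smxZ.
  by apply: smooth_onV; [move=> x Ux; rewrite -unitfE -unitmxE uF|exact: smooth_on_det].
move=> i j; apply: (@eq_smooth_on (fun x => cofactor (F x) j i)).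
  by move=> x _; rewrite mxE.
apply: smooth_onM; first exact: smooth_on_cst.
apply: smooth_on_det => s t; apply: (@eq_smooth_on (fun x => F x (lift j s) (lift i t))).
  by move=> x _; rewrite !mxE.
exact: sF.
Qed.

Lemma smx_derivable a b (F : 'rV[R]_n -> 'M[R]_(a, b)) x v : U x -> smx F -> derivable F x v.
Proof.
move=> Ux sF; apply/derivable_mxP => i j.
by case: (@C1_derive _ _ _ _ x v oU Ux (sF i j 1%N)).
Qed.

Lemma smx_derive a b (F : 'rV[R]_n -> 'M[R]_(a, b)) x v : U x -> smx F ->
  is_derive x v F ('D_v F x).
Proof. by move=> Ux sF; apply: derivableP; exact: smx_derivable. Qed.

Lemma smx_deriveE a b (F : 'rV[R]_n -> 'M[R]_(a, b)) x v : U x -> smx F ->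
  'D_v F x = \sum_i v 0 i *: 'D_('e_i) F x.
Proof.
move=> Ux sF; apply/matrixP => p q.
have := smx_derive v Ux sF => /is_derive_mxP/(_ p q) [_ <-].
have [_ ->] := @C1_derive _ _ _ _ x v oU Ux (sF p q 1%N).
rewrite summxE; apply: eq_bigr => i _; rewrite mxE; congr (_ * _).
by have := smx_derive 'e_i Ux sF => /is_derive_mxP/(_ p q) [_ <-].
Qed.

Lemma smx_pderive a b (F : 'rV[R]_n -> 'M[R]_(a, b)) i : smx F ->
  smx (fun x => 'D_('e_i) F x).
Proof.
move=> sF p q; apply: (@eq_smooth_on (fun x => 'D_('e_i) (fun y => F y p q) x)).
  by move=> x Ux; have /is_derive_mxP/(_ p q) [_ <-] := smx_derive 'e_i Ux sF.
exact: smooth_pderive.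
Qed.

Lemma smooth_onW (V : set 'rV[R]_n) f : V `<=` U -> smooth_on U f -> smooth_on V f.
Proof. by move=> VU sf k; exact: Ck_on_sub VU (sf k). Qed.

Lemma smooth_on_continuous f x : smooth_on U f -> U x -> {for x, continuous f}.
Proof. by move=> sf Ux; exact: Ck_on_continuous (sf 0%N) Ux. Qed.

End SmoothMatrix.

(** * Integration on manifolds *)

(* Comparing two Jacobians up to conversion unfolds the choice operator in
   their definition, which diverges. *)
Local Opaque jacobian.

(* Conversion tests between applications of these notions to different charts
   diverge, hence the opaque copies. *)
Definition seal (T : Type) (x : T) : {y : T | y = x}. Proof. by exists x. Qed.

Lemma continuous_translate (R : realType) (V : normedModType R) (b : V) :
  continuous (fun x : V => x + b).
Proof. by move=> x; apply: continuousD; [exact: cvg_id|exact: cst_continuous]. Qed.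

Lemma compact_finite_cover (T : topologicalType) (V : T -> set T) : compact [set: T] ->
  (forall p, open (V p)) -> (forall p, V p p) ->
  exists s : seq T, forall q, exists2 p, p \in s & V p q.
Proof.
move=> /compact_near_coveringP cT oV Vp.
(* The filter of properties that hold for all sequences containing a given finite one. A point is
   covered as soon as the sequence contains it, and the near-covering form of compactness gives one
   sequence for all points. *)
pose F : set_system (seq T) := fun A => exists s0 : seq T, forall s : seq T, {subset s0 <= s} -> A s.
have FF : Filter F.
  split; first by exists [::].
    move=> A B [s As] [t Bt]; exists (s ++ t) => u stu; split.
      by apply: As => x xs; apply: stu; rewrite mem_cat xs.
    by apply: Bt => x xs; apply: stu; rewrite mem_cat xs orbT.
  by move=> A B AB [s As]; exists s => u su; exact/AB/As.
have [s Hs] : \forall s \near F, [set: T] `<=` (fun q : T => exists2 p : T, p \in s & V p q).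
  apply: (cT _ _ (fun (s : seq T) (q : T) => exists2 p : T, p \in s & V p q)) => q _.
  exists (V q, [set s : seq T | q \in s]); last by move=> [x s] /= [Vx qs]; exists q.
  split=> /=; first by apply: open_nbhs_nbhs; split=> //; exact: oV.
  by exists [:: q] => s; apply; rewrite inE.
by exists s => q; exact: Hs.
Qed.

Section SealedCharts.
Variables (R : realType) (m : nat) (M : manifold R m).

Definition jac (c d : chart R M m) (p : M) : 'M[R]_m :=
  sval (seal (fun c d p => 'J (@cfun R M m d \o @cinv R M m c) (@cfun R M m c p))) c d p.

Definition vin (c : chart R M m) (X : vfield M) (x : 'rV[R]_m) : 'rV[R]_m :=
  sval (seal (@vfield_in R m M)) c X x.

Definition tin (c : chart R M m) (g : tensor2 M) (x : 'rV[R]_m) : 'M[R]_m :=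
  sval (seal (@tensor2_in R m M)) c g x.

Lemma jac_def c d p : jac c d p = 'J (@cfun R M m d \o @cinv R M m c) (@cfun R M m c p).
Proof. by rewrite /jac; case: (seal _) => y /= ->. Qed.

Lemma vin_def : vin = @vfield_in R m M.
Proof.
by apply/funext => c; apply/funext => X; apply/funext => x; rewrite /vin; case: (seal _) => y /= ->.
Qed.

Lemma tin_def : tin = @tensor2_in R m M.
Proof.
by apply/funext => c; apply/funext => X; apply/funext => x; rewrite /tin; case: (seal _) => y /= ->.
Qed.

Lemma vin_cfun c (X : vfield M) p : cdom c p -> vin c X (cfun c p) = X p *m jac (chart_at p) c p.
Proof. by move=> cp; rewrite vin_def jac_def /vfield_in cfunK. Qed.

Lemma tin_cfun c (g : tensor2 M) p : cdom c p ->
  tin c g (cfun c p) = jac c (chart_at p) p *m g p *m (jac c (chart_at p) p)^T.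
Proof. by move=> cp; rewrite tin_def jac_def /tensor2_in cfunK. Qed.

End SealedCharts.

(** * Transition maps, tensors in charts and partitions of unity *)

Section Charts.
Variables (R : realType) (m : nat) (M : manifold R m).
Implicit Types (p : M) (c d e : chart R M m).

Lemma open_chart_preimage c (W : set M) : open W -> open (cimg c `&` cinv c @^-1` W).
Proof.
move=> oW; rewrite openE => x [cx Wx]; rewrite /interior.
apply: filterI; first by apply: open_nbhs_nbhs; split => //; exact: open_cimg.
exact: (cinv_continuous cx (open_nbhs_nbhs (conj oW Wx))).
Qed.

Lemma open_overlap c d : open (cimg c `&` cinv c @^-1` cdom d).
Proof. exact/open_chart_preimage/open_cdom. Qed.

Lemma overlap_cfun c d p : cdom c p -> cdom d p ->
  (cimg c `&` cinv c @^-1` cdom d) (cfun c p).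
Proof. by move=> cp dp; split; [exact: cfun_cimg|rewrite /= cfunK]. Qed.

Lemma transition_C1 c d : atlas c -> atlas d -> forall j,
  Ck_on 1 (cimg c `&` cinv c @^-1` cdom d) (fun x => (cfun d \o cinv c) x 0 j).
Proof. by move=> ac ad j; exact: transition_smooth. Qed.

Lemma transition_diff c d p : atlas c -> atlas d -> cdom c p -> cdom d p ->
  differentiable (cfun d \o cinv c) (cfun c p).
Proof.
move=> ac ad cp dp.
by have [] := C1_vec_diff (@open_overlap c d) (overlap_cfun cp dp) (transition_C1 ac ad).
Qed.

Lemma jacE c d p : atlas c -> atlas d -> cdom c p -> cdom d p ->
  jac c d p = \matrix_(i, j) 'D_('e_i) (fun x => (cfun d \o cinv c) x 0 j) (cfun c p).
Proof.
move=> ac ad cp dp; rewrite jac_def.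
by have [] := C1_vec_diff (@open_overlap c d) (overlap_cfun cp dp) (transition_C1 ac ad).
Qed.

Lemma jacobian_comp (a b n : nat) (f : 'rV[R]_a -> 'rV[R]_b) (g : 'rV[R]_b -> 'rV[R]_n) x :
  differentiable f x -> differentiable g (f x) -> 'J (g \o f) x = 'J f x *m 'J g (f x).
Proof.
move=> df dg; apply/row_matrixP => i; rewrite !rowE mulmxA.
rewrite -!deriveEjacobian//; last exact: differentiable_comp.
have Hf : is_derive x 'e_i f ('D_('e_i) f x) by apply: derivableP; exact: diff_derivable.
have [_ ->] := is_derive_comp_diff Hf dg.
by rewrite [RHS]deriveE.
Qed.

Lemma diff_dist_conv (V W' : normedModType R) (f : V -> W') (x : V) : differentiable f x ->
  forall e : R, 0 < e -> \forall y \near x, `|f y - f x - 'd f x (y - x)| <= e * `|y - x|.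
Proof.
move=> /diff_locally E e e0; rewrite (near_shift 0) subr0.
have /eqaddoP/(_ e e0) := E.
by apply: filterS => h; rewrite /= addrK opprD addrA.
Qed.

Lemma near_eq_jacobian (a b : nat) (f g : 'rV[R]_a -> 'rV[R]_b) x :
  differentiable f x -> (\forall y \near x, f y = g y) ->
  differentiable g x /\ 'J g x = 'J f x.
Proof.
move=> df fg.
have dg : differentiable g x.
  have fg0 : f x = g x by exact: nbhs_singleton fg.
  have [] // := @diff_dist _ _ _ g ('d f x) x (diff_continuous df).
  move=> e e0; have H := diff_dist_conv df e0.
  near=> y; have <- : f y = g y by near: y.
  by rewrite -fg0; near: y.
split; first exact: dg.
suff E (v : 'rV[R]_a) : v *m 'J g x = v *m 'J f x.
  have := E; move: ('J g x) ('J f x) => A B AB.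
  by apply/row_matrixP => i; rewrite !rowE.
have E1 : 'D_v g x = v *m 'J g x by exact: deriveEjacobian.
have E2 : 'D_v f x = v *m 'J f x by exact: deriveEjacobian.
have E3 : 'D_v g x = 'D_v f x by apply: near_eq_derive; apply: filterS fg => y ->.
exact: etrans (esym E1) (etrans E3 E2).
Unshelve. all: by end_near. Qed.

Lemma jac_comp c d e p : atlas c -> atlas d -> atlas e -> cdom c p -> cdom d p -> cdom e p ->
  jac c e p = jac c d p *m jac d e p.
Proof.
move=> ac ad ae cp dp ep; rewrite !jac_def.
have dcd := transition_diff ac ad cp dp.
have xE : (cfun d \o cinv c) (cfun c p) = cfun d p by rewrite /= cfunK.
have dde : differentiable (cfun e \o cinv d) ((cfun d \o cinv c) (cfun c p)).
  by rewrite xE; exact: transition_diff.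
have E1 := jacobian_comp dcd dde; rewrite xE in E1.
have [_ E2] : differentiable (cfun e \o cinv c) (cfun c p) /\
    'J (cfun e \o cinv c) (cfun c p) =
    'J ((cfun e \o cinv d) \o (cfun d \o cinv c)) (cfun c p).
  apply: near_eq_jacobian; first exact: differentiable_comp.
  near=> x; rewrite /= cfunK//.
  have [] // : (cimg c `&` cinv c @^-1` cdom d) x.
  near: x; apply: open_nbhs_nbhs; split; [exact: open_overlap|exact: overlap_cfun].
exact: etrans E2 E1.
Unshelve. all: by end_near. Qed.

Lemma jac_id c p : atlas c -> cdom c p -> jac c c p = 1%:M.
Proof.
move=> ac cp; rewrite jacE//; apply/matrixP => i j; rewrite !mxE.
transitivity ('D_('e_i) (fun x : 'rV[R]_m => x 0 j) (cfun c p)).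
  apply: near_eq_derive; near=> x; rewrite /= cinvK//.
  near: x; apply: open_nbhs_nbhs; split; [exact: open_cimg|exact: cfun_cimg].
by case: (is_derive_coord (cfun c p) 'e_i j) => _ ->; rewrite mxE eqxx /= eq_sym.
Unshelve. all: by end_near. Qed.

Lemma jacK c d p : atlas c -> atlas d -> cdom c p -> cdom d p ->
  jac c d p *m jac d c p = 1%:M.
Proof. by move=> ac ad cp dp; rewrite -jac_comp// jac_id. Qed.

Lemma jac_unit c d p : atlas c -> atlas d -> cdom c p -> cdom d p -> jac c d p \in unitmx.
Proof. by move=> ac ad cp dp; have [h _] := mulmx1_unit (jacK ac ad cp dp). Qed.

Lemma invmx_jac c d p : atlas c -> atlas d -> cdom c p -> cdom d p ->
  invmx (jac c d p) = jac d c p.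
Proof.
move=> ac ad cp dp; have u := jac_unit ac ad cp dp; have E := jacK ac ad cp dp.
by rewrite -[LHS]mulmx1 -E mulKmx.
Qed.

Lemma jac_smooth c d : atlas c -> atlas d ->
  smx (cimg c `&` cinv c @^-1` cdom d) (fun x => jac c d (cinv c x)).
Proof.
move=> ac ad i j; apply: (@eq_smooth_on _ _ _ (@open_overlap c d)
   (fun x => 'D_('e_i) (fun x => (cfun d \o cinv c) x 0 j) x)).
  by move=> x [cx dx]; rewrite jacE ?mxE ?cinvK//; exact: cinv_cdom.
by apply: smooth_pderive; exact: transition_smooth.
Qed.

Lemma vin_jac c d (X : vfield M) p : atlas c -> atlas d -> cdom c p -> cdom d p ->
  vin d X (cfun d p) = vin c X (cfun c p) *m jac c d p.
Proof.
move=> ac ad cp dp.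
have E := jac_comp (chart_at_atlas p) ac ad (chart_at_cdom p) cp dp.
by rewrite (vin_cfun X dp) (vin_cfun X cp) -mulmxA -E.
Qed.

Lemma vin_chart_at (X : vfield M) p : vin (chart_at p) X (pos_at p) = X p.
Proof.
rewrite (vin_cfun X (chart_at_cdom p)) jac_id ?mulmx1//.
  exact: chart_at_atlas.
exact: chart_at_cdom.
Qed.

Lemma tin_jac c d (g : tensor2 M) p : atlas c -> atlas d -> cdom c p -> cdom d p ->
  tin c g (cfun c p) = jac c d p *m tin d g (cfun d p) *m (jac c d p)^T.
Proof.
move=> ac ad cp dp.
have E := jac_comp ac ad (chart_at_atlas p) cp dp (chart_at_cdom p).
by rewrite (tin_cfun g cp) (tin_cfun g dp) E trmx_mul !mulmxA.
Qed.

Lemma tin_chart_at (g : tensor2 M) p : tin (chart_at p) g (pos_at p) = g p.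
Proof.
rewrite (tin_cfun g (chart_at_cdom p)) jac_id ?trmx1 ?mulmx1 ?mul1mx//.
  exact: chart_at_atlas.
exact: chart_at_cdom.
Qed.

Lemma smooth_function_continuous (f : M -> R) : smooth_function f -> continuous f.
Proof.
move=> sf p; have ac := chart_at_atlas p; have cp := chart_at_cdom p.
have H : {for cfun (chart_at p) p, continuous (f \o cinv (chart_at p))}.
  exact: smooth_on_continuous (sf _ ac) (cfun_cimg cp).
apply: (@continuous_near_eq _ _ ((f \o cinv (chart_at p)) \o cfun (chart_at p))).
  near=> q; rewrite /= cfunK//; near: q; apply: open_nbhs_nbhs; split => //; exact: open_cdom.
exact: (@continuous_comp _ _ _ (cfun (chart_at p)) (f \o cinv (chart_at p)) p (cfun_continuous cp) H).
Unshelve. all: by end_near. Qed.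

Lemma smooth_transfer c d (W : set M) (f : M -> R) : atlas c -> atlas d -> open W ->
  smooth_on (cimg c `&` cinv c @^-1` W) (f \o cinv c) ->
  smooth_on (cimg d `&` cinv d @^-1` (W `&` cdom c)) (f \o cinv d).
Proof.
move=> ac ad oW sf k.
have oU : open (cimg d `&` cinv d @^-1` (W `&` cdom c)).
  by apply: open_chart_preimage; apply: openI => //; exact: open_cdom.
have oV := @open_chart_preimage c _ oW.
apply: (@eq_Ck_on _ _ _ _ ((f \o cinv c) \o (cfun c \o cinv d))) => //.
  by move=> x [dx [Wx cx]]; rewrite /= cfunK.
apply: (@Ck_comp _ _ _ _ _ (cimg c `&` cinv c @^-1` W)) => //.
- by move=> x [dx [Wx cx]]; split; [exact: cfun_cimg|rewrite /= cfunK].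
- move=> j; apply: (@Ck_on_sub _ _ _ (cimg d `&` cinv d @^-1` cdom c)); last exact: transition_smooth.
  by move=> x [dx [Wx cx]].
Qed.

Lemma smooth_on_cover (n : nat) (U V : set 'rV[R]_n) (f : 'rV[R]_n -> R) (O : set 'rV[R]_n) :
  O `<=` U `|` V -> smooth_on U f -> smooth_on V f -> smooth_on O f.
Proof. by move=> OUV sU sV k; apply: Ck_on_sub OUV _; exact: Ck_on_union. Qed.

(** The support [S] is the image of a closed coordinate cube; being compact in a Hausdorff space it
    is closed. The chart domain and the complement of [S] then cover [M] by open sets on which
    smoothness is clear. *)
Lemma manifold_bump p (W : set M) : open W -> W p ->
  exists b : M -> R, [/\ smooth_function b, forall q, 0 <= b q, 0 < b p &
     (exists2 S, closed S & (S `<=` W /\ S `<=` cdom (chart_at p)) /\ (forall q, ~ S q -> b q = 0))].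
Proof.
move=> oW Wp; pose c := chart_at p; have ac : atlas c := chart_at_atlas p.
have cp : cdom c p := chart_at_cdom p.
pose x0 := cfun c p.
have [r r0 Hr] : exists2 r, 0 < r & forall x, `|x - x0| <= r -> cimg c x /\ W (cinv c x).
  have : nbhs x0 (cimg c `&` cinv c @^-1` W).
    apply: open_nbhs_nbhs; split; first exact: open_chart_preimage.
    by split; [exact: cfun_cimg|rewrite /= cfunK].
  move=> /nbhs_ballP[r /= r0 H]; exists (r / 2); first by rewrite divr_gt0.
  move=> x xr; apply: H; rewrite -ball_normE /= distrC (le_lt_trans xr)//.
  by rewrite gtr_pMr// invf_lt1// ltr1n.
pose B := [set x : 'rV[R]_m | `|x - x0| <= r].
have cB : compact B.
  have -> : B = (fun x => x + x0) @` [set v : 'rV[R]_m | `|v| <= r].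
    apply/seteqP; split=> [x Bx|_ [v vr <-]]; last by rewrite /B /= addrK.
    by exists (x - x0) => //; rewrite subrK.
  apply: continuous_compact; last exact: compact_norm_le.
  apply: continuous_subspaceT => x; exact: continuous_translate.
pose S := cinv c @` B.
have cS : compact S.
  apply: continuous_compact cB; apply: continuous_in_subspaceT => x; rewrite inE => Bx.
  by apply: cinv_continuous; have [] := Hr x Bx.
have clS : closed S by apply: compact_closed cS; exact: manifold_hausdorff.
pose b (q : M) := if pselect (cdom c q) then bump_at x0 r (cfun c q) else 0.
have b0 q : ~ S q -> b q = 0.
  rewrite /b; case: pselect => // cq Sq; apply/eqP/negP => /negP /(bump_supp r0) Bq.
  by apply: Sq; exists (cfun c q) => //; exact: cfunK.
exists b; split.
- move=> d ad.
  apply: (@smooth_on_cover _ (cimg d `&` cinv d @^-1` cdom c) (cimg d `&` cinv d @^-1` (~` S))).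
  + move=> x dx; have [Sx|NSx] := pselect (S (cinv d x)); [left|right] => //.
    by split=> //; case: Sx => y By /= <-; apply: cinv_cdom; have [] := Hr y By.
  + have H := @smooth_transfer c d setT b ac ad openT.
    rewrite setTI in H; apply: H.
    apply: (@eq_smooth_on _ _ _ _ (bump_at x0 r)).
    * exact: (@open_chart_preimage c _ openT).
    * move=> x [cx _]; rewrite /b /=; case: (pselect _) => [cy|]; first by rewrite cinvK.
      by have := cinv_cdom cx.
    * exact/bump_smooth/(@open_chart_preimage c _ openT).
  + apply: (@eq_smooth_on _ _ _ _ (fun=> 0)).
    * by apply: open_chart_preimage; exact: closed_openC.
    * by move=> x [dx Sx]; rewrite /= b0.
    * exact: smooth_on_cst.
- by move=> q; rewrite /b; case: (pselect _) => // cq; exact: bump_ge0.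
- by rewrite /b; case: (pselect _) => // cq; exact: bump_center.
exists S => //; split=> //; split=> [_ [x Bx <-]|_ [x Bx <-]]; have [? ?] := Hr x Bx => //.
exact: cinv_cdom.
Qed.

Lemma smooth_function_sum (I : Type) (r : seq I) (f : I -> M -> R) :
  (forall i, smooth_function (f i)) -> smooth_function (fun p => \sum_(i <- r) f i p).
Proof.
move=> sf c ac.
have H : smooth_on (cimg c) (fun x => \sum_(i <- r) (f i \o cinv c) x).
  by apply: smooth_on_sum; [exact: open_cimg|move=> i _; exact: sf].
exact: H.
Qed.

Hypothesis M_compact : compact [set: M].

(** The sets [W p] will be preimages of chart domains of [N], so that each piece of the integral is
    read in one chart of [M] and one chart of [N]. *)
Lemma subordinate_partition (W : M -> set M) : (forall p, open (W p) /\ W p p) ->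
  exists P : partition_of_unity M, forall a, exists p,
    @pu_chart R m M P a = chart_at p /\ exists2 S, closed S &
      (S `<=` W p /\ S `<=` cdom (chart_at p)) /\ forall q, ~ S q -> @pu_fun R m M P a q = 0.
Proof.
move=> HW.
have /choice[b Hb] : forall p, exists b : M -> R, [/\ smooth_function b, forall q, 0 <= b q, 0 < b p &
     (exists2 S, closed S & (S `<=` W p /\ S `<=` cdom (chart_at p)) /\ (forall q, ~ S q -> b q = 0))].
  by move=> p; have [oW Wp] := HW p; exact: manifold_bump.
have oV p : open [set q | 0 < b p q].
  have [sb _ _ _] := Hb p.
  have := @open_comp _ _ (b p) [set x | 0 < x]; apply; last exact: open_gt.
  by move=> q _; exact: smooth_function_continuous.
have bp p : 0 < b p p by have [] := Hb p.
have [s HD] := compact_finite_cover M_compact oV bp.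
pose n := size s.
(* An empty sequence means that [M] is empty, and the partition of size 0 will do. Otherwise there
   is a point to serve as default value of [nth]. *)
have [e0|/eqP sN0] := pselect (s = [::]).
  have noM : forall q : M, False.
    by move=> q; have [p + _] := HD q; rewrite e0.
  unshelve eexists; first (unshelve econstructor; [exact: 0%N|by case|by case|..]).
  all: try by case.
  by move=> q; case: (noM q).
have [p0 _] : exists p0 : M, True by case: (s) sN0 => // p0 *; exists p0.
pose f (i : 'I_n) := b (nth p0 s i).
pose tot q := \sum_(i < n) f i q.
have stot : smooth_function tot.
  by apply: smooth_function_sum => i; have [] := Hb (nth p0 s i).
have tot0 q : 0 < tot q.
  have [p ps /= bpq] := HD q.
  have ip : (index p s < n)%N by rewrite index_mem.
  rewrite /tot (bigD1 (Ordinal ip)) //= ltr_wpDr//.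
    by apply: sumr_ge0 => i _; have [_ + _ _] := Hb (nth p0 s i); exact.
  by rewrite /f /= nth_index.
have supp (i : 'I_n) : exists2 S, closed S & (S `<=` W (nth p0 s i) /\ S `<=` cdom (chart_at (nth p0 s i)))
    /\ forall q : M, ~ S q -> f i q / tot q = 0.
  have [_ _ _ [S cS [SW S0]]] := Hb (nth p0 s i); exists S => //; split=> // q Sq.
  by rewrite /f S0// mul0r.
unshelve eexists; first (unshelve econstructor).
- exact: n.
- exact: (fun i => chart_at (nth p0 s i)).
- exact: (fun i q => f i q / tot q).
- by move=> i; exact: chart_at_atlas.
- move=> i c ac.
  have s1 : smooth_on (cimg c) (f i \o cinv c).
    by have [sb _ _ _] := Hb (nth p0 s i); exact: sb.
  have s2 : smooth_on (cimg c) (fun x => ((tot \o cinv c) x)^-1).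
    have tn0 x : cimg c x -> (tot \o cinv c) x != 0 by move=> _; rewrite gt_eqF//; exact: tot0.
    exact: (smooth_onV (@open_cimg _ _ _ c) tn0 (stot c ac)).
  exact: (smooth_onM (@open_cimg _ _ _ c) s1 s2).
- move=> i q; rewrite divr_ge0//; last exact/ltW/tot0.
  by have [_ + _ _] := Hb (nth p0 s i); exact.
- move=> i; have [S cS [[_ Sc] S0]] := supp i.
  apply: (subset_trans _ Sc); rewrite [X in _ `<=` X](closure_id S).1//; apply: closure_subset => q /= fq.
  by apply: contrapT => /S0 h; move: fq; rewrite h eqxx.
- by move=> q; rewrite -mulr_suml divff// gt_eqF// tot0.
by move=> i; exists (nth p0 s i); split.
Qed.

End Charts.

(** * Positive definite matrices *)

Section PositiveDefinite.
Variable R : realType.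

Definition posdef n (G : 'M[R]_n) : Prop := forall v : 'rV[R]_n, v != 0 -> 0 < gdot G v v.

Lemma gdot_congr n (A : 'M[R]_n) p (K : 'M[R]_(p, n)) (v w : 'rV[R]_p) :
  (v *m (K *m A *m K^T) *m w^T) 0 0 = gdot A (v *m K) (w *m K).
Proof. by rewrite /gdot trmx_mul !mulmxA. Qed.

Lemma posdef_congr n p (G : 'M[R]_n) (K : 'M[R]_(p, n)) :
  row_free K -> posdef G -> posdef (K *m G *m K^T).
Proof.
move=> fK pG v v0; rewrite [gdot _ _ _]gdot_congr; apply: pG; apply: contra v0 => /eqP vK.
by rewrite -(mulmxKp fK v) vK mul0mx.
Qed.

Lemma posdef_unit n (G : 'M[R]_n) : posdef G -> G \in unitmx.
Proof.
move=> pG; rewrite -row_free_unit -kermx_eq0; apply/negPn/negP => k0.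
have v0 : nz_row (kermx G) != 0 by rewrite nz_row_eq0.
have := pG _ v0; rewrite /gdot.
have /sub_kermxP -> : (nz_row (kermx G) <= kermx G)%MS by exact: nz_row_sub.
by rewrite mul0mx mxE ltxx.
Qed.

Lemma ord_lrshift (a b : nat) (i : 'I_(a + b)) :
  (exists j, i = lshift b j) \/ (exists j, i = rshift a j).
Proof.
by case: (fintype.splitP i) => j ij; [left|right]; exists j; apply: val_inj.
Qed.

Lemma smx_block m (U : set 'rV[R]_m) (a b c d : nat) (A : 'rV[R]_m -> 'M[R]_(a, b))
  (B : 'rV[R]_m -> 'M[R]_(a, d)) (C : 'rV[R]_m -> 'M[R]_(c, b)) (D : 'rV[R]_m -> 'M[R]_(c, d)) :
  open U -> smx U A -> smx U B -> smx U C -> smx U D ->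
  smx U (fun x => block_mx (A x) (B x) (C x) (D x)).
Proof.
move=> oU sA sB sC sD i j.
have [[i' ->]|[i' ->]] := ord_lrshift i; have [[j' ->]|[j' ->]] := ord_lrshift j.
- by apply: (eq_smooth_on oU _ (sA i' j')) => x _; rewrite block_mxEul.
- by apply: (eq_smooth_on oU _ (sB i' j')) => x _; rewrite block_mxEur.
- by apply: (eq_smooth_on oU _ (sC i' j')) => x _; rewrite block_mxEdl.
- by apply: (eq_smooth_on oU _ (sD i' j')) => x _; rewrite block_mxEdr.
Qed.

(** Gram-Schmidt with smooth dependence on [x]. One step clears the first row and column, dividing
    by the corner entry, which is positive near [x0]; the Schur complement is still positive
    definite at [x0] and the induction continues. Vertical orthonormal frames come from this. *)
Lemma smooth_cholesky m n (U : set 'rV[R]_m) (S : 'rV[R]_m -> 'M[R]_n) x0 :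
  open U -> U x0 -> smx U S -> (forall x, (S x)^T = S x) -> posdef (S x0) ->
  exists (W : set 'rV[R]_m) (L : 'rV[R]_m -> 'M[R]_n), [/\ open W, W `<=` U, W x0, smx W L &
    forall x, W x -> L x *m S x *m (L x)^T = 1%:M].
Proof.
elim: n U S => [|n IHn] U S oU Ux sS symS pS.
  exists U, (fun=> 1%:M); split=> //; first exact: smx_cst.
  by move=> x _; apply/matrixP => -[].
pose s x := S x 0 0.
pose b x : 'rV[R]_n := @ursubmx _ 1 n 1 n (S x).
pose C x : 'M[R]_n := @drsubmx _ 1 n 1 n (S x).
pose S1 : 'rV[R]_m -> 'M[R]_(1 + n) := S.
have SE x : S1 x = block_mx (s x)%:M (b x) (b x)^T (C x).
  have E1 : @ulsubmx _ 1 n 1 n (S x) = (s x)%:M.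
    by apply/matrixP => i j; rewrite !ord1 !mxE eqxx mulr1n /s; congr (S x _ _); apply: val_inj.
  have E2 : @dlsubmx _ 1 n 1 n (S x) = (b x)^T.
    by apply/matrixP => i j; rewrite !mxE -[in LHS]symS mxE.
  by rewrite -E1 -E2 /S1 (@submxK _ 1 n 1 n).
pose L1 x : 'M[R]_(1 + n) := block_mx ((Num.sqrt (s x))^-1)%:M 0 (- (s x)^-1 *: (b x)^T) 1%:M.
pose S' x := C x - (s x)^-1 *: ((b x)^T *m b x).
have L1S x : 0 < s x -> L1 x *m S1 x *m (L1 x)^T = block_mx 1%:M 0 0 (S' x).
  move=> s0; rewrite SE /L1 tr_block_mx !mulmx_block.
  rewrite !tr_scalar_mx !trmx0 !linearZ /= !trmxK.
  rewrite !mul0mx !mulmx0 !mulmx1 !mul1mx !addr0 !mul_scalar_mx !mul_mx_scalar.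
  have sn0 : s x != 0 by rewrite gt_eqF.
  have q0 : Num.sqrt (s x) != 0 by rewrite gt_eqF// sqrtr_gt0.
  have z : s x *: (- (s x)^-1 *: (b x)^T) + (b x)^T = 0.
    by rewrite scalerA mulrN mulfV// scaleN1r addNr.
  rewrite z mul0mx !scaler0 add0r; congr block_mx.
  - rewrite !scale_scalar_mx; congr (_%:M).
    by rewrite mulrA -invfM -expr2 sqr_sqrtr ?(ltW s0)// mulVf.
  - rewrite -scalemxAl mul_scalar_mx !scalerA -scalerDl.
    by rewrite mulrAC mulNr mulVf// mulN1r addNr scale0r.
  - by rewrite -scalemxAl scaleNr addrC.
have s0 : 0 < s x0.
  have d0 : delta_mx 0 0 != 0 :> 'rV[R]_n.+1.
    by apply/eqP => /matrixP/(_ 0 0); rewrite !mxE eqxx => /eqP; rewrite oner_eq0.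
  have := pS _ d0; rewrite /gdot -rowE trmx_delta -colE !mxE.
  by [].
pose U1 := U `&` [set x | 0 < s x].
have oU1 : open U1.
  rewrite openE => x [Ux' sx]; rewrite /interior; apply: filterI; first exact: open_nbhs_nbhs.
  have cs : {for x, continuous s} by exact: smooth_on_continuous (sS 0 0) Ux'.
  have nb : nbhs (s x) [set y | 0 < y] by apply: open_nbhs_nbhs; split=> //; exact: open_gt.
  exact: (cs _ nb).
have ss : smooth_on U1 s by apply: smooth_onW (sS 0 0) => x [].
have sb : smx U1 b.
  move=> i j; apply: (@eq_smooth_on _ _ _ oU1 (fun x => S x (lshift n i) (rshift 1 j))).
    by move=> x _; rewrite !mxE.
  by apply: smooth_onW (sS _ _) => x [].
have sC : smx U1 C.
  move=> i j; apply: (@eq_smooth_on _ _ _ oU1 (fun x => S x (rshift 1 i) (rshift 1 j))).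
    by move=> x _; rewrite !mxE.
  by apply: smooth_onW (sS _ _) => x [].
have sV : smooth_on U1 (fun x => (s x)^-1).
  by apply: (smooth_onV oU1 _ ss) => x [_ sx]; rewrite gt_eqF.
have sS' : smx U1 S'.
  apply: (smxB oU1 sC); apply: (smxZ oU1 sV); exact: (smxM oU1 (smx_tr oU1 sb) sb).
have symS' x : (S' x)^T = S' x.
  rewrite /S' linearB linearZ /= trmx_mul trmxK; congr (_ - _).
  by apply/matrixP => i j; rewrite !mxE -[in LHS]symS mxE.
have u1 x : row_free (L1 x) \/ ~~ (0 < s x).
  have [sx|] := boolP (0 < s x); [left|by right].
  rewrite row_free_unit unitmxE /L1 det_lblock det1 mulr1 det_scalar expr1.
  by rewrite unitfE invr_neq0// gt_eqF// sqrtr_gt0.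
have pS' : posdef (S' x0).
  have fL : row_free (L1 x0) by case: (u1 x0) => //; rewrite s0.
  have := @posdef_congr _ _ (S1 x0) _ fL pS; rewrite L1S// => pB v v0.
  have : row_mx 0 v != 0 :> 'rV[R]_(1 + n).
    by apply: contra v0 => /eqP /(congr1 (@rsubmx _ 1 1 n)); rewrite row_mxKr linear0 => ->.
  move/pB; rewrite /gdot mul_row_block tr_row_mx mul_row_col.
  by rewrite !mul0mx !mulmx0 !add0r trmx0 mulmx0 add0r.
have [W [L2 [oW WU Wx sL2 HL2]]] := IHn U1 S' oU1 (conj Ux s0) sS' symS' pS'.
exists W, (fun x => block_mx 1%:M 0 0 (L2 x) *m L1 x); split=> //.
- by move=> x /WU [].
- have sub (a c : nat) (F : 'rV[R]_m -> 'M[R]_(a, c)) : smx U1 F -> smx W F.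
    by move=> sF i j; apply: smooth_onW WU (sF i j).
  have sA : smx W (fun x => block_mx (1%:M : 'M[R]_1) (0 : 'M[R]_(1, n)) (0 : 'M[R]_(n, 1)) (L2 x)).
    exact: (smx_block oW (@smx_cst _ _ _ _ _ _) (@smx_cst _ _ _ _ _ _) (@smx_cst _ _ _ _ _ _) sL2).
  have sr : smx U1 (fun x => ((Num.sqrt (s x))^-1)%:M : 'M[R]_1).
    move=> i j; rewrite !ord1; apply: (@eq_smooth_on _ _ _ oU1 (fun x => (Num.sqrt (s x))^-1)).
      by move=> x _; rewrite mxE eqxx mulr1n.
    have sq : smooth_on U1 (fun x => Num.sqrt (s x)) by apply: (smooth_on_sqrt oU1 _ ss) => x [].
    by apply: (smooth_onV oU1 _ sq) => x [_ sx]; rewrite gt_eqF// sqrtr_gt0.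
  have sN : smooth_on U1 (fun x => - (s x)^-1) by exact: (smooth_onN oU1 sV).
  have sL1 : smx U1 L1.
    exact: (smx_block oU1 sr (@smx_cst _ _ _ _ _ _) (smxZ oU1 sN (smx_tr oU1 sb)) (@smx_cst _ _ _ _ _ _)).
  exact: (smxM oW sA (sub _ _ _ sL1)).
- move=> x Wx'; have [_ sx] := WU x Wx'.
  pose B2 := block_mx (1%:M : 'M[R]_1) (0 : 'M[R]_(1, n)) (0 : 'M[R]_(n, 1)) (L2 x).
  have HH : (B2 *m L1 x) *m S1 x *m (B2 *m L1 x)^T = 1%:M.
    have -> : (B2 *m L1 x) *m S1 x *m (B2 *m L1 x)^T = B2 *m (L1 x *m S1 x *m (L1 x)^T) *m B2^T.
      by rewrite trmx_mul !mulmxA.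
    rewrite L1S// /B2 tr_block_mx !mulmx_block trmx1 !trmx0.
    rewrite !(mul0mx, mulmx0, mulmx1, mul1mx, addr0, add0r) HL2//.
    exact: (esym (scalar_mx_block _ _ _)).
  exact: HH.
Qed.

(** Orthonormalisation over a point ([m = 0]) gives [L *m G *m L^T = 1%:M], so [\det G] times a
    square is 1. *)
Lemma posdef_det_gt0 n (G : 'M[R]_n) : G^T = G -> posdef G -> 0 < \det G.
Proof.
move=> symG pG.
have [] // := @smooth_cholesky 0 n setT (fun=> G) 0 openT I (@smx_cst _ _ _ _ _ G).
move=> W [L [_ _ W0 _ /(_ _ W0) /(congr1 determinant)]].
rewrite det1 !det_mulmx det_tr => E.
have u : 0 < \det (L 0) ^+ 2.
  by rewrite lt_def sqr_ge0 andbT sqrf_eq0; apply/eqP => z; move/eqP: E; rewrite z !mul0r eq_sym oner_eq0.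
by rewrite -(pmulr_rgt0 _ u) expr2 mulrAC E ltr01.
Qed.

End PositiveDefinite.

(** * Independence of the integral from charts and partitions *)

Section ManifoldIntegral.
Variables (R : realType) (m : nat) (M : manifold R m).
Implicit Types (p : M) (c d : chart R M m).

Lemma tin_cinv c (g : tensor2 M) x : cimg c x ->
  tin c g x = jac c (chart_at (cinv c x)) (cinv c x) *m g (cinv c x)
              *m (jac c (chart_at (cinv c x)) (cinv c x))^T.
Proof. by move=> cx; rewrite -[in LHS](cinvK cx) tin_cfun//; exact: cinv_cdom. Qed.

Variable g : tensor2 M.
Hypothesis g_metric : riemannian_metric g.

Lemma tin_sym c x : cimg c x -> (tin c g x)^T = tin c g x.
Proof.
move=> cx; have [_ symg _] := g_metric.
by rewrite tin_cinv// !trmx_mul trmxK symg mulmxA.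
Qed.

Lemma tin_posdef c x : atlas c -> cimg c x -> posdef (tin c g x).
Proof.
move=> ac cx; rewrite tin_cinv//; apply: posdef_congr.
  rewrite row_free_unit; apply: jac_unit => //; [exact: chart_at_atlas|exact: cinv_cdom|exact: chart_at_cdom].
by have [_ _ pg] := g_metric; move=> v; exact: pg.
Qed.

Lemma tin_det_gt0 c x : atlas c -> cimg c x -> 0 < \det (tin c g x).
Proof. by move=> ac cx; apply: posdef_det_gt0; [exact: tin_sym|exact: tin_posdef]. Qed.

Lemma tin_unit c x : atlas c -> cimg c x -> tin c g x \in unitmx.
Proof. by move=> ac cx; apply: posdef_unit; exact: tin_posdef. Qed.

Lemma tin_smooth c : atlas c -> smx (cimg c) (tin c g).
Proof. by move=> ac i j; rewrite tin_def; have [sg _ _] := g_metric; exact: sg. Qed.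

Definition density c x := Num.sqrt (\det (tin c g x)).

Lemma density_smooth c : atlas c -> smooth_on (cimg c) (density c).
Proof.
move=> ac; apply: (smooth_on_sqrt (@open_cimg _ _ _ c)).
  by move=> x cx; exact: tin_det_gt0.
exact: (smooth_on_det (@open_cimg _ _ _ c) (tin_smooth ac)).
Qed.

Lemma density_gt0 c x : atlas c -> cimg c x -> 0 < density c x.
Proof. by move=> ac cx; rewrite sqrtr_gt0 tin_det_gt0. Qed.

Lemma density_jac c d p : atlas c -> atlas d -> cdom c p -> cdom d p ->
  density c (cfun c p) = density d (cfun d p) * `|\det (jac c d p)|.
Proof.
move=> ac ad cp dp; rewrite /density (tin_jac g ac ad cp dp) !det_mulmx det_tr.
rewrite mulrAC -expr2 mulrC sqrtrM; last exact/ltW/tin_det_gt0/cfun_cimg.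
by rewrite sqrtr_sqr.
Qed.

Definition chart_integral c (F : M -> R) : R :=
  integral_Rn ((fun x => F (cinv c x) * density c x) \_ (cimg c)).

Lemma integral_wrtE (P : partition_of_unity M) f :
  integral_wrt P g f = \sum_a chart_integral (@pu_chart _ _ _ P a) (fun p => @pu_fun _ _ _ P a p * f p).
Proof. by rewrite /integral_wrt /chart_integral /density tin_def. Qed.

Hypothesis M_compact : compact [set: M].

Lemma compact_chart_image c (S : set M) : closed S -> S `<=` cdom c -> compact (cfun c @` S).
Proof.
move=> cS Sc; apply: continuous_compact.
  by apply: continuous_in_subspaceT => x; rewrite inE => /Sc; exact: cfun_continuous.
exact: (subclosed_compact cS M_compact).
Qed.

Lemma chart_image_cimg c (S : set M) : S `<=` cdom c -> cfun c @` S `<=` cimg c.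
Proof. by move=> Sc _ [p /Sc cp <-]; exact: cfun_cimg. Qed.

Lemma chart_integrand_continuous c (S : set M) (F : M -> R) : atlas c -> closed S -> S `<=` cdom c ->
  (forall p, S p -> {for p, continuous F}) -> (forall p, ~ S p -> F p = 0) ->
  continuous ((fun x => F (cinv c x) * density c x) \_ (cimg c)) /\
  forall x, ~ (cfun c @` S) x -> ((fun x => F (cinv c x) * density c x) \_ (cimg c)) x = 0.
Proof.
move=> ac cS Sc cF F0.
have cF' p : {for p, continuous F}.
  have [/cF//|NS] := pselect (S p).
  apply: (@continuous_near_eq _ _ (fun=> 0)); last exact: cst_continuous.
  have : nbhs p (~` S) by apply: open_nbhs_nbhs; split=> //; exact: closed_openC.
  by apply: filterS => q /F0 ->.
apply: continuous_restrict_compact.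
- exact: open_cimg.
- by apply: compact_closed_rV; exact: compact_chart_image.
- exact: chart_image_cimg.
- move=> x cx; apply: (@continuous_at_mul _ _ (F \o cinv c) (density c) x).
    exact: (@continuous_comp _ _ _ (cinv c) F x (cinv_continuous cx) (cF' _)).
  exact: smooth_on_continuous (density_smooth ac) cx.
- move=> x cx NS; rewrite F0 ?mul0r// => Sx; apply: NS; exists (cinv c x) => //; exact: cinvK.
Qed.

(** The radius depends on [S] only and thus serves a whole family of functions, as additivity of the
    integral demands. *)
Lemma chart_integral_ccont c (S : set M) : closed S -> S `<=` cdom c -> atlas c ->
  exists2 r, 0 < r & forall F : M -> R, 
    (forall p, S p -> {for p, continuous F}) -> (forall p, ~ S p -> F p = 0) ->
    ccont r ((fun x => F (cinv c x) * density c x) \_ (cimg c)).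
Proof.
move=> cS Sc ac; have cK := compact_chart_image cS Sc.
have [r [[r0 _ _] Kr]] := ccont_compact cK (@cst_continuous _ R 0) (fun _ _ => erefl).
exists r => // F cF F0.
have [cf f0] := chart_integrand_continuous ac cS Sc cF F0.
by split=> // x rx; apply: f0 => /Kr; rewrite leNgt rx.
Qed.

Lemma chart_integral_sum c (S : set M) (I : Type) (s : seq I) (F : I -> M -> R) :
  closed S -> S `<=` cdom c -> atlas c ->
  (forall i p, S p -> {for p, continuous (F i)}) -> (forall i p, ~ S p -> F i p = 0) ->
  chart_integral c (fun p => \sum_(i <- s) F i p) = \sum_(i <- s) chart_integral c (F i).
Proof.
move=> cS Sc ac cF F0; have [r r0 H] := chart_integral_ccont cS Sc ac.
rewrite -(@integral_Rn_sum _ _ _ s xpredT r (fun i => (fun x => F i (cinv c x) * density c x) \_ (cimg c)) r0);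
  last by move=> i _; apply: H; [exact: cF|exact: F0].
congr integral_Rn; apply/funext => x; rewrite /patch; case: ifP => _; last by rewrite big1.
by rewrite mulr_suml.
Qed.

Lemma chart_integral_change c d (S : set M) (F : M -> R) : atlas c -> atlas d ->
  closed S -> S `<=` cdom c -> S `<=` cdom d ->
  (forall p, S p -> {for p, continuous F}) -> (forall p, ~ S p -> F p = 0) ->
  chart_integral c F = chart_integral d F.
Proof.
move=> ac ad cS Sc Sd cF F0.
have [cf f0] := chart_integrand_continuous ad cS Sd cF F0.
pose U := cimg c `&` cinv c @^-1` cdom d; pose V := cimg d `&` cinv d @^-1` cdom c.
have E := @change_of_variables R m U V (cfun d @` S) (cfun d \o cinv c) (cfun c \o cinv d) _
  (@open_overlap _ _ _ c d) (@open_overlap _ _ _ d c).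
rewrite /chart_integral -[RHS]E //.
- congr integral_Rn; apply/funext => x; rewrite /patch.
  have [cx|] := boolP (x \in cimg c); last first.
    move=> cx; case: ifP => // /set_mem [cx' _]; move/negP: cx; case; exact: mem_set.
  move/set_mem: cx => cx; case: ifPn => [/set_mem [_ dx]|dx]; last first.
    rewrite F0 ?mul0r// => Sx; move/negP: dx; apply; apply: mem_set; split=> //; exact: Sd.
  have cp := cinv_cdom cx.
  rewrite mem_set /=; last exact: cfun_cimg.
  rewrite cfunK// -mulrA; congr (_ * _).
  have Jx : 'J (cfun d \o cinv c) x = jac c d (cinv c x) by rewrite jac_def cinvK.
  by rewrite Jx -density_jac// cinvK.
- move=> y [dy cy]; have cy' : cdom c (cinv d y) by exact: cy.
  by split; [exact: cfun_cimg|rewrite /= (cfunK cy'); exact: cinv_cdom].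
- by move=> x [cx dx]; rewrite /= cfunK// cinvK.
- by move=> x [cx dx]; rewrite /= cfunK// cinvK.
- exact: transition_C1.
- move=> y [dy cy].
  exact: (@continuous_comp _ _ _ (cinv d) (cfun c) y (cinv_continuous dy) (cfun_continuous cy)).
- move=> x [cx dx]; have -> : 'J (cfun d \o cinv c) x = jac c d (cinv c x) by rewrite jac_def cinvK.
  by apply: jac_unit => //; exact: cinv_cdom.
- exact: compact_chart_image.
- by move=> _ [p Sp <-]; split; [exact/cfun_cimg/Sd|rewrite /= cfunK; [exact: Sc|exact: Sd]].
Qed.

(** The partition [P] is inserted in each summand; on the intersection of the two supports the chart
    can be changed, and the sum over [i] is then taken inside the charts of [P]. Independence from
    the partition follows, and so does the cancellation of the derivatives of cutoffs in the first
    variation. *)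
Lemma sum_chart_integral (P : partition_of_unity M) n (c : 'I_n -> chart R M m) (S : 'I_n -> set M)
    (F : 'I_n -> M -> R) :
  (forall i, [/\ atlas (c i), closed (S i) & S i `<=` cdom (c i)]) ->
  (forall i p, S i p -> {for p, continuous (F i)}) -> (forall i p, ~ S i p -> F i p = 0) ->
  \sum_i chart_integral (c i) (F i) = integral_wrt P g (fun p => \sum_i F i p).
Proof.
move=> Hc cF F0; rewrite integral_wrtE.
have cF' i p : {for p, continuous (F i)}.
  have [/cF//|NS] := pselect (S i p); have [_ cS _] := Hc i.
  apply: (@continuous_near_eq _ _ (fun=> 0)); last exact: cst_continuous.
  have : nbhs p (~` S i) by apply: open_nbhs_nbhs; split=> //; exact: closed_openC.
  by apply: filterS => q /F0 ->.
pose chi := @pu_fun _ _ _ P; pose e := @pu_chart _ _ _ P.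
pose T a := closure [set p | chi a p != 0].
have cT a : closed (T a) by exact: closed_closure.
have Te a : T a `<=` cdom (e a) by exact: pu_support.
have chi0 a p : ~ T a p -> chi a p = 0.
  by move=> NT; apply/eqP/negPn/negP => h; apply: NT; exact: subset_closure.
have cchi a : continuous (chi a) by apply: smooth_function_continuous; exact: pu_smooth.
have cprod a i p : {for p, continuous (fun q => chi a q * F i q)}.
  by apply: (@continuous_at_mul _ _ (chi a) (F i) p); [exact: cchi|exact: cF'].
transitivity (\sum_i \sum_a chart_integral (c i) (fun q => chi a q * F i q)).
  apply: eq_bigr => i _; have [aci cSi Sci] := Hc i.
  rewrite -(@chart_integral_sum (c i) (S i))//; last by move=> a p /F0 ->; rewrite mulr0.
  by congr chart_integral; apply/funext => q; rewrite -mulr_suml pu_sum1 mul1r.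
rewrite exchange_big /=; apply: eq_bigr => a _.
have ae : atlas (e a) by exact: pu_atlas.
transitivity (\sum_i chart_integral (e a) (fun q => chi a q * F i q)).
  apply: eq_bigr => i _; have [aci cSi Sci] := Hc i.
  apply: (@chart_integral_change _ _ (S i `&` T a)) => //.
  - exact: closedI.
  - by move=> p [/Sci].
  - by move=> p [_ /Te].
  - move=> p NST; have [Sp|/F0 ->] := pselect (S i p); last by rewrite mulr0.
    by rewrite chi0 ?mul0r// => Tp; apply: NST.
rewrite -(@chart_integral_sum (e a) (T a))//; last by move=> i p /chi0 ->; rewrite mul0r.
by congr chart_integral; apply/funext => q; rewrite mulr_sumr.
Qed.

Lemma integral_wrt_indep (P P' : partition_of_unity M) (f : M -> R) : continuous f ->
  integral_wrt P g f = integral_wrt P' g f.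
Proof.
move=> cf; rewrite integral_wrtE.
pose chi := @pu_fun _ _ _ P; pose e := @pu_chart _ _ _ P.
have cchi a : continuous (chi a) by apply: smooth_function_continuous; exact: pu_smooth.
rewrite (@sum_chart_integral P' _ e (fun a => closure [set p | chi a p != 0])).
- congr (integral_wrt _ _ _); apply/funext => p; rewrite -mulr_suml.
  by rewrite (pu_sum1 P) mul1r.
- by move=> a; split; [exact: pu_atlas|exact: closed_closure|exact: pu_support].
- by move=> a p _; apply: (@continuous_at_mul _ _ (chi a) f p); [exact: cchi|exact: cf].
- move=> a p NT; suff -> : pu_fun a p = 0 by rewrite mul0r.
  by apply/eqP/negPn/negP => h; apply: NT; exact: subset_closure.
Qed.

Lemma vol_integralE (P : partition_of_unity M) (f : M -> R) : continuous f ->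
  vol_integral g f = integral_wrt P g f.
Proof.
by move=> cf; rewrite /vol_integral; case: pselect => [h|[]]; [exact: integral_wrt_indep|exists P].
Qed.

End ManifoldIntegral.

(** * Local geometry of a submersion *)

Section SubmersionAlgebra.
Variables (R : realType) (m k : nat).
Implicit Types (G : 'M[R]_m) (D : 'M[R]_(m, k)) (Q : 'M[R]_k).

(* The rows are the gradients of the components of the submersion. *)
Definition gradmx G D : 'M[R]_(k, m) := D^T *m invmx G.

(** The inverse metric of the fibers: the cometric minus its part along the gradients. *)
Definition vcometric G D Q : 'M[R]_m := invmx G - (gradmx G D)^T *m Q *m gradmx G D.

Lemma invmx_sym n (A : 'M[R]_n) : A^T = A -> (invmx A)^T = invmx A.
Proof. by move=> symA; rewrite trmx_inv symA. Qed.

Lemma gradmxG G D : G \in unitmx -> gradmx G D *m G = D^T.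
Proof. by move=> uG; rewrite /gradmx mulmxKV. Qed.

Lemma gradmx_tr G D : G^T = G -> (gradmx G D)^T = invmx G *m D.
Proof. by move=> sG; rewrite /gradmx trmx_mul trmxK invmx_sym. Qed.

Lemma Ggradmx_tr G D : G^T = G -> G \in unitmx -> G *m (gradmx G D)^T = D.
Proof. by move=> sG uG; rewrite gradmx_tr// mulKVmx. Qed.

Lemma vcometric_tr G D Q : G^T = G -> Q^T = Q -> (vcometric G D Q)^T = vcometric G D Q.
Proof.
move=> sG sQ; rewrite /vcometric; move: (gradmx G D) => X.
by rewrite linearB /= !trmx_mul trmxK sQ invmx_sym// mulmxA.
Qed.

Section Submersion.
Variables (G : 'M[R]_m) (D : 'M[R]_(m, k)) (Q : 'M[R]_k).
Hypotheses (sG : G^T = G) (uG : G \in unitmx) (sQ : Q^T = Q) (uQ : Q \in unitmx).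
Hypothesis PQ : gradmx G D *m D = invmx Q.

Lemma vcometricD : vcometric G D Q *m D = 0.
Proof.
by rewrite /vcometric mulmxBl -(mulmxA _ (gradmx G D)) PQ mulmxK// gradmx_tr// subrr.
Qed.

Lemma vcometric_vertical n (v : 'M[R]_(n, m)) : v *m D = 0 -> v *m G *m vcometric G D Q = v.
Proof.
move=> vD; rewrite /vcometric mulmxBr mulmxK// !mulmxA -(mulmxA v) Ggradmx_tr//.
by rewrite vD !mul0mx subr0.
Qed.

(** The rows of [E] and the gradients form a basis, whose dual basis is read off from
    [E *m G *m E^T = 1%:M] and [PQ]. The product in the other order expands the identity in this
    basis and isolates [E^T *m E]. Hence sums over an orthonormal vertical frame do not depend on
    the frame. *)
Lemma frame_vcometric n (E : 'M[R]_(n, m)) : (n + k)%N = m ->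
  E *m G *m E^T = 1%:M -> E *m D = 0 -> E^T *m E = vcometric G D Q.
Proof.
move=> nk EE ED.
have H : col_mx E (gradmx G D) *m (G *m row_mx E^T ((gradmx G D)^T *m Q)) = 1%:M.
  rewrite mul_mx_row mul_col_row !mulmxA EE -(mulmxA E) Ggradmx_tr// ED mul0mx.
  have DE : D^T *m E^T = 0 by rewrite -trmx_mul ED trmx0.
  rewrite gradmxG// DE.
  have -> : D^T *m (gradmx G D)^T = invmx Q.
    by rewrite -trmx_mul PQ invmx_sym.
  by rewrite mulVmx// -scalar_mx_block.
(* A one-sided inverse of a square matrix is two-sided; the equation [nk] is needed to see the
   stacked matrices as square. *)
have H2 : G *m row_mx E^T ((gradmx G D)^T *m Q) *m col_mx E (gradmx G D) = 1%:M.
  move: (col_mx _ _) (G *m row_mx _ _) H => A B; move: A B; rewrite nk => A B AB.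
  exact: mulmx1C.
rewrite -mulmxA mul_row_col in H2.
have := congr1 (mulmx (invmx G)) H2; rewrite mulKmx// mulmx1 /vcometric => <-.
by rewrite addrK.
Qed.

End Submersion.

Section Hessian.
Variables (G : 'M[R]_m) (D : 'M[R]_(m, k)).
Variables (dG : 'I_m -> 'M[R]_m) (dD : 'I_m -> 'M[R]_(m, k)).
Hypotheses (sG : G^T = G) (sdG : forall i, (dG i)^T = dG i)
  (sdD : forall i j a, dD i j a = dD j i a).
Let X := gradmx G D.
Let W := invmx G.

(** The covariant Hessian of the component [a]. The families [dG] and [dD] stand for the partial
    derivatives of the metric and of the differential, so that the identities below are pure tensor
    algebra. *)
Definition hessmx (a : 'I_k) : 'M[R]_m := \matrix_(i, j)
  (dD i j a - \sum_l (2^-1 * \sum_s W l s * (dG i j s + dG j i s - dG s i j)) * D l a).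

Let XE a s : X a s = \sum_l D l a * W l s.
Proof. by rewrite !mxE; apply: eq_bigr => l _; rewrite mxE. Qed.

Let Wsym i j : W i j = W j i.
Proof. by rewrite /W -[in LHS](invmx_sym sG) mxE. Qed.

Let dGsym s i j : dG s i j = dG s j i.
Proof. by rewrite -[in LHS](sdG s) mxE. Qed.

Lemma hessmxE a i j : hessmx a i j =
  dD i j a - 2^-1 * \sum_s X a s * (dG i j s + dG j i s - dG s i j).
Proof.
rewrite mxE; congr (_ - _).
under eq_bigr do rewrite -mulrA mulr_suml.
rewrite -mulr_sumr exchange_big /=; congr (_ * _); apply: eq_bigr => s _.
by rewrite XE mulr_suml; apply: eq_bigr => l _; rewrite mulrAC (mulrC (D l a)).
Qed.

Let T a b c := \sum_i \sum_j \sum_s X a i * X b j * X c s * dG i j s.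
Let S a b c := \sum_i \sum_j X a i * X b j * dD i j c.

Let SC a b c : S a b c = S b a c.
Proof.
by rewrite /S exchange_big /=; apply: eq_bigr => i _; apply: eq_bigr => j _; rewrite sdD (mulrC (X a j)).
Qed.

Let dP i := (dD i)^T *m X^T + X *m dD i - X *m dG i *m X^T.

Let sum_dP a b c : \sum_i X a i * dP i b c = S a c b + S a b c - T a b c.
Proof.
rewrite /S /T -big_split -sumrB /=; apply: eq_bigr => i _.
rewrite !mxE mulrBr mulrDr; congr (_ + _ - _).
- by rewrite mulr_sumr; apply: eq_bigr => j _; rewrite !mxE [dD _ _ _ * _]mulrC mulrA.
- by rewrite mulr_sumr; apply: eq_bigr => j _; rewrite mulrA.
- rewrite mulr_sumr exchange_big /=; apply: eq_bigr => j _; rewrite !mxE mulr_suml mulr_sumr.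
  by apply: eq_bigr => s _; rewrite -!mulrA (mulrC (dG i s j)).
Qed.

(** Koszul's formula evaluated on gradients: [dP i] is the [i]-th derivative of their Gram matrix
    [D^T *m invmx G *m D], and second derivatives of the components cancel in pairs by symmetry. *)
Lemma hess_gradmx a b c : (X *m hessmx a *m X^T) b c =
  2^-1 * (\sum_i X b i * dP i c a + \sum_i X c i * dP i b a - \sum_i X a i * dP i b c).
Proof.
rewrite !sum_dP.
have -> : (X *m hessmx a *m X^T) b c = S b c a - 2^-1 * (T b c a + T c b a - T a b c).
  rewrite mxE.
  transitivity (\sum_j \sum_i X b i * X c j * hessmx a i j).
    apply: eq_bigr => j _; rewrite !mxE mulr_suml; apply: eq_bigr => i _.
    by rewrite -/X mulrAC.
  rewrite exchange_big /=.
  transitivity (S b c a - 2^-1 * (\sum_i \sum_j \sum_s X b i * X c j * X a s * (dG i j s + dG j i s - dG s i j))).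
    rewrite /S mulr_sumr -sumrB; apply: eq_bigr => i _; rewrite mulr_sumr -sumrB; apply: eq_bigr => j _.
    rewrite hessmxE mulrBr; congr (_ - _); rewrite mulrCA; congr (_ * _); rewrite mulr_sumr.
    by apply: eq_bigr => s _; rewrite mulrA.
  congr (_ - _ * _).
  transitivity (T b c a + \sum_i \sum_j \sum_s X b i * X c j * X a s * dG j i s
     - \sum_i \sum_j \sum_s X b i * X c j * X a s * dG s i j).
    rewrite /T -big_split -sumrB; apply: eq_bigr => i _; rewrite -big_split -sumrB; apply: eq_bigr => j _.
    by rewrite -big_split -sumrB; apply: eq_bigr => s _; rewrite mulrBr mulrDr.
  congr (_ + _ - _).
    rewrite exchange_big; apply: eq_bigr => i _; apply: eq_bigr => j _; apply: eq_bigr => s _.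
    by rewrite (mulrC (X b j)).
  under eq_bigr do rewrite exchange_big /=.
  rewrite exchange_big /=; apply: eq_bigr => i _; apply: eq_bigr => j _; apply: eq_bigr => s _.
  by rewrite (mulrC (X b j * X c s)) mulrA.
rewrite (SC b a c) (SC c b a) (SC c a b).
move: (S a b c) (S b c a) (S a c b) (T b c a) (T c b a) (T a b c) => s1 s2 s3 t1 t2 t3.
by field.
Qed.

(** The trace of the Hessian is the divergence of the gradient: the first sum is the coordinate
    divergence of row [a] of [D^T *m invmx G], the second the logarithmic derivative of the volume
    density along that row. *)
Lemma trace_hess a : \sum_i \sum_j W i j * hessmx a i j =
  \sum_s ((dD s)^T *m W - X *m dG s *m W) a s + 2^-1 * \sum_s X a s * \tr (W *m dG s).
Proof.
pose T0 := \sum_i \sum_j \sum_s W i j * X a s * dG i j s.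
pose T1 := \sum_i \sum_j \sum_s W i j * X a s * dG s i j.
pose S0 := \sum_i \sum_j W i j * dD i j a.
have -> : \sum_i \sum_j W i j * hessmx a i j = S0 - 2^-1 * (T0 + T0 - T1).
  transitivity (S0 - 2^-1 * (\sum_i \sum_j \sum_s W i j * X a s * (dG i j s + dG j i s - dG s i j))).
    rewrite /S0 mulr_sumr -sumrB; apply: eq_bigr => i _; rewrite mulr_sumr -sumrB; apply: eq_bigr => j _.
    rewrite hessmxE mulrBr; congr (_ - _); rewrite mulrCA; congr (_ * _); rewrite mulr_sumr.
    by apply: eq_bigr => s _; rewrite mulrA.
  congr (_ - _ * _).
  transitivity (T0 + \sum_i \sum_j \sum_s W i j * X a s * dG j i s - T1).
    rewrite /T0 /T1 -big_split -sumrB; apply: eq_bigr => i _; rewrite -big_split -sumrB; apply: eq_bigr => j _.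
    by rewrite -big_split -sumrB; apply: eq_bigr => s _; rewrite mulrBr mulrDr.
  congr (_ + _ - _).
  rewrite exchange_big; apply: eq_bigr => i _; apply: eq_bigr => j _; apply: eq_bigr => s _.
  by rewrite Wsym.
have -> : \sum_s ((dD s)^T *m W - X *m dG s *m W) a s = S0 - T0.
  rewrite /S0 /T0 -sumrB; apply: eq_bigr => i _; rewrite !mxE; congr (_ - _).
    by apply: eq_bigr => j _; rewrite !mxE mulrC Wsym.
  apply: eq_bigr => j _; rewrite !mxE mulr_suml; apply: eq_bigr => s _.
  by rewrite dGsym mulrC mulrA (Wsym j i).
have -> : \sum_s X a s * \tr (W *m dG s) = T1.
  rewrite /T1; under [RHS]eq_bigr do rewrite exchange_big /=.
  rewrite exchange_big /=; apply: eq_bigr => s _; rewrite /mxtrace mulr_sumr; apply: eq_bigr => i _.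
  rewrite [(W *m dG s) i i]mxE mulr_sumr; apply: eq_bigr => j _.
  by rewrite dGsym mulrA (mulrC (X a s)).
by move: S0 T0 T1 => *; field.
Qed.

End Hessian.
End SubmersionAlgebra.

Section SmoothMatrixDerivatives.
Variables (R : realType) (m : nat) (U : set 'rV[R]_m).
Hypothesis oU : open U.

Lemma smooth_on_derive (f : 'rV[R]_m -> R) x v : smooth_on U f -> U x -> is_derive x v f ('D_v f x).
Proof.
move=> sf Ux; have H := C1_derive v oU Ux (sf 1%N).
by case: (H) => _ ->.
Qed.

Lemma smooth_on_deriveE (f : 'rV[R]_m -> R) x v : smooth_on U f -> U x ->
  'D_v f x = \sum_i v 0 i * 'D_('e_i) f x.
Proof. by move=> sf Ux; have [_ ->] := C1_derive v oU Ux (sf 1%N). Qed.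

Lemma D_mxE a b (F : 'rV[R]_m -> 'M[R]_(a, b)) x v i j : smx U F -> U x ->
  ('D_v F x) i j = 'D_v (fun y => F y i j) x.
Proof.
by move=> sF Ux; have /is_derive_mxP/(_ i j)[_ ->] := smx_derive oU v Ux sF.
Qed.

Lemma D_mul a b c (F : 'rV[R]_m -> 'M[R]_(a, b)) (G : 'rV[R]_m -> 'M[R]_(b, c)) x v :
  smx U F -> smx U G -> U x ->
  'D_v (fun y => F y *m G y) x = 'D_v F x *m G x + F x *m 'D_v G x.
Proof.
move=> sF sG Ux.
by have [_ ->] := is_derive_mulmx (smx_derive oU v Ux sF) (smx_derive oU v Ux sG).
Qed.

Lemma D_tr a b (F : 'rV[R]_m -> 'M[R]_(a, b)) x v : smx U F -> U x ->
  'D_v (fun y => (F y)^T) x = ('D_v F x)^T.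
Proof. by move=> sF Ux; have [_ ->] := is_derive_tr (smx_derive oU v Ux sF). Qed.

Lemma open_nbhs_near x : U x -> \forall y \near x, U y.
Proof. by move=> Ux; exact: open_nbhs_nbhs. Qed.

Lemma D_inv a (F : 'rV[R]_m -> 'M[R]_a) x v : smx U F ->
  (forall y, U y -> F y \in unitmx) -> U x ->
  'D_v (fun y => invmx (F y)) x = - (invmx (F x) *m 'D_v F x *m invmx (F x)).
Proof.
move=> sF uF Ux.
have nu : \forall y \near x, F y \in unitmx by apply: filterS (open_nbhs_near Ux).
have dI := smx_derivable (v := v) oU Ux (smx_inv oU uF sF).
by have [_ ->] := is_derive_invmx nu dI (smx_derive oU v Ux sF).
Qed.

Lemma D_det a (F : 'rV[R]_m -> 'M[R]_a) x v : smx U F -> F x \in unitmx -> U x ->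
  'D_v (fun y => \det (F y)) x = \det (F x) * \tr (invmx (F x) *m 'D_v F x).
Proof.
move=> sF uF Ux; have [_ ->] := is_derive_det (smx_derive oU v Ux sF).
by rewrite /invmx uF -mxtraceZ scalemxAl scalerA divrr ?scale1r// -unitmxE.
Qed.

Lemma D_near_eq (W : normedModType R) (f g : 'rV[R]_m -> W) x v :
  (forall y, U y -> f y = g y) -> U x -> 'D_v f x = 'D_v g x.
Proof. by move=> fg Ux; apply: near_eq_derive; apply: filterS (open_nbhs_near Ux) => y /fg. Qed.

End SmoothMatrixDerivatives.

(** * Divergence of a vector field with respect to a metric *)

Section Divergence.
Variables (R : realType) (m : nat).
Implicit Types (G : 'rV[R]_m -> 'M[R]_m) (Y : 'rV[R]_m -> 'rV[R]_m).

Definition pdmx (n : nat) (Y : 'rV[R]_m -> 'rV[R]_n) x : 'M[R]_(m, n) :=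
  \matrix_(i, j) 'D_('e_i) (fun y => Y y 0 j) x.

(* The term with the trace is half the logarithmic derivative of det G. *)
Definition ldiv G Y x : R := \tr (pdmx Y x) +
  2^-1 * \sum_s Y x 0 s * \tr (invmx (G x) *m 'D_('e_s) G x).

Lemma ldiv_density (U : set 'rV[R]_m) G Y x : open U -> U x -> smx U G -> smx U Y ->
  (forall y, U y -> 0 < \det (G y)) ->
  \sum_s 'D_('e_s) (fun y => Num.sqrt (\det (G y)) * Y y 0 s) x = Num.sqrt (\det (G x)) * ldiv G Y x.
Proof.
move=> oU Ux sG sY dG.
have uG : G x \in unitmx by rewrite unitmxE unitfE gt_eqF// dG.
have w0 : 0 < Num.sqrt (\det (G x)) by rewrite sqrtr_gt0 dG.
rewrite /ldiv mulrDr [\tr (pdmx _ _)]/mxtrace !mulr_sumr -big_split /=; apply: eq_bigr => s _.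
have sdet := smooth_on_det oU sG.
have Hd := smooth_on_derive oU 'e_s sdet Ux; rewrite (D_det oU) // in Hd.
have Hs := @is_derive_sqrt _ _ (fun y => \det (G y)) _ _ _ (dG _ Ux) Hd.
have HY := smooth_on_derive oU 'e_s (sY 0 s) Ux.
have [_ ->] := is_deriveMr Hs HY.
rewrite mxE addrC; congr (_ + _).
have E : \det (G x) = Num.sqrt (\det (G x)) ^+ 2 by rewrite sqr_sqrtr// ltW// dG.
move: E w0; set w := Num.sqrt _ => -> w0.
move: (\tr _) => t; move: (Y x 0 s) => y; clearbody w.
by field; rewrite gt_eqF.
Qed.

Lemma ldiv_linear (U : set 'rV[R]_m) G Y Y' x : open U -> U x -> smx U Y -> smx U Y' ->
  ldiv G (fun y => Y y - Y' y) x = ldiv G Y x - ldiv G Y' x.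
Proof.
move=> oU Ux sY sY'.
have E : pdmx (fun y => Y y - Y' y) x = pdmx Y x - pdmx Y' x.
  apply/matrixP => i j; rewrite !mxE.
  have H := is_deriveB (smooth_on_derive oU 'e_i (sY 0 j) Ux) (smooth_on_derive oU 'e_i (sY' 0 j) Ux).
  have E1 : (fun y => (Y y - Y' y) 0 j) = (fun y => Y y 0 j) - (fun y => Y' y 0 j).
    by apply/funext => y; rewrite !mxE.
  by rewrite E1; case: H.
rewrite /ldiv E linearB /= opprD addrACA -mulrBr; congr (_ + _ * _).
by rewrite -sumrB; apply: eq_bigr => s _; rewrite !mxE mulrBl.
Qed.

End Divergence.

Section DivergenceChange.
Variables (R : realType) (m : nat) (U V : set 'rV[R]_m) (phi : 'rV[R]_m -> 'rV[R]_m).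
Variables (G G' : 'rV[R]_m -> 'M[R]_m) (Y Y' : 'rV[R]_m -> 'rV[R]_m).
Hypotheses (oU : open U) (oV : open V) (phiUV : forall x, U x -> V (phi x)).
Hypotheses (sphi : smx U phi) (sG' : smx V G') (sY : smx U Y) (sY' : smx V Y').
Let J := pdmx phi.
Hypothesis uJ : forall x, U x -> J x \in unitmx.
Hypothesis uG' : forall y, V y -> G' y \in unitmx.
Hypothesis GE : forall x, U x -> G x = J x *m G' (phi x) *m (J x)^T.
Hypothesis YE : forall x, U x -> Y x *m J x = Y' (phi x).

Lemma smx_pdmx n (O : set 'rV[R]_m) (F : 'rV[R]_m -> 'rV[R]_n) : open O -> smx O F -> smx O (pdmx F).
Proof.
move=> oO sF i j; apply: (eq_smooth_on oO _ (smooth_pderive i (sF 0 j))) => x _.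
by rewrite mxE.
Qed.

Lemma smx_comp n a b (O : set 'rV[R]_m) (O' : set 'rV[R]_n) (psi : 'rV[R]_m -> 'rV[R]_n)
    (F : 'rV[R]_n -> 'M[R]_(a, b)) : open O -> open O' -> (forall x, O x -> O' (psi x)) ->
  smx O psi -> smx O' F -> smx O (F \o psi).
Proof.
move=> oO oO' OO' sp sF i j l; apply: (@Ck_comp _ _ _ _ O O' psi (fun y => F y i j)) => //.
- by move=> q; exact: sp.
- exact: sF.
Qed.

Lemma D_comp n a b (O : set 'rV[R]_m) (O' : set 'rV[R]_n) (psi : 'rV[R]_m -> 'rV[R]_n)
    (F : 'rV[R]_n -> 'M[R]_(a, b)) x i : open O -> open O' -> (forall x, O x -> O' (psi x)) ->
  smx O psi -> smx O' F -> O x ->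
  'D_('e_i) (F \o psi) x = \sum_l pdmx psi x i l *: 'D_('e_l) F (psi x).
Proof.
move=> oO oO' OO' sp sF Ox; apply/matrixP => p q.
rewrite (D_mxE oO)//; last exact: smx_comp sF.
have H := @C1_chain _ _ _ O O' psi (fun y => F y p q) x 'e_i oO oO' Ox (OO' _ Ox)
  (fun j => sp 0 j 1%N) (sF p q 1%N).
have [_ E] := H.
rewrite [LHS]E summxE; apply: eq_bigr => l _.
by rewrite !mxE (D_mxE oO')//; exact: OO'.
Qed.

Lemma pdmx_sym n (O : set 'rV[R]_m) (F : 'rV[R]_m -> 'rV[R]_n) x i j a : open O -> smx O F -> O x ->
  'D_('e_i) (pdmx F) x j a = 'D_('e_j) (pdmx F) x i a.
Proof.
move=> oO sF Ox.
have sP := smx_pdmx oO sF.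
have E (p q : 'I_m) : 'D_('e_p) (pdmx F) x q a = 'D_('e_p) ('D_('e_q) (fun y => F y 0 a)) x.
  have F' : (fun y => pdmx F y q a) = 'D_('e_q) (fun y => F y 0 a).
    by apply/funext => y; rewrite mxE.
  exact: (etrans (@D_mxE _ _ O oO _ _ (pdmx F) x 'e_p q a sP Ox) (congr1 (fun h => 'D_('e_p) h x) F')).
apply: (etrans (E i j)); apply: (etrans _ (esym (E j i))).
by apply: (pderiveC _ _ oO Ox); exact: sF.
Qed.

(** Second derivatives of [phi] enter twice: through the derivative of [Y *m J], and through the
    logarithmic derivative of [\det J] contained in that of [\det G]. The two contributions agree by
    symmetry of mixed derivatives ([pdmx_sym]). *)
Lemma ldiv_change x : U x -> ldiv G Y x = ldiv G' Y' (phi x).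
Proof.
move=> Ux; have Vx := phiUV Ux; have ux := uJ Ux; have uGx := uG' Vx.
have sJ : smx U J by exact: smx_pdmx.
have sG'p : smx U (G' \o phi) := smx_comp oU oV phiUV sphi sG'.
(* The logarithmic derivative of [\det G] is twice that of [\det J] plus that of [\det G'] pulled
   back by [phi]. *)
have trG s : \tr (invmx (G x) *m 'D_('e_s) G x) =
    2 * \tr (invmx (J x) *m 'D_('e_s) J x) +
    \sum_a J x s a * \tr (invmx (G' (phi x)) *m 'D_('e_a) G' (phi x)).
  have -> : 'D_('e_s) G x = 'D_('e_s) J x *m G' (phi x) *m (J x)^T
     + J x *m 'D_('e_s) (G' \o phi) x *m (J x)^T + J x *m G' (phi x) *m ('D_('e_s) J x)^T.
    rewrite (D_near_eq oU 'e_s GE Ux).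
    rewrite (D_mul oU 'e_s (smxM oU sJ sG'p) (smx_tr oU sJ) Ux) (D_tr oU)//.
    by rewrite (D_mul oU 'e_s sJ sG'p Ux) mulmxDl.
  have iG : invmx (G x) = invmx (J x)^T *m invmx (G' (phi x)) *m invmx (J x).
    have uJt : (J x)^T \in unitmx by rewrite unitmx_tr.
    have uG : G x \in unitmx by rewrite GE// !unitmx_mul ux uGx uJt.
    apply: (can_inj (mulmxK uG)); rewrite mulVmx// GE// -!mulmxA mulKmx// mulKmx// mulVmx//.
  rewrite iG !mulmxDr !linearD /= .
  have -> : \tr (invmx (J x)^T *m invmx (G' (phi x)) *m invmx (J x) *m
      ('D_('e_s) J x *m G' (phi x) *m (J x)^T)) = \tr (invmx (J x) *m 'D_('e_s) J x).
    rewrite mxtrace_mulC -!mulmxA (mulmxA (J x)^T) mulmxV ?unitmx_tr// mul1mx.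
    by rewrite (mulmxA (G' _)) mulmxV// mul1mx mxtrace_mulC.
  have -> : \tr (invmx (J x)^T *m invmx (G' (phi x)) *m invmx (J x) *m
      (J x *m G' (phi x) *m ('D_('e_s) J x)^T)) = \tr (invmx (J x) *m 'D_('e_s) J x).
    rewrite -!mulmxA mulKmx// mulKmx// -trmx_inv -mxtrace_tr trmx_mul !trmxK.
    by rewrite mxtrace_mulC.
  have -> : \tr (invmx (J x)^T *m invmx (G' (phi x)) *m invmx (J x) *m
      (J x *m 'D_('e_s) (G' \o phi) x *m (J x)^T)) =
      \tr (invmx (G' (phi x)) *m 'D_('e_s) (G' \o phi) x).
    rewrite mxtrace_mulC -!mulmxA (mulmxA (J x)^T) mulmxV ?unitmx_tr// mul1mx.
    by rewrite mxtrace_mulC -!mulmxA mulVmx// mulmx1 mxtrace_mulC.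
  have E2 : \tr (invmx (G' (phi x)) *m 'D_('e_s) (G' \o phi) x) =
     \sum_a J x s a * \tr (invmx (G' (phi x)) *m 'D_('e_a) G' (phi x)).
    rewrite (D_comp s oU oV phiUV sphi sG' Ux) mulmx_sumr linear_sum /=.
    by apply: eq_bigr => a _; rewrite -scalemxAr mxtraceZ.
  by rewrite mulr_natl mulr2n addrAC; congr (_ + _); exact: E2.
rewrite /ldiv; under eq_bigr do rewrite trG mulrDr.
rewrite big_split mulrDr /= addrA; congr (_ + _); last first.
  congr (_ * _); under eq_bigr do rewrite mulr_sumr.
  rewrite exchange_big /=; apply: eq_bigr => a _; rewrite -YE// [in RHS]mxE mulr_suml.
  by apply: eq_bigr => s _; rewrite mulrA.
have sYJ : smx U (fun y => Y y *m J y) := smxM oU sY sJ.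
have DYE s b : \sum_r (pdmx Y x s r * J x r b) + \sum_r Y x 0 r * ('D_('e_s) J x) r b =
    \sum_a J x s a * pdmx Y' (phi x) a b.
  have E : 'D_('e_s) (fun y => Y y *m J y) x = 'D_('e_s) (Y' \o phi) x.
    exact: (D_near_eq oU 'e_s YE Ux).
  move: E; rewrite (D_mul oU 'e_s sY sJ Ux) (D_comp s oU oV phiUV sphi sY' Ux).
  move=> /matrixP/(_ 0 b); rewrite mxE summxE ![in X in X + _ = _ -> _]mxE.
  rewrite ![in X in _ + X = _ -> _]mxE => E.
  transitivity (\sum_a (J x s a *: 'D_('e_a) Y' (phi x)) 0 b); last first.
    by apply: eq_bigr => a _; rewrite !mxE (D_mxE oV)// .
  rewrite -E; congr (_ + _); apply: eq_bigr => r _.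
  by rewrite !mxE (D_mxE oU).
(* The coordinate divergence of [Y'] at [phi x] is the trace of [J^-1] times the derivative of
   [Y *m J]. *)
transitivity (\sum_s \sum_b invmx (J x) b s *
   (\sum_r (pdmx Y x s r * J x r b) + \sum_r Y x 0 r * ('D_('e_s) J x) r b)); last first.
  under eq_bigr do under eq_bigr do rewrite DYE.
  rewrite exchange_big /mxtrace /=; apply: eq_bigr => b _.
  transitivity ((invmx (J x) *m J x *m pdmx Y' (phi x)) b b); last by rewrite mulVmx// mul1mx.
  rewrite -mulmxA mxE; apply: eq_bigr => s _; congr (_ * _).
  by rewrite [in RHS]mxE.
under [RHS]eq_bigr do (under eq_bigr do rewrite mulrDr; rewrite big_split /=).
rewrite big_split /=; congr (_ + _).
  rewrite /mxtrace; apply: eq_bigr => s _.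
  transitivity ((pdmx Y x *m J x *m invmx (J x)) s s); first by rewrite mulmxK.
  rewrite mxE; apply: eq_bigr => b _; rewrite mulrC; congr (_ * _).
  by rewrite [in LHS]mxE.
have -> : 2^-1 * (\sum_i Y x 0 i * (2 * \tr (invmx (J x) *m 'D_('e_i) J x))) =
   \sum_i Y x 0 i * \tr (invmx (J x) *m 'D_('e_i) J x).
  by rewrite mulr_sumr; apply: eq_bigr => i _; rewrite mulrCA mulKf// pnatr_eq0.
under [RHS]eq_bigr do (under eq_bigr do rewrite mulr_sumr).
under [RHS]eq_bigr do rewrite exchange_big /=.
rewrite exchange_big /=; apply: eq_bigr => r _.
rewrite /mxtrace mulr_sumr exchange_big /=; apply: eq_bigr => b _.
rewrite mxE mulr_sumr; apply: eq_bigr => s _.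
by rewrite mulrCA; congr (_ * (_ * _)); exact: (pdmx_sym r s b oU sphi Ux).
Qed.

End DivergenceChange.

(** * Coordinate formula for the mean curvature of the fibers *)

Section LocalMeanCurvature.
Variables (R : realType) (m k : nat).
Implicit Types (f : 'rV[R]_m -> 'rV[R]_k) (Q : 'rV[R]_k -> 'M[R]_k) (G : 'rV[R]_m -> 'M[R]_m).

(* Curvature terms that only involve the metric [Q] of the base: they come from
   the values of the Hessian of the submersion on gradients. *)
Definition base_term Q (y : 'rV[R]_k) : 'rV[R]_k :=
  let P z := invmx (Q z) in
  \row_a \sum_b \sum_c Q y b c * (2^-1 *
    (\sum_l P y b l * ('D_('e_l) P y) c a + \sum_l P y c l * ('D_('e_l) P y) b a
     - \sum_l P y a l * ('D_('e_l) P y) b c)).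

Definition gradf f G x : 'M[R]_(k, m) := gradmx (G x) (pdmx f x).

(** The expected value of [dpi H] in coordinates. The divergences are the Laplacians of the
    components of [f]; for metrics inducing the same [Q] only this term can change. *)
Definition etaF f Q G x : 'rV[R]_k :=
  base_term Q (f x) - \row_a ldiv G (fun y => row a (gradf f G y)) x.

Variables (U : set 'rV[R]_m) (V : set 'rV[R]_k) (f : 'rV[R]_m -> 'rV[R]_k) (Q : 'rV[R]_k -> 'M[R]_k).
Hypotheses (oU : open U) (oV : open V) (fUV : forall x, U x -> V (f x)) (sf : smx U f) (sQ : smx V Q).
Hypotheses (symQ : forall y, V y -> (Q y)^T = Q y) (uQ : forall y, V y -> Q y \in unitmx).

Definition submetric G := [/\ smx U G, forall x, U x -> (G x)^T = G x,
  forall x, U x -> G x \in unitmx &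
  forall x, U x -> gradf f G x *m pdmx f x = invmx (Q (f x))].

Lemma smx_D : smx U (pdmx f). Proof. exact: smx_pdmx. Qed.

Lemma smx_gradf G : submetric G -> smx U (gradf f G).
Proof. by move=> [sG _ uG _]; exact: (smxM oU (smx_tr oU smx_D) (smx_inv oU uG sG)). Qed.

Lemma smx_row n p (F : 'rV[R]_m -> 'M[R]_(n, p)) a : smx U F -> smx U (fun x => row a (F x)).
Proof.
by move=> sF i j; apply: (eq_smooth_on oU _ (sF a j)) => x _; rewrite mxE.
Qed.

Lemma D_gradf G x s : submetric G -> U x ->
  'D_('e_s) (gradf f G) x = ('D_('e_s) (pdmx f) x)^T *m invmx (G x)
    - gradf f G x *m 'D_('e_s) G x *m invmx (G x).
Proof.
move=> [sG _ uG _] Ux.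
apply: (etrans (D_mul oU 'e_s (smx_tr oU smx_D) (smx_inv oU uG sG) Ux)).
by rewrite (D_tr oU 'e_s smx_D Ux) (D_inv oU 'e_s sG uG Ux) mulmxN /gradf /gradmx !mulmxA.
Qed.

Lemma D_base G x i : submetric G -> U x ->
  ('D_('e_i) (pdmx f) x)^T *m (gradf f G x)^T + gradf f G x *m 'D_('e_i) (pdmx f) x
    - gradf f G x *m 'D_('e_i) G x *m (gradf f G x)^T =
  \sum_l pdmx f x i l *: 'D_('e_l) (fun z => invmx (Q z)) (f x).
Proof.
move=> sG' Ux; have [sG symG uG PE] := sG'.
have sI := smx_inv oV uQ sQ.
rewrite -(D_comp i oU oV fUV sf sI Ux).
have -> : 'D_('e_i) ((fun z => invmx (Q z)) \o f) x = 'D_('e_i) (fun y => gradf f G y *m pdmx f y) x.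
  by apply: (D_near_eq oU 'e_i _ Ux) => y Uy; rewrite PE.
rewrite (D_mul oU 'e_i (smx_gradf sG') smx_D Ux) (D_gradf i sG' Ux) mulmxBl.
have Xt : (gradf f G x)^T = invmx (G x) *m pdmx f x := gradmx_tr _ (symG _ Ux).
by rewrite Xt !mulmxA addrAC.
Qed.

(** The vertical trace is the full trace minus the trace over gradients. The full trace is a
    divergence by [trace_hess]; the other one is computed by Koszul's formula. *)
Lemma hess_eta G x a : submetric G -> U x ->
  - \sum_i \sum_j vcometric (G x) (pdmx f x) (Q (f x)) i j *
     hessmx (G x) (pdmx f x) (fun s => 'D_('e_s) G x) (fun s => 'D_('e_s) (pdmx f) x) a i j
  = etaF f Q G x 0 a.
Proof.
move=> sG' Ux; have [sG symG uG PE] := sG'.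
set h := hessmx _ _ _ _ a; set X := gradf f G x.
have dGs s : ('D_('e_s) G x)^T = 'D_('e_s) G x.
  apply: (etrans (esym (D_tr oU 'e_s sG Ux))).
  by apply: (D_near_eq oU 'e_s _ Ux) => y Uy; exact: symG.
have dDs i j b : ('D_('e_i) (pdmx f) x) j b = ('D_('e_j) (pdmx f) x) i b.
  exact: (pdmx_sym i j b oU sf Ux).
have tr := @trace_hess _ _ _ (G x) (pdmx f x) _ (fun s => 'D_('e_s) (pdmx f) x) (symG _ Ux) dGs a.
have -> : \sum_i \sum_j vcometric (G x) (pdmx f x) (Q (f x)) i j * h i j =
   \sum_i \sum_j invmx (G x) i j * h i j - \sum_b \sum_c Q (f x) b c * (X *m h *m X^T) b c.
  transitivity (\sum_i \sum_j invmx (G x) i j * h i j - \sum_i \sum_j (X^T *m Q (f x) *m X) i j * h i j).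
    by rewrite -sumrB; apply: eq_bigr => i _; rewrite -sumrB; apply: eq_bigr => j _; rewrite !mxE mulrBl.
  congr (_ - _).
  transitivity (\tr (X^T *m Q (f x) *m X *m h^T)).
    by rewrite /mxtrace; apply: eq_bigr => i _; rewrite [RHS]mxE; apply: eq_bigr => j _; rewrite [h^T _ _]mxE.
  transitivity (\tr (Q (f x) *m (X *m h *m X^T)^T)).
    by clearbody X; rewrite -!mulmxA mxtrace_mulC !trmx_mul trmxK !mulmxA.
  by rewrite /mxtrace; apply: eq_bigr => i _; rewrite [LHS]mxE; apply: eq_bigr => j _; rewrite [(_ ^T) _ _]mxE.
rewrite opprB /etaF [in RHS]mxE [X in _ = X + _]mxE; congr (_ + _).
  apply: eq_bigr => b _; apply: eq_bigr => c _; congr (_ * _).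
  apply: (etrans (@hess_gradmx _ _ _ (G x) (pdmx f x) (fun s => 'D_('e_s) G x) (fun s => 'D_('e_s) (pdmx f) x) dDs a b c)); congr (_ * _).
  (* A derivative of [Q^-1] composed with [f] along a gradient brings in the product [X *m D], which
     is [Q^-1] again; only quantities on the base remain. *)
  have E p q r : \sum_i X p i * (('D_('e_i) (pdmx f) x)^T *m X^T + X *m 'D_('e_i) (pdmx f) x
        - X *m 'D_('e_i) G x *m X^T) q r =
      \sum_l invmx (Q (f x)) p l * ('D_('e_l) (fun z => invmx (Q z)) (f x)) q r.
    under eq_bigr do rewrite (D_base _ sG' Ux) summxE mulr_sumr.
    rewrite exchange_big /=; apply: eq_bigr => l _; rewrite -PE// [in RHS]mxE mulr_suml.
    by apply: eq_bigr => i _; rewrite -mulrA; congr (_ * _); exact: mxE.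
  by congr (_ + _ - _); exact: E.
rewrite [in RHS]mxE [in RHS]mxE; congr (- _).
apply: (etrans tr); rewrite /ldiv; congr (_ + _ * _).
  rewrite /mxtrace; apply: eq_bigr => s _.
  have D1 := D_gradf s sG' Ux.
  rewrite [in RHS]mxE.
  transitivity (('D_('e_s) (gradf f G) x) a s); first by rewrite D1.
  apply: (etrans (@D_mxE _ _ U oU _ _ (gradf f G) x 'e_s a s (smx_gradf sG') Ux)).
  by apply: (congr1 (fun h => 'D_('e_s) h x)); apply/funext => y; rewrite [RHS]mxE.
by apply: eq_bigr => s _; rewrite [in RHS]mxE.
Qed.

(** Differentiating [e a *m D = 0] along [e a] trades derivatives of the frame for second
    derivatives of [f]. Only the values of the frame at [x] remain, through the sum of [e^T *m e],
    so the result is the same for every frame. *)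
Lemma frame_eta G x n (O : set 'rV[R]_m) (e : 'I_n -> 'rV[R]_m -> 'rV[R]_m) : submetric G ->
  open O -> O x -> O `<=` U -> (forall a, smx O (e a)) ->
  (forall a y, O y -> e a y *m pdmx f y = 0) ->
  \sum_a (e a x)^T *m e a x = vcometric (G x) (pdmx f x) (Q (f x)) ->
  \sum_a ('D_(e a x) (e a) x + \row_l \sum_i \sum_j christoffel G x i j l * e a x 0 i * e a x 0 j)
     *m pdmx f x = etaF f Q G x.
Proof.
move=> sG' oO Ox OU se eD BE; have [sG symG uG PE] := sG'; have Ux := OU _ Ox.
apply/rowP => al; rewrite -(hess_eta al sG' Ux) summxE -BE.
set h := hessmx _ _ _ _ al.
transitivity (- \sum_a \sum_i \sum_j e a x 0 i * e a x 0 j * h i j); last first.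
  congr (- _); rewrite exchange_big /=; apply: eq_bigr => i _.
  rewrite exchange_big /=; apply: eq_bigr => j _; rewrite summxE mulr_suml.
  by apply: eq_bigr => a _; congr (_ * _); rewrite mxE big_ord1 mxE.
rewrite -sumrN; apply: eq_bigr => a _; set v := e a x.
have sD : smx O (pdmx f) by move=> i j; apply: smooth_onW OU (smx_D i j).
have E0 : 'D_v (e a) x *m pdmx f x = - (v *m 'D_v (pdmx f) x).
  have E1 := D_mul oO v (se a) sD Ox.
  apply/eqP; rewrite -addr_eq0 -E1; apply/eqP.
  rewrite (D_near_eq (g := fun=> 0) oO v (eD a) Ox).
  exact: derive_cst.
have E2 : 'D_v (pdmx f) x = \sum_i v 0 i *: 'D_('e_i) (pdmx f) x by exact: (smx_deriveE oU v Ux smx_D).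
rewrite mulmxDl E0 mxE [X in X + _]mxE.
have E3 : (v *m 'D_v (pdmx f) x) 0 al = \sum_i \sum_j v 0 i * v 0 j * ('D_('e_i) (pdmx f) x) j al.
  rewrite E2 mulmx_sumr summxE; apply: eq_bigr => i _; rewrite -scalemxAr mxE [X in _ * X]mxE mulr_sumr.
  by apply: eq_bigr => j _; rewrite mulrA.
rewrite E3 /h; under [in RHS]eq_bigr do under eq_bigr do rewrite mxE mulrBr.
under [in RHS]eq_bigr do rewrite sumrB.
rewrite sumrB opprB addrC; congr (_ - _).
transitivity (\sum_l \sum_i \sum_j christoffel G x i j l * v 0 i * v 0 j * pdmx f x l al).
  rewrite mxE; apply: eq_bigr => l _; rewrite [X in X * _]mxE mulr_suml; apply: eq_bigr => i _.
  by rewrite mulr_suml.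
rewrite exchange_big /=; apply: eq_bigr => i _; rewrite exchange_big /=; apply: eq_bigr => j _.
rewrite mulr_sumr; apply: eq_bigr => l _.
have DE p q r : 'D_('e_p) (fun y => G y q r) x = ('D_('e_p) G x) q r.
  exact: (esym (D_mxE oU 'e_p q r sG Ux)).
have -> : christoffel G x i j l = 2^-1 * \sum_s invmx (G x) l s *
    (('D_('e_i) G x) j s + ('D_('e_j) G x) i s - ('D_('e_s) G x) i j).
  by rewrite /christoffel; congr (_ * _); apply: eq_bigr => s _; rewrite !DE.
move: (\sum_s _) (v 0 i) (v 0 j) (pdmx f x l al) => s1 v1 v2 d1.
by ring.
Qed.

Lemma smooth_mxtrace n p (O : set 'rV[R]_n) (F : 'rV[R]_n -> 'M[R]_p) : open O -> smx O F ->
  smooth_on O (fun x => \tr (F x)).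
Proof. by move=> oO sF; apply: (smooth_on_sum oO) => i _; exact: sF. Qed.

Lemma ldiv_smooth G Y : smx U G -> (forall x, U x -> G x \in unitmx) -> smx U Y -> smooth_on U (ldiv G Y).
Proof.
move=> sG uG sY; apply: (smooth_onD oU (smooth_mxtrace oU (smx_pdmx oU sY))).
apply: (smooth_onM oU (smooth_on_cst _ _)).
apply: (smooth_on_sum oU) => s _; apply: (smooth_onM oU (sY 0 s)).
apply: (smooth_mxtrace oU); exact: (smxM oU (smx_inv oU uG sG) (smx_pderive oU s sG)).
Qed.

Lemma base_term_smooth : smx V (base_term Q).
Proof.
move=> i a; have sP := smx_inv oV uQ sQ.
have sDP l := smx_pderive oV l sP.
pose P z := invmx (Q z).
apply: (@eq_smooth_on _ _ _ oV (fun y => \sum_b \sum_c Q y b c * (2^-1 *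
    (\sum_l P y b l * ('D_('e_l) P y) c a + \sum_l P y c l * ('D_('e_l) P y) b a
     - \sum_l P y a l * ('D_('e_l) P y) b c)))).
  by move=> y _; rewrite mxE.
apply: (smooth_on_sum oV) => b _; apply: (smooth_on_sum oV) => c _.
apply: (smooth_onM oV (sQ b c)); apply: (smooth_onM oV (smooth_on_cst _ _)).
have H p q r : smooth_on V (fun y => \sum_l P y p l * ('D_('e_l) P y) q r).
  by apply: (smooth_on_sum oV) => l _; exact: (smooth_onM oV (sP p l) (sDP l q r)).
exact: (smooth_onB oV (smooth_onD oV (H _ _ _) (H _ _ _)) (H _ _ _)).
Qed.

Lemma etaF_smooth G : submetric G -> smx U (etaF f Q G).
Proof.
move=> sG'; have [sG symG uG PE] := sG'.
apply: (smxB oU); first exact: (smx_comp oU oV fUV sf base_term_smooth).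
move=> i a; apply: (@eq_smooth_on _ _ _ oU (ldiv G (fun y => row a (gradf f G y)))).
  by move=> y _; rewrite mxE.
by apply: ldiv_smooth => //; apply: smx_row; exact: smx_gradf.
Qed.

(** A divergence sees the metric only through its volume density. *)
Lemma ldiv_det G0 G Y x : smx U G0 -> smx U G -> (forall y, U y -> G0 y \in unitmx) ->
  (forall y, U y -> \det (G y) = \det (G0 y)) -> U x -> ldiv G Y x = ldiv G0 Y x.
Proof.
move=> sG0 sG uG0 dE Ux.
have uG : G x \in unitmx by rewrite unitmxE dE// -unitmxE uG0.
suff E : \sum_s Y x 0 s * \tr (invmx (G x) *m 'D_('e_s) G x) =
  \sum_s Y x 0 s * \tr (invmx (G0 x) *m 'D_('e_s) G0 x).
  exact: (congr1 (fun z => \tr (pdmx Y x) + 2^-1 * z) E).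
apply: eq_bigr => s _; apply: (congr1 (fun z => Y x 0 s * z)).
have E1 := D_det oU 'e_s sG uG Ux.
have E2 := D_det oU 'e_s sG0 (uG0 _ Ux) Ux.
have E := etrans (esym E1) (etrans (D_near_eq oU 'e_s dE Ux) E2).
rewrite (dE x Ux) in E; apply: mulfI E; rewrite -unitfE -unitmxE; exact: uG0.
Qed.

Lemma etaF_variation G0 G x : submetric G0 -> submetric G -> U x ->
  (forall y, U y -> \det (G y) = \det (G0 y)) ->
  etaF f Q G x - etaF f Q G0 x = - \row_a ldiv G0 (fun y => row a (gradf f G y) - row a (gradf f G0 y)) x.
Proof.
move=> sG0' sG' Ux dE; have [sG symG uG PE] := sG'; have [sG0 symG0 uG0 PE0] := sG0'.
have E a : ldiv G0 (fun y => row a (gradf f G y) - row a (gradf f G0 y)) x =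
   ldiv G (fun y => row a (gradf f G y)) x - ldiv G0 (fun y => row a (gradf f G0 y)) x.
  rewrite (ldiv_linear _ oU Ux (smx_row a (smx_gradf sG')) (smx_row a (smx_gradf sG0'))).
  apply: (congr1 (fun z => z - _)).
  exact: (esym (ldiv_det _ sG0 sG uG0 dE Ux)).
have -> : \row_a ldiv G0 (fun y => row a (gradf f G y) - row a (gradf f G0 y)) x =
   \row_a ldiv G (fun y => row a (gradf f G y)) x - \row_a ldiv G0 (fun y => row a (gradf f G0 y)) x.
  apply/rowP => a; apply: (etrans (mxE _ _ _ _)); rewrite E; apply: esym.
  apply: (etrans (mxE _ _ _ _)); apply: (f_equal2 +%R); first exact: mxE.
  by apply: (etrans (mxE _ _ _ _)); apply: (congr1 -%R); exact: mxE.
have H (b r r0 : 'rV[R]_k) : b - r - (b - r0) = - (r - r0) by rewrite opprB addrC addrA subrK opprB.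
exact: H.
Qed.

End LocalMeanCurvature.

(** * Invariance under changes of coordinates *)

Section EtaChange.
Variables (R : realType) (m k : nat) (U U' : set 'rV[R]_m) (V : set 'rV[R]_k).
Variables (phi : 'rV[R]_m -> 'rV[R]_m) (f f' : 'rV[R]_m -> 'rV[R]_k) (Q : 'rV[R]_k -> 'M[R]_k).
Variables (G G' : 'rV[R]_m -> 'M[R]_m).
Hypotheses (oU : open U) (oU' : open U') (phiU : forall x, U x -> U' (phi x)).
Hypotheses (sphi : smx U phi) (sf : smx U f) (sf' : smx U' f').
Hypothesis (uJ : forall x, U x -> pdmx phi x \in unitmx).
Hypothesis fE : forall x, U x -> f x = f' (phi x).
Hypothesis sG : submetric U f Q G.
Hypothesis sG' : submetric U' f' Q G'.
Hypothesis GE : forall x, U x -> G x = pdmx phi x *m G' (phi x) *m (pdmx phi x)^T.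

Lemma pdmx_change x : U x -> pdmx f x = pdmx phi x *m pdmx f' (phi x).
Proof.
move=> Ux; apply/matrixP => i a.
rewrite [LHS]mxE.
have -> : 'D_('e_i) (fun y => f y 0 a) x = ('D_('e_i) f x) 0 a.
  exact: (esym (D_mxE oU 'e_i 0 a sf Ux)).
rewrite (D_near_eq oU 'e_i (fE : forall y, U y -> f y = (f' \o phi) y) Ux).
rewrite (D_comp i oU oU' phiU sphi sf' Ux) summxE [RHS]mxE; apply: eq_bigr => l _.
rewrite [LHS]mxE [X in _ = _ * X]mxE; congr (_ * _).
exact: (D_mxE oU' 'e_l 0 a sf' (phiU Ux)).
Qed.

Lemma gradf_change x : U x -> gradf f G x *m pdmx phi x = gradf f' G' (phi x).
Proof.
move=> Ux; have [_ _ uG' _] := sG'; have := uG' _ (phiU Ux); have uj := uJ Ux.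
rewrite /gradf /gradmx pdmx_change// GE//; move: (pdmx phi x) (G' _) (pdmx f' _) uj => J A D uj uA.
have iE : invmx (J *m A *m J^T) = invmx J^T *m invmx A *m invmx J.
  have uJt : J^T \in unitmx by rewrite unitmx_tr.
  have u : J *m A *m J^T \in unitmx by rewrite !unitmx_mul uj uA uJt.
  apply: (can_inj (mulmxK u)); rewrite mulVmx// -!mulmxA mulKmx// mulKmx// mulVmx//.
by rewrite iE trmx_mul !mulmxA mulmxKV// mulmxK// unitmx_tr.
Qed.

Lemma etaF_change x : U x -> etaF f Q G x = etaF f' Q G' (phi x).
Proof.
move=> Ux.
have [gG symG uG PE] := sG; have [gG' symG' uG' PE'] := sG'.
have E1 : base_term Q (f x) = base_term Q (f' (phi x)) by rewrite fE.
suff E2 : \row_a ldiv G (fun y => row a (gradf f G y)) x =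
    \row_a ldiv G' (fun y => row a (gradf f' G' y)) (phi x).
  exact: (f_equal2 (fun a b => a - b) E1 E2).
apply/rowP => a; apply: (etrans (mxE _ _ _ _)); apply: (etrans _ (esym (mxE _ _ _ _))).
apply: (ldiv_change oU oU' phiU sphi gG' _ _ uJ uG' GE _ Ux).
- exact: (smx_row oU a (smx_gradf oU sf sG)).
- exact: (smx_row oU' a (smx_gradf oU' sf' sG')).
- by move=> y Uy; apply: (etrans (esym (row_mul _ _ _))); rewrite gradf_change.
Qed.

End EtaChange.

(** * Mean curvature of the fibers *)

Section HorizontalAlgebra.
Variables (R : realType) (m k : nat).
Implicit Types (G : 'M[R]_m) (D : 'M[R]_(m, k)) (Q : 'M[R]_k).

Lemma gradmx_congr (J : 'M[R]_m) G D : J \in unitmx -> G \in unitmx ->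
  gradmx (J *m G *m J^T) (J *m D) *m J = gradmx G D.
Proof.
move=> uJ uG; have uJt : J^T \in unitmx by rewrite unitmx_tr.
have u : J *m G *m J^T \in unitmx by rewrite !unitmx_mul uJ uG uJt.
have iE : invmx (J *m G *m J^T) = invmx J^T *m invmx G *m invmx J.
  apply: (can_inj (mulmxK u)); rewrite mulVmx// -!mulmxA mulKmx// mulKmx// mulVmx//.
by rewrite /gradmx iE trmx_mul !mulmxA mulmxKV// mulmxK.
Qed.

Lemma gradmx_mulr G D (j : 'M[R]_k) : gradmx G (D *m j) = j^T *m gradmx G D.
Proof. by rewrite /gradmx trmx_mul mulmxA. Qed.

Lemma gradmx_base_congr (J : 'M[R]_m) (j : 'M[R]_k) G D : J \in unitmx -> G \in unitmx ->
  gradmx (J *m G *m J^T) (J *m D *m j) *m (J *m D *m j) = j^T *m (gradmx G D *m D) *m j.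
Proof.
by move=> uJ uG; rewrite gradmx_mulr -(gradmx_congr D uJ uG) !mulmxA.
Qed.

Variables (G : 'M[R]_m) (D : 'M[R]_(m, k)) (Q : 'M[R]_k) (X : 'M[R]_(k, m)).
Hypotheses (sG : G^T = G) (uG : G \in unitmx) (sQ : Q^T = Q) (uQ : Q \in unitmx).
Hypothesis XG : X *m G = D^T.
Let hor := kermx (G *m (kermx D)^T).

Let GX : G *m X^T = D.
Proof. by rewrite -[G]sG -trmx_mul XG trmxK. Qed.

Lemma gradmx_horizontal : (X <= hor)%MS.
Proof. by apply/sub_kermxP; rewrite mulmxA XG -trmx_mul mulmx_ker trmx0. Qed.

Section Isometric.
Hypothesis PQ : X *m D = invmx Q.

(** The projection onto [kermx D] along the gradients, acting on row vectors from the right. *)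
Let Pi := 1%:M - D *m Q *m X.

Lemma vprojD : Pi *m D = 0.
Proof. by rewrite mulmxBl mul1mx -(mulmxA _ X) PQ mulmxK// subrr. Qed.

Lemma vproj_vertical n (v : 'M[R]_(n, m)) : v *m D = 0 -> v *m Pi = v.
Proof. by move=> vD; rewrite mulmxBr mulmx1 !mulmxA vD !mul0mx subr0. Qed.

Lemma horizontalE (v : 'rV[R]_m) : (v <= hor)%MS -> v = v *m D *m Q *m X.
Proof.
move=> /sub_kermxP vh.
have /submxP[Z PiZ] : (Pi <= kermx D)%MS by apply/sub_kermxP; exact: vprojD.
have H : v *m G *m Pi^T = 0.
  by rewrite PiZ trmx_mul !mulmxA -(mulmxA v) vh mul0mx.
have : v *m G = v *m D *m Q *m D^T.
  move: H; rewrite linearB /= trmx1 mulmxBr mulmx1 => /eqP; rewrite subr_eq0 => /eqP {1}->.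
  by rewrite !trmx_mul sQ !mulmxA -(mulmxA v G) GX.
by rewrite -XG mulmxA => /(congr1 (mulmx^~ (invmx G))); rewrite !mulmxK.
Qed.

Lemma horizontal_vertical (v : 'rV[R]_m) : (v <= hor + kermx D)%MS.
Proof.
have -> : v = v *m D *m Q *m X + v *m Pi by rewrite mulmxBr mulmx1 !mulmxA addrC subrK.
apply: addmx_sub_adds; first exact: (submx_trans (submxMl _ _) gradmx_horizontal).
by apply/sub_kermxP; rewrite -mulmxA vprojD mulmx0.
Qed.

Lemma hprojD (v : 'rV[R]_m) : v *m proj_mx hor (kermx D) *m D = v *m D.
Proof.
have /sub_kermxP := proj_mx_compl_sub (horizontal_vertical v).
by rewrite mulmxBl => /eqP; rewrite subr_eq0 => /eqP.
Qed.

Lemma horizontal_isometry (v w : 'rV[R]_m) : (v <= hor)%MS -> (w <= hor)%MS ->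
  gdot G v w = gdot Q (v *m D) (w *m D).
Proof.
move=> /horizontalE vE /horizontalE wE; rewrite /gdot {1}vE {1}wE.
rewrite (trmx_mul _ X) (trmx_mul _ Q) sQ -!mulmxA (mulmxA G) GX (mulmxA X) PQ.
by rewrite mulKVmx.
Qed.

End Isometric.

(** The rows of [X] are horizontal, so the isometry hypothesis on them reads [P = P *m Q *m P] for
    their Gram matrix [P = X *m D]. Full rank of [D] makes [P] positive definite, hence
    cancellable. *)
Lemma submersion_isometric : \rank D = k -> posdef (invmx G) ->
  (forall v w : 'rV[R]_m, (v <= hor)%MS -> (w <= hor)%MS -> gdot G v w = gdot Q (v *m D) (w *m D)) ->
  X *m D = invmx Q.
Proof.
move=> rD pG iso.
have XE : X = D^T *m invmx G by rewrite -XG mulmxK.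
have E : X *m D = X *m D *m Q *m (X *m D)^T.
  rewrite -{1}GX mulmxA; apply/matrixP => i j.
  have rX a : (row a X <= hor)%MS by apply: submx_trans (row_sub _ _) gradmx_horizontal.
  have := iso _ _ (rX i) (rX j); rewrite /gdot -(row_mul i X G) -(row_mul i X D) -(row_mul i _ Q) -(row_mul j X D) => H.
  have aux n p (A : 'M[R]_(n, p)) (B : 'M[R]_(n, p)) a b :
      (row a A *m (row b B)^T) 0 0 = (A *m B^T) a b.
    by rewrite !mxE; apply: eq_bigr => s _; rewrite !mxE.
  exact: (etrans (esym (aux _ _ (X *m G) X i j)) (etrans H (aux _ _ (X *m D *m Q) (X *m D) i j))).
have symP : (X *m D)^T = X *m D by rewrite trmx_mul -XG -{1}GX -mulmxA GX.
have uP : X *m D \in unitmx.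
  have -> : X *m D = D^T *m invmx G *m D^T^T by rewrite trmxK -XE.
  by apply: posdef_unit; apply: posdef_congr => //; rewrite /row_free mxrank_tr rD.
rewrite symP in E.
have E1 : 1%:M = X *m D *m Q.
  by apply: (can_inj (mulmxK uP)); rewrite mul1mx.
by rewrite -[LHS](mulmxK uQ) -E1 mul1mx.
Qed.

End HorizontalAlgebra.

Section MetricValues.
Variables (R : realType) (m : nat) (M : manifold R m) (g : tensor2 M).
Hypothesis g_metric : riemannian_metric g.

Lemma riem_sym p : (g p)^T = g p. Proof. by have [_ + _] := g_metric; apply. Qed.

Lemma riem_posdef p : posdef (g p). Proof. by have [_ _ +] := g_metric; move=> H v; exact: H. Qed.

Lemma riem_unit p : g p \in unitmx. Proof. exact/posdef_unit/riem_posdef. Qed.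

End MetricValues.

(** * The submersion in charts *)

Section SubmersionCharts.
Variables (R : realType) (m k : nat) (M : manifold R m) (N : manifold R k) (pi : M -> N).
Implicit Types (p : M) (c : chart R M m) (d : chart R N k).
Hypothesis pi_smooth : smooth_map pi.

Definition pidom c d : set 'rV[R]_m := cimg c `&` cinv c @^-1` (pi @^-1` cdom d).

Definition pimap c d : 'rV[R]_m -> 'rV[R]_k := cfun d \o pi \o cinv c.

Definition Dpi c d p : 'M[R]_(m, k) :=
  sval (seal (fun c d p => pdmx (pimap c d) (cfun c p))) c d p.

Lemma Dpi_def c d p : Dpi c d p = pdmx (pimap c d) (cfun c p).
Proof. by rewrite /Dpi; case: (seal _) => y /= ->. Qed.

Lemma open_pi_preimage (W : set N) : open W -> open (pi @^-1` W).
Proof. by move=> oW; apply: open_comp => // p _; have [cpi _] := pi_smooth; exact: cpi. Qed.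

Lemma open_pidom c d : open (pidom c d).
Proof. by apply: open_chart_preimage; apply: open_pi_preimage; exact: open_cdom. Qed.

Lemma pidom_cfun c d p : cdom c p -> cdom d (pi p) -> pidom c d (cfun c p).
Proof. by move=> cp dp; split; [exact: cfun_cimg|rewrite /= cfunK]. Qed.

Lemma pimap_smooth c d : atlas c -> atlas d -> smx (pidom c d) (pimap c d).
Proof. by move=> ac ad i j; rewrite ord1; have [_ sp] := pi_smooth; exact: (sp c d ac ad j). Qed.

Lemma pimap_cimg c d x : pidom c d x -> cimg d (pimap c d x).
Proof. by move=> [cx dx]; exact: cfun_cimg. Qed.

Lemma pimap_cfun c d p : cdom c p -> pimap c d (cfun c p) = cfun d (pi p).
Proof. by move=> cp; rewrite /pimap /= cfunK. Qed.

Lemma smooth_pos n q (O : set 'rV[R]_n) (F : 'rV[R]_n -> 'rV[R]_q) : smooth_vec_on O F -> smx O F.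
Proof. by move=> sF i j; rewrite ord1; exact: sF. Qed.

Lemma transition_smx r (P : manifold R r) (e e' : chart R P r) : atlas e -> atlas e' ->
  smx (cimg e `&` cinv e @^-1` cdom e') (cfun e' \o cinv e).
Proof. by move=> ae ae'; apply: smooth_pos; exact: transition_smooth. Qed.

Lemma pdmx_transition r (P : manifold R r) (e e' : chart R P r) q : atlas e -> atlas e' ->
  cdom e q -> cdom e' q -> pdmx (cfun e' \o cinv e) (cfun e q) = jac e e' q.
Proof. by move=> ae ae' eq eq'; rewrite jacE. Qed.

Lemma dpiE p : dpi pi p = Dpi (chart_at p) (chart_at (pi p)) p.
Proof.
rewrite Dpi_def /dpi.
have H j : Ck_on 1 (pidom (chart_at p) (chart_at (pi p))) (fun x => pimap (chart_at p) (chart_at (pi p)) x 0 j).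
  exact: (pimap_smooth (chart_at_atlas p) (chart_at_atlas (pi p)) 0 j 1%N).
by have [_ ->] := C1_vec_diff (@open_pidom _ _) (pidom_cfun (chart_at_cdom p) (chart_at_cdom (pi p))) H.
Qed.

Lemma Dpi_changel c c' d p : atlas c -> atlas c' -> atlas d -> cdom c p -> cdom c' p -> cdom d (pi p) ->
  Dpi c d p = jac c c' p *m Dpi c' d p.
Proof.
move=> ac ac' ad cp cp' dp; rewrite !Dpi_def -(pdmx_transition ac ac' cp cp').
pose U := cimg c `&` cinv c @^-1` (cdom c' `&` pi @^-1` cdom d).
have oU : open U.
  by apply: open_chart_preimage; apply: openI; [exact: open_cdom|exact/open_pi_preimage/open_cdom].
have Ux : U (cfun c p) by split; [exact: cfun_cimg|rewrite /= cfunK].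
have E : cfun c' p = (cfun c' \o cinv c) (cfun c p) by rewrite /= cfunK.
rewrite E.
apply: (@pdmx_change _ _ _ U (pidom c' d) (cfun c' \o cinv c) (pimap c d) (pimap c' d) oU (@open_pidom c' d)) => //.
- by move=> x [cx [cx' dx]]; apply: pidom_cfun.
- by move=> i j; apply: smooth_onW (transition_smx ac ac' i j) => x [? []].
- by move=> i j; apply: smooth_onW (pimap_smooth ac ad i j) => x [? []].
- exact: pimap_smooth.
- by move=> x [cx [cx' dx]]; rewrite /pimap /= cfunK.
Qed.

Lemma Dpi_changer c d d' p : atlas c -> atlas d -> atlas d' -> cdom c p -> cdom d (pi p) -> cdom d' (pi p) ->
  Dpi c d' p = Dpi c d p *m jac d d' (pi p).
Proof.
move=> ac ad ad' cp dp dp'; rewrite !Dpi_def -(pdmx_transition ad ad' dp dp').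
pose U := cimg c `&` cinv c @^-1` (pi @^-1` (cdom d `&` cdom d')).
have oU : open U.
  by apply: open_chart_preimage; apply: open_pi_preimage; apply: openI; exact: open_cdom.
have Ux : U (cfun c p) by split; [exact: cfun_cimg|rewrite /= cfunK].
have s1 : smx U (pimap c d) by move=> i j; apply: smooth_onW (pimap_smooth ac ad i j) => x [? []].
have s2 : smx U (pimap c d') by move=> i j; apply: smooth_onW (pimap_smooth ac ad' i j) => x [? []].
have oV := @open_overlap _ _ _ d d'.
have UV x : U x -> (cimg d `&` cinv d @^-1` cdom d') (pimap c d x).
  by move=> [cx [dx dx']]; exact: overlap_cfun.
have fE x : U x -> pimap c d' x = ((cfun d' \o cinv d) \o pimap c d) x.
  by move=> [cx [dx dx']]; rewrite /pimap /= cfunK.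
apply/matrixP => i a; rewrite [LHS]mxE.
apply: (etrans (esym (D_mxE oU 'e_i 0 a s2 Ux))).
rewrite (D_near_eq oU 'e_i fE Ux) (D_comp i oU oV UV s1 (transition_smx ad ad') Ux) summxE [RHS]mxE.
apply: eq_bigr => l _; rewrite [LHS]mxE; congr (_ * _).
rewrite (pimap_cfun _ cp) [RHS]mxE.
exact: (D_mxE oV 'e_l 0 a (transition_smx ad ad') (overlap_cfun dp dp')).
Qed.

Lemma Dpi_dpi c d p : atlas c -> atlas d -> cdom c p -> cdom d (pi p) ->
  Dpi c d p = jac c (chart_at p) p *m dpi pi p *m jac (chart_at (pi p)) d (pi p).
Proof.
move=> ac ad cp dp; rewrite dpiE.
rewrite (Dpi_changel ac (chart_at_atlas p) ad cp (chart_at_cdom p) dp) -mulmxA; congr (_ *m _).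
by apply: Dpi_changer => //; first [exact: chart_at_atlas|exact: chart_at_cdom].
Qed.

Section Metric.
Variables (g : tensor2 M) (gN : tensor2 N).
Hypotheses (g_metric : riemannian_metric g) (gN_metric : riemannian_metric gN).

Lemma posdef_inv n (G : 'M[R]_n) : G^T = G -> posdef G -> posdef (invmx G).
Proof.
move=> sG pG; have uG := posdef_unit pG.
have -> : invmx G = invmx G *m G *m (invmx G)^T by rewrite invmx_sym// mulVmx// mul1mx.
by apply: posdef_congr pG; rewrite row_free_unit unitmx_inv.
Qed.

(** A matrix equation in place of the condition on all pairs of horizontal vectors; it transforms
    well under changes of chart and can be differentiated. *)
Definition isometric_at p := gradmx (g p) (dpi pi p) *m dpi pi p = invmx (gN (pi p)).

Lemma submersion_isometric_at p : riemannian_submersion pi g gN -> isometric_at p.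
Proof.
move=> [_ rk iso]; apply: submersion_isometric.
- exact: (riem_sym g_metric).
- exact: (riem_unit g_metric).
- exact: (riem_unit gN_metric).
- exact/gradmxG/(riem_unit g_metric).
- exact: rk.
- exact: (posdef_inv (riem_sym g_metric p) (@riem_posdef _ _ _ _ g_metric p)).
- exact: iso.
Qed.

Lemma isometric_submersion : (forall p, \rank (dpi pi p) = k) -> (forall p, isometric_at p) ->
  riemannian_submersion pi g gN.
Proof.
move=> rk H; split=> // p X Y hX hY.
apply: (horizontal_isometry (riem_sym g_metric p) (riem_unit g_metric p) (riem_sym gN_metric _) (riem_unit gN_metric _) _ (H p)) => //.
exact/gradmxG/(riem_unit g_metric).
Qed.

Lemma chart_isometric c d p : atlas c -> atlas d -> cdom c p -> cdom d (pi p) -> isometric_at p ->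
  gradmx (tin c g (cfun c p)) (Dpi c d p) *m Dpi c d p = invmx (tin d gN (cfun d (pi p))).
Proof.
move=> ac ad cp dp H; rewrite tin_cfun// Dpi_dpi// gradmx_base_congr; last 2 first.
- by apply: jac_unit => //; [exact: chart_at_atlas|exact: chart_at_cdom].
- exact: (riem_unit g_metric).
rewrite H tin_cfun//.
have uj : jac (chart_at (pi p)) d (pi p) \in unitmx.
  by apply: jac_unit => //; [exact: chart_at_atlas|exact: chart_at_cdom].
rewrite -(invmx_jac (chart_at_atlas _) ad (chart_at_cdom _) dp).
move: (jac _ _ _) (gN _) uj (riem_unit gN_metric (pi p)) => j A uj uA.
have uI : invmx j \in unitmx by rewrite unitmx_inv.
have uIt : (invmx j)^T \in unitmx by rewrite unitmx_tr.
have u : invmx j *m A *m (invmx j)^T \in unitmx by rewrite !unitmx_mul uI uA uIt.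
apply: (can_inj (mulmxK u)); rewrite mulVmx// -!mulmxA mulKVmx// mulKmx//.
by rewrite -trmx_mul mulVmx// trmx1.
Qed.

Lemma chart_submetric c d : atlas c -> atlas d -> (forall p, isometric_at p) ->
  submetric (pidom c d) (pimap c d) (tin d gN) (tin c g).
Proof.
move=> ac ad H; split.
- by move=> i j; apply: smooth_onW (tin_smooth g_metric ac i j) => x [].
- by move=> x [cx _]; exact: tin_sym.
- by move=> x [cx _]; exact: tin_unit.
- move=> x [cx dx]; have cp := cinv_cdom cx.
  have := chart_isometric ac ad cp dx (H _).
  by rewrite Dpi_def cinvK.
Qed.

End Metric.
End SubmersionCharts.

Lemma smooth_on_local (R : realType) (n : nat) (O : set 'rV[R]_n) (f : 'rV[R]_n -> R) :
  (forall x, O x -> exists V, [/\ open V, V x & smooth_on V f]) -> smooth_on O f.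
Proof.
move=> H k.
have {H} : forall x, O x -> exists V, [/\ open V, V x & Ck_on k V f].
  by move=> x /H[V [oV Vx sV]]; exists V; split=> //; exact: sV.
elim: k f => [|k IHk] f H; first by split=> // x /H[V [_ Vx []]] cf _; exact: cf.
split; first by move=> x /H[V [_ Vx []]] cf _; exact: cf.
move=> i; split; first by move=> x /H[V [_ Vx [_ /(_ i)[df _]]]]; exact: df.
by apply: IHk => x /H[V [oV Vx [_ /(_ i)[_ sD]]]]; exists V.
Qed.

Section MeanCurvature.
Variables (R : realType) (m k : nat) (M : manifold R m) (N : manifold R k) (pi : M -> N).
Implicit Types (p : M) (c : chart R M m) (d : chart R N k).

Lemma open_chart_pullback c (O : set 'rV[R]_m) : open O -> open (cdom c `&` cfun c @^-1` O).
Proof.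
move=> oO; rewrite openE => p [cp Op]; rewrite /interior.
apply: filterI; first by apply: open_nbhs_nbhs; split => //; exact: open_cdom.
exact: (cfun_continuous cp (open_nbhs_nbhs (conj oO Op))).
Qed.

Lemma vin_smooth_transfer c c' (X : vfield M) (W : set M) : atlas c -> atlas c' -> open W ->
  smx (cimg c `&` cinv c @^-1` W) (vin c X) ->
  smx (cimg c' `&` cinv c' @^-1` (W `&` cdom c)) (vin c' X).
Proof.
move=> ac ac' oW sX.
set O := cimg c' `&` _.
have oO : open O by apply: open_chart_preimage; apply: openI => //; exact: open_cdom.
have oW' : open (cimg c `&` cinv c @^-1` W) by exact: open_chart_preimage.
have sphi : smx O (cfun c \o cinv c').
  by move=> i j; apply: smooth_onW (transition_smx ac' ac i j) => x [? []].
have OW x : O x -> (cimg c `&` cinv c @^-1` W) ((cfun c \o cinv c') x).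
  by move=> [cx [Wx cx']]; split; [exact: cfun_cimg|rewrite /= cfunK].
have OJ x : O x -> (cimg c `&` cinv c @^-1` cdom c') ((cfun c \o cinv c') x).
  by move=> [cx [Wx cx']]; split; [exact: cfun_cimg|rewrite /= cfunK//; exact: cinv_cdom].
have s1 := smx_comp oO oW' OW sphi sX.
have s2 := smx_comp oO (@open_overlap _ _ _ c c') OJ sphi (jac_smooth ac ac').
apply: (eq_smx oO _ (smxM oO s1 s2)) => x [cx [Wx cx']].
have cp' := cinv_cdom cx.
rewrite /= (cfunK cx') -[in RHS](cinvK cx).
exact: (esym (vin_jac X ac ac' cx' cp')).
Qed.

Lemma smooth_vfield_chart c (X : vfield M) (W : set M) : atlas c -> open W -> W `<=` cdom c ->
  smx (cimg c `&` cinv c @^-1` W) (vin c X) -> smooth_vfield_on W X.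
Proof.
move=> ac oW Wc sX c' ac' j; rewrite -vin_def.
have H := vin_smooth_transfer ac ac' oW sX.
by apply: smooth_onW (H 0 j) => x [cx Wx]; split=> //; split=> //; exact: Wc.
Qed.

Hypothesis pi_smooth : smooth_map pi.
Variables (g : tensor2 M) (gN : tensor2 N).
Hypotheses (g_metric : riemannian_metric g) (gN_metric : riemannian_metric gN).
Hypothesis rank_dpi : forall p, \rank (dpi pi p) = k.
Hypothesis iso : forall p, isometric_at pi g gN p.

Lemma verticalE p (v : 'rV[R]_m) : (v <= vertical pi p)%MS <-> v *m dpi pi p = 0.
Proof. by split=> [/sub_kermxP|/sub_kermxP]. Qed.

Lemma vertical_Dpi c d p (v : 'rV[R]_m) : atlas c -> atlas d -> cdom c p -> cdom d (pi p) ->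
  v *m Dpi pi c d p = 0 <-> v *m jac c (chart_at p) p *m dpi pi p = 0.
Proof.
move=> ac ad cp dp; rewrite Dpi_dpi// !mulmxA.
split=> [E|->]; last by rewrite mul0mx.
have uj : jac (chart_at (pi p)) d (pi p) \in unitmx.
  by apply: jac_unit => //; [exact: chart_at_atlas|exact: chart_at_cdom].
by apply: (can_inj (mulmxK uj)); rewrite E mul0mx.
Qed.

Lemma vin_vertical c d p (V : vfield M) : atlas c -> atlas d -> cdom c p -> cdom d (pi p) ->
  vin c V (cfun c p) *m Dpi pi c d p = 0 <-> V p *m dpi pi p = 0.
Proof.
move=> ac ad cp dp; rewrite vertical_Dpi// vin_cfun// -(mulmxA (V p)) jacK ?mulmx1//.
  exact: chart_at_atlas.
exact: chart_at_cdom.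
Qed.

Lemma vertical_basis n (D : 'M[R]_(m, n)) :
  exists V0 : 'M[R]_(m - \rank D, m), row_free V0 /\ V0 *m D = 0.
Proof.
have H r : \rank (kermx D) = r -> exists V0 : 'M[R]_(r, m), row_free V0 /\ V0 *m D = 0.
  move=> <-; exists (row_base (kermx D)); split; first exact: row_base_free.
  by apply/sub_kermxP; rewrite eq_row_base.
by apply: H; rewrite mxrank_ker.
Qed.

Lemma rank_Dpi c d p : atlas c -> atlas d -> cdom c p -> cdom d (pi p) -> \rank (Dpi pi c d p) = k.
Proof.
move=> ac ad cp dp; rewrite Dpi_dpi// mxrankMfree; last first.
  by rewrite row_free_unit; apply: jac_unit => //; [exact: chart_at_atlas|exact: chart_at_cdom].
rewrite eqmxMfull// row_full_unit; apply: jac_unit => //; [exact: chart_at_atlas|exact: chart_at_cdom].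
Qed.

(** A basis of the vertical space at [p], kept constant in a chart, is projected onto the
    neighbouring vertical spaces by [Pi] and then orthonormalised smoothly. *)
Lemma vertical_frame_exists p : exists W E,
  [/\ open W, W p & @vertical_frame_on R m k M N pi g W E].
Proof.
pose c := chart_at p; pose d := chart_at (pi p).
have ac : atlas c by exact: chart_at_atlas.
have ad : atlas d by exact: chart_at_atlas.
have cp : cdom c p by exact: chart_at_cdom.
have dp : cdom d (pi p) by exact: chart_at_cdom.
pose U := pidom pi c d; have oU : open U by exact: open_pidom.
have Ux : U (cfun c p) by exact: pidom_cfun.
have sm := chart_submetric pi_smooth g_metric gN_metric ac ad iso.
have sf := pimap_smooth pi_smooth ac ad.
have [sG symG uG PE] := sm.
pose f := pimap pi c d; pose G := tin c g; pose Q x := tin d gN (f x).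
have sQ : smx U Q.
  apply: (@smx_comp _ _ _ _ _ U (cimg d) f (tin d gN) oU (@open_cimg _ _ _ d)) => //.
    by move=> x; exact: pimap_cimg.
  exact: tin_smooth.
have sX : smx U (gradf f G) := smx_gradf oU sf sm.
have sD : smx U (pdmx f) := smx_pdmx oU sf.
pose Pi x := 1%:M - pdmx f x *m Q x *m gradf f G x.
have sPi : smx U Pi.
  exact: (smxB oU (@smx_cst _ _ _ _ _ _) (smxM oU (smxM oU sD sQ) sX)).
have uQ x : U x -> Q x \in unitmx by move=> /pimap_cimg; exact: tin_unit.
have PiD x : U x -> Pi x *m pdmx f x = 0 by move=> Ux'; apply: vprojD; [exact: uQ|exact: PE].
have [V0 [fV0 V0D]] := @vertical_basis k (pdmx f (cfun c p)).
have rk : \rank (pdmx f (cfun c p)) = k by rewrite -Dpi_def; exact: rank_Dpi.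
move: V0 fV0 V0D; rewrite rk => V0 fV0 V0D.
pose A x := V0 *m Pi x.
have sA : smx U A := smxM oU (@smx_cst _ _ _ _ _ _) sPi.
pose S x := A x *m G x *m (A x)^T.
(* The Gram matrix [S] is known to be symmetric on [U] only, whereas [smooth_cholesky] asks for
   symmetry at every [x]; [S'] agrees with [S] on [U]. *)
pose S' (x : 'rV[R]_m) : 'M[R]_(m - k) := 2^-1 *: (S x + (S x)^T).
have S'E x : U x -> S' x = S x.
  move=> Ux'; rewrite /S'; have -> : (S x)^T = S x.
    by rewrite /S; move: (A x) => a; rewrite !trmx_mul trmxK symG// mulmxA.
  have h : 2^-1 + 2^-1 = 1 :> R by field.
  by rewrite scalerDr -scalerDl h scale1r.
have sS : smx U S := smxM oU (smxM oU sA sG) (smx_tr oU sA).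
have sS' : smx U S' := eq_smx oU (fun x Ux' => esym (S'E x Ux')) sS.
have pS : posdef (S' (cfun c p)).
  rewrite S'E//; apply: posdef_congr; last by apply: tin_posdef => //; exact: cfun_cimg.
  by rewrite /A vproj_vertical.
have symS' x : (S' x)^T = S' x by rewrite /S' linearZ /= linearD /= trmxK addrC.
have [W [L [oW WU Wx sL LS]]] := smooth_cholesky oU Ux sS' symS' pS.
pose E (a : 'I_(m - k)) : vfield M := fun q => row a (L (cfun c q) *m A (cfun c q)) *m jac c (chart_at q) q.
have vE a q : cdom c q -> vin c (E a) (cfun c q) = row a (L (cfun c q) *m A (cfun c q)).
  move=> cq; rewrite vin_cfun// /E -mulmxA jacK ?mulmx1//; [exact: chart_at_atlas|exact: chart_at_cdom].
exists (cdom c `&` cfun c @^-1` W), E; split.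
- exact: open_chart_pullback.
- by split.
split.
- move=> a; apply: (@smooth_vfield_chart c) => //; first exact: open_chart_pullback.
  have oO : open (cimg c `&` cinv c @^-1` (cdom c `&` cfun c @^-1` W)).
    by apply: open_chart_preimage; exact: open_chart_pullback.
  have OW : cimg c `&` cinv c @^-1` (cdom c `&` cfun c @^-1` W) `<=` W.
    by move=> x [cx [_ /=]]; rewrite cinvK.
  have sAW : smx W A by move=> i j; apply: smooth_onW WU (sA i j).
  have sLA : smx W (fun x => row a (L x *m A x)) := smx_row oW a (smxM oW sL sAW).
  apply: (@eq_smx _ _ _ oO _ _ (fun x => row a (L x *m A x))).
    by move=> x [cx _]; rewrite -(cinvK cx) vE ?cinvK//; exact: cinv_cdom.
  by move=> i j; apply: smooth_onW OW (sLA i j).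
- move=> a q [cq Wq]; apply/verticalE.
  have Uq := WU _ Wq; have dq : cdom d (pi q) by case: Uq => _ /=; rewrite cfunK.
  apply/(vertical_Dpi (row a (L (cfun c q) *m A (cfun c q))) ac ad cq dq).
  by rewrite Dpi_def -row_mul -mulmxA /A -mulmxA PiD// !mulmx0 row0.
- move=> a b q [cq Wq]; rewrite /E /gdot.
  have Gq : G (cfun c q) = jac c (chart_at q) q *m g q *m (jac c (chart_at q) q)^T := tin_cfun g cq.
  have := LS _ Wq; rewrite (S'E _ (WU _ Wq)) /S Gq.
  have Uq := WU _ Wq.
  move=> /matrixP/(_ a b); rewrite [in RHS]mxE => <-.
  set B := L _ *m A _; set j := jac _ _ _.
  have -> : L (cfun c q) *m (A (cfun c q) *m (j *m g q *m j^T) *m (A (cfun c q))^T) *m (L (cfun c q))^T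
     = (B *m j) *m g q *m (B *m j)^T by rewrite /B !trmx_mul !mulmxA.
  rewrite -!row_mul; set Y := B *m j.
  by rewrite !mxE; apply: eq_bigr => s _; rewrite !mxE.
Qed.

End MeanCurvature.

Section MeanCurvatureCharts.
Variables (R : realType) (m k : nat) (M : manifold R m) (N : manifold R k) (pi : M -> N).
Implicit Types (p : M) (c : chart R M m) (d : chart R N k).
Variables (g : tensor2 M) (gN : tensor2 N).

Definition eta_in c d x : 'rV[R]_k := etaF (pimap pi c d) (tin d gN) (tin c g) x.

Hypothesis pi_smooth : smooth_map pi.
Hypotheses (g_metric : riemannian_metric g) (gN_metric : riemannian_metric gN).
Hypothesis rank_dpi : forall p, \rank (dpi pi p) = k.
Hypothesis iso : forall p, isometric_at pi g gN p.

Lemma gradmx_metric p : gradmx (g p) (dpi pi p) *m g p = (dpi pi p)^T.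
Proof. exact/gradmxG/(riem_unit g_metric). Qed.

Lemma Dpi_chart_at d p : atlas d -> cdom d (pi p) ->
  Dpi pi (chart_at p) d p = dpi pi p *m jac (chart_at (pi p)) d (pi p).
Proof.
move=> ad dp; rewrite dpiE//.
apply: (Dpi_changer pi_smooth) => //; first [exact: chart_at_atlas|exact: chart_at_cdom].
Qed.

Lemma hproj_Dpi d p (v : 'rV[R]_m) : atlas d -> cdom d (pi p) ->
  v *m hproj pi g p *m Dpi pi (chart_at p) d p = v *m Dpi pi (chart_at p) d p.
Proof.
move=> ad dp; rewrite Dpi_chart_at// (mulmxA (v *m hproj pi g p) (dpi pi p)) (mulmxA v (dpi pi p)).
have H := hprojD (riem_unit gN_metric (pi p)) (gradmx_metric p) (iso p) v.
exact: (congr1 (mulmx^~ _) H).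
Qed.

Lemma frame_value W E d p : open W -> W p -> @vertical_frame_on R m k M N pi g W E ->
  atlas d -> cdom d (pi p) ->
  (\sum_a levi_civita g (E a) (E a) p *m hproj pi g p) *m Dpi pi (chart_at p) d p =
  eta_in (chart_at p) d (pos_at p).
Proof.
move=> oW Wp [sE vE oE] ad dp.
pose c := chart_at p.
have ac : atlas c by exact: chart_at_atlas.
have cp : cdom c p by exact: chart_at_cdom.
have sm := chart_submetric pi_smooth g_metric gN_metric ac ad iso.
have sf := pimap_smooth pi_smooth ac ad.
have oU := @open_pidom _ _ _ _ _ _ pi_smooth c d.
have Ux : pidom pi c d (cfun c p) by exact: pidom_cfun.
have [sG symG uG PE] := sm.
pose O := cimg c `&` cinv c @^-1` (W `&` pi @^-1` cdom d).
have oO : open O.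
  apply: open_chart_preimage; apply: openI => //.
  by apply: (open_pi_preimage pi_smooth); exact: open_cdom.
have Ox : O (cfun c p) by split; [exact: cfun_cimg|rewrite /= cfunK].
have OU : O `<=` pidom pi c d by move=> x [cx [_ dx]].
pose e a := vin c (E a).
have e_at a : e a (cfun c p) = E a p by exact: vin_chart_at.
have se a : smx O (e a).
  move=> i j; rewrite ord1 /e vin_def; have H := sE a c ac j.
  by apply: smooth_onW H => x [cx [Wx _]].
have eD a x : O x -> e a x *m pdmx (pimap pi c d) x = 0.
  move=> [cx [Wx dx]]; have cq := cinv_cdom cx.
  have := (vin_vertical pi_smooth (E a) ac ad cq dx).2 ((verticalE pi _ _).1 (vE a _ Wx)).
  by rewrite Dpi_def cinvK.
have BE : \sum_a (e a (cfun c p))^T *m e a (cfun c p) =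
    vcometric (tin c g (cfun c p)) (pdmx (pimap pi c d) (cfun c p)) (tin d gN (pimap pi c d (cfun c p))).
  pose Em := \matrix_a e a (cfun c p).
  have -> : \sum_a (e a (cfun c p))^T *m e a (cfun c p) = Em^T *m Em.
    apply/matrixP => i j; rewrite summxE [RHS]mxE; apply: eq_bigr => a _.
    by rewrite mxE big_ord1 !mxE.
  have kd := pimap_cimg Ux.
  have := PE _ Ux; rewrite /gradf => PE'.
  apply: (frame_vcometric (symG _ Ux) (uG _ Ux) (tin_sym gN_metric kd) (tin_unit gN_metric ad kd) PE').
  - by rewrite subnK// -(rank_dpi p) rank_leq_row.
  - apply/matrixP => a b; rewrite [RHS]mxE -(oE a b p Wp) /gdot.
    have -> : g p = tin c g (cfun c p) by exact: (esym (tin_chart_at g p)).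
    rewrite -!e_at !mxE; apply: eq_bigr => s _; rewrite !mxE; congr (_ * _).
    by apply: eq_bigr => t _; rewrite mxE.
  - by apply/row_matrixP => a; rewrite row_mul rowK row0; exact: eD.
have H := frame_eta oU (@open_cimg _ _ _ d) (@pimap_cimg _ _ _ _ _ pi c d) (pimap_smooth pi_smooth ac ad)
  (tin_smooth gN_metric ad) (fun y => @tin_unit _ _ _ _ gN_metric d y ad) sm oO Ox OU se eD BE.
rewrite mulmx_suml; apply: (etrans _ H); apply: eq_bigr => a _.
rewrite hproj_Dpi// -/c -Dpi_def; congr (_ *m _).
by rewrite /levi_civita -/c -/(pos_at p) -vin_def -tin_def -!/(e a) !e_at.
Qed.

(** The choice made by [xget] is harmless: a local frame exists, and every candidate is horizontal
    with the same image under [dpi]. These two facts are all that is used of the mean curvature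
    afterwards. *)
Lemma mean_curvature_spec p : (mean_curvature pi g p <= horizontal pi g p)%MS /\
  forall d, atlas d -> cdom d (pi p) ->
  mean_curvature pi g p *m Dpi pi (chart_at p) d p = eta_in (chart_at p) d (pos_at p).
Proof.
have [W [E [oW Wp fE]]] := vertical_frame_exists pi_smooth g_metric gN_metric rank_dpi iso p.
have : [set H | exists W E, [/\ open W, W p, @vertical_frame_on R m k M N pi g W E &
        H = \sum_a levi_civita g (E a) (E a) p *m hproj pi g p]] (mean_curvature pi g p).
  by apply: xgetPex; exists (\sum_a levi_civita g (E a) (E a) p *m hproj pi g p), W, E.
move=> [W' [E' [oW' Wp' fE' ->]]]; split.
  apply: summx_sub => a _; exact: proj_mx_sub.
by move=> d ad dp; exact: (frame_value oW' Wp' fE' ad dp).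
Qed.

(** The vector itself stays in its preferred chart; only [eta_in] is moved to an arbitrary chart of
    [M], by invariance of the divergence. *)
Lemma mean_curvature_eta c d p : atlas c -> atlas d -> cdom c p -> cdom d (pi p) ->
  mean_curvature pi g p *m Dpi pi (chart_at p) d p = eta_in c d (cfun c p).
Proof.
move=> ac ad cp dp; have [_ HS] := mean_curvature_spec p.
apply: (etrans (HS d ad dp)); clear HS.
pose c' := chart_at p.
have ac' : atlas c' by exact: chart_at_atlas.
have cp' : cdom c' p by exact: chart_at_cdom.
pose U := cimg c `&` cinv c @^-1` (cdom c' `&` pi @^-1` cdom d).
have oU : open U.
  by apply: open_chart_preimage; apply: openI; [exact: open_cdom|exact/(open_pi_preimage pi_smooth)/open_cdom].
have oU' := @open_pidom _ _ _ _ _ _ pi_smooth c' d.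
have Ux : U (cfun c p) by split; [exact: cfun_cimg|rewrite /= cfunK].
have phiU x : U x -> pidom pi c' d ((cfun c' \o cinv c) x).
  by move=> [cx [cx' dx]]; apply: pidom_cfun.
have sphi : smx U (cfun c' \o cinv c).
  by move=> i j; apply: smooth_onW (transition_smx ac ac' i j) => x [? []].
have sf : smx U (pimap pi c d).
  by move=> i j; apply: smooth_onW (pimap_smooth pi_smooth ac ad i j) => x [? []].
have pJ x : U x -> pdmx (cfun c' \o cinv c) x = jac c c' (cinv c x).
  move=> [cx [cx' _]]; rewrite -{1}(cinvK cx).
  by apply: pdmx_transition => //; exact: cinv_cdom.
have sub : submetric U (pimap pi c d) (tin d gN) (tin c g).
  have [sG symG uG PE] := chart_submetric pi_smooth g_metric gN_metric ac ad iso.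
  have UU : U `<=` pidom pi c d by move=> x [cx [_ dx]].
  split; first by move=> i j; exact: smooth_onW UU (sG i j).
  - by move=> x /UU; exact: symG.
  - by move=> x /UU; exact: uG.
  - by move=> x /UU; exact: PE.
have H := @etaF_change _ _ _ U (pidom pi c' d) (cfun c' \o cinv c) (pimap pi c d) (pimap pi c' d)
  (tin d gN) (tin c g) (tin c' g) oU oU' phiU sphi sf (pimap_smooth pi_smooth ac' ad) _ _ sub
  (chart_submetric pi_smooth g_metric gN_metric ac' ad iso) _ (cfun c p) Ux.
have E : (cfun c' \o cinv c) (cfun c p) = pos_at p by rewrite /= cfunK.
apply: (etrans (esym (congr1 (eta_in c' d) E))); apply: esym; apply: H.
- move=> x Ux'; rewrite pJ//; case: Ux' => cx [cx' _]; apply: jac_unit => //; exact: cinv_cdom.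
- by move=> x [cx [cx' _]]; rewrite /pimap /= cfunK.
- move=> x Ux'; rewrite pJ//; case: Ux' => cx [cx' _].
  rewrite -{1}(cinvK cx); apply: (tin_jac g ac ac') => //; exact: cinv_cdom.
Qed.

Lemma base_metric_jac d p : atlas d -> cdom d (pi p) ->
  gN (pi p) = jac (chart_at (pi p)) d (pi p) *m tin d gN (cfun d (pi p)) *m (jac (chart_at (pi p)) d (pi p))^T.
Proof.
move=> ad dp; rewrite -[LHS]tin_chart_at.
by apply: tin_jac => //; first [exact: chart_at_atlas|exact: chart_at_cdom].
Qed.

Lemma norm_mean_curvature c d p : atlas c -> atlas d -> cdom c p -> cdom d (pi p) ->
  gdot (g p) (mean_curvature pi g p) (mean_curvature pi g p) =
  gdot (tin d gN (cfun d (pi p))) (eta_in c d (cfun c p)) (eta_in c d (cfun c p)).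
Proof.
move=> ac ad cp dp; have [hH _] := mean_curvature_spec p.
rewrite (horizontal_isometry (riem_sym g_metric p) (riem_unit g_metric p)
  (riem_sym gN_metric (pi p)) (riem_unit gN_metric (pi p)) (gradmx_metric p) (iso p) hH hH).
rewrite -(mean_curvature_eta ac ad cp dp) Dpi_chart_at//.
rewrite (base_metric_jac ad dp) (mulmxA _ (dpi pi p)).
exact: gdot_congr.
Qed.

Lemma vin_mean_curvature c d p : atlas c -> atlas d -> cdom c p -> cdom d (pi p) ->
  vin c (mean_curvature pi g) (cfun c p) =
  eta_in c d (cfun c p) *m tin d gN (cfun d (pi p)) *m gradmx (tin c g (cfun c p)) (Dpi pi c d p).
Proof.
move=> ac ad cp dp; have [hH _] := mean_curvature_spec p.
have HE := horizontalE (riem_sym g_metric p) (riem_unit g_metric p)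
  (riem_sym gN_metric (pi p)) (riem_unit gN_metric (pi p)) (gradmx_metric p) (iso p) hH.
rewrite vin_cfun// -(mean_curvature_eta ac ad cp dp) Dpi_chart_at//.
set H := mean_curvature pi g p in HE *; set j := jac (chart_at (pi p)) d (pi p).
have DE : Dpi pi c d p = jac c (chart_at p) p *m (dpi pi p *m j) by rewrite Dpi_dpi// mulmxA.
have uJ : jac c (chart_at p) p \in unitmx.
  by apply: jac_unit => //; [exact: chart_at_atlas|exact: chart_at_cdom].
have E2 := etrans (gradmx_congr (dpi pi p *m j) uJ (riem_unit g_metric p)) (gradmx_mulr _ _ _).
rewrite {1}HE (base_metric_jac ad dp) -/j (tin_cfun g cp) DE.
have -> : gradmx (jac c (chart_at p) p *m g p *m (jac c (chart_at p) p)^T) (jac c (chart_at p) p *m (dpi pi p *m j))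
    = j^T *m gradmx (g p) (dpi pi p) *m jac (chart_at p) c p.
  apply: (can_inj (mulmxK uJ)); rewrite E2 -(mulmxA _ (jac (chart_at p) c p)) jacK ?mulmx1//; [exact: chart_at_atlas|exact: chart_at_cdom].
by rewrite !mulmxA.
Qed.

End MeanCurvatureCharts.

(** * First variation *)

Section ParametricIntegral.
Variables (R : realType) (m : nat).

Definition tdom (eps : R) (U : set 'rV[R]_m) : set 'rV[R]_(1 + m) :=
  [set v | `|lsubmx v 0 0| < eps /\ U (rsubmx v)].

Definition tpair (t : R) (x : 'rV[R]_m) : 'rV[R]_(1 + m) := row_mx (t%:M : 'rV_1) x.

Lemma lsub_tpair t x : lsubmx (tpair t x) 0 0 = t.
Proof. by rewrite row_mxKl mxE eqxx mulr1n. Qed.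

Lemma rsub_tpair t x : rsubmx (tpair t x) = x.
Proof. by rewrite row_mxKr. Qed.

Lemma tdom_tpair eps U t x : `|t| < eps -> U x -> tdom eps U (tpair t x).
Proof. by move=> te Ux; split; rewrite ?lsub_tpair ?rsub_tpair. Qed.

Lemma coord_smooth n (O : set 'rV[R]_n) j : smooth_on O (fun x => x 0 j).
Proof. by move=> k; exact: Ck_coord. Qed.

Lemma lsubmx_smooth (O : set 'rV[R]_(1 + m)) : smooth_on O (fun v => lsubmx v 0 0).
Proof.
have -> : (fun v : 'rV[R]_(1 + m) => lsubmx v 0 0) = (fun v => v 0 (lshift m 0)).
  by apply/funext => v; rewrite mxE.
exact: coord_smooth.
Qed.

Lemma rsubmx_smooth (O : set 'rV[R]_(1 + m)) : smx O (fun v : 'rV[R]_(1 + m) => rsubmx v).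
Proof.
move=> i j; rewrite ord1.
have -> : (fun v : 'rV[R]_(1 + m) => rsubmx v 0 j) = (fun v => v 0 (rshift 1 j)).
  by apply/funext => v; rewrite mxE.
exact: coord_smooth.
Qed.

Lemma open_tdom eps U : open U -> open (tdom eps U).
Proof.
move=> oU; rewrite openE => v [ve Uv]; rewrite /interior.
have c1 : {for v, continuous (fun v : 'rV[R]_(1 + m) => `|lsubmx v 0 0|)}.
  apply: (@continuous_comp _ _ _ (fun v : 'rV[R]_(1 + m) => lsubmx v 0 0) (fun t : R => `|t|) v).
    exact: (smooth_on_continuous (lsubmx_smooth setT) I).
  exact: norm_continuous.
have c2 : {for v, continuous (fun v : 'rV[R]_(1 + m) => rsubmx v)}.
  apply: (@continuous_mx_coord _ _ _ _ (fun v : 'rV[R]_(1 + m) => rsubmx v)) => i j.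
  exact: (smooth_on_continuous (rsubmx_smooth setT i j) I).
apply: filterI.
  have nb : nbhs `|lsubmx v 0 0| [set y | y < eps] by apply: open_nbhs_nbhs; split=> //; exact: open_lt.
  exact: (c1 _ nb).
exact: (c2 _ (open_nbhs_nbhs (conj oU Uv))).
Qed.

Lemma tpair_slice_smooth eps U t (h : 'rV[R]_(1 + m) -> R) : open U -> `|t| < eps ->
  smooth_on (tdom eps U) h -> smooth_on U (fun x => h (tpair t x)).
Proof.
move=> oU te sh k; apply: (@Ck_comp _ _ _ _ U (tdom eps U) (tpair t) h) => //.
- exact: open_tdom.
- by move=> x Ux; exact: tdom_tpair.
- move=> j; have [[i ->]|[i ->]] := ord_lrshift j.
    have -> : (fun y : 'rV[R]_m => tpair t y 0 (lshift m i)) = (fun=> t).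
      by apply/funext => y; rewrite /tpair row_mxEl ord1 mxE eqxx mulr1n.
    exact: Ck_cst.
  have -> : (fun y : 'rV[R]_m => tpair t y 0 (rshift 1 i)) = (fun y => y 0 i).
    by apply/funext => y; rewrite /tpair row_mxEr.
  exact: Ck_coord.
Qed.

Variables (eps : R) (U L : set 'rV[R]_m).
Hypotheses (eps0 : 0 < eps) (oU : open U) (cL : compact L) (LU : L `<=` U).

Let clL : closed L. Proof. exact: compact_closed_rV. Qed.

(** One radius for all functions supported in [L], so that several of them can be added and a whole
    time family can be differentiated. *)
Lemma ccont_restrict_open : exists2 r, 0 < r & forall h : 'rV[R]_m -> R,
  (forall x, U x -> {for x, continuous h}) -> (forall x, U x -> ~ L x -> h x = 0) -> ccont r (h \_ U).
Proof.
have [r [[r0 _ _] Lr]] := ccont_compact cL (@cst_continuous _ R 0) (fun _ _ => erefl).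
exists r => // h ch h0; have [ch' h0'] := continuous_restrict_compact oU clL LU ch h0.
by split=> // x rx; apply: h0' => /Lr; rewrite leNgt rx.
Qed.

Lemma restrict_pderive (f : 'rV[R]_m -> R) i : smooth_on U f -> (forall x, U x -> ~ L x -> f x = 0) ->
  (forall x, is_derive x 'e_i (f \_ U) (('D_('e_i) f \_ U) x)) /\
  (forall x, U x -> ~ L x -> 'D_('e_i) f x = 0).
Proof.
move=> sf f0.
have D0 x : U x -> ~ L x -> 'D_('e_i) f x = 0.
  move=> Ux Lx; have oUL : open (U `&` ~` L) by apply: openI => //; exact: closed_openC.
  rewrite (@D_near_eq _ _ _ oUL _ f (fun=> 0)); first exact: derive_cst.
    by move=> y [Uy Ly]; exact: f0.
  by [].
split=> // x; have [Ux|NU] := pselect (U x).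
  rewrite patchE mem_set//.
  apply: (@near_eq_is_derive _ _ _ f); last exact: (smooth_on_derive oU 'e_i sf Ux).
  by apply: filterS (open_nbhs_near oU Ux) => y Uy; rewrite patchE mem_set.
have -> : ('D_('e_i) f \_ U) x = 0 by rewrite patchE memNset.
apply: (@near_eq_is_derive _ _ _ (fun _ : 'rV[R]_m => (0 : R))).
have nL : nbhs x (~` L).
  by apply: open_nbhs_nbhs; split; [exact: closed_openC|move=> /LU].
apply: filterS nL => y Ly; rewrite patchE; case: ifP => // /set_mem Uy.
by rewrite f0.
Qed.

Lemma integral_pderive_restrict (f : 'rV[R]_m -> R) i : smooth_on U f ->
  (forall x, U x -> ~ L x -> f x = 0) -> integral_Rn ('D_('e_i) f \_ U) = 0.
Proof.
move=> sf f0; have [r r0 H] := ccont_restrict_open; have [dF D0] := restrict_pderive i sf f0.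
have E : 'D_('e_i) (f \_ U) = ('D_('e_i) f \_ U).
  by apply/funext => x; case: (dF x) => _ ->.
rewrite -E; apply: (@integral_Rn_pderive _ _ r).
- by apply: H => // x Ux; exact: smooth_on_continuous sf Ux.
- by move=> x; case: (dF x).
- rewrite E; have [] // := H ('D_('e_i) f) _ D0.
  by move=> x Ux; exact: (smooth_on_continuous (smooth_pderive i sf) Ux).
Qed.

Lemma integral_param_derive (h : 'rV[R]_(1 + m) -> R) : smooth_on (tdom eps U) h ->
  (forall v, tdom eps U v -> ~ L (rsubmx v) -> h v = 0) ->
  is_derive (0 : R) (1 : R) (fun t => integral_Rn ((fun x => h (tpair t x)) \_ U))
    (integral_Rn ((fun x => 'D_('e_(lshift m 0)) h (tpair 0 x)) \_ U)).
Proof.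
move=> sh h0; have [r r0 H] := ccont_restrict_open.
have oT : open (tdom eps U) := @open_tdom eps U oU.
pose dh := 'D_('e_(lshift m 0)) h.
have sdh : smooth_on (tdom eps U) dh := smooth_pderive (lshift m 0) sh.
have zero0 : `|0 : R| < eps by rewrite normr0.
have near0 : \forall t \near (0 : R), `|t| < eps.
  have : nbhs (0 : R) (ball (0 : R) eps) by exact: nbhsx_ballx.
  by apply: filterS => t; rewrite -ball_normE /= sub0r normrN.
have hd t x : `|t| < eps -> U x -> is_derive t (1 : R) (fun s => h (tpair s x)) (dh (tpair t x)).
  move=> te Ux; apply/is_derive_slicel.
  by apply: (smooth_on_derive oT _ sh); exact: tdom_tpair.
have dh0 t x : `|t| < eps -> U x -> ~ L x -> dh (tpair t x) = 0.
  move=> te Ux Lx; case: (hd t x te Ux) => _ <-.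
  rewrite (@near_eq_derive _ _ _ _ (fun=> 0)); first exact: derive_cst.
  have : nbhs t (ball t (eps - `|t|)) by apply: nbhsx_ballx; rewrite subr_gt0.
  apply: filterS => s; rewrite -ball_normE /= => ts; apply: h0; last by rewrite rsub_tpair.
  apply: tdom_tpair => //; rewrite -(subrK t s); apply: le_lt_trans (ler_normD _ _) _.
  by rewrite -ltrBrDr distrC.
apply: (@integral_Rn_derive _ _ (fun t => (fun x => h (tpair t x)) \_ U)
   (fun t => (fun x => dh (tpair t x)) \_ U) 0 r).
- apply: filterS near0 => t te; apply: H.
    move=> x Ux; exact: (smooth_on_continuous (tpair_slice_smooth oU te sh) Ux).
  move=> x Ux Lx; apply: h0; [exact: tdom_tpair|by rewrite rsub_tpair].
- apply: filterS near0 => t te x; rewrite /patch.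
  case: ifP => [/set_mem Ux|_]; first exact: hd.
  exact: is_derive_cst.
- have [] // := H (fun x => dh (tpair 0 x)) _ _.
    move=> x Ux; exact: (smooth_on_continuous (tpair_slice_smooth oU zero0 sdh) Ux).
  by move=> x Ux Lx; exact: dh0.
- move=> v; have [Uv|NU] := pselect (U v).
    apply: (@continuous_near_eq _ _ (fun p : R * 'rV[R]_m => dh (tpair p.1 p.2))).
      have : nbhs v U by exact: open_nbhs_near.
      move=> nU; exists ([set: R], U); first by split=> //=; exact: filterT.
      by move=> [s x] [_ /= Ux]; rewrite patchE mem_set.
    apply: (@continuous_comp _ _ _ (fun p : R * 'rV[R]_m => tpair p.1 p.2) dh (0, v)).
      exact: row_mx_continuous.
    by apply: smooth_on_continuous sdh _; exact: tdom_tpair.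
  apply: (@continuous_near_eq _ _ (fun=> 0)); last exact: cst_continuous.
  have nL : nbhs v (~` L).
    by apply: open_nbhs_nbhs; split; [exact: closed_openC|move=> /LU].
  exists ([set s : R | `|s| < eps], ~` L); first by split.
  move=> [s x] [/= se Lx]; rewrite /patch; case: ifP => // /set_mem Ux.
  by rewrite dh0.
Qed.

End ParametricIntegral.

(** * First variation in one chart *)

Section LocalVariation.
Variables (R : realType) (m k : nat).
Variables (U L : set 'rV[R]_m) (V : set 'rV[R]_k) (f : 'rV[R]_m -> 'rV[R]_k) (Q : 'rV[R]_k -> 'M[R]_k).
Hypotheses (oU : open U) (oV : open V) (fUV : forall x, U x -> V (f x)) (sf : smx U f) (sQ : smx V Q).
Hypotheses (symQ : forall y, V y -> (Q y)^T = Q y) (uQ : forall y, V y -> Q y \in unitmx).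
Hypotheses (cL : compact L) (LU : L `<=` U).
Variables (eps : R) (G : R -> 'rV[R]_m -> 'M[R]_m) (chi : 'rV[R]_m -> R).
Hypotheses (eps0 : 0 < eps).
Hypothesis sGv : smx (tdom eps U) (fun v => G (lsubmx v 0 0) (rsubmx v)).
Hypothesis subG : forall t, `|t| < eps -> submetric U f Q (G t).
Hypothesis detG : forall t x, `|t| < eps -> U x -> \det (G t x) = \det (G 0 x).
Hypothesis detG0 : forall x, U x -> 0 < \det (G 0 x).
Hypotheses (schi : smooth_on U chi) (chi0 : forall x, U x -> ~ L x -> chi x = 0).

Let Om := tdom eps U.
Let oOm : open Om. Proof. exact: open_tdom. Qed.
Let zero0 : `|0 : R| < eps. Proof. by rewrite normr0. Qed.
Let sub0 : submetric U f Q (G 0). Proof. exact: subG. Qed.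

Lemma smx_rsub (F : 'rV[R]_m -> R) : smooth_on U F -> smooth_on Om (fun v => F (rsubmx v)).
Proof.
move=> sF n; apply: (@Ck_comp _ _ _ _ Om U (fun v : 'rV[R]_(1 + m) => rsubmx v) F) => //.
- by move=> v [].
- by move=> j; exact: rsubmx_smooth.
Qed.

Definition gradv (v : 'rV[R]_(1 + m)) : 'M[R]_(k, m) := gradf f (G (lsubmx v 0 0)) (rsubmx v).

Lemma gradv_smooth : smx Om gradv.
Proof.
have s1 : smx Om (fun v => pdmx f (rsubmx v)).
  by move=> i j; exact: (smx_rsub (smx_pdmx oU sf i j)).
apply: (smxM oOm (smx_tr oOm s1) (smx_inv oOm _ sGv)).
by move=> v [te Uv]; have [_ _ uG _] := subG te; exact: uG.
Qed.

(** The initial velocity of the gradients of the components of [f]: the field [Z] of the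
    overview. *)
Definition gradd x : 'M[R]_(k, m) := 'D_('e_(lshift m 0)) gradv (tpair 0 x).

Lemma D_slice (h : 'rV[R]_(1 + m) -> R) t x s : `|t| < eps -> U x -> smooth_on Om h ->
  'D_('e_(rshift 1 s)) h (tpair t x) = 'D_('e_s) (fun y => h (tpair t y)) x.
Proof.
move=> te Ux sh.
have H := smooth_on_derive oOm 'e_(rshift 1 s) sh (tdom_tpair te Ux).
by have /is_derive_slicer[_ ->] := H.
Qed.

Lemma graddE x a s : U x -> gradd x a s = 'D_('e_(lshift m 0)) (fun v => gradv v a s) (tpair 0 x).
Proof. by move=> Ux; exact: (D_mxE oOm 'e_(lshift m 0) a s gradv_smooth (tdom_tpair zero0 Ux)). Qed.

Lemma gradd_smooth : smx U gradd.
Proof.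
move=> a s; apply: (@eq_smooth_on _ _ _ oU (fun x => 'D_('e_(lshift m 0)) (fun v => gradv v a s) (tpair 0 x))).
  by move=> x Ux; rewrite graddE.
apply: (@tpair_slice_smooth _ _ eps U 0 ('D_('e_(lshift m 0)) (fun v => gradv v a s)) oU zero0).
exact: smooth_pderive (gradv_smooth a s).
Qed.

Let X0 := gradf f (G 0).
Let sX0 : smx U X0. Proof. exact: (smx_gradf oU sf sub0). Qed.
Let eta0 := etaF f Q (G 0).
Let seta0 : smx U eta0. Proof. exact: (etaF_smooth oU oV fUV sf sQ uQ sub0). Qed.
Let tau x s := 2^-1 * \tr (invmx (G 0 x) *m 'D_('e_s) (G 0) x).

Let stau s : smooth_on U (fun x => tau x s).
Proof.
have [sG0 _ uG0 _] := sub0; apply: (smooth_onM oU (smooth_on_cst _ _)).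
exact: (smooth_mxtrace oU (smxM oU (smx_inv oU uG0 sG0) (smx_pderive oU s sG0))).
Qed.

(** As the determinant is constant in time, all divergences can be taken with the density of time 0.
    Written in this way [etaF] is smooth in time and space together, and time enters only through
    [gradv]. *)
Let etav (v : 'rV[R]_(1 + m)) a := eta0 (rsubmx v) 0 a
  - (\sum_s ('D_('e_(rshift 1 s)) (fun w => gradv w a s) v - 'D_('e_s) (fun y => X0 y a s) (rsubmx v))
     + \sum_s (gradv v a s - X0 (rsubmx v) a s) * tau (rsubmx v) s).

Let setav a : smooth_on Om (fun v => etav v a).
Proof.
apply: (smooth_onB oOm (smx_rsub (seta0 0 a))); apply: (smooth_onD oOm).
  apply: (smooth_on_sum oOm) => s _; apply: (smooth_onB oOm).
    exact: smooth_pderive (gradv_smooth a s).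
  exact: (smx_rsub (smooth_pderive s (sX0 a s))).
apply: (smooth_on_sum oOm) => s _; apply: (smooth_onM oOm).
  exact: (smooth_onB oOm (gradv_smooth a s) (smx_rsub (sX0 a s))).
exact: (smx_rsub (stau s)).
Qed.

Let etavE t x a : `|t| < eps -> U x -> etav (tpair t x) a = etaF f Q (G t) x 0 a.
Proof.
move=> te Ux; rewrite /etav rsub_tpair.
have E := etaF_variation oU sf sub0 (subG te) Ux (fun y Uy => detG te Uy).
have {}E : etaF f Q (G t) x 0 a - eta0 x 0 a = - ldiv (G 0) (fun y => row a (gradf f (G t) y) - row a (X0 y)) x.
  have /rowP/(_ a) := E; rewrite [in X in X -> _]mxE [X in _ + X = _ -> _]mxE => ->.
  by rewrite mxE; congr (- _); exact: mxE.
have rowB (A B : 'M[R]_(k, m)) b s : (row b A - row b B) 0 s = A b s - B b s by rewrite !mxE.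
have gen (p q r z : R) : q - p = - r -> z = r -> p - z = q.
  by move=> h ->; rewrite -h addrC subrK.
apply: (gen _ _ _ _ E); clear E.
rewrite /ldiv mulr_sumr; congr (_ + _).
  rewrite /mxtrace; apply: eq_bigr => s _.
  rewrite (D_slice s te Ux (gradv_smooth a s)) [RHS]mxE.
  have E1 : (fun y => gradv (tpair t y) a s) = (fun y => gradf f (G t) y a s).
    by apply/funext => y; rewrite /gradv lsub_tpair rsub_tpair.
  rewrite E1.
  have H1 := smooth_on_derive oU 'e_s (smx_gradf oU sf (subG te) a s) Ux.
  have H2 := smooth_on_derive oU 'e_s (sX0 a s) Ux.
  have [_ H] := is_deriveB H1 H2.
  apply: (etrans (esym H)); apply: (congr1 (fun h => 'D_('e_s) h x)); apply/funext => y.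
  exact: (esym (rowB _ _ _ _)).
apply: eq_bigr => s _; rewrite [RHS]mulrCA; congr (_ * _).
rewrite /gradv lsub_tpair rsub_tpair; exact: (esym (rowB _ _ _ _)).
Qed.

Let detav x a : U x ->
  'D_('e_(lshift m 0)) (fun v => etav v a) (tpair 0 x) = - ldiv (G 0) (fun y => row a (gradd y)) x.
Proof.
move=> Ux.
have H := smooth_on_derive oOm 'e_(lshift m 0) (setav a) (tdom_tpair zero0 Ux).
have /is_derive_slicel Hs := H.
have H1 s : is_derive (0 : R) (1 : R) (fun t => 'D_('e_(rshift 1 s)) (fun w => gradv w a s) (tpair t x)
     - 'D_('e_s) (fun y => X0 y a s) x) ('D_('e_s) (fun y => gradd y a s) x).
  have sD := smooth_pderive (rshift 1 s) (gradv_smooth a s).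
  have /is_derive_slicel Hd := smooth_on_derive oOm 'e_(lshift m 0) sD (tdom_tpair zero0 Ux).
  have E : 'D_('e_(lshift m 0)) ('D_('e_(rshift 1 s)) (fun w => gradv w a s)) (tpair 0 x)
      = 'D_('e_s) (fun y => gradd y a s) x.
    rewrite (pderiveC _ _ oOm (tdom_tpair zero0 Ux) (gradv_smooth a s 2%N)).
    have sL := smooth_pderive (lshift m 0) (gradv_smooth a s).
    rewrite (D_slice s zero0 Ux sL).
    by apply: (D_near_eq oU 'e_s _ Ux) => y Uy; rewrite graddE.
  rewrite E in Hd.
  apply: (is_derive_cast (is_deriveB Hd (is_derive_cst ('D_('e_s) (fun y => X0 y a s) x) _ _))).
  by rewrite subr0.
have H2 s : is_derive (0 : R) (1 : R) (fun t => (gradv (tpair t x) a s - X0 x a s) * tau x s) (gradd x a s * tau x s).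
  have /is_derive_slicel Hd := smooth_on_derive oOm 'e_(lshift m 0) (gradv_smooth a s) (tdom_tpair zero0 Ux).
  rewrite -(graddE a s Ux) in Hd.
  have Hb := is_deriveB Hd (is_derive_cst (X0 x a s) (0 : R) (1 : R)).
  apply: (is_derive_cast (is_deriveMr Hb (is_derive_cst (tau x s) (0 : R) (1 : R)))).
  by rewrite mulr0 addr0 subr0.
have Hall := is_deriveB (is_derive_cst (eta0 x 0 a) (0 : R) (1 : R))
   (is_deriveD (is_derive_sumr H1) (is_derive_sumr H2)).
have [_ E1] := Hs; have [_ E2] := Hall.
have EF : (fun t => etav (tpair t x) a) = (cst (eta0 x 0 a) -
   ((fun t => \sum_s ('D_('e_(rshift 1 s)) (fun w => gradv w a s) (tpair t x) - 'D_('e_s) (fun y => X0 y a s) x))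
   + (fun t => \sum_s (gradv (tpair t x) a s - X0 x a s) * tau x s))).
  by apply/funext => t; rewrite /etav rsub_tpair.
apply: (etrans (esym E1)); apply: (etrans (congr1 (fun h => 'D_(1 : R) h (0 : R)) EF)).
apply: (etrans E2); rewrite sub0r /ldiv mulr_sumr; congr (- (_ + _)).
  rewrite /mxtrace; apply: eq_bigr => s _; rewrite [RHS]mxE.
  by apply: (congr1 (fun h => 'D_('e_s) h x)); apply/funext => y; rewrite mxE.
by apply: eq_bigr => s _; rewrite [RHS]mulrCA; congr (_ * _); rewrite mxE.
Qed.

Lemma gdotE n (A : 'M[R]_n) (u v : 'rV[R]_n) : gdot A u v = \sum_a \sum_b u 0 a * A a b * v 0 b.
Proof.
rewrite /gdot mxE exchange_big /=; apply: eq_bigr => b _.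
rewrite mxE mulr_suml; apply: eq_bigr => a _; by rewrite [v^T _ _]mxE.
Qed.

Let w x := Num.sqrt (\det (G 0 x)).
Let y x : 'rV[R]_k := eta0 x *m Q (f x).

Let sw : smooth_on U w.
Proof. by have [sG0 _ _ _] := sub0; exact: (smooth_on_sqrt oU detG0 (smooth_on_det oU sG0)). Qed.

Let sQf : smx U (fun x => Q (f x)).
Proof. exact: (smx_comp oU oV fUV sf sQ). Qed.

Let sy : smx U y. Proof. exact: (smxM oU seta0 sQf). Qed.

Let hv v := chi (rsubmx v) * (\sum_a \sum_b etav v a * Q (f (rsubmx v)) a b * etav v b) * w (rsubmx v).

Let shv : smooth_on Om hv.
Proof.
apply: (smooth_onM oOm _ (smx_rsub sw)); apply: (smooth_onM oOm (smx_rsub schi)).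
apply: (smooth_on_sum oOm) => a _; apply: (smooth_on_sum oOm) => b _.
exact: (smooth_onM oOm (smooth_onM oOm (setav a) (smx_rsub (sQf a b))) (setav b)).
Qed.

Let Dhv x : U x -> 'D_('e_(lshift m 0)) hv (tpair 0 x) =
  - 2 * (chi x * (\sum_a y x 0 a * ldiv (G 0) (fun z => row a (gradd z)) x) * w x).
Proof.
move=> Ux; have T0 := tdom_tpair zero0 Ux.
have /is_derive_slicel[_ E1] := smooth_on_derive oOm 'e_(lshift m 0) shv T0.
pose d a := - ldiv (G 0) (fun z => row a (gradd z)) x.
have Ha a : is_derive (0 : R) (1 : R) (fun t => etav (tpair t x) a) (d a).
  have /is_derive_slicel := smooth_on_derive oOm 'e_(lshift m 0) (setav a) T0.
  by rewrite (detav a Ux).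
have e0 a : etav (tpair 0 x) a = eta0 x 0 a by rewrite (etavE a zero0 Ux).
have Hab a b : is_derive (0 : R) (1 : R) (fun t => etav (tpair t x) a * Q (f x) a b * etav (tpair t x) b)
    (d a * Q (f x) a b * eta0 x 0 b + eta0 x 0 a * Q (f x) a b * d b).
  have H1 := is_deriveMr (Ha a) (is_derive_cst (Q (f x) a b) (0 : R) (1 : R)).
  apply: (is_derive_cast (is_deriveMr H1 (Ha b))).
  by rewrite /= mulr0 addr0 !e0.
have Hs := is_derive_sumr (fun a => is_derive_sumr (Hab a)).
have H2 := is_deriveMr (is_deriveMr (is_derive_cst (chi x) (0 : R) (1 : R)) Hs) (is_derive_cst (w x) (0 : R) (1 : R)).
have [_ E2] := H2.
apply: (etrans (esym E1)).
have EF : (fun t => hv (tpair t x)) = (fun t => cst (chi x) t * (\sum_a \sum_b etav (tpair t x) a * Q (f x) a b * etav (tpair t x) b) * cst (w x) t).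
  by apply/funext => t; rewrite /hv rsub_tpair.
apply: (etrans (congr1 (fun h => 'D_(1 : R) h (0 : R)) EF)); apply: (etrans E2).
rewrite /= mulr0 addr0 mul0r add0r.
have -> : \sum_a \sum_b (d a * Q (f x) a b * eta0 x 0 b + eta0 x 0 a * Q (f x) a b * d b) =
   2 * \sum_b y x 0 b * d b.
  have S1 : \sum_a \sum_b eta0 x 0 a * Q (f x) a b * d b = \sum_b y x 0 b * d b.
    rewrite exchange_big /=; apply: eq_bigr => b _; rewrite /y [(_ *m _) _ _]mxE mulr_suml.
    by [].
  have S2 : \sum_a \sum_b d a * Q (f x) a b * eta0 x 0 b = \sum_b y x 0 b * d b.
    rewrite -S1 exchange_big /=; apply: eq_bigr => b _; apply: eq_bigr => a _.
    have -> : Q (f x) a b = Q (f x) b a by rewrite -{1}(symQ (fUV Ux)) mxE.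
    by rewrite mulrC (mulrC (d a)) mulrA.
  under eq_bigr do rewrite big_split /=.
  rewrite big_split /=; apply: (etrans (f_equal2 +%R S2 S1)).
  by move: (\sum_b _) => z; ring.
have -> : \sum_b y x 0 b * d b = - \sum_a y x 0 a * ldiv (G 0) (fun z => row a (gradd z)) x.
  by rewrite -sumrN; apply: eq_bigr => a _; rewrite mulrN.
move: (chi x) (\sum_a _) (w x) => c1 c2 c3.
by ring.
Qed.

(** The total derivatives left by the integration by parts; they integrate to zero because [chi]
    vanishes off the compact [L]. *)
Let divpart (p : 'I_k * 'I_m) x := 'D_('e_p.2) (fun z => chi z * y z 0 p.1 * (w z * gradd z p.1 p.2)) x.

(** The derivative still falls on the cutoff [chi]; this contribution disappears only after
    summation over a partition of unity. *)
Definition variation_integrand x :=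
  (\sum_a \sum_s 'D_('e_s) (fun z => chi z * (etaF f Q (G 0) z *m Q (f z)) 0 a) x * gradd x a s) * w x.

(** Leibniz's rule for [chi * y] against the density times [gradd]; [ldiv_density] recognises the
    divergence of the latter. *)
Let Dhv_div x : U x -> 'D_('e_(lshift m 0)) hv (tpair 0 x) =
  2 * (variation_integrand x - \sum_p divpart p x).
Proof.
move=> Ux; rewrite (Dhv Ux) mulNr -mulrN; congr (_ * _).
have scy a : smooth_on U (fun z => chi z * y z 0 a) := smooth_onM oU schi (sy 0 a).
have swZ a s : smooth_on U (fun z => w z * gradd z a s) := smooth_onM oU sw (gradd_smooth a s).
have [sG0 _ _ _] := sub0.
have E (p : 'I_k * 'I_m) : divpart p x = 'D_('e_p.2) (fun z => chi z * y z 0 p.1) x * (w x * gradd x p.1 p.2)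
   + chi x * y x 0 p.1 * 'D_('e_p.2) (fun z => w z * gradd z p.1 p.2) x.
  have := is_deriveMr (smooth_on_derive oU 'e_p.2 (scy p.1) Ux) (smooth_on_derive oU 'e_p.2 (swZ p.1 p.2) Ux).
  by case=> _ E'; exact: E'.
have -> : \sum_p divpart p x = \sum_a \sum_s 'D_('e_s) (fun z => chi z * y z 0 a) x * (w x * gradd x a s)
   + \sum_a \sum_s chi x * y x 0 a * 'D_('e_s) (fun z => w z * gradd z a s) x.
  rewrite -big_split /=; under [RHS]eq_bigr do rewrite -big_split /=.
  rewrite (pair_bigA _ (fun a s => 'D_('e_s) (fun z => chi z * y z 0 a) x * (w x * gradd x a s)
    + chi x * y x 0 a * 'D_('e_s) (fun z => w z * gradd z a s) x)) /=.
  by apply: eq_bigr => p _; exact: E.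
have -> : \sum_a \sum_s 'D_('e_s) (fun z => chi z * y z 0 a) x * (w x * gradd x a s) = variation_integrand x.
  rewrite /variation_integrand mulr_suml; apply: eq_bigr => a _; rewrite mulr_suml; apply: eq_bigr => s _.
  by rewrite -mulrA (mulrC (w x)).
have -> : \sum_a \sum_s chi x * y x 0 a * 'D_('e_s) (fun z => w z * gradd z a s) x =
   chi x * (\sum_a y x 0 a * ldiv (G 0) (fun z => row a (gradd z)) x) * w x.
  rewrite -mulrA mulr_suml mulr_sumr; apply: eq_bigr => a _; rewrite -mulr_sumr -!mulrA; congr (_ * (_ * _)).
  rewrite mulrC.
  have H := ldiv_density oU Ux sG0 (smx_row oU a gradd_smooth) detG0.
  apply: (etrans _ H); apply: eq_bigr => s _.
  by apply: (congr1 (fun h => 'D_('e_s) h x)); apply/funext => z; rewrite [in RHS]mxE.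
by rewrite opprD addrA subrr sub0r.
Qed.

Lemma local_variation : is_derive (0 : R) (1 : R)
  (fun t => integral_Rn ((fun x => chi x * gdot (Q (f x)) (etaF f Q (G t) x) (etaF f Q (G t) x) *
     Num.sqrt (\det (G 0 x))) \_ U))
  (2 * integral_Rn (variation_integrand \_ U)).
Proof.
have [r r0 H] := ccont_restrict_open oU cL LU.
have hv0 v : Om v -> ~ L (rsubmx v) -> hv v = 0.
  by move=> [_ Uv] Lv; rewrite /hv chi0// !mul0r.
have D := integral_param_derive eps0 oU cL LU shv hv0.
have near0 : \forall t \near (0 : R), `|t| < eps.
  have : nbhs (0 : R) (ball (0 : R) eps) by exact: nbhsx_ballx.
  by apply: filterS => t; rewrite -ball_normE /= sub0r normrN.
have scy a : smooth_on U (fun z => chi z * y z 0 a) := smooth_onM oU schi (sy 0 a).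
have cy0 a z : U z -> ~ L z -> chi z * y z 0 a = 0 by move=> Uz Lz; rewrite chi0// mul0r.
have sT (p : 'I_k * 'I_m) : smooth_on U (fun z => chi z * y z 0 p.1 * (w z * gradd z p.1 p.2)).
  exact: (smooth_onM oU (scy p.1) (smooth_onM oU sw (gradd_smooth p.1 p.2))).
have T0 (p : 'I_k * 'I_m) z : U z -> ~ L z -> chi z * y z 0 p.1 * (w z * gradd z p.1 p.2) = 0.
  by move=> Uz Lz; rewrite cy0// mul0r.
have cV : ccont r (variation_integrand \_ U).
  apply: H.
    have sV : smooth_on U variation_integrand.
      apply: (smooth_onM oU _ sw); apply: (smooth_on_sum oU) => a _; apply: (smooth_on_sum oU) => s _.
      exact: (smooth_onM oU (smooth_pderive s (scy a)) (gradd_smooth a s)).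
    by move=> x Ux; exact: smooth_on_continuous sV Ux.
  move=> x Ux Lx; rewrite /variation_integrand big1 ?mul0r// => a _; rewrite big1// => s _.
  have [_ E] := restrict_pderive oU cL LU s (scy a) (cy0 a).
  by have -> := E x Ux Lx; rewrite mul0r.
have cT p : ccont r (divpart p \_ U).
  apply: H.
    by move=> x Ux; exact: (smooth_on_continuous (smooth_pderive p.2 (sT p)) Ux).
  move=> x Ux Lx.
  by have [_ E] := restrict_pderive oU cL LU p.2 (sT p) (T0 p); exact: E.
apply: (@near_eq_is_derive _ _ _ (fun t => integral_Rn ((fun x => hv (tpair t x)) \_ U))).
  apply: filterS near0 => t te; congr integral_Rn; apply/funext => x; rewrite /patch.
  case: ifP => // /set_mem Ux; rewrite /hv rsub_tpair gdotE; congr (_ * _ * _).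
  by apply: eq_bigr => a _; apply: eq_bigr => b _; rewrite !(etavE _ te Ux).
apply: (is_derive_cast D).
have -> : ((fun x => 'D_('e_(lshift m 0)) hv (tpair 0 x)) \_ U) =
   (fun x => 2 * ((variation_integrand \_ U) x - \sum_p (divpart p \_ U) x)).
  apply/funext => x; rewrite /patch; case: ifP => [/set_mem Ux|_]; first exact: Dhv_div.
  by rewrite big1// subr0 mulr0.
have cS : ccont r (fun x => \sum_p (divpart p \_ U) x) 
  by apply: (@ccont_sum R m _ (index_enum _) xpredT r (fun p => divpart p \_ U) r0) => p _; exact: cT.
have cD : ccont r (fun x => (variation_integrand \_ U) x - \sum_p (divpart p \_ U) x).
  have -> : (fun x => (variation_integrand \_ U) x - \sum_p (divpart p \_ U) x) =
    (fun x => (variation_integrand \_ U) x + (-1) * \sum_p (divpart p \_ U) x).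
    by apply/funext => x; rewrite mulN1r.
  exact: (ccontD cV (ccontZ (-1) cS)).
rewrite (integral_RnZ _ cD) (integral_RnB cV cS).
rewrite (@integral_Rn_sum _ _ _ (index_enum _) xpredT r (fun p => divpart p \_ U) r0 (fun p _ => cT p)).
rewrite big1 ?subr0// => p _.
exact: (integral_pderive_restrict oU cL LU p.2 (sT p) (T0 p)).
Qed.

Lemma near_time : \forall t \near (0 : R), `|t| < eps.
Proof.
have : nbhs (0 : R) (ball (0 : R) eps) by exact: nbhsx_ballx.
by apply: filterS => t; rewrite -ball_normE /= sub0r normrN.
Qed.

Lemma slice_derive x a s : U x ->
  is_derive (0 : R) (1 : R) (fun t => gradf f (G t) x a s) (gradd x a s).
Proof.
move=> Ux.
have /is_derive_slicel := smooth_on_derive oOm 'e_(lshift m 0) (gradv_smooth a s) (tdom_tpair zero0 Ux).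
rewrite -(graddE a s Ux).
have -> : (fun t => gradv (row_mx (t%:M : 'rV_1) x) a s) = (fun t => gradf f (G t) x a s).
  by apply/funext => t; rewrite -/(tpair t x) /gradv lsub_tpair rsub_tpair.
by [].
Qed.

(** The product of the gradients with the differential is [invmx (Q (f x))], which does not depend
    on time. *)
Lemma gradd_vertical x : U x -> gradd x *m pdmx f x = 0.
Proof.
move=> Ux; apply/matrixP => a b; rewrite !mxE.
have H s : is_derive (0 : R) (1 : R) (fun t => gradf f (G t) x a s * pdmx f x s b) (gradd x a s * pdmx f x s b).
  apply: (is_derive_cast (is_deriveMr (slice_derive a s Ux) (is_derive_cst (pdmx f x s b) (0 : R) (1 : R)))).
  by rewrite mulr0 addr0.
have [_ E1] := is_derive_sumr H.
have near1 : \forall t \near (0 : R), \sum_s gradf f (G t) x a s * pdmx f x s b = invmx (Q (f x)) a b.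
  apply: filterS near_time => t te; have [_ _ _ PE] := subG te.
  by rewrite -(PE _ Ux) [RHS]mxE.
have near2 : \forall t \near (0 : R), cst (invmx (Q (f x)) a b) t = \sum_s gradf f (G t) x a s * pdmx f x s b.
  by apply: filterS near1 => t ->.
have [_ E2] := near_eq_is_derive near2 (is_derive_cst (invmx (Q (f x)) a b) (0 : R) (1 : R)).
exact: (etrans (esym E1) E2).
Qed.

(** In this form the time derivative [h] of the metric appears as a tensor, which is how [gradd],
    defined in charts, is related to a field on [M]. *)
Lemma gradd_formula x (h : 'M[R]_m) : U x -> is_derive (0 : R) (1 : R) (fun t => G t x) h ->
  gradd x = - (gradf f (G 0) x *m h *m invmx (G 0 x)).
Proof.
move=> Ux dG.
have uGt : \forall t \near (0 : R), G t x \in unitmx.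
  by apply: filterS near_time => t te; have [_ _ uG _] := subG te; exact: uG.
have sI : smx Om (fun v => invmx (G (lsubmx v 0 0) (rsubmx v))).
  by apply: (smx_inv oOm _ sGv) => v [te Uv]; have [_ _ uG _] := subG te; exact: uG.
have dI : derivable (fun t => invmx (G t x)) (0 : R) (1 : R).
  suff H : is_derive (0 : R) (1 : R) (fun t => invmx (G t x))
     ('D_('e_(lshift m 0)) (fun v => invmx (G (lsubmx v 0 0) (rsubmx v))) (tpair 0 x)) by case: H.
  apply/is_derive_mxP => i j.
  have /is_derive_slicel H := smooth_on_derive oOm 'e_(lshift m 0) (sI i j) (tdom_tpair zero0 Ux).
  have E := D_mxE oOm 'e_(lshift m 0) i j sI (tdom_tpair zero0 Ux).
  rewrite E.
  have -> : (fun t => invmx (G t x) i j) = (fun t => invmx (G (lsubmx (row_mx (t%:M : 'rV_1) x) 0 0) (rsubmx (row_mx (t%:M : 'rV_1) x))) i j).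
    by apply/funext => t; rewrite -/(tpair t x) lsub_tpair rsub_tpair.
  exact: H.
have H1 := is_derive_invmx uGt dI dG.
have H2 := is_derive_mulmx (is_derive_cst ((pdmx f x)^T) (0 : R) (1 : R)) H1.
apply/matrixP => a s.
have [_ <-] := slice_derive a s Ux.
have /is_derive_mxP/(_ a s)[_ E] := H2.
apply: (etrans E); rewrite mul0mx add0r mulmxN /= .
by rewrite /gradf /gradmx !mulmxA.
Qed.

End LocalVariation.

Section DetVariation.
Variables (R : realType) (m k : nat).

(* In the frame made of a basis of the kernel of D and of the gradients, both
   metrics have the same Gram matrix, and the two frames differ by a unipotent matrix. *)
Lemma det_variation (G0 G : 'M[R]_m) (D : 'M[R]_(m, k)) (Q : 'M[R]_k) :
  G0^T = G0 -> posdef G0 -> G^T = G -> posdef G -> Q \in unitmx -> \rank D = k ->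
  gradmx G0 D *m D = invmx Q -> gradmx G D *m D = invmx Q ->
  (forall v w : 'rV[R]_m, v *m D = 0 -> w *m D = 0 -> gdot G v w = gdot G0 v w) ->
  \det G = \det G0.
Proof.
move=> sG0 pG0 sG pG uQ rD P0 P ver.
have uG0 := posdef_unit pG0; have uG := posdef_unit pG.
have [V0 [fV V0D]] := vertical_basis D.
have nk : (m - \rank D + k)%N = m by rewrite rD subnK// -rD rank_leq_row.
have DV : D^T *m V0^T = 0 by rewrite -trmx_mul V0D trmx0.
have VV : V0 *m G *m V0^T = V0 *m G0 *m V0^T.
  apply/matrixP => i j.
  have aux (A : 'M[R]_m) : (V0 *m A *m V0^T) i j = gdot A (row i V0) (row j V0).
    by rewrite /gdot -row_mul mxE [RHS]mxE; apply: eq_bigr => s _; rewrite [row _ _ _ _]mxE !mxE.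
  rewrite !aux; apply: ver; by rewrite -row_mul V0D row0.
have block (A : 'M[R]_m) (X : 'M[R]_(k, m)) : A^T = A -> X *m A = D^T -> X *m D = invmx Q ->
    col_mx V0 X *m A *m (col_mx V0 X)^T = block_mx (V0 *m A *m V0^T) 0 0 (invmx Q).
  move=> sA XA XD; have AX : A *m X^T = D by rewrite -[A]sA -trmx_mul XA trmxK.
  rewrite tr_col_mx mul_col_mx mul_col_row XA DV -(mulmxA V0 A X^T) AX V0D.
  have -> : D^T *m X^T = invmx Q by rewrite -XA -mulmxA AX.
  by [].
have [C CE] : exists C, gradmx G D - gradmx G0 D = C *m V0.
  apply/submxP.
  have h1 : (V0 <= kermx D)%MS by apply/sub_kermxP.
  have h2 : (gradmx G D - gradmx G0 D <= kermx D)%MS.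
    by apply/sub_kermxP; rewrite mulmxBl P P0 subrr.
  apply: submx_trans h2 _.
  have /eqmxP E : (V0 == kermx D)%MS.
    by rewrite -(geq_leqif (mxrank_leqif_eq h1)) mxrank_ker (eqP fV).
  by rewrite E.
have T : col_mx V0 (gradmx G D) = block_mx 1%:M 0 C 1%:M *m col_mx V0 (gradmx G0 D).
  by rewrite mul_block_col mul1mx mul0mx addr0 mul1mx -CE subrK.
have B0 := block _ _ sG0 (gradmxG D uG0) P0; have B := block _ _ sG (gradmxG D uG) P.
rewrite VV -B0 T in B.
have detT : \det (block_mx 1%:M 0 C 1%:M : 'M[R]_(m - \rank D + k)) = 1.
  by rewrite det_lblock !det1 mulr1.
have uB : \det (block_mx (V0 *m G0 *m V0^T) 0 0 (invmx Q)) != 0.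
  rewrite det_lblock mulf_neq0//; rewrite -unitfE -unitmxE ?unitmx_inv//.
  exact/posdef_unit/posdef_congr.
rewrite -B0 in uB.
move: (block_mx _ _ _ _) detT (col_mx V0 (gradmx G0 D)) B uB => J; move: J; rewrite nk => J dJ A B uB.
have := congr1 determinant B; rewrite !det_mulmx !det_tr !det_mulmx dJ !mul1r.
move: uB; rewrite !det_mulmx det_tr; move: (\det A) (\det G) (\det G0) => a b c h E.
have a0 : a != 0 by apply: contra h => /eqP ->; rewrite mulr0.
by move: E => /(mulIf a0) /(mulfI a0).
Qed.

End DetVariation.

(** * Derivatives of functions along vector fields *)

Section Mderiv.
Variables (R : realType) (m : nat) (M : manifold R m).
Implicit Types (c : chart R M m).

Definition mderiv (Y : vfield M) (F : M -> R) (p : M) : R :=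
  'D_(vin (chart_at p) Y (pos_at p)) (F \o cinv (chart_at p)) (pos_at p).

Lemma chart_deriveE c c' (W : set M) (F : M -> R) (Y : vfield M) p : atlas c -> atlas c' ->
  cdom c p -> cdom c' p -> open W -> W p ->
  smooth_on (cimg c `&` cinv c @^-1` W) (F \o cinv c) ->
  'D_(vin c' Y (cfun c' p)) (F \o cinv c') (cfun c' p) = 'D_(vin c Y (cfun c p)) (F \o cinv c) (cfun c p).
Proof.
move=> ac ac' cp cp' oW Wp sF.
pose O := cimg c' `&` cinv c' @^-1` (W `&` cdom c).
have oO : open O by apply: open_chart_preimage; apply: openI => //; exact: open_cdom.
have oV : open (cimg c `&` cinv c @^-1` W) by exact: open_chart_preimage.
have Ox : O (cfun c' p) by split; [exact: cfun_cimg|rewrite /= cfunK].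
have Vx : (cimg c `&` cinv c @^-1` W) (cfun c p) by split; [exact: cfun_cimg|rewrite /= cfunK].
have OV x : O x -> (cimg c `&` cinv c @^-1` W) ((cfun c \o cinv c') x).
  by move=> [cx [Wx cx']]; split; [exact: cfun_cimg|rewrite /= cfunK].
have E : (cfun c \o cinv c') (cfun c' p) = cfun c p by rewrite /= cfunK.
have sphi : smx O (cfun c \o cinv c').
  by move=> i j; apply: smooth_onW (transition_smx ac' ac i j) => x [? []].
have sFp : smooth_on O ((F \o cinv c) \o (cfun c \o cinv c')).
  move=> n; apply: (@Ck_comp _ _ _ _ O _ (cfun c \o cinv c') (F \o cinv c) oO oV OV) => //.
  by move=> j; exact: sphi.
have EF x : O x -> (F \o cinv c') x = ((F \o cinv c) \o (cfun c \o cinv c')) x.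
  by move=> [cx [Wx cx']]; rewrite /= cfunK.
rewrite (D_near_eq oO _ EF Ox) (smooth_on_deriveE oO _ sFp Ox) (smooth_on_deriveE oV _ sF Vx).
have Hc i : 'D_('e_i) ((F \o cinv c) \o (cfun c \o cinv c')) (cfun c' p) =
    \sum_l jac c' c p i l * 'D_('e_l) (F \o cinv c) (cfun c p).
  have [_ Ec] := @C1_chain _ _ _ O _ (cfun c \o cinv c') (F \o cinv c) (cfun c' p) 'e_i oO oV Ox (OV _ Ox)
    (fun j => sphi 0 j 1%N) (sF 1%N).
  rewrite Ec; apply: eq_bigr => l _; rewrite E; congr (_ * _).
  by rewrite (jacE ac' ac cp' cp) mxE.
under eq_bigr do rewrite Hc mulr_sumr.
rewrite exchange_big /=; apply: eq_bigr => l _.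
have EV : vin c Y (cfun c p) = vin c' Y (cfun c' p) *m jac c' c p := vin_jac Y ac' ac cp' cp.
rewrite EV mxE mulr_suml; apply: eq_bigr => i _; by rewrite mulrA.
Qed.

Lemma mderiv_chart c (F : M -> R) (Y : vfield M) p : atlas c -> cdom c p -> smooth_function F ->
  mderiv Y F p = 'D_(vin c Y (cfun c p)) (F \o cinv c) (cfun c p).
Proof.
move=> ac cp sF.
have sFc : smooth_on (cimg c `&` cinv c @^-1` setT) (F \o cinv c).
  by apply: smooth_onW (sF c ac) => x [].
exact: (chart_deriveE Y ac (chart_at_atlas p) cp (chart_at_cdom p) openT I sFc).
Qed.

Lemma mderiv_sum n (F : 'I_n -> M -> R) (Y : vfield M) (C : R) p : (forall i, smooth_function (F i)) ->
  (forall q, \sum_i F i q = C) -> \sum_i mderiv Y (F i) p = 0.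
Proof.
move=> sF FC; pose c := chart_at p; have ac : atlas c := chart_at_atlas p.
have Ux : cimg c (pos_at p) by apply: cfun_cimg; exact: chart_at_cdom.
have H i := smooth_on_derive (@open_cimg _ _ _ c) (vin c Y (pos_at p)) (sF i c ac) Ux.
have [_ E] := is_derive_sumr H.
rewrite /mderiv -E -/c.
have -> : (fun y => \sum_i (F i \o cinv c) y) = cst C by apply/funext => y; exact: FC.
exact: derive_cst.
Qed.

Lemma mderiv0 (F : M -> R) (Y : vfield M) (S : set M) p : closed S -> (forall q, ~ S q -> F q = 0) -> ~ S p ->
  mderiv Y F p = 0.
Proof.
move=> cS F0 Sp; pose c := chart_at p.
have oO : open (cimg c `&` cinv c @^-1` (~` S)) by apply: open_chart_preimage; exact: closed_openC.
have Ox : (cimg c `&` cinv c @^-1` (~` S)) (pos_at p).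
  by split; [apply: cfun_cimg; exact: chart_at_cdom|rewrite /= cfunK//; exact: chart_at_cdom].
rewrite /mderiv (@D_near_eq _ _ _ oO _ _ (fun=> 0) _ _ _ Ox); first exact: derive_cst.
by move=> y [_ Sy]; rewrite /= F0.
Qed.

End Mderiv.

(** * First variation on the manifold *)

Section GlobalVariation.
Variables (R : realType) (m k : nat) (M : manifold R m) (N : manifold R k) (pi : M -> N).
Implicit Types (p : M) (c : chart R M m) (d : chart R N k).
Variables (g0 : tensor2 M) (gN : tensor2 N).
Hypotheses (g0_metric : riemannian_metric g0) (gN_metric : riemannian_metric gN).
Hypothesis pi_sub : riemannian_submersion pi g0 gN.

Lemma sub_smooth : smooth_map pi. Proof. by case: pi_sub. Qed.
Lemma sub_rank p : \rank (dpi pi p) = k. Proof. by case: pi_sub. Qed.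

Lemma eta_smooth (g : tensor2 M) c d : riemannian_metric g -> riemannian_submersion pi g gN ->
  atlas c -> atlas d -> smx (pidom pi c d) (eta_in pi g gN c d).
Proof.
move=> gm gs ac ad.
have iso p := submersion_isometric_at gm gN_metric p gs.
have sm := chart_submetric sub_smooth gm gN_metric ac ad iso.
exact: (etaF_smooth (@open_pidom _ _ _ _ _ _ sub_smooth c d) (@open_cimg _ _ _ d) (@pimap_cimg _ _ _ _ _ pi c d)
  (pimap_smooth sub_smooth ac ad) (tin_smooth gN_metric ad) (fun y => @tin_unit _ _ _ _ gN_metric d y ad) sm).
Qed.

Lemma base_smooth c d : atlas c -> atlas d -> smx (pidom pi c d) (fun x => tin d gN (pimap pi c d x)).
Proof.
move=> ac ad.
exact: (smx_comp (@open_pidom _ _ _ _ _ _ sub_smooth c d) (@open_cimg _ _ _ d) (@pimap_cimg _ _ _ _ _ pi c d)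
  (pimap_smooth sub_smooth ac ad) (tin_smooth gN_metric ad)).
Qed.

Lemma continuous_in_chart c (F : M -> R) (O : set 'rV[R]_m) (h : 'rV[R]_m -> R) p : cdom c p -> open O ->
  O (cfun c p) -> smooth_on O h -> (forall q, cdom c q -> O (cfun c q) -> F q = h (cfun c q)) ->
  {for p, continuous F}.
Proof.
move=> cp oO Op sh Fh.
have nb : nbhs p (cdom c `&` cfun c @^-1` O).
  by apply: open_nbhs_nbhs; split; [exact: open_chart_pullback|split].
apply: (@continuous_near_eq _ _ (h \o cfun c)).
  by apply: filterS nb => q [cq Oq]; rewrite /= Fh.
exact: (@continuous_comp _ _ _ (cfun c) h p (cfun_continuous cp) (smooth_on_continuous sh Op)).
Qed.

(** Continuity of the integrand allows [vol_integral] to be computed with any chosen partition. *)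
Lemma norm_mean_curvature_continuous (g : tensor2 M) : riemannian_metric g -> riemannian_submersion pi g gN ->
  continuous (fun p => gdot (g p) (mean_curvature pi g p) (mean_curvature pi g p)).
Proof.
move=> gm gs p.
have iso q := submersion_isometric_at gm gN_metric q gs.
pose c := chart_at p; pose d := chart_at (pi p).
have ac : atlas c by exact: chart_at_atlas.
have ad : atlas d by exact: chart_at_atlas.
have cp : cdom c p by exact: chart_at_cdom.
have dp : cdom d (pi p) by exact: chart_at_cdom.
have oU := @open_pidom _ _ _ _ _ _ sub_smooth c d.
have se := eta_smooth gm gs ac ad; have sQ := base_smooth ac ad.
apply: (@continuous_in_chart c _ (pidom pi c d)
  (fun x => \sum_a \sum_b eta_in pi g gN c d x 0 a * tin d gN (pimap pi c d x) a b * eta_in pi g gN c d x 0 b) p cp oU).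
- exact: pidom_cfun.
- apply: (smooth_on_sum oU) => a _; apply: (smooth_on_sum oU) => b _.
  exact: (smooth_onM oU (smooth_onM oU (se 0 a) (sQ a b)) (se 0 b)).
- move=> q cq [_ /=]; rewrite (cfunK cq) => dq.
  rewrite (norm_mean_curvature sub_smooth gm gN_metric sub_rank iso ac ad cq dq) gdotE.
  by rewrite (pimap_cfun _ _ cq).
Qed.

Variables (eps : R) (gt : R -> tensor2 M).
Hypotheses (var : Defs.variation pi g0 eps gt) (pres : preserves pi gN eps gt).

Let eps0 : 0 < eps. Proof. by case: var. Qed.
Let gt_metric t : `|t| < eps -> riemannian_metric (gt t). Proof. by move=> te; case: var => _ /(_ t te) []. Qed.
Let gt0 : gt 0 = g0. Proof. by case: var. Qed.
Let zero0 : `|0 : R| < eps. Proof. by rewrite normr0. Qed.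
Let iso t (te : `|t| < eps) p := submersion_isometric_at (gt_metric te) gN_metric p (pres te).

Section Charts.
Variables (c : chart R M m) (d : chart R N k).
Hypotheses (ac : atlas c) (ad : atlas d).
Let U := pidom pi c d.
Let f := pimap pi c d.
Let G t := tin c (gt t).
Let oU : open U. Proof. exact: (open_pidom sub_smooth). Qed.
Let sf : smx U f. Proof. exact: (pimap_smooth sub_smooth ac ad). Qed.

Lemma variation_submetric t : `|t| < eps -> submetric U f (tin d gN) (G t).
Proof. by move=> te; exact: (chart_submetric sub_smooth (gt_metric te) gN_metric ac ad (iso te)). Qed.

Lemma variation_smooth : smx (tdom eps U) (fun v => G (lsubmx v 0 0) (rsubmx v)).
Proof.
move=> i j; have [_ _ sg _] := var; have H := sg c ac i j.
by rewrite /G tin_def; apply: smooth_onW H => v [te [cv _]].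
Qed.

Lemma variation_det t x : `|t| < eps -> U x -> \det (G t x) = \det (G 0 x).
Proof.
move=> te [cx dx]; have cp := cinv_cdom cx; set p := cinv c x in cp dx.
have xE : x = cfun c p by rewrite cinvK.
have PE s : `|s| < eps -> gradmx (G s x) (Dpi pi c d p) *m Dpi pi c d p = invmx (tin d gN (cfun d (pi p))).
  move=> se; rewrite {1}xE; exact: (chart_isometric sub_smooth (gt_metric se) gN_metric ac ad cp dx (iso se p)).
have kd : cimg d (cfun d (pi p)) by exact: cfun_cimg.
apply: (@det_variation _ _ _ _ _ (Dpi pi c d p) (tin d gN (cfun d (pi p)))).
- exact: (tin_sym (gt_metric zero0) cx).
- exact: (tin_posdef (gt_metric zero0) ac cx).
- exact: (tin_sym (gt_metric te) cx).
- exact: (tin_posdef (gt_metric te) ac cx).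
- exact: (tin_unit gN_metric ad kd).
- exact: (rank_Dpi sub_smooth sub_rank ac ad cp dx).
- exact: PE.
- exact: PE.
move=> v w vD wD; rewrite /G xE !tin_cfun// [LHS]gdot_congr [RHS]gdot_congr gt0.
have [_ /(_ t te) [_ H] _ _] := var.
apply: H; apply/verticalE.
  exact/(vertical_Dpi sub_smooth v ac ad cp dx).
exact/(vertical_Dpi sub_smooth w ac ad cp dx).
Qed.

Lemma variation_time_derivable x : cimg c x -> derivable (fun t => G t x) (0 : R) (1 : R).
Proof.
move=> cx.
have oT : open (tdom eps (cimg c)) by apply: open_tdom; exact: open_cimg.
have sG : smx (tdom eps (cimg c)) (fun v => G (lsubmx v 0 0) (rsubmx v)).
  by move=> i j; rewrite /G tin_def; have [_ _ sg _] := var; exact: (sg c ac i j).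
suff H : is_derive (0 : R) (1 : R) (fun t => G t x)
    ('D_('e_(lshift m 0)) (fun v => G (lsubmx v 0 0) (rsubmx v)) (tpair 0 x)) by case: H.
apply/is_derive_mxP => i j.
have T0 := tdom_tpair zero0 cx.
have /is_derive_slicel H := smooth_on_derive oT 'e_(lshift m 0) (sG i j) T0.
rewrite (D_mxE oT 'e_(lshift m 0) i j sG T0).
have -> : (fun t => G t x i j) = (fun t => G (lsubmx (row_mx (t%:M : 'rV_1) x) 0 0) (rsubmx (row_mx (t%:M : 'rV_1) x)) i j).
  by apply/funext => t; rewrite -/(tpair t x) lsub_tpair rsub_tpair.
exact: H.
Qed.

End Charts.

Definition variation_tensor : tensor2 M := fun p => 'D_(1 : R) (fun t => gt t p) (0 : R).

Lemma variation_tensor_derive p : is_derive (0 : R) (1 : R) (fun t => gt t p) (variation_tensor p).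
Proof.
have H := variation_time_derivable (chart_at_atlas p) (cfun_cimg (chart_at_cdom p)).
have E : (fun t => tin (chart_at p) (gt t) (cfun (chart_at p) p)) = (fun t => gt t p).
  by apply/funext => t; exact: tin_chart_at.
by rewrite E in H; exact: derivableP.
Qed.

Lemma tin_variation_derive c p : cdom c p -> is_derive (0 : R) (1 : R) (fun t => tin c (gt t) (cfun c p))
  (tin c variation_tensor (cfun c p)).
Proof.
move=> cp; rewrite tin_cfun//.
have -> : (fun t => tin c (gt t) (cfun c p)) =
    (fun t => cst (jac c (chart_at p) p) t *m gt t p *m cst ((jac c (chart_at p) p)^T) t).
  by apply/funext => t; rewrite tin_cfun.
set J := jac _ _ _.
have H := is_derive_mulmx (is_derive_mulmx (is_derive_cst J (0 : R) (1 : R)) (variation_tensor_derive p))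
  (is_derive_cst (J^T) (0 : R) (1 : R)).
by apply: (is_derive_cast H); rewrite mul0mx add0r mulmx0 addr0.
Qed.

(* The vector field whose divergence appears in the first variation. *)
Definition variation_field : vfield M := fun p =>
  - (mean_curvature pi g0 p *m variation_tensor p *m invmx (g0 p)).

(** The coefficient of the derivative of the cutoff, [eta Q Z] in charts, is the expression of one
    vector field on [M]. Without this the contributions of different charts could not be added
    up. *)
Lemma vin_variation_field c d p : atlas c -> atlas d -> cdom c p -> cdom d (pi p) ->
  vin c variation_field (cfun c p) = eta_in pi g0 gN c d (cfun c p) *m tin d gN (cfun d (pi p)) *m
    gradd (pimap pi c d) (fun t => tin c (gt t)) (cfun c p).
Proof.
move=> ac ad cp dp; have Ux := pidom_cfun cp dp.
have oU : open (pidom pi c d) by exact: (open_pidom sub_smooth).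
have GF := gradd_formula oU (pimap_smooth sub_smooth ac ad) eps0 (variation_smooth d ac)
  (fun t te => variation_submetric ac ad te) Ux (tin_variation_derive cp).
rewrite gt0 /gradf -Dpi_def in GF; rewrite {}GF.
have gen (e : 'rV[R]_k) (q : 'M[R]_k) (X : 'M[R]_(k, m)) (h i : 'M[R]_m) :
    e *m q *m (- (X *m h *m i)) = - (e *m q *m X *m h *m i) by rewrite mulmxN !mulmxA.
rewrite gen.
have iso0 q := submersion_isometric_at g0_metric gN_metric q pi_sub.
rewrite -(vin_mean_curvature sub_smooth g0_metric gN_metric sub_rank iso0 ac ad cp dp).
rewrite !vin_cfun// !tin_cfun// /variation_field mulNmx; congr (- _).
have uJ : jac c (chart_at p) p \in unitmx.
  by apply: jac_unit => //; [exact: chart_at_atlas|exact: chart_at_cdom].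
rewrite -(invmx_jac ac (chart_at_atlas p) cp (chart_at_cdom p)).
move: (jac _ _ _) (g0 p) (riem_unit g0_metric p) uJ (mean_curvature _ _ _) (variation_tensor p) => J g ug uJ H h.
have uJt : J^T \in unitmx by rewrite unitmx_tr.
have uu : J *m g *m J^T \in unitmx by rewrite !unitmx_mul uJ ug uJt.
apply: (can_inj (mulmxK uu)); rewrite (mulmxKV uu).
by rewrite !mulmxA !mulmxKV.
Qed.

Hypothesis M_compact : compact [set: M].
Variables (P : partition_of_unity M) (pt : 'I_(pu_size P) -> M) (S : 'I_(pu_size P) -> set M).
Let c a := @pu_chart _ _ _ P a.
Let d a : chart R N k := chart_at (pi (pt a)).
Let chi a := @pu_fun _ _ _ P a.
Hypothesis HS : forall a, [/\ closed (S a), S a `<=` cdom (c a), S a `<=` pi @^-1` cdom (d a) &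
  forall q, ~ S a q -> chi a q = 0].

Let U a := pidom pi (c a) (d a).
Let L a := cfun (c a) @` S a.
Let Q a := tin (d a) gN.
Let f a := pimap pi (c a) (d a).
Let w a := density g0 (c a).
Let ac a : atlas (c a). Proof. exact: pu_atlas. Qed.
Let ad a : atlas (d a). Proof. exact: chart_at_atlas. Qed.
Let oU a : open (U a). Proof. exact: (open_pidom sub_smooth). Qed.
Let cL a : compact (L a).
Proof. by have [cS Sc _ _] := HS a; exact: compact_chart_image. Qed.
Let LU a : L a `<=` U a.
Proof.
have [_ Sc Sd _] := HS a; move=> _ [p Sp <-]; apply: pidom_cfun; [exact: Sc|exact: Sd].
Qed.
Let chi0 a x : U a x -> ~ L a x -> chi a (cinv (c a) x) = 0.
Proof.
move=> [cx _] Lx; have [_ _ _ S0] := HS a; apply: S0 => Sx; apply: Lx.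
by exists (cinv (c a) x) => //; exact: cinvK.
Qed.
Let schi a : smooth_on (U a) (chi a \o cinv (c a)).
Proof.
have H := @pu_smooth _ _ _ P a (c a) (ac a).
by apply: smooth_onW H => x [].
Qed.

(** What remains of the integrand without the derivatives of the cutoffs. The rows of [gradd] are
    vertical, so lowering the index of eta commutes with the derivative ([pdmx_lowered]) and only
    vertical derivatives of eta occur. *)
Definition variation_density a x : R :=
  \tr (gradd (f a) (fun t => tin (c a) (gt t)) x *m
       pdmx (fun z => eta_in pi g0 gN (c a) (d a) z *m Q a (f a z)) x).

Let eta0 a := eta_in pi g0 gN (c a) (d a).
Let y a z : 'rV[R]_k := eta0 a z *m Q a (f a z).
Let sy a : smx (U a) (y a).
Proof. exact: (smxM (@oU a) (eta_smooth g0_metric pi_sub (ac a) (ad a)) (base_smooth (ac a) (ad a))). Qed.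

Let G a t := tin (c a) (gt t).
Let sZ a : smx (U a) (gradd (f a) (G a)).
Proof.
exact: (gradd_smooth (@oU a) (pimap_smooth sub_smooth (ac a) (ad a)) eps0 (variation_smooth (d a) (ac a))
  (fun t te => variation_submetric (ac a) (ad a) te)).
Qed.

Let vinY a p : cdom (c a) p -> cdom (d a) (pi p) ->
  vin (c a) variation_field (cfun (c a) p) = y a (cfun (c a) p) *m gradd (f a) (G a) (cfun (c a) p).
Proof.
move=> cp dp; rewrite (vin_variation_field (ac a) (ad a) cp dp) /y /f (pimap_cfun _ _ cp).
by [].
Qed.

Let mderivE a x : U a x -> mderiv variation_field (chi a) (cinv (c a) x) =
  \sum_s (y a x *m gradd (f a) (G a) x) 0 s * 'D_('e_s) (chi a \o cinv (c a)) x.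
Proof.
move=> Ux; have [cx dx] := Ux; have cp := cinv_cdom cx.
rewrite (mderiv_chart _ (ac a) cp (pu_smooth a)) (vinY cp dx) (cinvK cx).
exact: (smooth_on_deriveE (@oU a) _ (schi a) Ux).
Qed.

Let integrandE a x : U a x -> variation_integrand (f a) (Q a) (G a) (chi a \o cinv (c a)) x =
  mderiv variation_field (chi a) (cinv (c a) x) * w a x
  + chi a (cinv (c a) x) * variation_density a x * w a x.
Proof.
move=> Ux; rewrite (mderivE Ux) -mulrDl /variation_integrand /w /density /G gt0; congr (_ * _).
set Z := gradd _ _ x.
have E b s : 'D_('e_s) (fun z => (chi a \o cinv (c a)) z * (etaF (f a) (Q a) (tin (c a) g0) z *m Q a (f a z)) 0 b) x
   = 'D_('e_s) (chi a \o cinv (c a)) x * y a x 0 b + chi a (cinv (c a) x) * 'D_('e_s) (fun z => y a z 0 b) x.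
  have [_ E'] := is_deriveMr (smooth_on_derive (@oU a) 'e_s (schi a) Ux) (smooth_on_derive (@oU a) 'e_s (@sy a 0 b) Ux).
  exact: E'.
transitivity (\sum_b \sum_s ('D_('e_s) (chi a \o cinv (c a)) x * y a x 0 b
    + chi a (cinv (c a) x) * 'D_('e_s) (fun z => y a z 0 b) x) * Z b s).
  by apply: eq_bigr => b _; apply: eq_bigr => s _; rewrite -E.
under eq_bigr do (under eq_bigr do rewrite mulrDl; rewrite big_split /=).
rewrite big_split /=; congr (_ + _).
  rewrite exchange_big /=; apply: eq_bigr => s _; rewrite mxE mulr_suml; apply: eq_bigr => b _.
  by rewrite -mulrA mulrC.
rewrite /variation_density /mxtrace mulr_sumr; apply: eq_bigr => b _.
rewrite [in RHS]mxE mulr_sumr; apply: eq_bigr => s _.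
by rewrite -mulrA; congr (_ * _); rewrite mulrC; congr (_ * _); rewrite [RHS]mxE.
Qed.

Lemma variation_density_smooth a : smooth_on (U a) (variation_density a).
Proof. exact: (smooth_mxtrace (@oU a) (smxM (@oU a) (@sZ a) (smx_pdmx (@oU a) (@sy a)))). Qed.

Lemma JH_derive : is_derive (0 : R) (1 : R) (fun t => JH pi (gt t))
  (2 * \sum_a integral_Rn ((fun x => chi a (cinv (c a) x) * variation_density a x * w a x) \_ (U a))).
Proof.
have H a : is_derive (0 : R) (1 : R) (fun t => integral_Rn ((fun x => (chi a \o cinv (c a)) x *
      gdot (Q a (f a x)) (etaF (f a) (Q a) (G a t) x) (etaF (f a) (Q a) (G a t) x) *
     Num.sqrt (\det (G a 0 x))) \_ (U a)))
    (2 * integral_Rn (variation_integrand (f a) (Q a) (G a) (chi a \o cinv (c a)) \_ (U a))).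
  apply: (@local_variation _ _ _ (U a) (L a) (cimg (d a)) (f a) (Q a) (@oU a) (@open_cimg _ _ _ (d a)) (@pimap_cimg _ _ _ _ _ pi (c a) (d a))
    (pimap_smooth sub_smooth (ac a) (ad a)) (tin_smooth gN_metric (ad a)) _
    (fun y => @tin_unit _ _ _ _ gN_metric (d a) y (ad a)) (@cL a) (@LU a) eps (G a) (chi a \o cinv (c a)) eps0
    (variation_smooth (d a) (ac a)) (fun t te => variation_submetric (ac a) (ad a) te) _ _ (schi a)).
  - by move=> z dz; exact: (tin_sym gN_metric dz).
  - by move=> t x te Ux; exact: (variation_det (ac a) (ad a) te Ux).
  - by move=> x [cx _]; exact: (tin_det_gt0 (gt_metric zero0) (ac a) cx).
  - by move=> x; exact: chi0.
have Hsum := is_derive_sumr H.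
apply: (@near_eq_is_derive _ _ _ (fun t => \sum_a integral_Rn ((fun x => (chi a \o cinv (c a)) x *
      gdot (Q a (f a x)) (etaF (f a) (Q a) (G a t) x) (etaF (f a) (Q a) (G a t) x) *
     Num.sqrt (\det (G a 0 x))) \_ (U a)))).
  apply: filterS (near_time eps0) => t te.
  have cH := norm_mean_curvature_continuous (gt_metric te) (pres te).
  rewrite /JH (vol_integralE (gt_metric te) M_compact P cH) (integral_wrtE (gt t)).
  apply: eq_bigr => a _; rewrite /chart_integral; congr integral_Rn; apply/funext => x; rewrite /patch.
  have [cx|ncx] := boolP (x \in cimg (c a)); last first.
    case: ifP => // /set_mem [cx _]; move/negP: ncx; case; exact: mem_set.
  move/set_mem: cx => cx; have cp := cinv_cdom cx.
  case: ifPn => [/set_mem Ux|nUx]; last first.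
    have -> : pu_fun a (cinv (c a) x) = 0; last by rewrite !mul0r.
    have [_ _ Sd S0] := HS a; apply: S0 => /Sd dx; move/negP: nUx; apply; exact: mem_set.
  have [_ dx] := Ux.
  have iso_t := iso te.
  rewrite (norm_mean_curvature sub_smooth (gt_metric te) gN_metric sub_rank iso_t (ac a) (ad a) cp dx).
  rewrite -(variation_det (ac a) (ad a) te Ux) /density.
  by rewrite -(pimap_cfun pi (d a) cp) (cinvK cx).
apply: (is_derive_cast Hsum); rewrite -mulr_sumr; congr (_ * _).
have sw a : smooth_on (U a) (w a).
  by apply: smooth_onW (density_smooth g0_metric (ac a)) => x [].
pose K a x := \sum_s (y a x *m gradd (f a) (G a) x) 0 s * 'D_('e_s) (chi a \o cinv (c a)) x.
have sK a : smooth_on (U a) (K a).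
  apply: (smooth_on_sum (@oU a)) => s _; apply: (smooth_onM (@oU a)).
    exact: (smxM (@oU a) (@sy a) (@sZ a) 0 s).
  exact: (smooth_pderive s (schi a)).
pose T1 a x := mderiv variation_field (chi a) (cinv (c a) x) * w a x.
pose T2 a x := chi a (cinv (c a) x) * variation_density a x * w a x.
have T10 a x : U a x -> ~ L a x -> T1 a x = 0.
  move=> [cx dx] Lx; have [cS _ _ S0] := HS a; rewrite /T1 (mderiv0 _ cS S0) ?mul0r// => Sx.
  by apply: Lx; exists (cinv (c a) x) => //; exact: cinvK.
have T20 a x : U a x -> ~ L a x -> T2 a x = 0.
  by move=> Ux Lx; rewrite /T2 chi0// !mul0r.
have sT1 a : smooth_on (U a) (T1 a).
  apply: (@eq_smooth_on _ _ _ (@oU a) (fun x => K a x * w a x)).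
    by move=> x Ux; rewrite /T1 (mderivE Ux).
  exact: (smooth_onM (@oU a) (sK a) (sw a)).
have sT2 a : smooth_on (U a) (T2 a).
  apply: (smooth_onM (@oU a) _ (sw a)); apply: (smooth_onM (@oU a) (schi a)).
  exact: variation_density_smooth.
transitivity (\sum_a (integral_Rn (T1 a \_ (U a)) + integral_Rn (T2 a \_ (U a)))).
  apply: eq_bigr => a _; have [r r0 Hr] := ccont_restrict_open (@oU a) (@cL a) (@LU a).
  have c1 := Hr (T1 a) (fun x Ux => smooth_on_continuous (sT1 a) Ux) (@T10 a).
  have c2 := Hr (T2 a) (fun x Ux => smooth_on_continuous (sT2 a) Ux) (@T20 a).
  rewrite -(integral_RnD c1 c2); congr integral_Rn; apply/funext => x; rewrite /patch.
  by case: ifP => [/set_mem Ux|_]; [exact: integrandE|rewrite addr0].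
rewrite big_split /=; apply: (etrans (congr1 (fun z => z + _) _)); last exact: add0r.
transitivity (\sum_a chart_integral g0 (c a) (mderiv variation_field (chi a))).
  apply: eq_bigr => a _; rewrite /chart_integral; congr integral_Rn; apply/funext => x; rewrite /patch.
  have [cx|ncx] := boolP (x \in cimg (c a)); last first.
    case: ifP => // /set_mem [cx _]; move/negP: ncx; case; exact: mem_set.
  move/set_mem: cx => cx; have cp := cinv_cdom cx.
  case: ifPn => // nUx; have [cS _ Sd S0] := HS a.
  rewrite (mderiv0 _ cS S0) ?mul0r// => /Sd dx; move/negP: nUx; apply; exact: mem_set.
(* The terms with derivatives of cutoffs are gathered into one integral over [M], whose integrand is
   the derivative of the constant 1 along [variation_field]. *)
rewrite (@sum_chart_integral _ _ _ g0 g0_metric M_compact P _ c S).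
- transitivity (integral_wrt P g0 (fun=> 0)).
    congr integral_wrt; apply/funext => p.
    apply: (@mderiv_sum _ _ _ _ chi variation_field 1 p) => [a|q]; first exact: pu_smooth.
    exact: pu_sum1.
  rewrite (integral_wrtE g0) big1// => a _; rewrite /chart_integral.
  have -> : ((fun x => @pu_fun _ _ _ P a (cinv (@pu_chart _ _ _ P a) x) * 0 * density g0 (@pu_chart _ _ _ P a) x)
     \_ (cimg (@pu_chart _ _ _ P a))) = (fun=> 0).
    by apply/funext => x; rewrite /patch mulr0 mul0r; case: ifP.
  exact: integral_Rn0.
- by move=> a; have [cS Sc _ _] := HS a; split.
- move=> a p Sp; have [cS Sc Sd _] := HS a.
  apply: (@continuous_in_chart (c a) _ (U a) (K a) p (Sc _ Sp) (@oU a)).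
  + by apply: pidom_cfun; [exact: Sc|exact: Sd].
  + exact: sK.
  + by move=> q cq Uq; rewrite /K -(mderivE Uq) cfunK.
- by move=> a p NS; have [cS _ _ S0] := HS a; exact: (mderiv0 _ cS S0).
Qed.

End GlobalVariation.

(** * Projectability and criticality *)

Section VerticalDerivatives.
Variables (R : realType) (m k : nat) (U : set 'rV[R]_m) (V : set 'rV[R]_k).
Variable f : 'rV[R]_m -> 'rV[R]_k.
Hypotheses (oU : open U) (oV : open V) (fUV : forall x, U x -> V (f x)) (sf : smx U f).

Lemma pdmx_row n (Y : 'rV[R]_m -> 'rV[R]_n) x (v : 'rV[R]_m) : smx U Y -> U x ->
  v *m pdmx Y x = 'D_v Y x.
Proof.
move=> sY Ux; rewrite (smx_deriveE oU v Ux sY); apply/rowP => j; rewrite mxE summxE.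
apply: eq_bigr => i _; rewrite [RHS]mxE; congr (_ * _); rewrite mxE.
exact: (esym (D_mxE oU 'e_i 0 j sY Ux)).
Qed.

Lemma D_vertical a b (F : 'rV[R]_k -> 'M[R]_(a, b)) x (v : 'rV[R]_m) : smx V F -> U x ->
  v *m pdmx f x = 0 -> 'D_v (F \o f) x = 0.
Proof.
move=> sF Ux vD; rewrite (smx_deriveE oU v Ux (smx_comp oU oV fUV sf sF)).
under eq_bigr do rewrite (D_comp _ oU oV fUV sf sF Ux) scaler_sumr.
rewrite exchange_big /= big1// => l _.
under eq_bigr do rewrite scalerA.
rewrite -scaler_suml.
have -> : \sum_i v 0 i * pdmx f x i l = (v *m pdmx f x) 0 l by rewrite mxE.
by rewrite vD mxE scale0r.
Qed.

(** In vertical directions a matrix depending only on the base point behaves like a constant. This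
    applies both to the metric of [N] and to its transition matrices. *)
Lemma pdmx_vertical_mul n (Y : 'rV[R]_m -> 'rV[R]_k) (F : 'rV[R]_k -> 'M[R]_(k, n)) x p (v : 'M[R]_(p, m)) :
  smx U Y -> smx V F -> U x -> v *m pdmx f x = 0 ->
  v *m pdmx (fun z => Y z *m F (f z)) x = v *m pdmx Y x *m F (f x).
Proof.
move=> sY sF Ux vD; apply/row_matrixP => i; rewrite !row_mul.
have rD : row i v *m pdmx f x = 0 by rewrite -row_mul vD row0.
have sFf := smx_comp oU oV fUV sf sF.
rewrite (pdmx_row _ (smxM oU sY sFf) Ux) (pdmx_row _ sY Ux).
apply: (etrans (D_mul oU (row i v) sY sFf Ux)).
by rewrite (D_vertical sF Ux rD) mulmx0 addr0.
Qed.

End VerticalDerivatives.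

(** * Projectability in terms of eta *)

Section Projectable.
Variables (R : realType) (m k : nat) (M : manifold R m) (N : manifold R k) (pi : M -> N).
Implicit Types (p : M) (c : chart R M m) (d : chart R N k).
Variables (g0 : tensor2 M) (gN : tensor2 N).
Hypotheses (g0_metric : riemannian_metric g0) (gN_metric : riemannian_metric gN).
Hypothesis pi_sub : riemannian_submersion pi g0 gN.

Let ps : smooth_map pi. Proof. exact: sub_smooth pi_sub. Qed.
Let rk p : \rank (dpi pi p) = k. Proof. by case: pi_sub. Qed.
Let iso p : isometric_at pi g0 gN p. Proof. exact: submersion_isometric_at. Qed.
Let H := mean_curvature pi g0.

Lemma eta_in_change c c' d x : atlas c -> atlas c' -> atlas d -> cimg c x -> cdom c' (cinv c x) ->
  cdom d (pi (cinv c x)) -> eta_in pi g0 gN c d x = eta_in pi g0 gN c' d (cfun c' (cinv c x)).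
Proof.
move=> ac ac' ad cx cx' dx.
have H1 := mean_curvature_eta ps g0_metric gN_metric rk iso ac ad (cinv_cdom cx) dx.
have H2 := mean_curvature_eta ps g0_metric gN_metric rk iso ac' ad cx' dx.
rewrite (cinvK cx) in H1.
exact: (etrans (esym H1) H2).
Qed.

Lemma pdmx_eta_change c c' d p : atlas c -> atlas c' -> atlas d -> cdom c p -> cdom c' p -> cdom d (pi p) ->
  pdmx (eta_in pi g0 gN c d) (cfun c p) = jac c c' p *m pdmx (eta_in pi g0 gN c' d) (cfun c' p).
Proof.
move=> ac ac' ad cp cp' dp; rewrite -(pdmx_transition ac ac' cp cp').
pose U := cimg c `&` cinv c @^-1` (cdom c' `&` pi @^-1` cdom d).
have oU : open U.
  by apply: open_chart_preimage; apply: openI; [exact: open_cdom|exact/(open_pi_preimage ps)/open_cdom].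
have Ux : U (cfun c p) by split; [exact: cfun_cimg|rewrite /= cfunK].
have E : (cfun c' \o cinv c) (cfun c p) = cfun c' p by rewrite /= cfunK.
apply: (etrans (@pdmx_change _ _ _ U (pidom pi c' d) (cfun c' \o cinv c) (eta_in pi g0 gN c d) (eta_in pi g0 gN c' d)
   oU (@open_pidom _ _ _ _ _ _ ps c' d) _ _ _ _ _ (cfun c p) Ux)).
- by move=> x [cx [cx' dx]]; apply: pidom_cfun.
- by move=> i j; apply: smooth_onW (transition_smx ac ac' i j) => x [? []].
- by move=> i j; apply: smooth_onW (eta_smooth gN_metric pi_sub g0_metric pi_sub ac ad i j) => x [? []].
- exact: (eta_smooth gN_metric pi_sub g0_metric pi_sub ac' ad).
- by move=> x [cx [cx' dx]]; exact: eta_in_change.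
by rewrite E.
Qed.

(** In a chart [V *m D = 0] and [H *m D = eta]. The first is differentiated along [H], the second
    along [V]; the second derivatives of [pi] cancel in the bracket by symmetry. *)
Lemma lie_bracket_eta (V : vfield M) d p : smooth_vfield_on setT V -> vertical_vfield pi V ->
  atlas d -> cdom d (pi p) ->
  lie_bracket H V p *m Dpi pi (chart_at p) d p = - (V p *m pdmx (eta_in pi g0 gN (chart_at p) d) (pos_at p)).
Proof.
move=> sV vV ad dp; pose c := chart_at p.
have ac : atlas c by exact: chart_at_atlas.
have cp : cdom c p by exact: chart_at_cdom.
have oU := @open_pidom _ _ _ _ _ _ ps c d.
have Ux : pidom pi c d (cfun c p) by exact: pidom_cfun.
have sm := chart_submetric ps g0_metric gN_metric ac ad iso.
have [sG symG uG PE] := sm.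
have sf := pimap_smooth ps ac ad.
have sD := smx_pdmx oU sf.
have se := eta_smooth gN_metric pi_sub g0_metric pi_sub ac ad.
have sQ := base_smooth gN_metric pi_sub ac ad.
have sX := smx_gradf oU sf sm.
have sv : smx (pidom pi c d) (vin c V).
  move=> i j; rewrite ord1 vin_def; have HV := sV c ac j.
  by apply: smooth_onW HV => x [cx _].
have vD x : pidom pi c d x -> vin c V x *m pdmx (pimap pi c d) x = 0.
  move=> [cx dx]; have cq := cinv_cdom cx.
  have := (vin_vertical ps V ac ad cq dx).2 ((verticalE pi _ _).1 (vV _)).
  by rewrite Dpi_def cinvK.
have hE x : pidom pi c d x -> vin c H x = eta_in pi g0 gN c d x *m tin d gN (pimap pi c d x) *m gradf (pimap pi c d) (tin c g0) x.
  move=> [cx dx]; have cq := cinv_cdom cx.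
  have E := vin_mean_curvature ps g0_metric gN_metric rk iso ac ad cq dx.
  rewrite Dpi_def -(pimap_cfun pi d cq) (cinvK cx) in E.
  exact: E.
have sh : smx (pidom pi c d) (vin c H).
  by apply: (eq_smx oU (fun x Ux' => esym (hE x Ux'))); exact: (smxM oU (smxM oU se sQ) sX).
have hD x : pidom pi c d x -> vin c H x *m pdmx (pimap pi c d) x = eta_in pi g0 gN c d x.
  move=> Ux'; rewrite hE// -(mulmxA _ (gradf _ _ _)) PE// mulmxK//.
  exact: (tin_unit gN_metric ad (pimap_cimg Ux')).
have E1 : 'D_(H p) (vin c V) (cfun c p) *m pdmx (pimap pi c d) (cfun c p) =
    - (vin c V (cfun c p) *m 'D_(H p) (pdmx (pimap pi c d)) (cfun c p)).
  apply/eqP; rewrite -addr_eq0 -(D_mul oU (H p) sv sD Ux); apply/eqP.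
  rewrite (D_near_eq (g := fun=> 0) oU (H p) vD Ux).
  exact: derive_cst.
have E2 : 'D_(V p) (vin c H) (cfun c p) *m pdmx (pimap pi c d) (cfun c p) =
    'D_(V p) (eta_in pi g0 gN c d) (cfun c p) - vin c H (cfun c p) *m 'D_(V p) (pdmx (pimap pi c d)) (cfun c p).
  rewrite -(D_near_eq oU (V p) hD Ux) (D_mul oU (V p) sh sD Ux).
  by rewrite addrK.
have vp : vin c V (cfun c p) = V p by exact: vin_chart_at.
have hp : vin c H (cfun c p) = H p by exact: vin_chart_at.
have sym : V p *m 'D_(H p) (pdmx (pimap pi c d)) (cfun c p) = H p *m 'D_(V p) (pdmx (pimap pi c d)) (cfun c p).
  rewrite (smx_deriveE oU (H p) Ux sD) (smx_deriveE oU (V p) Ux sD) !mulmx_sumr.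
  apply/rowP => a; rewrite !summxE.
  transitivity (\sum_i \sum_j H p 0 i * V p 0 j * ('D_('e_i) (pdmx (pimap pi c d)) (cfun c p)) j a).
    apply: eq_bigr => i _; rewrite -scalemxAr mxE [X in _ * X]mxE mulr_sumr.
    by apply: eq_bigr => j _; rewrite mulrA.
  rewrite exchange_big /=; apply: eq_bigr => j _; rewrite -scalemxAr [RHS]mxE [X in _ = _ * X]mxE mulr_sumr.
  apply: eq_bigr => i _; rewrite mulrA (mulrC (V p 0 j)); congr (_ * _).
  exact: (pdmx_sym i j a oU sf Ux).
have EL : lie_bracket H V p = 'D_(H p) (vin c V) (cfun c p) - 'D_(V p) (vin c H) (cfun c p).
  by rewrite vin_def.
rewrite EL Dpi_def mulmxBl E1 E2 vp hp sym (pdmx_row oU (V p) se Ux).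
have gen (A B : 'rV[R]_k) : - A - (B - A) = - B by rewrite opprB addKr.
exact: gen.
Qed.

Lemma projectable_of_eta : (forall p, exists d, [/\ atlas d, cdom d (pi p) &
    forall v : 'rV[R]_m, v *m Dpi pi (chart_at p) d p = 0 -> v *m pdmx (eta_in pi g0 gN (chart_at p) d) (pos_at p) = 0]) ->
  projectable pi H.
Proof.
move=> He V sV vV p; have [d [ad dp Hd]] := He p; apply/verticalE.
have ac := chart_at_atlas p; have cp := chart_at_cdom p.
have E := lie_bracket_eta sV vV ad dp.
rewrite Hd ?oppr0 in E; last first.
  rewrite -{1}(vin_chart_at V p).
  exact: ((vin_vertical ps V ac ad cp dp).2 ((verticalE pi _ _).1 (vV p))).
have := (vertical_Dpi ps _ ac ad cp dp).1 E.
by rewrite jac_id// mulmx1.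
Qed.

(** Projectability is tested on vertical fields defined on all of [M], so a single vertical vector
    is extended constantly in a chart, projected by [Pi] and cut off. The factor [a] is the value of
    the bump function at [p]. *)
Lemma vertical_extension c d p (v : 'rV[R]_m) : atlas c -> atlas d -> cdom c p -> cdom d (pi p) ->
  v *m Dpi pi c d p = 0 -> exists (V : vfield M) (a : R), [/\ smooth_vfield_on setT V, vertical_vfield pi V, a != 0 &
    vin c V (cfun c p) = a *: v].
Proof.
move=> ac ad cp dp vD.
pose W := cdom c `&` pi @^-1` cdom d.
have oW : open W by apply: openI; [exact: open_cdom|exact/(open_pi_preimage ps)/open_cdom].
have Wp : W p by split.
have [b [sb b0 bp [S cS [[SW _] bS]]]] := manifold_bump oW Wp.
have oU := @open_pidom _ _ _ _ _ _ ps c d.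
have sm := chart_submetric ps g0_metric gN_metric ac ad iso.
have [sG symG uG PE] := sm.
have sf := pimap_smooth ps ac ad.
have sQ := base_smooth gN_metric pi_sub ac ad.
pose Pi x := 1%:M - pdmx (pimap pi c d) x *m tin d gN (pimap pi c d x) *m gradf (pimap pi c d) (tin c g0) x.
have sPi : smx (pidom pi c d) Pi.
  exact: (smxB oU (@smx_cst _ _ _ _ _ _) (smxM oU (smxM oU (smx_pdmx oU sf) sQ) (smx_gradf oU sf sm))).
have PiD x : pidom pi c d x -> Pi x *m pdmx (pimap pi c d) x = 0.
  by move=> Ux; apply: vprojD; [exact: (tin_unit gN_metric ad (pimap_cimg Ux))|exact: PE].
pose V : vfield M := fun q => b q *: (v *m Pi (cfun c q)) *m jac c (chart_at q) q.
have vE q : cdom c q -> vin c V (cfun c q) = b q *: (v *m Pi (cfun c q)).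
  move=> cq; rewrite vin_cfun// /V -mulmxA jacK ?mulmx1//; [exact: chart_at_atlas|exact: chart_at_cdom].
have V0 q : ~ S q -> V q = 0 by move=> /bS bq; rewrite /V bq scale0r mul0mx.
exists V, (b p); split.
- move=> c' ac' j; rewrite -vin_def; apply: smooth_on_local => x [cx _].
  have [Wx|NW] := pselect (W (cinv c' x)).
    exists (cimg c' `&` cinv c' @^-1` W); split; [exact: open_chart_preimage|by split|].
    rewrite vin_def; apply: (@smooth_vfield_chart _ _ _ c V W ac oW) => //; first by move=> q [].
    have oO : open (cimg c `&` cinv c @^-1` W) by exact: open_chart_preimage.
    have OU : cimg c `&` cinv c @^-1` W `<=` pidom pi c d by move=> z [cz [_ dz]].
    have s1 : smx (cimg c `&` cinv c @^-1` W) (fun z => (b \o cinv c) z *: (v *m Pi z)).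
      apply: (smxZ oO).
        by apply: smooth_onW (sb c ac) => z [].
      have s2 := smxM oU (@smx_cst _ _ _ _ _ v) sPi.
      by move=> i l; apply: smooth_onW OU (s2 i l).
    apply: (eq_smx oO _ s1) => z [cz _].
    by rewrite -[in RHS](cinvK cz) vE ?cinvK//; exact: cinv_cdom.
  exists (cimg c' `&` cinv c' @^-1` (~` S)); split.
  + by apply: open_chart_preimage; exact: closed_openC.
  + by split=> // /SW.
  + apply: (@eq_smooth_on _ _ _ _ (fun=> 0)).
    * by apply: open_chart_preimage; exact: closed_openC.
    * move=> z [cz Sz]; rewrite -(cinvK cz) vin_cfun; last exact: cinv_cdom.
      by rewrite V0// mul0mx mxE.
    * exact: smooth_on_cst.
- move=> q; apply/verticalE; have [Sq|NS] := pselect (S q); last by rewrite V0// mul0mx.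
  have [cq dq] := SW _ Sq; apply/(vin_vertical ps V ac ad cq dq).
  by rewrite vE// -scalemxAl -mulmxA Dpi_def PiD ?mulmx0 ?scaler0//; exact: pidom_cfun.
- by rewrite gt_eqF.
- rewrite vE//; congr (_ *: _).
  by apply: vproj_vertical; rewrite -Dpi_def.
Qed.

Lemma eta_of_projectable c d p (v : 'rV[R]_m) : projectable pi H -> atlas c -> atlas d -> cdom c p -> cdom d (pi p) ->
  v *m Dpi pi c d p = 0 -> v *m pdmx (eta_in pi g0 gN c d) (cfun c p) = 0.
Proof.
move=> pH ac ad cp dp vD.
have [V [a [sV vV a0 Va]]] := vertical_extension ac ad cp dp vD.
have ac' := chart_at_atlas p; have cp' := chart_at_cdom p.
have E := lie_bracket_eta sV vV ad dp.
have /verticalE bv := pH V sV vV p.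
have b0 : lie_bracket H V p *m Dpi pi (chart_at p) d p = 0.
  by apply: (vertical_Dpi ps _ ac' ad cp' dp).2; rewrite jac_id// mulmx1.
rewrite b0 in E; move/esym/eqP: E; rewrite oppr_eq0 => /eqP E.
rewrite (pdmx_eta_change ac' ac ad cp' cp dp) mulmxA -(vin_cfun V cp) Va -scalemxAl in E.
by move/eqP: E; rewrite scaler_eq0 (negbTE a0) => /eqP.
Qed.

End Projectable.

(** * Linear algebra of the shear *)

Section ShearAlgebra.
Variables (R : realType) (m k : nat).

Lemma vcometric_congr (J G : 'M[R]_m) (D : 'M[R]_(m, k)) (Q : 'M[R]_k) : J \in unitmx -> G \in unitmx ->
  J^T *m vcometric (J *m G *m J^T) (J *m D) Q *m J = vcometric G D Q.
Proof.
move=> uJ uG; have uJt : J^T \in unitmx by rewrite unitmx_tr.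
have u : J *m G *m J^T \in unitmx by rewrite !unitmx_mul uJ uG uJt.
have iE : J^T *m invmx (J *m G *m J^T) *m J = invmx G.
  apply: (can_inj (mulmxK uG)); rewrite mulVmx//.
  apply: (can_inj (mulmxK uJt)); rewrite mul1mx -!mulmxA (mulmxA J) mulVmx// mulmx1.
  by [].
have XE := gradmx_congr D uJ uG.
rewrite /vcometric; move: (gradmx _ _) XE => X XE.
by rewrite mulmxBr mulmxBl iE -XE trmx_mul !mulmxA.
Qed.

Lemma vcometric_mulr (G : 'M[R]_m) (D : 'M[R]_(m, k)) (j Q Q' : 'M[R]_k) : Q = j *m Q' *m j^T ->
  vcometric G (D *m j) Q' = vcometric G D Q.
Proof.
by move=> ->; rewrite /vcometric gradmx_mulr; move: (gradmx G D) => X; rewrite trmx_mul trmxK !mulmxA.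
Qed.

Lemma invmx_shear (K G : 'M[R]_m) (t : R) : K *m K = 0 -> G \in unitmx ->
  invmx ((1%:M - t *: K) *m G *m (1%:M - t *: K)^T) = (1%:M + t *: K)^T *m invmx G *m (1%:M + t *: K).
Proof.
move=> KK uG.
have E : (1%:M - t *: K) *m (1%:M + t *: K) = 1%:M.
  rewrite mulmxDr mulmx1 mulmxBl mul1mx -scalemxAl -scalemxAr KK !scaler0 subr0.
  by rewrite subrK.
have E' := mulmx1C E.
have [uS uS'] := mulmx1_unit E.
have uSt : (1%:M - t *: K)^T \in unitmx by rewrite unitmx_tr.
have uu : (1%:M - t *: K) *m G *m (1%:M - t *: K)^T \in unitmx by rewrite !unitmx_mul uS uG uSt.
apply: (can_inj (mulmxK uu)); rewrite mulVmx//.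
move: (1%:M - t *: K) (1%:M + t *: K) E' E => S S' SS' E2.
rewrite -!mulmxA (mulmxA S') SS' mul1mx mulKmx// -trmx_mul.
by rewrite E2 trmx1.
Qed.

Lemma vcometric_congr_mul (J G G' : 'M[R]_m) (D D' A A' : 'M[R]_(m, k)) (Q : 'M[R]_k) : J \in unitmx ->
  G' \in unitmx -> G = J *m G' *m J^T -> D = J *m D' -> A = J *m A' ->
  J^T *m (vcometric G D Q *m A) = vcometric G' D' Q *m A'.
Proof. by move=> uJ uG -> -> ->; rewrite !mulmxA vcometric_congr. Qed.

(** With [Q = C *m C^T] the trace is the sum of the squared [G]-norms of the columns of [A *m C],
    and [C] is invertible. *)
Lemma posdef_trace (G : 'M[R]_m) (Q : 'M[R]_k) (A : 'M[R]_(m, k)) : posdef G -> Q^T = Q -> posdef Q ->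
  0 <= \tr (A^T *m G *m A *m Q) /\ (\tr (A^T *m G *m A *m Q) = 0 -> A = 0).
Proof.
move=> pG sQ pQ.
have [C uC QE] : exists2 C : 'M[R]_k, C \in unitmx & Q = C *m C^T.
  have [W [L [_ _ W0 _ /(_ _ W0) LQ]]] := @smooth_cholesky R 0 k setT (fun=> Q) 0 openT I (@smx_cst _ _ _ _ _ Q)
    (fun=> sQ) pQ.
  have uL : L 0 \in unitmx by have [] := mulmx1_unit (etrans (mulmxA _ _ _) LQ).
  exists (invmx (L 0)); first by rewrite unitmx_inv.
  have uLt : (L 0)^T \in unitmx by rewrite unitmx_tr.
  apply: (can_inj (mulmxK uLt)); rewrite -mulmxA -trmx_mul mulmxV// trmx1 mulmx1.
  by apply: (can_inj (mulKmx uL)); rewrite mulmxV// mulmxA.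
have E : \tr (A^T *m G *m A *m Q) = \sum_a gdot G (row a (A *m C)^T) (row a (A *m C)^T).
  have aux (Y : 'M[R]_(m, k)) a : (Y^T *m G *m Y) a a = gdot G (row a Y^T) (row a Y^T).
    rewrite /gdot -row_mul mxE [RHS]mxE; apply: eq_bigr => s _; rewrite [row _ _ _ _]mxE.
    by congr (_ * _); rewrite !mxE.
  rewrite QE mulmxA mxtrace_mulC; apply: eq_bigr => a _.
  by rewrite -aux trmx_mul !mulmxA.
have pos a : 0 <= gdot G (row a (A *m C)^T) (row a (A *m C)^T).
  have [->|/pG/ltW//] := eqVneq (row a (A *m C)^T) 0.
  by rewrite /gdot mul0mx mul0mx mxE.
split; first by rewrite E; apply: sumr_ge0 => a _.
rewrite E => /eqP; rewrite psumr_eq0 => [/allP z|a _ //].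
have : (A *m C)^T = 0.
  apply/row_matrixP => a; rewrite row0; apply/eqP/negPn/negP => /pG.
  by have := z a (mem_index_enum _) => /eqP ->; rewrite ltxx.
move=> /(congr1 trmx); rewrite trmxK trmx0 => AC.
by apply: (can_inj (mulmxK uC)); rewrite AC mul0mx.
Qed.

End ShearAlgebra.

(** * The shear variation *)

Section ShearVariation.
Variables (R : realType) (m k : nat) (M : manifold R m) (N : manifold R k) (pi : M -> N).
Implicit Types (p : M) (c : chart R M m) (d : chart R N k).
Variables (g0 : tensor2 M) (gN : tensor2 N).
Hypotheses (g0_metric : riemannian_metric g0) (gN_metric : riemannian_metric gN).
Hypothesis pi_sub : riemannian_submersion pi g0 gN.

Let ps : smooth_map pi. Proof. by case: pi_sub. Qed.
Let rk p : \rank (dpi pi p) = k. Proof. by case: pi_sub. Qed.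
Let iso p : isometric_at pi g0 gN p. Proof. exact: submersion_isometric_at. Qed.

(* The vertical gradients of the components of the mean curvature. *)
Definition vgrad c d p : 'M[R]_(m, k) :=
  vcometric (tin c g0 (cfun c p)) (Dpi pi c d p) (tin d gN (cfun d (pi p))) *m
  pdmx (eta_in pi g0 gN c d) (cfun c p).

(** The factor [tin d gN] compensates the Gram matrix of the gradients, so that the gradient matrix
    times the shear is exactly the transpose of [vgrad] ([gradmx_shear_in]). *)
Definition shear_in c d p : 'M[R]_m :=
  Dpi pi c d p *m tin d gN (cfun d (pi p)) *m (vgrad c d p)^T.

Definition shear p : 'M[R]_m := shear_in (chart_at p) (chart_at (pi p)) p.

Lemma vgrad_changel c c' d p : atlas c -> atlas c' -> atlas d -> cdom c p -> cdom c' p -> cdom d (pi p) ->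
  (jac c c' p)^T *m vgrad c d p = vgrad c' d p.
Proof.
move=> ac ac' ad cp cp' dp.
have uG : tin c' g0 (cfun c' p) \in unitmx by apply: (tin_unit g0_metric ac'); exact: cfun_cimg.
exact: (vcometric_congr_mul _ (jac_unit ac ac' cp cp') uG (tin_jac g0 ac ac' cp cp')
  (Dpi_changel ps ac ac' ad cp cp' dp) (pdmx_eta_change g0_metric gN_metric pi_sub ac ac' ad cp cp' dp)).
Qed.

Lemma chart_isom c d p : atlas c -> atlas d -> cdom c p -> cdom d (pi p) ->
  gradmx (tin c g0 (cfun c p)) (Dpi pi c d p) *m Dpi pi c d p = invmx (tin d gN (cfun d (pi p))).
Proof. by move=> ac ad cp dp; exact: (chart_isometric ps g0_metric gN_metric ac ad cp dp (iso p)). Qed.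

Lemma vcometric_Dpi c d p : atlas c -> atlas d -> cdom c p -> cdom d (pi p) ->
  vcometric (tin c g0 (cfun c p)) (Dpi pi c d p) (tin d gN (cfun d (pi p))) *m Dpi pi c d p = 0.
Proof.
move=> ac ad cp dp; apply: vcometricD; last exact: chart_isom.
  by apply: (tin_sym g0_metric); exact: cfun_cimg.
by apply: (tin_unit gN_metric ad); exact: cfun_cimg.
Qed.

Lemma vcometric_sym c d p : cdom c p -> cdom d (pi p) ->
  (vcometric (tin c g0 (cfun c p)) (Dpi pi c d p) (tin d gN (cfun d (pi p))))^T =
  vcometric (tin c g0 (cfun c p)) (Dpi pi c d p) (tin d gN (cfun d (pi p))).
Proof.
move=> cp dp; apply: vcometric_tr; first by apply: (tin_sym g0_metric); exact: cfun_cimg.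
by apply: (tin_sym gN_metric); exact: cfun_cimg.
Qed.

Lemma vgradD c d p : atlas c -> atlas d -> cdom c p -> cdom d (pi p) -> (vgrad c d p)^T *m Dpi pi c d p = 0.
Proof.
by move=> ac ad cp dp; rewrite /vgrad trmx_mul vcometric_sym// -mulmxA vcometric_Dpi// mulmx0.
Qed.

Lemma pdmx_near_eq (n q : nat) (O : set 'rV[R]_n) (F F' : 'rV[R]_n -> 'rV[R]_q) x : open O -> O x ->
  (forall y, O y -> F y = F' y) -> pdmx F x = pdmx F' x.
Proof.
move=> oO Ox E; apply/matrixP => i j; rewrite [LHS]mxE [RHS]mxE.
by apply: (D_near_eq oO _ _ Ox) => y Oy; rewrite E.
Qed.

Lemma eta_in_changer c d d' p : atlas c -> atlas d -> atlas d' -> cdom c p -> cdom d (pi p) -> cdom d' (pi p) ->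
  eta_in pi g0 gN c d' (cfun c p) = eta_in pi g0 gN c d (cfun c p) *m jac d d' (pi p).
Proof.
move=> ac ad ad' cp dp dp'.
rewrite -(mean_curvature_eta ps g0_metric gN_metric rk iso ac ad cp dp).
rewrite -(mean_curvature_eta ps g0_metric gN_metric rk iso ac ad' cp dp').
rewrite (Dpi_changer ps (chart_at_atlas p) ad ad' (chart_at_cdom p) dp dp').
exact: mulmxA.
Qed.

(** A change of chart in [N] multiplies eta by a transition matrix that depends on the point. Its
    derivative drops out because the vertical cometric annihilates [dpi]. *)
Lemma vgrad_changer c d d' p : atlas c -> atlas d -> atlas d' -> cdom c p -> cdom d (pi p) -> cdom d' (pi p) ->
  vgrad c d' p = vgrad c d p *m jac d d' (pi p).
Proof.
move=> ac ad ad' cp dp dp'; rewrite /vgrad (Dpi_changer ps ac ad ad' cp dp dp').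
rewrite (vcometric_mulr _ _ (tin_jac gN ad ad' dp dp')).
have vD := vcometric_Dpi ac ad cp dp; move: (vcometric _ _ _) vD => B; rewrite Dpi_def => BD.
pose U := cimg c `&` cinv c @^-1` (pi @^-1` (cdom d `&` cdom d')).
have oU : open U.
  by apply: open_chart_preimage; apply: (open_pi_preimage ps); apply: openI; exact: open_cdom.
have Ux : U (cfun c p) by split; [exact: cfun_cimg|rewrite /= cfunK].
have oV := @open_overlap _ _ _ d d'.
have UV x : U x -> (cimg d `&` cinv d @^-1` cdom d') (pimap pi c d x).
  by move=> [cx [dx dx']]; exact: overlap_cfun.
have sf : smx U (pimap pi c d) by move=> i j; apply: smooth_onW (pimap_smooth ps ac ad i j) => x [? []].
have se : smx U (eta_in pi g0 gN c d).
  by move=> i j; apply: smooth_onW (eta_smooth gN_metric pi_sub g0_metric pi_sub ac ad i j) => x [? []].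
have E x : U x -> eta_in pi g0 gN c d' x = eta_in pi g0 gN c d x *m jac d d' (cinv d (pimap pi c d x)).
  move=> [cx [dx dx']]; have := eta_in_changer ac ad ad' (cinv_cdom cx) dx dx'.
  by rewrite (cinvK cx) => ->; rewrite /pimap /= cfunK.
apply: (etrans (congr1 (mulmx B) (pdmx_near_eq oU Ux E))).
have H := @pdmx_vertical_mul _ _ _ U _ (pimap pi c d) oU oV UV sf _ (eta_in pi g0 gN c d)
  (fun y => jac d d' (cinv d y)) (cfun c p) _ B se (jac_smooth ad ad') Ux BD.
apply: (etrans H); apply: (congr1 (mulmx _)).
by rewrite (pimap_cfun _ _ cp) (cfunK dp).
Qed.

(** The transformations of [vgrad], of [Dpi] and of the metric of [N] compensate each other: the
    shear is an endomorphism field on [M], independent of both charts. *)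
Lemma shear_inE c d p : atlas c -> atlas d -> cdom c p -> cdom d (pi p) ->
  jac c (chart_at p) p *m shear p = shear_in c d p *m jac c (chart_at p) p.
Proof.
move=> ac ad cp dp; rewrite /shear.
have ac' := chart_at_atlas p; have cp' := chart_at_cdom p.
have ad' := chart_at_atlas (pi p); have dp' := chart_at_cdom (pi p).
have -> : shear_in (chart_at p) (chart_at (pi p)) p = shear_in (chart_at p) d p.
  rewrite /shear_in (vgrad_changer ac' ad ad' cp' dp dp') (Dpi_changer ps ac' ad ad' cp' dp dp').
  rewrite (tin_jac gN ad ad' dp dp') trmx_mul !mulmxA.
  by [].
rewrite /shear_in (Dpi_changel ps ac ac' ad cp cp' dp) -(vgrad_changel ac ac' ad cp cp' dp).
by rewrite trmx_mul trmxK !mulmxA.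
Qed.

Section ShearIn.
Variables (c : chart R M m) (d : chart R N k) (p : M).
Hypotheses (ac : atlas c) (ad : atlas d) (cp : cdom c p) (dp : cdom d (pi p)).

Lemma shear_inD : shear_in c d p *m Dpi pi c d p = 0.
Proof. by rewrite /shear_in -mulmxA vgradD// mulmx0. Qed.

Lemma shear_in_sqr : shear_in c d p *m shear_in c d p = 0.
Proof. by rewrite {2}/shear_in !mulmxA shear_inD !mul0mx. Qed.

Lemma vertical_shear_in n (v : 'M[R]_(n, m)) : v *m Dpi pi c d p = 0 -> v *m shear_in c d p = 0.
Proof. by move=> vD; rewrite /shear_in !mulmxA vD !mul0mx. Qed.

Lemma gradmx_shear_in : gradmx (tin c g0 (cfun c p)) (Dpi pi c d p) *m shear_in c d p = (vgrad c d p)^T.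
Proof.
rewrite /shear_in; have := chart_isom ac ad cp dp; move: (gradmx _ _) => X XD.
by rewrite !mulmxA XD mulVmx ?mul1mx//; apply: (tin_unit gN_metric ad); exact: cfun_cimg.
Qed.

End ShearIn.

(* The shear kills vertical vectors and has vertical values, so it squares to
   zero, and neither the metric on the fibers nor the metric induced on the base
   depends on [t]. *)
Definition shear_metric (t : R) : tensor2 M := fun p =>
  (1%:M - t *: shear p) *m g0 p *m (1%:M - t *: shear p)^T.

Lemma tin_shear_metric c d p t : atlas c -> atlas d -> cdom c p -> cdom d (pi p) ->
  tin c (shear_metric t) (cfun c p) =
  (1%:M - t *: shear_in c d p) *m tin c g0 (cfun c p) *m (1%:M - t *: shear_in c d p)^T.
Proof.
move=> ac ad cp dp; rewrite !tin_cfun// /shear_metric.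
have E := shear_inE ac ad cp dp; move: (jac _ _ _) (shear p) (shear_in _ _ _) E => J K Kc E.
have E1 : J *m (1%:M - t *: K) = (1%:M - t *: Kc) *m J.
  by rewrite mulmxBr mulmxBl mulmx1 mul1mx -scalemxAr -scalemxAl E.
have -> : J *m ((1%:M - t *: K) *m g0 p *m (1%:M - t *: K)^T) *m J^T =
   (J *m (1%:M - t *: K)) *m g0 p *m (J *m (1%:M - t *: K))^T by rewrite trmx_mul !mulmxA.
by rewrite E1 trmx_mul !mulmxA.
Qed.

End ShearVariation.

(** * Critical metrics and projectability *)

Section Criticality.
Variables (R : realType) (m k : nat) (M : manifold R m) (N : manifold R k) (pi : M -> N).
Implicit Types (p : M) (c : chart R M m) (d : chart R N k).
Variables (g0 : tensor2 M) (gN : tensor2 N).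
Hypotheses (g0_metric : riemannian_metric g0) (gN_metric : riemannian_metric gN).
Hypothesis pi_sub : riemannian_submersion pi g0 gN.

Let ps : smooth_map pi. Proof. by case: pi_sub. Qed.
Let rk p : \rank (dpi pi p) = k. Proof. by case: pi_sub. Qed.
Let iso p : isometric_at pi g0 gN p. Proof. exact: submersion_isometric_at. Qed.
Let gs := shear_metric pi g0 gN.

Lemma gradd_pi (eps : R) (gt : R -> tensor2 M) c d x : Defs.variation pi g0 eps gt -> preserves pi gN eps gt ->
  atlas c -> atlas d -> pidom pi c d x -> gradd (pimap pi c d) (fun t => tin c (gt t)) x *m pdmx (pimap pi c d) x = 0.
Proof.
move=> var pres ac ad Ux; have eps0 : 0 < eps by case: var.
exact: (gradd_vertical (open_pidom ps (c := c) (d := d)) (pimap_smooth ps ac ad) eps0 (variation_smooth var d ac)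
  (fun t te => variation_submetric gN_metric pi_sub var pres ac ad te) Ux).
Qed.

Lemma pdmx_lowered n c d x (v : 'M[R]_(n, m)) : atlas c -> atlas d -> pidom pi c d x ->
  v *m pdmx (pimap pi c d) x = 0 ->
  v *m pdmx (fun z => eta_in pi g0 gN c d z *m tin d gN (pimap pi c d z)) x =
  v *m pdmx (eta_in pi g0 gN c d) x *m tin d gN (pimap pi c d x).
Proof.
move=> ac ad Ux vD.
exact: (pdmx_vertical_mul (@open_pidom _ _ _ _ _ _ ps c d) (@open_cimg _ _ _ d) (@pimap_cimg _ _ _ _ _ pi c d)
  (pimap_smooth ps ac ad) (eta_smooth gN_metric pi_sub g0_metric pi_sub ac ad) (tin_smooth gN_metric ad) Ux vD).
Qed.

Lemma adapted_partition : compact [set: M] -> exists (P : partition_of_unity M) (pt : 'I_(pu_size P) -> M)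
    (S : 'I_(pu_size P) -> set M), forall a,
  [/\ closed (S a), S a `<=` cdom (pu_chart a), S a `<=` pi @^-1` cdom (chart_at (pi (pt a)))
    & forall q, ~ S a q -> pu_fun a q = 0].
Proof.
move=> cM.
have [p|P HP] := subordinate_partition cM (W := fun p => pi @^-1` cdom (chart_at (pi p))).
  by split; [apply: (open_pi_preimage ps); exact: open_cdom|exact: chart_at_cdom].
have /choice[pt Hpt] := HP.
have /choice[S HS] : forall a, exists S : set M, closed S /\ (S `<=` pi @^-1` cdom (chart_at (pi (pt a))) /\
    S `<=` cdom (chart_at (pt a))) /\ forall q, ~ S q -> pu_fun a q = 0.
  by move=> a; have [_ [S cS HS]] := Hpt a; exists S.
exists P, pt, S => a; have [ca _] := Hpt a; have [cS [[SW Sc] S0]] := HS a.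
by split=> //; rewrite ca.
Qed.

Lemma projectable_critical : compact [set: M] -> projectable pi (mean_curvature pi g0) -> critical_JH pi gN g0.
Proof.
move=> cM pH eps gt var pres.
have [P [pt [S HS]]] := adapted_partition cM.
apply: (is_derive_cast (JH_derive g0_metric gN_metric pi_sub var pres cM HS)).
rewrite big1 ?mulr0// => a _.
transitivity (integral_Rn (fun _ : 'rV[R]_m => (0 : R))); last exact: integral_Rn0.
congr integral_Rn; apply/funext => x; rewrite /patch; case: ifP => // /set_mem Ux.
pose c := @pu_chart _ _ _ P a; pose d : chart R N k := chart_at (pi (pt a)).
have ac : atlas c by exact: pu_atlas.
have ad : atlas d by exact: chart_at_atlas.
have ZD := gradd_pi var pres ac ad Ux.
suff -> : variation_density pi g0 gN gt pt a x = 0 by rewrite mulr0 mul0r.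
rewrite /variation_density -/c -/d (pdmx_lowered ac ad Ux ZD).
suff -> : gradd (pimap pi c d) (fun t => tin c (gt t)) x *m pdmx (eta_in pi g0 gN c d) x = 0.
  by rewrite mul0mx linear0.
have [cx dx] := Ux; have cp := cinv_cdom cx.
apply/row_matrixP => i; rewrite row_mul row0.
have := @eta_of_projectable _ _ _ _ _ _ _ _ g0_metric gN_metric pi_sub c d (cinv c x)
  (row i (gradd (pimap pi c d) (fun t => tin c (gt t)) x)) pH ac ad cp dx.
rewrite Dpi_def (cinvK cx); apply.
by rewrite -row_mul ZD row0.
Qed.

Lemma shear_in_smooth c d : atlas c -> atlas d -> smx (pidom pi c d) (fun x => shear_in pi g0 gN c d (cinv c x)).
Proof.
move=> ac ad.
have oU := @open_pidom _ _ _ _ _ _ ps c d.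
have sf := pimap_smooth ps ac ad.
have sm := chart_submetric ps g0_metric gN_metric ac ad iso.
have [sG symG uG PE] := sm.
have sD := smx_pdmx oU sf.
have sQ := base_smooth gN_metric pi_sub ac ad.
have sX := smx_gradf oU sf sm.
have se := smx_pdmx oU (eta_smooth gN_metric pi_sub g0_metric pi_sub ac ad).
have sB := smxB oU (smx_inv oU uG sG) (smxM oU (smxM oU (smx_tr oU sX) sQ) sX).
apply: (eq_smx oU _ (smxM oU (smxM oU sD sQ) (smx_tr oU (smxM oU sB se)))) => x [cx dx].
by rewrite /shear_in /vgrad Dpi_def (cinvK cx).
Qed.

Lemma shear_family_smooth c : atlas c ->
  smx (tdom 1 (cimg c)) (fun v => tin c (gs (lsubmx v 0 0)) (rsubmx v)).
Proof.
move=> ac i j; apply: smooth_on_local => v [te cx].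
(* Smoothness is a local property, and near each point the shear is expressed with one chart of [N]
   around the image of that point. *)
pose d : chart R N k := chart_at (pi (cinv c (rsubmx v))).
have ad : atlas d by exact: chart_at_atlas.
have dx : cdom d (pi (cinv c (rsubmx v))) by exact: chart_at_cdom.
have oU := @open_pidom _ _ _ _ _ _ ps c d.
have oT : open (tdom 1 (pidom pi c d)) by exact: open_tdom.
exists (tdom 1 (pidom pi c d)); split; [exact: oT|exact: (conj te (conj cx dx))|].
have sR a b (F : 'rV[R]_m -> 'M[R]_(a, b)) : smx (pidom pi c d) F ->
    smx (tdom 1 (pidom pi c d)) (fun v : 'rV[R]_(1 + m) => F (rsubmx v)).
  move=> sF a' b'; exact: (@smx_rsub _ _ _ oU 1 (fun x => F x a' b') (sF a' b')).
have sG : smx (pidom pi c d) (tin c g0).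
  by move=> a b; apply: smooth_onW (tin_smooth g0_metric ac a b) => x [].
have sS := sR _ _ _ (shear_in_smooth ac ad).
have s1 := smxB oT (@smx_cst _ _ (tdom 1 (pidom pi c d)) _ _ (1%:M : 'M[R]_m))
  (smxZ oT (lsubmx_smooth (tdom 1 (pidom pi c d))) sS).
have s2 := smxM oT (smxM oT s1 (sR _ _ _ sG)) (smx_tr oT s1).
apply: (eq_smooth_on oT _ (s2 i j)) => w [we [cw dw]].
have := tin_shear_metric g0_metric gN_metric pi_sub (lsubmx w 0 0) ac ad (cinv_cdom cw) dw.
by rewrite (cinvK cw) => ->.
Qed.

Lemma shear0 p : shear pi g0 gN p *m dpi pi p = 0.
Proof.
rewrite (dpiE ps); apply: (shear_inD g0_metric gN_metric pi_sub); first [exact: chart_at_atlas|exact: chart_at_cdom].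
Qed.

Lemma shear_sqr p : shear pi g0 gN p *m shear pi g0 gN p = 0.
Proof.
apply: (shear_in_sqr g0_metric gN_metric pi_sub); first [exact: chart_at_atlas|exact: chart_at_cdom].
Qed.

Lemma vertical_shear p (v : 'rV[R]_m) : v *m dpi pi p = 0 -> v *m shear pi g0 gN p = 0.
Proof. by rewrite (dpiE ps) => vD; exact: vertical_shear_in. Qed.

Lemma shear_metric_riemannian t : `|t| < 1 -> riemannian_metric (gs t).
Proof.
move=> te; split.
- move=> c ac i j; rewrite -tin_def.
  have H := tpair_slice_smooth (@open_cimg _ _ _ c) te (shear_family_smooth ac i j).
  apply: (eq_smooth_on (@open_cimg _ _ _ c) _ H) => x cx.
  by rewrite lsub_tpair rsub_tpair.
- by move=> p; rewrite /gs /shear_metric !trmx_mul trmxK (riem_sym g0_metric) mulmxA.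
- move=> p; apply: posdef_congr; last by move=> v; exact: riem_posdef.
  rewrite row_free_unit.
  have E : (1%:M - t *: shear pi g0 gN p) *m (1%:M + t *: shear pi g0 gN p) = 1%:M.
    by rewrite mulmxDr mulmx1 mulmxBl mul1mx -scalemxAl -scalemxAr shear_sqr !scaler0 subr0 subrK.
  by have [] := mulmx1_unit E.
Qed.

Lemma shear_variation : Defs.variation pi g0 1 gs.
Proof.
split; first exact: ltr01.
- move=> t te; split; first exact: shear_metric_riemannian.
  move=> p X Y /verticalE XD /verticalE YD.
  rewrite /gs /shear_metric [LHS]gdot_congr !mulmxBr !mulmx1 -!scalemxAr.
  by rewrite !vertical_shear// !scaler0 !subr0.
- move=> c ac i j; rewrite -tin_def; exact: (shear_family_smooth ac).
- by apply/funext => p; rewrite /gs /shear_metric scale0r subr0 trmx1 mul1mx mulmx1.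
Qed.

Lemma shear_preserves : preserves pi gN 1 gs.
Proof.
move=> t te; apply: (isometric_submersion ps (shear_metric_riemannian te) gN_metric rk) => p.
rewrite /isometric_at -(iso p) /gradmx /gs /shear_metric.
rewrite (invmx_shear _ (shear_sqr p) (riem_unit g0_metric p)).
have E : (1%:M + t *: shear pi g0 gN p) *m dpi pi p = dpi pi p.
  by rewrite mulmxDl mul1mx -scalemxAl shear0 scaler0 addr0.
by rewrite !mulmxA -trmx_mul E -mulmxA E.
Qed.

(** The inverse metric is [(1 + t K)^T G^-1 (1 + t K)] and [1 + t K] fixes the differential, so the
    gradients are affine in [t] with slope the gradients times [K]. *)
Lemma gradd_shear c d x : atlas c -> atlas d -> pidom pi c d x ->
  gradd (pimap pi c d) (fun t => tin c (gs t)) x = (vgrad pi g0 gN c d (cinv c x))^T.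
Proof.
move=> ac ad Ux; have [cx dx] := Ux; have cp := cinv_cdom cx; set p := cinv c x in cp dx *.
have xE : x = cfun c p by rewrite /p cinvK.
have uG : tin c g0 x \in unitmx by exact: (tin_unit g0_metric ac cx).
have E t : gradf (pimap pi c d) (tin c (gs t)) x = gradf (pimap pi c d) (tin c g0) x + t *: (vgrad pi g0 gN c d p)^T.
  rewrite /gradf xE -Dpi_def (tin_shear_metric g0_metric gN_metric pi_sub t ac ad cp dx) -xE /gradmx.
  rewrite (invmx_shear _ (shear_in_sqr g0_metric gN_metric pi_sub ac ad cp dx) uG).
  have DK : (Dpi pi c d p)^T *m (1%:M + t *: shear_in pi g0 gN c d p)^T = (Dpi pi c d p)^T.
    rewrite -trmx_mul mulmxDl mul1mx -scalemxAl.
    by rewrite (shear_inD g0_metric gN_metric pi_sub ac ad cp dx) scaler0 addr0.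
  rewrite !mulmxA DK mulmxDr mulmx1 -scalemxAr; congr (_ + _ *: _).
  rewrite {1}xE; exact: (gradmx_shear_in g0_metric gN_metric pi_sub ac ad cp dx).
apply/matrixP => a s.
have [_ <-] := slice_derive (@open_pidom _ _ _ _ _ _ ps c d) (pimap_smooth ps ac ad) ltr01 (variation_smooth shear_variation d ac)
  (fun t te => variation_submetric gN_metric pi_sub shear_variation shear_preserves ac ad te) a s Ux.
have -> : (fun t => gradf (pimap pi c d) (tin c (gs t)) x a s) =
   (fun t => cst (gradf (pimap pi c d) (tin c g0) x a s) t + id t * cst ((vgrad pi g0 gN c d p)^T a s) t).
  by apply/funext => t; rewrite E mxE; congr (_ + _); rewrite mxE.
have H := is_deriveD (is_derive_cst (gradf (pimap pi c d) (tin c g0) x a s) (0 : R) (1 : R))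
  (is_deriveMr (is_derive_id (0 : R) (1 : R)) (is_derive_cst ((vgrad pi g0 gN c d p)^T a s) (0 : R) (1 : R))).
have [_ D] := H; apply: (etrans D).
by rewrite mulr0 addr0 add0r mul1r.
Qed.

(* For the shear variation the first variation of J_H is the integral of a
   positive definite quadratic form in the vertical derivatives of H. *)
Lemma shear_density (P : partition_of_unity M) (pt : 'I_(pu_size P) -> M) a x :
  let c := pu_chart a in let d := chart_at (pi (pt a)) in pidom pi c d x ->
  0 <= variation_density pi g0 gN gs pt a x /\
  (variation_density pi g0 gN gs pt a x = 0 -> vgrad pi g0 gN c d (cinv c x) = 0).
Proof.
move=> c d Ux; have [cx dx] := Ux; have cp := cinv_cdom cx.
have ac : atlas c by exact: pu_atlas.
have ad : atlas d by exact: chart_at_atlas.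
have ZD := gradd_pi shear_variation shear_preserves ac ad Ux.
rewrite /variation_density -/c -/d (pdmx_lowered ac ad Ux ZD) (gradd_shear ac ad Ux).
set p := cinv c x in cp dx *; set A := vgrad pi g0 gN c d p.
have xE : x = cfun c p by rewrite /p cinvK.
(* With [B] the vertical cometric, [A = B d(eta)], and [B *m G *m B = B] turns the product into a
   quadratic expression in [A]. *)
have -> : A^T *m pdmx (eta_in pi g0 gN c d) x = A^T *m tin c g0 x *m A.
  have sG : (tin c g0 x)^T = tin c g0 x by exact: (tin_sym g0_metric cx).
  have uG : tin c g0 x \in unitmx by exact: (tin_unit g0_metric ac cx).
  have BD := vcometric_Dpi g0_metric gN_metric pi_sub ac ad cp dx.
  have BS := vcometric_sym g0_metric gN_metric cp dx.
  rewrite -xE in BD BS.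
  have BGB := vcometric_vertical (tin d gN (cfun d (pi p))) sG uG BD.
  have AE : A = vcometric (tin c g0 x) (Dpi pi c d p) (tin d gN (cfun d (pi p))) *m pdmx (eta_in pi g0 gN c d) x.
    by rewrite /A /vgrad -xE.
  rewrite AE trmx_mul BS; move: (vcometric _ _ _) BGB => B BGB.
  by rewrite -{1}BGB !mulmxA.
have kd : cimg d (pimap pi c d x) by exact: pimap_cimg.
exact: (posdef_trace _ (tin_posdef g0_metric ac cx) (tin_sym gN_metric kd) (tin_posdef gN_metric ad kd)).
Qed.

(** The integrands in all charts are nonnegative and their integrals add up to zero, so each
    integral vanishes; by continuity the density vanishes wherever the partition function does
    not. *)
Lemma critical_vgrad0 (P : partition_of_unity M) (pt : 'I_(pu_size P) -> M) (S : 'I_(pu_size P) -> set M) a p :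
  compact [set: M] -> critical_JH pi gN g0 ->
  (forall a, [/\ closed (S a), S a `<=` cdom (pu_chart a), S a `<=` pi @^-1` cdom (chart_at (pi (pt a)))
    & forall q, ~ S a q -> pu_fun a q = 0]) ->
  pu_fun a p != 0 -> vgrad pi g0 gN (pu_chart a) (chart_at (pi (pt a))) p = 0.
Proof.
move=> cM crit HS chip.
have [_ D1] := crit 1 gs shear_variation shear_preserves.
have [_ D2] := JH_derive g0_metric gN_metric pi_sub shear_variation shear_preserves cM HS.
pose F b x := pu_fun b (cinv (pu_chart b) x) * variation_density pi g0 gN gs pt b x * density g0 (pu_chart b) x.
pose U b := pidom pi (@pu_chart _ _ _ P b) (chart_at (pi (pt b))).
have ac b : atlas (@pu_chart _ _ _ P b) by exact: pu_atlas.
have oU b : open (U b) by exact: (open_pidom ps).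
have S0 : \sum_b integral_Rn (F b \_ (U b)) = 0.
  have E := etrans (esym D2) D1.
  by move/eqP: E; rewrite mulf_eq0 pnatr_eq0 /= => /eqP.
have F0 b x : 0 <= (F b \_ (U b)) x.
  rewrite /patch; case: ifP => // /set_mem Ux; rewrite /F.
  have [q0 _] := @shear_density P pt b x Ux.
  by rewrite mulr_ge0 ?mulr_ge0 ?pu_ge0// ltW// density_gt0//; case: Ux.
have cF b : exists r, ccont r (F b \_ (U b)).
  have [cS Sc Sd Sz] := HS b.
  have cL : compact (cfun (@pu_chart _ _ _ P b) @` S b) by exact: compact_chart_image.
  have LU : cfun (@pu_chart _ _ _ P b) @` S b `<=` U b.
    by move=> _ [q Sq <-]; apply: pidom_cfun; [exact: Sc|exact: Sd].
  have [r r0 Hr] := ccont_restrict_open (oU b) cL LU; exists r; apply: Hr.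
    have sF : smooth_on (U b) (F b).
      apply: (smooth_onM (oU b)); last by apply: smooth_onW (density_smooth g0_metric (ac b)) => x [].
      apply: (smooth_onM (oU b)); last exact: (variation_density_smooth g0_metric gN_metric pi_sub shear_variation shear_preserves).
      have sc := @pu_smooth _ _ _ P b _ (ac b).
      by apply: smooth_onW sc => x [].
    by move=> x Ux; exact: smooth_on_continuous sF Ux.
  move=> x [cx _] Lx; rewrite /F Sz ?mul0r// => Sx; apply: Lx.
  by exists (cinv (pu_chart b) x) => //; exact: cinvK.
have I0 b : integral_Rn (F b \_ (U b)) = 0.
  have pos b' : 0 <= integral_Rn (F b' \_ (U b')) by have [r cr] := cF b'; exact: (integral_Rn_ge0 cr (F0 b')).
  move/eqP: S0; rewrite psumr_eq0 => [/allP z|b' _]; last exact: pos.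
  by have /eqP := z b (mem_index_enum _).
have Sp : S a p by apply: contrapT => /(let: And4 _ _ _ h := HS a in h) h; rewrite h eqxx in chip.
have [_ Sc Sd _] := HS a; have cp := Sc _ Sp; have dp := Sd _ Sp.
have Ux : U a (cfun (pu_chart a) p) by exact: pidom_cfun.
have [q0 qz] := @shear_density P pt a _ Ux.
rewrite (cfunK cp) in qz; apply: qz; apply/eqP/negPn/negP => qn.
have [r cr] := cF a.
have : 0 < integral_Rn (F a \_ (U a)).
  apply: (integral_Rn_gt0 cr (F0 a) (x0 := cfun (pu_chart a) p)).
  rewrite patchE mem_set// /F (cfunK cp) !mulr_gt0//.
  - by rewrite lt_def chip pu_ge0.
  - by rewrite lt_def qn q0.
  - by apply: (density_gt0 g0_metric (ac a)); exact: cfun_cimg.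
by rewrite I0 ltxx.
Qed.

Lemma critical_projectable : compact [set: M] -> critical_JH pi gN g0 -> projectable pi (mean_curvature pi g0).
Proof.
move=> cM crit; have [P [pt [S HS]]] := adapted_partition cM.
apply: (projectable_of_eta g0_metric gN_metric pi_sub) => p.
have [a chip] : exists a, @pu_fun _ _ _ P a p != 0.
  apply: contrapT => no; have := pu_sum1 P p; rewrite big1 => [/eqP|a _]; first by rewrite eq_sym oner_eq0.
  by apply/eqP/negPn/negP => h; apply: no; exists a.
have z := critical_vgrad0 cM crit HS chip.
have [cS Sc Sd Sz] := HS a.
have Sp : S a p by apply: contrapT => /Sz h; rewrite h eqxx in chip.
have cp := Sc _ Sp; have dp := Sd _ Sp.
have ac : atlas (@pu_chart _ _ _ P a) by exact: pu_atlas.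
pose d : chart R N k := chart_at (pi (pt a)).
have ad : atlas d by exact: chart_at_atlas.
exists d; split=> // v vD.
have ac' := chart_at_atlas p; have cp' := chart_at_cdom p.
have kx := cfun_cimg cp.
rewrite (pdmx_eta_change g0_metric gN_metric pi_sub ac' ac ad cp' cp dp) mulmxA.
rewrite (Dpi_changel ps ac' ac ad cp' cp dp) mulmxA in vD.
(* A vertical [v] satisfies [v = v *m G *m B] with [B] the vertical cometric, so the derivative of
   eta along [v] is [v *m G] times [vgrad], which vanishes. *)
have E := vcometric_vertical (tin d gN (cfun d (pi p))) (tin_sym g0_metric kx) (tin_unit g0_metric ac kx) vD.
by rewrite -E -mulmxA -/(vgrad pi g0 gN _ d p) z mulmx0.
Qed.

End Criticality.

Theorem theorem4p5 (R : realType) (m k : nat) (M : manifold R m)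
    (N : manifold R k) (pi : M -> N) (g0 : tensor2 M) (gN : tensor2 N)
    (M_compact : compact [set: M])
    (g0_metric : riemannian_metric g0) (gN_metric : riemannian_metric gN)
    (pi_submersion : riemannian_submersion pi g0 gN) :
  critical_JH pi gN g0 <-> projectable pi (mean_curvature pi g0).
Proof.
split; first exact: critical_projectable.
exact: projectable_critical.
Qed.
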